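(* Assume that $W$ satisfies $H_{\mathrm{Finite}}$ or $H_{\mathrm{Lin}}$ with some exponent $p\in(1,2]$. Define $V(F):=W(\mathrm{Id}+\tilde QF\tilde Q^T)$ for some $\tilde Q\in\mathrm{SO}(3)$ in the first case, and $V:=W$ in the second case. Let $\mathbb C^V:=D^2V(0)$, $c_K>0$ and $\ell_0>0$. There is a nondecreasing function $\sigma:(0,\infty)\to(0,\infty)$ with $\lim_{s\to0}\sigma(s)=0$, depending only on $V$, $p$, $c_K$ and $\ell_0$, with the following property: if $0<2r\le R\le h$, $\varepsilon>0$, $b\in\mathbb R^3$, $t\in S^2$, $\xi\in L^1(Q_tT^R_h;\mathbb R^{3\times3})$ obey $|b|\ge\ell_0$, $$\|\Phi_p(|\xi|)\|_{L^1(Q_tT^{R,r}_h)}\le c_K\,\varepsilon^2h|b|^2\log\frac Rr$$ and $$\operatorname{curl}\xi=\varepsilon\,b\otimes t\,\mathcal H^1\llcorner(\mathbb Rt\cap Q_tT^R_h),$$ then $$\frac1{\varepsilon^2h\log\frac Rr}\int_{Q_tT^{R,r}_h}V(\xi)\,dx\ \ge\ \psi_{\mathbb C^V}(b,t)\left(1-\sigma\Big(\frac rR+\frac{\varepsilon|b|}r\Big)\right).$$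
   Context: Notation. $A\cdot B=\sum_{ij}A_{ij}B_{ij}$, $(b\otimes t)_{ij}=b_it_j$; $\operatorname{curl}$ of matrix-valued distributions is row-wise, distributional. $B'_\rho\subset\mathbb R^2$ is the disk of radius $\rho$ centered at $0$; $T^{R,r}_h:=(B'_R\setminus B'_r)\times(0,h)$ and $T^R_h:=B'_R\times(0,h)$. For each $t\in S^2$ a rotation $Q_t\in\mathrm{SO}(3)$ with $Q_te_3=t$ is fixed. Energy densities. $\Phi_p(t):=\min\{t^p,t^2\}$, $t\ge0$. $W:\mathbb R^{3\times3}\to[0,\infty)$ satisfies $H_{\mathrm{Finite}}$ with exponent $p\in(1,2]$ if $W$ is Borel, minimized at $\mathrm{Id}$, twice differentiable in a neighbourhood of $\mathrm{Id}$, $W(F)=W(FQ)$ for all $F\in\mathbb R^{3\times3}$, $Q\in\mathrm{SO}(3)$, and for some $c>0$, $\frac1c\Phi_p(\operatorname{dist}(F,\mathrm{SO}(3)))\le W(F)\le c\,\Phi_p(\operatorname{dist}(F,\mathrm{SO}(3)))$ for all $F$. It satisfies $H_{\mathrm{Lin}}$ with exponent $p\in(1,2]$ if $W$ is Borel, minimized at $0$, twice differentiable in a neighbourhood of $0$, $W(F)=W(F+S)$ for all $F$ and all skew $S$, and for some $c>0$, $\frac1c\Phi_p(|F+F^T|)\le W(F)\le c\,\Phi_p(|F+F^T|)$ for all $F$. In both cases $\mathbb C=\mathbb C^V$ satisfies $\mathbb C=\mathbb C^T$, $\mathbb CA\cdot A\ge c_0|A+A^T|^2$ for some $c_0>0$,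 and $\mathbb C(A-A^T)=0$ for all $A\in\mathbb R^{3\times3}$. Line-tension energy. Let $e_r(\theta)=(\cos\theta,\sin\theta,0)$, $e_\theta(\theta)=(-\sin\theta,\cos\theta,0)$. For such a tensor $\mathbb C$, $b\in\mathbb R^3$ and $t\in S^2$, $\psi_{\mathbb C}(b,t)$ is the minimum of $\int_0^{2\pi}\frac12\mathbb CG(\theta)\cdot G(\theta)\,d\theta$ over $G(\theta)=f(\theta)\otimes Q_te_\theta(\theta)+g\otimes Q_te_r(\theta)$ with $f\in L^2((0,2\pi);\mathbb R^3)$, $\int_0^{2\pi}f\,d\theta=b$, $g\in\mathbb R^3$. *)

(* Defs.v *)
From HB Require Import structures.
From mathcomp Require Import all_boot all_order all_algebra.
From mathcomp Require Import all_classical all_reals all_analysis.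

Set Implicit Arguments.
Unset Strict Implicit.
Unset Printing Implicit Defensive.
Import Order.TTheory GRing.Theory Num.Theory.
Import numFieldNormedType.Exports.

Local Open Scope classical_set_scope.
Local Open Scope ring_scope.

Definition mdot (R : realType) (m n : nat) (A B : 'M[R]_(m, n)) : R :=
  \sum_i \sum_j A i j * B i j.

(* Euclidean (Frobenius) norm; the library's norm on matrices is the maximum
   norm, which is used here only through the topology that it induces. *)
Definition enorm (R : realType) (m n : nat) (A : 'M[R]_(m, n)) : R :=
  Num.sqrt (mdot A A).

Definition otimes (R : realType) (b t : 'cV[R]_3) : 'M[R]_3 :=
  \matrix_(i, j) (b i 0 * t j 0).

Definition SO3 (R : realType) : set 'M[R]_3 :=
  [set Q | Q *m Q^T = 1%:M /\ \det Q = 1].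

Definition dist_SO3 (R : realType) (F : 'M[R]_3) : R :=
  inf [set enorm (F - Q) | Q in @SO3 R].

Definition vec3 (R : realType) (p : R * R * R) : 'cV[R]_3 :=
  \col_(i < 3) [:: p.1.1; p.1.2; p.2]`_i.

Definition e3 (R : realType) : 'cV[R]_3 := vec3 (0, 0, 1).
Definition e_r (R : realType) (theta : R) : 'cV[R]_3 :=
  vec3 (cos theta, sin theta, 0).
Definition e_theta (R : realType) (theta : R) : 'cV[R]_3 :=
  vec3 (- sin theta, cos theta, 0).

Notation borel T := (g_sigma_algebraType (@open T)).

Lemma measurable_vec3 (R : realType) :
  measurable_fun [set: R * R * R] (@vec3 R : R * R * R -> borel 'cV[R]_3).
Proof.
apply: (@measurability _ _ _ (borel 'cV[R]_3) setT _ (@open 'cV[R]_3)) => //.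
move=> _ [U oU <-]; rewrite setTI.
pose I := (rat * rat * rat * nat)%type.
pose J (q : rat) (n : nat) := ball (ratr q : R) (n.+1%:R^-1).
pose box (k : I) : set (R * R * R) :=
  (J k.1.1.1 k.2 `*` J k.1.1.2 k.2) `*` J k.1.2 k.2.
pose D : set I := [set k | box k `<=` @vec3 R @^-1` U].
have -> : @vec3 R @^-1` U = \bigcup_(k in D) box k.
  apply/seteqP; split => [p Up|p [k Dk kp]]; last exact: Dk.
  have [e e0 eU] : exists2 e : R, 0 < e & ball (vec3 p) e `<=` U.
    by move: (oU); rewrite openE => /(_ _ Up) /nbhs_ballP[e /= ? ?]; exists e.
  have [n ne] : exists n : nat, (n.+1%:R^-1 : R) < e / 2.
    have [N _ /(_ N)/(_ (leqnn _)) Ne] :=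
      near_infty_natSinv_lt (PosNum (divr_gt0 e0 (ltr0n R 2))).
    by exists N.
  have n0 : 0 < (n.+1%:R^-1 : R) by rewrite invr_gt0.
  have apx (x : R) : exists q : rat, J q n x.
    have [||y [xy [q _ qy]]] := @dense_rat R (ball x n.+1%:R^-1).
    - by exists x; exact: ballxx.
    - exact: ball_open.
    - by exists q; apply: ball_sym; rewrite qy.
  have [q0 h0] := apx p.1.1; have [q1 h1] := apx p.1.2.
  have [q2 h2] := apx p.2.
  exists (q0, q1, q2, n); last by [].
  have key (q : rat) (x y : R) : J q n x -> J q n y -> ball x e y.
    move=> qx qy; apply: (@le_ball _ _ _ (n.+1%:R^-1 + n.+1%:R^-1)).
      by rewrite [leRHS]splitr lerD// ltW.
    by apply: ball_triangle qy; exact: ball_sym.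
  move=> y [[/= y0 y1] y2]; apply: eU; split=> // i j.
  rewrite !mxE; case: i => -[|[|[|//]]] ? /=.
  - exact: key h0 y0.
  - exact: key h1 y1.
  - exact: key h2 y2.
rewrite bigcup_mkcond; apply: countable_bigcupT_measurable => [|k]; first exact/countableP.
case: ifP => // _.
by do ?[apply: measurableX]; rewrite /J ball_itv; exact: measurable_itv.
Qed.

Definition leb3 (R : realType) : set (borel 'cV[R]_3) -> \bar R :=
  pushforward ((@lebesgue_measure R \x @lebesgue_measure R)
               \x @lebesgue_measure R)%E (@vec3 R : R * R * R -> borel 'cV[R]_3).

Section leb3_measure.
Variable R : realType.

Let leb30 : @leb3 R set0 = 0%E.
Proof. by rewrite /leb3 /pushforward preimage_set0 measure0. Qed.

Let leb3_ge0 A : (0 <= @leb3 R A)%E.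
Proof. by rewrite /leb3 /pushforward measure_ge0. Qed.

Let leb3_sigma_additive : semi_sigma_additive (@leb3 R).
Proof.
have mf (A : set (borel 'cV[R]_3)) : measurable A ->
    measurable (@vec3 R @^-1` A).
  by move=> mA; rewrite -[X in measurable X]setTI; exact: measurable_vec3.
move=> F mF tF mUF; rewrite /leb3 /pushforward preimage_bigcup.
apply: measure_semi_sigma_additive.
- by move=> n; exact: mf.
- apply/trivIsetP => /= i j _ _ ij; rewrite -preimage_setI.
  by move/trivIsetP : tF => /(_ _ _ _ _ ij) ->//; rewrite preimage_set0.
- by rewrite -preimage_bigcup; exact: mf.
Qed.

HB.instance Definition _ := isMeasure.Build _ _ _ (@leb3 R)
  leb30 leb3_ge0 leb3_sigma_additive.

End leb3_measure.

Definition diam (R : realType) (A : set 'cV[R]_3) : \bar R :=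
  maxe 0%E (ereal_sup [set (enorm (p.1 - p.2))%:E | p in A `*` A]).

Definition hausdorff1_size (R : realType) (delta : R) (A : set 'cV[R]_3) :
    \bar R :=
  ereal_inf [set (\sum_(k <oo) diam (C k))%E | C in
    [set C : (set 'cV[R]_3)^nat |
      (forall k, (diam (C k) <= delta%:E)%E) /\ A `<=` \bigcup_k C k]].

(* The outer measure H^1 on all subsets of R^3.  It is a measure on the Borel
   sets; [integral] accepts any set function, so that fact is not needed to
   write the integral with respect to H^1. *)
Definition hausdorff1 (R : realType) (A : set (borel 'cV[R]_3)) : \bar R :=
  ereal_sup [set hausdorff1_size delta A | delta in [set d : R | 0 < d]].

Definition pderiv (R : realType) (k : 'I_3) (phi : 'cV[R]_3 -> R) :
    'cV[R]_3 -> R :=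
  fun x => 'D_(delta_mx k 0) phi x.

Definition smooth (R : realType) (phi : 'cV[R]_3 -> R) : Prop :=
  forall (s : seq 'I_3) (x : 'cV[R]_3),
    differentiable (foldr (@pderiv R) phi s) x.

Definition test_function (R : realType) (Omega : set 'cV[R]_3)
    (phi : 'cV[R]_3 -> R) : Prop :=
  let supp := closure [set x | phi x != 0] in
  [/\ smooth phi, compact supp & supp `<=` Omega].

Definition dist_pderiv (R : realType) (Omega : set (borel 'cV[R]_3))
    (u : borel 'cV[R]_3 -> R) (k : 'I_3) (phi : 'cV[R]_3 -> R) : R :=
  - \int[@leb3 R]_(x in Omega) (u x * pderiv k phi x).

(* The row-wise distributional curl on Omega, evaluated at phi.  Indices are
   added modulo 3, so the entries are d_2 xi_i3 - d_3 xi_i2 and its cyclic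
   permutations (with coordinates numbered from 1). *)
Definition dist_curl (R : realType) (Omega : set (borel 'cV[R]_3))
    (xi : borel 'cV[R]_3 -> 'M[R]_3) (phi : 'cV[R]_3 -> R) : 'M[R]_3 :=
  \matrix_(i, j)
    (dist_pderiv Omega (fun x => xi x i (j + 2)) (j + 1) phi
     - dist_pderiv Omega (fun x => xi x i (j + 1)) (j + 2) phi).

(* curl xi = B H^1|_S on Omega, in the sense of distributions *)
Definition curl_eq_hausdorff1 (R : realType) (Omega : set (borel 'cV[R]_3))
    (xi : borel 'cV[R]_3 -> 'M[R]_3) (B : 'M[R]_3)
    (S : set (borel 'cV[R]_3)) : Prop :=
  forall phi : 'cV[R]_3 -> R, test_function Omega phi ->
    dist_curl Omega xi phi =
    fine (integral (@hausdorff1 R) S (fun x => (phi x)%:E)) *: B.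

Definition L1_fun (R : realType) (Omega : set (borel 'cV[R]_3))
    (xi : borel 'cV[R]_3 -> 'M[R]_3) : Prop :=
  forall i j, (@leb3 R).-integrable Omega (fun x => (xi x i j)%:E).

Definition L1_norm (R : realType) (Omega : set (borel 'cV[R]_3))
    (u : borel 'cV[R]_3 -> R) : \bar R :=
  (\int[@leb3 R]_(x in Omega) `|u x|%:E)%E.

Definition disk (R : realType) (rho : R) : set (R * R) :=
  [set y | Num.sqrt (y.1 ^+ 2 + y.2 ^+ 2) < rho].

Definition tube (R : realType) (rho h : R) : set 'cV[R]_3 :=
  @vec3 R @` (disk rho `*` `]0, h[).

Definition shell (R : realType) (rho r h : R) : set 'cV[R]_3 :=
  @vec3 R @` ((disk rho `\` disk r) `*` `]0, h[).

Definition line (R : realType) (t : 'cV[R]_3) : set 'cV[R]_3 :=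
  [set s *: t | s in [set: R]].

Definition Phi (R : realType) (p s : R) : R := Num.min (s `^ p) (s ^+ 2).

Definition borel_fun (R : realType) (W : 'M[R]_3 -> R) : Prop :=
  measurable_fun setT (W : borel 'M[R]_3 -> R).

(* The second condition is differentiability at F of the gradient of W. *)
Definition twice_differentiable_near (R : realType) (W : 'M[R]_3 -> R)
    (F0 : 'M[R]_3) : Prop :=
  \forall F \near F0, differentiable W F /\
    forall i j, differentiable (fun G => 'D_(delta_mx i j) W G) F.

Definition HFinite (R : realType) (p : R) (W : 'M[R]_3 -> R) : Prop :=
  [/\ forall F, 0 <= W F, borel_fun W, forall F, W 1%:M <= W F
    & twice_differentiable_near W 1%:M] /\
  (forall F Q, SO3 Q -> W F = W (F *m Q)) /\
  exists2 c : R, 0 < c & forall F,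
    c^-1 * Phi p (dist_SO3 F) <= W F <= c * Phi p (dist_SO3 F).

Definition HLin (R : realType) (p : R) (W : 'M[R]_3 -> R) : Prop :=
  [/\ forall F, 0 <= W F, borel_fun W, forall F, W 0 <= W F
    & twice_differentiable_near W 0] /\
  (forall F S : 'M[R]_3, S^T = - S -> W F = W (F + S)) /\
  exists2 c : R, 0 < c & forall F,
    c^-1 * Phi p (enorm (F + F^T)) <= W F <= c * Phi p (enorm (F + F^T)).

(* D^2 V(F0) as a linear map on matrices: its (i, j) entry at A is the second
   derivative of V at F0 in the directions A and e_i (x) e_j. *)
Definition hessian (R : realType) (V : 'M[R]_3 -> R) (F0 A : 'M[R]_3) :
    'M[R]_3 :=
  \matrix_(i, j) 'D_A (fun F => 'D_(delta_mx i j) V F) F0.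

Definition L2_fun (R : realType) (f : R -> 'cV[R]_3) : Prop :=
  forall i, measurable_fun `]0, 2 * pi[ (fun theta => f theta i 0) /\
    (\int[@lebesgue_measure R]_(theta in `]0%R, (2 * pi)%R[)
       ((f theta i 0) ^+ 2)%:E < +oo)%E.

Definition cell_field (R : realType) (Q : 'M[R]_3) (f : R -> 'cV[R]_3)
    (g : 'cV[R]_3) (theta : R) : 'M[R]_3 :=
  otimes (f theta) (Q *m e_theta theta) + otimes g (Q *m e_r theta).

Definition cell_energy (R : realType) (C : 'M[R]_3 -> 'M[R]_3)
    (G : R -> 'M[R]_3) : R :=
  \int[@lebesgue_measure R]_(theta in `]0, 2 * pi[)
    (1 / 2 * mdot (C (G theta)) (G theta)).

(* The infimum is a minimum for the tensors C that arise as hessians of the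
   energy densities above.  Q t is the rotation that maps e_3 to t. *)
Definition psi (R : realType) (Q : 'cV[R]_3 -> 'M[R]_3)
    (C : 'M[R]_3 -> 'M[R]_3) (b t : 'cV[R]_3) : R :=
  inf [set E | exists f g, [/\ L2_fun f,
    forall i, \int[@lebesgue_measure R]_(theta in `]0, 2 * pi[)
      f theta i 0 = b i 0
    & E = cell_energy C (cell_field (Q t) f g)]].

(* Main.v *)
Require Import Defs.
From HB Require Import structures.
From mathcomp Require Import all_boot all_order all_algebra.
From mathcomp Require Import all_classical all_reals all_analysis.
From mathcomp Require Import measurable_realfun ring lra.

Set Implicit Arguments.
Unset Strict Implicit.
Unset Printing Implicit Defensive.
Import Order.TTheory GRing.Theory Num.Theory.
Import numFieldNormedType.Exports.

Local Open Scope classical_set_scope.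
Local Open Scope ring_scope.

(** The lower bound is a duality argument, with the optimal cell field as a
    calibration. Write q for the quadratic form of the Hessian of V at 0.

    The cell problem that defines psi has a smooth, 2 pi-periodic solution
    G(theta) ([cell_solution], [optimal_cell_field]). It is linear in b, its
    energy E dominates psi and is of order |b|^2, and the symmetric stress of G
    splits along the cylindrical frame into an azimuthal traction l that does
    not depend on theta (the equation in f), a radial traction m of mean zero
    (the equation in g), and an axial traction n. Testing with f gives
    l . b = 2 E. Coercivity of the cell problem is Korn's inequality on the
    circle ([korn_cell]): the only obstruction to a pointwise bound is a second
    Fourier mode, which integrates to zero against the constant g.

    For the calibration X = eps G(theta) / rho, convexity of q gives
    q(xi) / 2 >= beta(X, xi) - q(X) / 2, beta being the polar form of q. Where xi
    is small, V(xi) is q(xi) / 2 up to a small multiple of Phi_p(|xi|), by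
    Taylor's formula; where xi is large, the right side is linear in xi, and
    |X| |xi| is at most |X| Phi_p(|xi|) / d, a gain of a factor eps |b| / r over
    the energy. So [pointwise_bound] needs no truncation of xi.

    It remains to integrate beta(X, xi) against a cutoff w in the radius and the
    height. Each traction is paired with one part of the curl of xi. A radial
    test function sees the circulation of xi around the line, and the azimuthal
    part yields eps l . b = 2 eps E times the mass of w, about h log (R/r)
    ([azimuthal_test]). The radial traction is an angular derivative, m = k',
    and the axial part is a planar divergence, so these two contribute only
    on the transition layers of the cutoff ([radial_test], [axial_test]). On
    those layers the integral of |xi| is of the order of
    eps |b| h sqrt(log (R/r)), by Young's inequality ([transition_integral]):
    lower order than eps |b| h log (R/r). Invariance of the volume under
    rotations about the line replaces q(G(theta)) by its mean, so the integral
    of q(X) / 2 is at most eps^2 E h log (R/r) ([rotation_average],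
    [shell_log_bound]).

    Hence the energy is at least eps^2 (2 E - E) h log (R/r) minus errors, and
    the errors are small compared with psi since psi >= c |b|^2 ([psi_low]).
    This proves, for each e > 0, the bound with error e whenever
    r/R + eps |b| / r is below some s0(e) ([small_error]). The bound with error
    1 holds always, as V >= 0. The function sigma(s) is the infimum of the errors
    admissible up to s, plus s, which makes it positive and leaves room for an
    infimum that is not attained. *)

(** * Smooth functions of one real variable *)

Section smooth1.
Variable R : realType.
Implicit Types (f g h : R -> R).

(** Infinite differentiability is encoded coinductively, by membership in a set
    of functions each of which has a derivative in the set. To prove a function
    smooth it suffices to exhibit a family closed under one derivation. *)
Definition derive_stable (S : set (R -> R)) : Prop :=
  forall f, S f -> exists2 f', S f' & forall x : R, is_derive x 1 f (f' x).

Definition Cinf f : Prop := exists2 S, derive_stable S & S f.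

Lemma CinfP f : Cinf f ->
  exists2 f', Cinf f' & forall x : R, is_derive x 1 f (f' x).
Proof.
move=> [S sS Sf]; have [f' Sf' df] := sS _ Sf.
by exists f' => //; exists S.
Qed.

Lemma Cinf_continuous f : Cinf f -> continuous f.
Proof.
move=> /CinfP[f' _ df] x; apply: differentiable_continuous.
by apply/derivable1_diffP; exact: (@ex_derive _ _ _ _ _ _ _ (df x)).
Qed.

(** The algebra and composition closure of the smooth functions is itself stable
    under derivation, by the Leibniz and chain rules. This is how sums, products
    and compositions are shown smooth. *)
Inductive Calg : (R -> R) -> Prop :=
| Calg_base f : Cinf f -> Calg f
| Calg_add f g : Calg f -> Calg g -> Calg (fun x => f x + g x)
| Calg_mul f g : Calg f -> Calg g -> Calg (fun x => f x * g x)
| Calg_comp f g : Calg f -> Calg g -> Calg (fun x => f (g x)).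

Lemma Calg_stable : derive_stable Calg.
Proof.
move=> f; elim=> {f} [f /CinfP[f' cf' df]|f g _ [f' cf' df] _ [g' cg' dg]|
    f g cf [f' cf' df] cg [g' cg' dg]|f g cf [f' cf' df] cg [g' cg' dg]].
- by exists f' => //; exact: Calg_base.
- exists (fun x => f' x + g' x); first exact: Calg_add.
  by move=> x; exact: is_deriveD.
- exists (fun x => f x * g' x + g x * f' x).
    by apply: Calg_add; exact: Calg_mul.
  by move=> x; exact: is_deriveM.
- exists (fun x => f' (g x) * g' x).
    by apply: Calg_mul => //; exact: Calg_comp.
  move=> x; have := @is_derive1_comp _ f g x _ _ (df (g x)) (dg x).
  by [].
Qed.

Lemma Calg_Cinf f : Calg f -> Cinf f.
Proof. by move=> cf; exists Calg => //; exact: Calg_stable. Qed.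

Lemma CinfD f g : Cinf f -> Cinf g -> Cinf (fun x => f x + g x).
Proof. by move=> cf cg; apply/Calg_Cinf/Calg_add; exact: Calg_base. Qed.

Lemma CinfM f g : Cinf f -> Cinf g -> Cinf (fun x => f x * g x).
Proof. by move=> cf cg; apply/Calg_Cinf/Calg_mul; exact: Calg_base. Qed.

Lemma Cinf_comp f g : Cinf f -> Cinf g -> Cinf (fun x => f (g x)).
Proof. by move=> cf cg; apply/Calg_Cinf/Calg_comp; exact: Calg_base. Qed.

Lemma Cinf_affine (a b : R) : Cinf (fun x => a * x + b).
Proof.
exists [set f | exists c d : R, f = fun x => c * x + d]; last by exists a, b.
move=> _ [c [d ->]]; exists (fun=> c).
  by exists 0, c; apply/funext => x; rewrite mul0r add0r.
move=> x; have := is_deriveD (is_deriveZ c (is_derive_id x (1 : R))) (is_derive_cst d x (1 : R)).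
by rewrite addr0 -mulr_algl mulr1 /GRing.scale /= mulr1.
Qed.

Lemma Cinf_cst (a : R) : Cinf (fun=> a).
Proof.
have := Cinf_affine 0 a; congr Cinf.
by apply/funext => x; rewrite mul0r add0r.
Qed.

Lemma CinfN f : Cinf f -> Cinf (fun x => - f x).
Proof.
move=> cf; have := CinfM (Cinf_cst (-1)) cf; congr Cinf.
by apply/funext => x; rewrite mulN1r.
Qed.

(** A primitive on the whole line is glued from integrals based at the left end
    of growing intervals. *)
Lemma Cinf_primitive g : Cinf g ->
  exists2 G, Cinf G & forall x : R, is_derive x 1 G (g x).
Proof.
move=> cg.
suff [G dG] : exists G : R -> R, forall x : R, is_derive x 1 G (g x).
  exists G => //; exists (Cinf `|` [set G]); last by right.
  move=> f [/CinfP[f' cf' df]|->]; first by exists f' => //; left.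
  by exists g => //; left.
have gc : continuous g by exact: Cinf_continuous.
have ig (a b : R) : (@lebesgue_measure R).-integrable `[a, b] (EFin \o g).
  apply: continuous_compact_integrable; first exact: segment_compact.
  exact: continuous_subspaceT.
have [F dF] : exists F : nat -> R -> R, forall n (x : R), - n%:R < x ->
    is_derive x 1 (F n) (g x).
  exists (fun n x => \int[@lebesgue_measure R]_(t in `[- n%:R, x]) g t) => n x nx.
  have [] := @continuous_FTC1_closed R g (- n%:R) x (x + 1) _ _ _ (gc x).
  - by rewrite ltrDl.
  - exact: ig.
  - by [].
  move=> h1 h2; apply: DeriveDef; first exact: h1.
  by rewrite -derive1E; exact: h2.
(* two of these primitives differ by a constant where both are defined *)
pose G (x : R) := let n := (Num.truncn `|x|).+2 in F n x - F n 0.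
have Fst (n m : nat) (x : R) : - n%:R < x -> - m%:R < x -> (0 < n)%N -> (0 < m)%N ->
    F n x - F n 0 = F m x - F m 0.
  wlog x0 : n m x / (n <= m)%N.
    move=> H nx mx n0 m0; have [nm|/ltnW nm] := leqP n m; first exact: H.
    by apply/esym; exact: H.
  move=> nx mx n0 m0.
  have H (y : R) : - n%:R < y -> F m y - F n y = F m 0 - F n 0.
    move=> ny; pose a := Num.min y 0; pose b := Num.max y 0.
    have na : - n%:R < a by rewrite lt_min ny oppr_lt0 ltr0n.
    have D (z : R) : z \in `[a, b] -> is_derive z 1 (fun z => F m z - F n z) 0.
      rewrite in_itv /= => /andP[az _].
      have nz : - n%:R < z by exact: lt_le_trans az.
      have mz : - m%:R < z.
        by apply: le_lt_trans nz; rewrite lerN2 ler_nat.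
      by have := is_deriveB (dF m z mz) (dF n z nz); rewrite subrr.
    have ab : a <= b by rewrite /a /b ge_min le_max lexx.
    pose H z := F m z - F n z.
    have D1 z : z \in `]a, b[ -> is_derive z 1 H ((fun=> 0) z).
      by move=> /subset_itv_oo_cc /D.
    have D2 : {within `[a, b], continuous H}.
      apply: derivable_within_continuous => z /D dz.
      exact: (@ex_derive _ _ _ _ _ _ _ dz).
    have [c _] := MVT_segment ab D1 D2.
    rewrite mul0r => /eqP; rewrite subr_eq0 /a /b /H; case: (leP y 0) => _ /eqP //.
  have := H _ nx; lra.
exists G => x.
pose N := (Num.truncn `|x|).+3.
have Nx : `|x| < N%:R - 1.
  apply: (lt_le_trans (truncnS_gt _)); rewrite /N.
  by rewrite lerBrDr natr1 ler_nat.
have eG : \forall z \near x, (F N z - F N 0) = G z.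
  have : \forall z \near x, `|x - z| < 1.
    by apply/nbhs_ballP; exists 1 => //=.
  apply: filterS => z xz; apply: Fst => //.
  - have := ler_normB x (x - z); rewrite opprB addrC subrK => H.
    have : `|z| < N%:R by lra.
    by rewrite ltr_norml => /andP[].
  - have H := truncnS_gt `|z|; rewrite ltrNl.
    apply: (@le_lt_trans _ _ `|z|); first by rewrite -normrN ler_norm.
    by apply: (lt_trans H); rewrite ltr_nat.
apply: near_eq_is_derive eG _.
have Nx' : - N%:R < x by have := ler_norm (- x); rewrite normrN; lra.
by have := is_deriveB (dF N x Nx') (is_derive_cst (F N 0) x 1); rewrite subr0.
Qed.


Lemma is_derive_quadratic f (C : R) : (forall x, `|f x| <= C * x ^+ 2) ->
  is_derive (0 : R) 1 f 0.
Proof.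
move=> fC.
have f0 : f 0 = 0.
  by apply/eqP; rewrite -normr_le0; apply: le_trans (fC 0) _; rewrite expr0n mulr0.
have C0 : 0 <= C by have := fC 1; rewrite expr1n mulr1; apply: le_trans.
apply/is_derive1_caratheodory; exists (fun x => f x / x); split.
- move=> z; rewrite f0 !subr0; have [->|z0] := eqVneq z 0; first by rewrite f0 mulr0.
  by rewrite /= divfK.
- rewrite /prop_for /continuous_at /= invr0 mulr0.
  apply/cvgrPdist_le => e e0.
  near=> x; rewrite sub0r normrN normrM normfV.
  have [->|x0] := eqVneq x 0; first by rewrite normr0 invr0 mulr0 ltW.
  rewrite ler_pdivrMr ?normr_gt0//.
  apply: le_trans (fC x) _; rewrite -real_normK ?num_real// expr2 mulrA.
  rewrite ler_pM2r ?normr_gt0//.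
  have xd : `|x| <= e / (C + 1).
    near: x; apply/nbhs_ballP; exists (e / (C + 1)) => /=.
      by rewrite divr_gt0// ltr_wpDl.
    by move=> y; rewrite /ball /= sub0r normrN => /ltW.
  have C1 : 0 < C + 1 by rewrite ltr_wpDl.
  have : (C + 1) * `|x| <= e by rewrite mulrC -ler_pdivlMr.
  have := normr_ge0 x; nra.
- by rewrite invr0 mulr0.
Unshelve. all: by end_near. Qed.

(** The function exp(-1/x) times a polynomial in 1/x, extended by 0: a family
    closed under derivation. *)
Definition flat (p : {poly R}) (x : R) : R :=
  if 0 < x then p.[x^-1] * expR (- x^-1) else 0.

Lemma exprn_expRN n (y : R) : 0 <= y -> y ^+ n * expR (- y) <= n`!%:R.
Proof.
move=> y0; rewrite expRN ler_pdivrMr ?expR_gt0//; case: n => [|n].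
  by rewrite expr0 fact0 mul1r; have := expR_ge1Dx y; lra.
rewrite mulrC -ler_pdivrMr ?ltr0n ?fact_gt0//.
by have := expR_ge1Dxn n y0; lra.
Qed.

Lemma horner_expRN (p : {poly R}) :
  exists C : R, forall y, 0 <= y -> `|p.[y]| * expR (- y) <= C.
Proof.
exists (\sum_(i < size p) `|p`_i| * i`!%:R) => y y0.
rewrite horner_coef; apply: (@le_trans _ _ ((\sum_(i < size p) `|p`_i| * y ^+ i) * expR (- y))).
  rewrite ler_wpM2r ?expR_ge0//; apply: (le_trans (ler_norm_sum _ _ _)).
  by apply: ler_sum => i _; rewrite normrM normrX (ger0_norm y0).
rewrite mulr_suml; apply: ler_sum => i _; rewrite -mulrA ler_wpM2l//.
exact: exprn_expRN.
Qed.

Lemma flat_le0 (p : {poly R}) (x : R) : x <= 0 -> flat p x = 0.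
Proof. by rewrite /flat ltNge => ->. Qed.

(** At 0 the function is dominated by a square, since the exponential beats every
    power of 1/x. *)
Lemma is_derive_flat (p : {poly R}) (x : R) :
  is_derive x 1 (flat p) (flat ('X^2 * (p - p^`())) x).
Proof.
have [x0|x0|<-] := ltgtP 0 x.
- have dV : is_derive x 1 (fun y : R => y^-1) (- x ^- 2).
    apply: is_derive_eq; first by apply: is_deriveV; rewrite gt_eqF.
    by rewrite /GRing.scale /= mulr1.
  have dp := @is_derive1_comp _ (horner p) (fun y : R => y^-1) x _ _ (is_derive_poly _ _) dV.
  have de := @is_derive1_comp _ expR (fun y : R => - y^-1) x _ _ (is_derive_expR _) (is_deriveN dV).
  have D := is_deriveM dp de.
  rewrite /flat x0; apply: near_eq_is_derive (is_derive_eq D _).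
    near=> z; rewrite ifT//; near: z; exact: lt_nbhsr.
  rewrite /GRing.scale /= hornerM hornerXn hornerD hornerN -exprVn; ring.
- rewrite (flat_le0 _ (ltW x0)).
  apply: near_eq_is_derive (is_derive_cst (0 : R) x 1).
  near=> z; rewrite flat_le0//; apply: ltW; near: z; exact: lt_nbhsl.
- rewrite flat_le0//.
  have [C HC] := horner_expRN ('X^2 * p).
  have C0 : 0 <= C.
    by apply: le_trans (HC 0 (lexx _)); rewrite mulr_ge0// expR_ge0.
  apply: (@is_derive_quadratic _ C) => y; rewrite /flat; case: ifPn => y0; last first.
    by rewrite normr0 mulr_ge0// sqr_ge0.
  rewrite normrM (ger0_norm (expR_ge0 _)).
  have yV : 0 <= y^-1 by rewrite invr_ge0 ltW.
  have := HC _ yV; rewrite hornerM hornerXn normrM.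
  rewrite (ger0_norm (exprn_ge0 2 yV)) exprVn -mulrA ler_pdivrMl ?exprn_gt0//.
  by rewrite (mulrC (_ ^+ 2)).
Unshelve. all: by end_near. Qed.

Lemma Cinf_flat (p : {poly R}) : Cinf (flat p).
Proof.
exists [set f | exists q, f = flat q]; last by exists p.
move=> _ [q ->]; exists (flat ('X^2 * (q - q^`()))); last exact: is_derive_flat.
by eexists.
Qed.

Lemma is_derive_mono (f f' : R -> R) (a b : R) : (forall x : R, is_derive x 1 f (f' x)) ->
  (forall x, a < x < b -> 0 <= f' x) -> a <= b -> f a <= f b.
Proof.
move=> df f'0.
rewrite le_eqVlt => /predU1P[-> //|ab].
have [|c cab H] := @MVT R f f' a b ab.
  apply: derivable_within_continuous => z _.
  exact: (@ex_derive _ _ _ _ _ _ _ (df z)).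
rewrite -subr_ge0 H mulr_ge0//; last by rewrite subr_ge0 ltW.
by apply: f'0; move: cab; rewrite in_itv.
Qed.

Lemma is_derive_cst_seg (f f' : R -> R) (a b : R) : (forall x : R, is_derive x 1 f (f' x)) ->
  (forall x, a < x < b -> f' x = 0) -> a <= b -> f a = f b.
Proof.
move=> df f'0 ab; apply/eqP; rewrite eq_le (is_derive_mono df) //=; last first.
  by move=> x /f'0 ->.
have dN (x : R) : is_derive x 1 (fun x => - f x) (- f' x) by exact: is_deriveN.
rewrite -lerN2 (is_derive_mono dN) // => x /f'0 ->; by rewrite oppr0.
Qed.

(** The normalised primitive of the product of two flat functions, one for each
    end of the interval. *)
Lemma smooth_step : exists s : R -> R, [/\ Cinf s,
  forall x, 0 <= s x <= 1, forall x, x <= 0 -> s x = 0,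
  forall x, 1 <= x -> s x = 1 & {homo s : x y / x <= y}].
Proof.
pose b x := flat 1 x * flat 1 (1 - x).
have b_ge0 x : 0 <= b x.
  by rewrite /b /flat !hornerE mulr_ge0//; case: ifP; rewrite ?mul1r ?expR_ge0.
have cb : Cinf b.
  apply: CinfM; first exact: Cinf_flat.
  apply: (@Cinf_comp (flat 1) (fun x => 1 - x)); first exact: Cinf_flat.
  have := Cinf_affine (-1) 1; congr Cinf; apply/funext => x.
  by rewrite mulN1r addrC.
have [G cG dG] := Cinf_primitive cb.
have homoG x y : x <= y -> G x <= G y.
  by move=> xy; apply: (is_derive_mono dG) => //.
have bout x : x <= 0 \/ 1 <= x -> b x = 0.
  rewrite /b => -[x0|x1]; first by rewrite (flat_le0 _ x0) mul0r.
  by rewrite (@flat_le0 _ (1 - x)) ?mulr0// subr_le0.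
have G0 x : x <= 0 -> G x = G 0.
  move=> x0; apply: (is_derive_cst_seg dG) => // y /andP[_ y0].
  by apply: bout; left; exact: ltW.
have G1 x : 1 <= x -> G x = G 1.
  move=> x0; apply/esym/(is_derive_cst_seg dG) => // y /andP[y0 _].
  by apply: bout; right; exact: ltW.
have G01 : 0 < G 1 - G 0.
  have [|c + ->] := @MVT R G b 0 1 ltr01.
    apply: derivable_within_continuous => z _.
    exact: (@ex_derive _ _ _ _ _ _ _ (dG z)).
  rewrite in_itv /= => /andP[c0 c1]; rewrite subr0 mulr1 /b /flat c0 subr_gt0 c1.
  by rewrite !hornerC !mul1r mulr_gt0 ?expR_gt0.
exists (fun x => (G x - G 0) / (G 1 - G 0)); split.
- apply: (@CinfM (fun x => G x - G 0) (fun=> (G 1 - G 0)^-1)); last exact: Cinf_cst.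
  by apply: (@CinfD G (fun=> - G 0)) => //; exact: Cinf_cst.
- move=> x; apply/andP; split.
    rewrite divr_ge0 ?(ltW G01)// subr_ge0.
    by have [/G0 ->//|/ltW /homoG] := leP x 0.
  rewrite ler_pdivrMr// mul1r lerD2r.
  by have [/G1 ->//|/ltW /homoG] := leP 1 x.
- by move=> x /G0 ->; rewrite subrr mul0r.
- by move=> x /G1 ->; rewrite divff// gt_eqF.
- by move=> x y /homoG xy; rewrite ler_pM2r ?invr_gt0// lerD2r.
Qed.

Lemma is_derive_flat_left (f f' : R -> R) (c : R) : (forall x : R, is_derive x 1 f (f' x)) ->
  (forall x, x <= c -> f x = 0) -> forall x, x < c -> f' x = 0.
Proof.
move=> df f0 x xc.
have : is_derive x 1 f 0.
  apply: near_eq_is_derive (is_derive_cst (0 : R) x 1).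
  near=> z; rewrite f0//; apply: ltW; near: z; exact: lt_nbhsl.
move=> H0; have H1 := df x.
by rewrite -(@derive_val _ _ _ _ _ _ _ H1) (@derive_val _ _ _ _ _ _ _ H0).
Unshelve. all: by end_near. Qed.

Inductive sqrt_class : (R -> R) -> Prop :=
| Sqrt_base f n (c : R) : Cinf f -> 0 < c -> (forall x, x <= c -> f x = 0) ->
    sqrt_class (fun x => f x * (Num.sqrt x)^-1 ^+ n)
| Sqrt_add f g : sqrt_class f -> sqrt_class g ->
    sqrt_class (fun x => f x + g x).

Lemma is_derive_invsqrt n (x : R) : 0 < x ->
  is_derive x 1 (fun x => (Num.sqrt x)^-1 ^+ n)
    (- (n%:R / 2) * (Num.sqrt x)^-1 ^+ n.+2).
Proof.
move=> x0; have sx0 : Num.sqrt x != 0 by rewrite gt_eqF// sqrtr_gt0.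
have dV : is_derive x 1 (fun y : R => (Num.sqrt y)^-1)
    (- (2 * Num.sqrt x ^+ 3)^-1).
  have /is_derive_eq := is_deriveV sx0 (is_derive1_sqrt x0); apply.
  by rewrite /GRing.scale /=; field; rewrite ?sx0.
have D := is_deriveX n dV.
have -> : (fun x : R => (Num.sqrt x)^-1 ^+ n) =
    (fun y : R => (Num.sqrt y)^-1) ^+ n by rewrite exprfctE.
apply: (is_derive_eq D); rewrite /GRing.scale /=; case: n D => [|n] D.
  by rewrite !mul0r ?oppr0 ?mul0r ?mulr0n ?mul0r ?oppr0 ?mul0r.
rewrite succnK -mulr_natl -[n.+3]addn3 exprD; move: (_^-1 ^+ n) => u.
by field; rewrite sx0.
Qed.

Lemma sqrt_class_stable : derive_stable sqrt_class.
Proof.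
move=> h; elim=> {h} [f n c cf c0 f0|f g _ [f' cf' df] _ [g' cg' dg]]; last first.
  exists (fun x => f' x + g' x); first exact: Sqrt_add.
  by move=> x; exact: is_deriveD.
have [f' cf' df] := CinfP cf.
have c2 : 0 < c / 2 by rewrite divr_gt0.
exists (fun x => f' x * (Num.sqrt x)^-1 ^+ n +
    (- (n%:R / 2) * f x) * (Num.sqrt x)^-1 ^+ n.+2).
  apply: Sqrt_add.
    apply: (@Sqrt_base _ _ (c / 2)) => // x xc.
    by apply: (is_derive_flat_left df f0); lra.
  apply: (@Sqrt_base (fun x => - (n%:R / 2) * f x) n.+2 c) => //.
    by apply: CinfM => //; exact: Cinf_cst.
  by move=> x /f0 ->; rewrite mulr0.
move=> x; have [x0|x0] := ltP 0 x.
  have := is_deriveM (df x) (is_derive_invsqrt n x0).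
  by move=> /is_derive_eq; apply; rewrite /GRing.scale /=; ring.
have xc : x < c by exact: le_lt_trans c0.
rewrite (is_derive_flat_left df f0 xc) f0 ?(ltW xc)// !(mul0r, mulr0) addr0.
apply: near_eq_is_derive (is_derive_cst (0 : R) x 1).
near=> z; rewrite f0 ?mul0r//; apply: ltW; near: z; exact: lt_nbhsl.
Unshelve. all: by end_near. Qed.

Lemma smooth_invsqrt (c : R) : 0 < c -> exists2 i : R -> R, Cinf i &
  forall x, c <= x -> i x = (Num.sqrt x)^-1.
Proof.
move=> c0; have [s [cs _ s0 s1 _]] := smooth_step.
exists (fun x => s (2 / c * x - 1) * (Num.sqrt x)^-1 ^+ 1).
  exists sqrt_class; first exact: sqrt_class_stable.
  apply: (@Sqrt_base (fun x => s (2 / c * x - 1)) 1 (c / 2)).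
  - apply: (@Cinf_comp s (fun x => 2 / c * x - 1)) => //.
    exact: Cinf_affine.
  - by rewrite divr_gt0.
  - move=> x xc; apply: s0; rewrite subr_le0 mulrAC ler_pdivrMr// mul1r; lra.
move=> x cx; rewrite s1 ?mul1r ?expr1// lerBrDl mulrAC ler_pdivlMr//; lra.
Qed.

End smooth1.

(** * Test functions built from coordinates *)

Section smooth3.
Variable R : realType.
Local Notation V := ('cV[R]_3).
Implicit Types (f g : V -> R).

(** A class of functions of three variables, stable under partial derivatives by
    construction, and rich enough for all the test functions used below. *)
Inductive S3 : (V -> R) -> Prop :=
| S3_cst c : S3 (fun=> c)
| S3_coord k : S3 (fun x => x k 0)
| S3_add f g : S3 f -> S3 g -> S3 (fun x => f x + g x)
| S3_mul f g : S3 f -> S3 g -> S3 (fun x => f x * g x)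
| S3_comp (h : R -> R) f : Cinf h -> S3 f -> S3 (fun x => h (f x)).

Lemma Cinf_differentiable (h : R -> R) x : Cinf h -> differentiable h x.
Proof.
move=> /CinfP[h' _ dh]; apply/derivable1_diffP.
exact: (@ex_derive _ _ _ _ _ _ _ (dh x)).
Qed.

Lemma S3_differentiable f x : S3 f -> differentiable f x.
Proof.
move=> sf; elim: sf x => {f} [c|k|f g _ df _ dg|f g _ df _ dg|h f ch _ df] x.
- exact: differentiable_cst.
- exact: differentiable_coord.
- exact: differentiableD.
- exact: differentiableM.
- apply: (@differentiable_comp _ _ _ _ f h) => //; exact: Cinf_differentiable.
Qed.

Lemma S3_continuous f : S3 f -> continuous f.
Proof. by move=> sf x; apply/differentiable_continuous/S3_differentiable. Qed.

Lemma is_derive_comp3 (h h' : R -> R) f (x v : V) (d : R) :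
  (forall s : R, is_derive s 1 h (h' s)) -> differentiable f x -> is_derive x v f d ->
  is_derive x v (fun x => h (f x)) (h' (f x) * d).
Proof.
move=> dh df fd.
have dhx : differentiable h (f x).
  by apply/derivable1_diffP; exact: (@ex_derive _ _ _ _ _ _ _ (dh _)).
have dhf := @differentiable_comp _ _ _ _ f h _ df dhx.
apply: DeriveDef; first exact: diff_derivable.
rewrite (deriveE _ dhf) diff_comp//= -(deriveE _ df) (@derive_val _ _ _ _ _ _ _ fd).
rewrite deriv1E; last exact/derivable1_diffP.
by rewrite derive1E (@derive_val _ _ _ _ _ _ _ (dh _)) mulrC.
Qed.

Lemma is_derive_coord k (x v : V) : is_derive x v (fun x : V => x k 0) (v k 0).
Proof.
have dc : differentiable (fun x : V => x k 0) x by exact: differentiable_coord.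
apply: DeriveDef; first exact: diff_derivable.
have := @derive_mx _ _ _ _ (@id V) x v (@derivable_id _ _ x v).
by rewrite derive_id => vE; rewrite [in RHS]vE mxE.
Qed.

Lemma S3_derive f : S3 f -> forall v : V,
  exists2 f', S3 f' & forall x : V, is_derive x v f (f' x).
Proof.
elim=> {f} [c|k|f g sf Hf sg Hg|f g sf Hf sg Hg|h f ch sf Hf] v.
- exists (fun=> 0); [exact: S3_cst|move=> x; exact: is_derive_cst].
- exists (fun=> v k 0); [exact: S3_cst|move=> x; exact: is_derive_coord].
- have [f' sf' df] := Hf v; have [g' sg' dg] := Hg v.
  exists (fun x => f' x + g' x); [exact: S3_add|move=> x; exact: is_deriveD].
- have [f' sf' df] := Hf v; have [g' sg' dg] := Hg v.
  exists (fun x => f x * g' x + g x * f' x).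
    by apply: S3_add; exact: S3_mul.
  by move=> x; exact: is_deriveM.
- have [f' sf' df] := Hf v; have [h' ch' dh] := CinfP ch.
  exists (fun x => h' (f x) * f' x); first by apply: S3_mul => //; exact: S3_comp.
  move=> x; apply: is_derive_comp3 => //; exact: S3_differentiable.
Qed.

Lemma S3_pderiv f k : S3 f -> S3 (pderiv k f).
Proof.
move=> sf; have [f' sf' df] := S3_derive sf (delta_mx k 0).
suff -> : pderiv k f = f' by [].
apply/funext => x; exact: (@derive_val _ _ _ _ _ _ _ (df x)).
Qed.

Lemma S3_smooth f : S3 f -> smooth f.
Proof.
move=> sf s x; apply: S3_differentiable.
by elim: s => //= k s IH; exact: S3_pderiv.
Qed.

Lemma S3_derive_dir f (x v : V) : S3 f ->
  'D_v f x = \sum_k v k 0 * pderiv k f x.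
Proof.
move=> sf; have df := S3_differentiable x sf.
rewrite (deriveE _ df) {1}(matrix_sum_delta v).
under eq_bigr do rewrite big_ord1.
rewrite linear_sum/=; apply: eq_bigr => k _.
by rewrite linearZ /= /pderiv (deriveE _ df).
Qed.

End smooth3.

(** * Real integrals, Borel sets and rotated coordinates *)

Section integrable_real.
Context d (T : measurableType d) (R : realType).
Variables (mu : {measure set T -> \bar R}) (D : set T).
Hypothesis mD : measurable D.
Implicit Types f g : T -> R.

Definition rintegrable f := mu.-integrable D (EFin \o f).

Lemma rintegrableD f g : rintegrable f -> rintegrable g ->
  rintegrable (fun x => f x + g x).
Proof. by move=> If Ig; have := integrableD mD If Ig. Qed.

Lemma rintegrableZ (c : R) f : rintegrable f -> rintegrable (fun x => c * f x).
Proof. by move=> If; have := integrableZl mD c If. Qed.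

Lemma rintegrableN f : rintegrable f -> rintegrable (fun x => - f x).
Proof. by move=> If; have := integrableN If. Qed.

Lemma rintegrableB f g : rintegrable f -> rintegrable g ->
  rintegrable (fun x => f x - g x).
Proof. by move=> If Ig; apply: rintegrableD => //; exact: rintegrableN. Qed.

Lemma rintegrable_sum n (f : 'I_n -> T -> R) : (forall i, rintegrable (f i)) ->
  rintegrable (fun x => \sum_i f i x).
Proof.
move=> If; rewrite /rintegrable.
have -> : EFin \o (fun x => \sum_i f i x) = (fun x => \sum_i (f i x)%:E)%E.
  by apply/funext => x /=; rewrite sumEFin.
by apply: integrable_sum => // i _; exact: If.
Qed.

Lemma rintegrable_mulb (M : R) f g : rintegrable f -> measurable_fun D g ->
  (forall x, D x -> `|g x| <= M) -> rintegrable (fun x => f x * g x).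
Proof.
move=> If mg gM; apply: (integrableMl mD If mg).
exists M; split; first exact: num_real.
by move=> y My x Dx; apply: le_trans (ltW My); exact: gM.
Qed.

Lemma rintegrable_bounded (M : R) f : (mu D < +oo)%E -> measurable_fun D f ->
  (forall x, D x -> `|f x| <= M) -> rintegrable f.
Proof.
move=> muD mf fM; apply: measurable_bounded_integrable => //.
exists M; split; first exact: num_real.
by move=> y My x Dx; apply: le_trans (ltW My); exact: fM.
Qed.

Lemma Rintegral_sum n (f : 'I_n -> T -> R) : (forall i, rintegrable (f i)) ->
  \int[mu]_(x in D) (\sum_i f i x) = \sum_i \int[mu]_(x in D) f i x.
Proof.
elim: n f => [|n IH] f If.
  rewrite big_ord0; under eq_Rintegral do rewrite big_ord0.
  by rewrite /Rintegral integral0.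
rewrite big_ord_recl -IH//; under eq_Rintegral do rewrite big_ord_recl.
by rewrite RintegralD//; [exact: If|apply: rintegrable_sum => i; exact: If].
Qed.

Lemma RintegralZ (c : R) f : rintegrable f ->
  \int[mu]_(x in D) (c * f x) = c * \int[mu]_(x in D) f x.
Proof. by move=> If; rewrite RintegralZl. Qed.

End integrable_real.

Section borel_continuous.
Variable R : realType.

Lemma borel_open (T : ptopologicalType) (A : set (borel T)) :
  open (A : set T) -> measurable A.
Proof. exact: sub_sigma_algebra. Qed.

Lemma borel_closed (T : ptopologicalType) (A : set (borel T)) :
  closed (A : set T) -> measurable A.
Proof.
move=> cA; rewrite -(setCK A); apply: measurableC; apply: borel_open.
exact: (@closed_openC T A).
Qed.

Lemma continuous_borel (T : ptopologicalType) (f : T -> R) :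
  continuous f -> measurable_fun setT (f : borel T -> R).
Proof.
move=> /continuousP cf.
apply: (@measurability _ _ (borel T) R setT f _ (measurable_realfun.RGenOpens.measurableE R)).
move=> _ [_ [a [b ->] <-]]; rewrite setTI.
by apply: borel_open; apply: cf; exact: interval_open.
Qed.

Lemma trmx_continuous m n : continuous (@trmx R m n).
Proof.
move=> v A /nbhs_ballP[e e0 eA]; apply/nbhs_ballP; exists e => // w [_ vw].
by apply: eA; split => // i j; rewrite !mxE; exact: vw.
Qed.

Lemma cV_box_compact n (M : R) :
  compact [set v : 'cV[R]_n | forall i, `|v i 0| <= M].
Proof.
have := @rV_compact R n (fun=> `[- M, M]%classic) (fun=> @segment_compact _ _ _).
move/(@continuous_compact _ _ (@trmx R 1 n)).
have -> : trmx @` [set v : 'rV[R]_n | forall i, `[- M, M]%classic (v ord0 i)] =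
   [set v : 'cV[R]_n | forall i, `|v i 0| <= M].
  apply/seteqP; split => [_ [v vM <-] i|v vM].
    by have := vM i; rewrite /= mxE in_itv /= ler_norml.
  exists v^T; last by rewrite trmxK.
  by move=> i; rewrite /= mxE in_itv /= -ler_norml.
by apply; apply: continuous_subspaceT; exact: trmx_continuous.
Qed.

End borel_continuous.

Section rotation.
Variable R : realType.
Local Notation V := ('cV[R]_3).

Lemma sum3 (T : nmodType) (F : 'I_3 -> T) : \sum_i F i = F 0 + F 1 + F 2.
Proof.
rewrite 3!big_ord_recr big_ord0 /= add0r.
by congr (F _ + F _ + F _); apply: val_inj.
Qed.

Lemma ord3P (k : 'I_3) : [\/ k = 0, k = 1 | k = 2].
Proof.
case: k => -[|[|[|//]]] h; [apply: Or31|apply: Or32|apply: Or33]; exact: val_inj.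
Qed.

Lemma add3E : prod (prod (prod ((0 : 'I_3) + 1 = 1) ((0 : 'I_3) + 2 = 2))
  (prod ((1 : 'I_3) + 1 = 2) ((1 : 'I_3) + 2 = 0)))
  (prod ((2 : 'I_3) + 1 = 0) ((2 : 'I_3) + 2 = 1)).
Proof. by do !split; apply: val_inj. Qed.

Lemma det3 (A : 'M[R]_3) : \det A =
  A 0 0 * (A 1 1 * A 2 2 - A 1 2 * A 2 1)
  - A 0 1 * (A 1 0 * A 2 2 - A 1 2 * A 2 0)
  + A 0 2 * (A 1 0 * A 2 1 - A 1 1 * A 2 0).
Proof.
have l00 : lift (0 : 'I_3) (0 : 'I_2) = 1 by exact: val_inj.
have l01 : lift (0 : 'I_3) (1 : 'I_2) = 2 by exact: val_inj.
have l10 : lift (1 : 'I_3) (0 : 'I_2) = 0 by exact: val_inj.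
have l11 : lift (1 : 'I_3) (1 : 'I_2) = 2 by exact: val_inj.
have l20 : lift (2 : 'I_3) (0 : 'I_2) = 0 by exact: val_inj.
have l21 : lift (2 : 'I_3) (1 : 'I_2) = 1 by exact: val_inj.
have m00 : lift (0 : 'I_2) (0 : 'I_1) = 1 by exact: val_inj.
have m10 : lift (1 : 'I_2) (0 : 'I_1) = 0 by exact: val_inj.
have sum2 (F : 'I_2 -> R) : \sum_i F i = F 0 + F 1.
  by rewrite 2!big_ord_recr big_ord0 /= add0r; congr (F _ + F _); apply: val_inj.
rewrite (expand_det_row _ 0) sum3 /cofactor !(expand_det_row _ (0 : 'I_2)) !sum2.
rewrite /cofactor !det_mx11 !mxE.
rewrite !(l00, l01, l10, l11, l20, l21, m00, m10) /=; ring.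
Qed.

Variable Q : 'M[R]_3.
Hypothesis QSO : SO3 Q.

Lemma SO3_trmul : Q^T *m Q = 1%:M.
Proof. by apply: mulmx1C; case: QSO. Qed.

Definition yc k (x : V) : R := (Q^T *m x) k 0.

Lemma ycE k x : yc k x = \sum_l Q l k * x l 0.
Proof. by rewrite /yc mxE; apply: eq_bigr => l _; rewrite mxE. Qed.

Lemma S3_scale (c : R) (f : V -> R) : S3 f -> S3 (fun x => c * f x).
Proof. by move=> sf; apply: S3_mul => //; exact: S3_cst. Qed.

Lemma S3_yc k : S3 (yc k).
Proof.
have -> : yc k = fun x => Q 0 k * x 0 0 + Q 1 k * x 1 0 + Q 2 k * x 2 0.
  by apply/funext => x; rewrite ycE sum3.
by do 2?apply: S3_add; apply: S3_scale; exact: S3_coord.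
Qed.

Lemma yc_scale (s : R) k x : yc k (s *: x) = s * yc k x.
Proof. by rewrite /yc -scalemxAr mxE. Qed.

Lemma is_derive_yc k l (x : V) : is_derive x (col l Q) (yc k) ((k == l)%:R).
Proof.
have -> : yc k = fun x => Q 0 k * x 0 0 + Q 1 k * x 1 0 + Q 2 k * x 2 0.
  by apply/funext => y; rewrite ycE sum3.
have D j := is_deriveZ (Q j k) (is_derive_coord j x (col l Q)).
apply: is_derive_eq (is_deriveD (is_deriveD (D 0) (D 1)) (D 2)) _.
have <- : (Q^T *m Q) k l = (k == l)%:R by rewrite SO3_trmul mxE.
by rewrite [in RHS]mxE [in RHS]sum3 !mxE.
Qed.



Lemma yc_mul k (v : V) : yc k (Q *m v) = v k 0.
Proof. by rewrite /yc mulmxA SO3_trmul mul1mx. Qed.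

Lemma ycK (x : V) : Q *m (\col_k yc k x) = x.
Proof.
have -> : \col_k yc k x = Q^T *m x.
  by apply/matrixP => i j; rewrite mxE (ord1 j).
by rewrite mulmxA (proj1 QSO) mul1mx.
Qed.

Lemma coord_yc i (x : V) : x i 0 = \sum_k Q i k * yc k x.
Proof. by rewrite -{1}(ycK x) mxE; apply: eq_bigr => k _; rewrite mxE. Qed.

Lemma vec3E (a b c : R) : [/\ vec3 (a, b, c) 0 0 = a, vec3 (a, b, c) 1 0 = b
  & vec3 (a, b, c) 2 0 = c].
Proof. by rewrite /vec3 !mxE. Qed.

Lemma vec3_col (v : V) : v = vec3 (v 0 0, v 1 0, v 2 0).
Proof.
apply/matrixP => i j; rewrite (ord1 j).
by have [e0 e1 e2] := vec3E (v 0 0) (v 1 0) (v 2 0); case: (ord3P i) => ->.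
Qed.

Definition rad2 (x : V) := yc 0 x ^+ 2 + yc 1 x ^+ 2.

Lemma rad2_ge0 x : 0 <= rad2 x.
Proof. by rewrite addr_ge0 ?sqr_ge0. Qed.

Lemma image_vec3P (A : set (R * R)) (I : set R) (x : V) :
  (mulmx Q @` (@vec3 R @` (A `*` I))) x <-> A (yc 0 x, yc 1 x) /\ I (yc 2 x).
Proof.
split => [[_ [[[a b] c] [/= Aab Ic] <-] <-]|[A01 I2]].
  by have [e0 e1 e2] := vec3E a b c; rewrite !yc_mul e0 e1 e2.
exists (Q^T *m x); last by rewrite mulmxA (proj1 QSO) mul1mx.
by exists (yc 0 x, yc 1 x, yc 2 x) => //; rewrite [RHS]vec3_col.
Qed.

Lemma lt_sqrt (a b : R) : 0 < b -> 0 <= a -> (Num.sqrt a < b) = (a < b ^+ 2).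
Proof.
move=> b0 a0.
by rewrite -(@ltr_pXn2r _ 2) ?nnegrE ?sqrtr_ge0 ?(ltW b0)// sqr_sqrtr.
Qed.

Lemma tubeP rho h (x : V) : 0 < rho ->
  (mulmx Q @` tube rho h) x <-> rad2 x < rho ^+ 2 /\ 0 < yc 2 x < h.
Proof.
move=> rho0; rewrite image_vec3P /disk /= in_itv /= lt_sqrt ?rad2_ge0//.
Qed.

Lemma shellP rho r h (x : V) : 0 < rho -> 0 < r ->
  (mulmx Q @` shell rho r h) x <-> r ^+ 2 <= rad2 x < rho ^+ 2 /\ 0 < yc 2 x < h.
Proof.
move=> rho0 r0; rewrite image_vec3P /setD /disk /= in_itv /=.
rewrite !lt_sqrt ?rad2_ge0// -/(rad2 x).
split=> [[[h1 /negP h2] h3]|[/andP[h1 h2] h3]]; split => //.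
  by rewrite h1 andbT leNgt.
by split => //; apply/negP; rewrite -leNgt.
Qed.

Lemma S3_rad2 : S3 rad2.
Proof. by apply: S3_add; apply: S3_mul; exact: S3_yc. Qed.

Lemma open_tube rho h : 0 < rho -> open (mulmx Q @` tube rho h).
Proof.
move=> rho0.
have -> : mulmx Q @` tube rho h =
    rad2 @^-1` [set s | s < rho ^+ 2] `&` yc 2 @^-1` `]0, h[.
  apply/seteqP; split => x; first by move=> /(tubeP _ _ rho0)[? ?]; split; rewrite //= in_itv.
  by move=> [/= ? ]; rewrite in_itv /= => ?; apply/tubeP.
apply: openI; apply: open_comp => //.
- by move=> x _; exact: (S3_continuous S3_rad2).
- by move=> x _; exact: (S3_continuous (S3_yc 2)).
Qed.

Lemma measurable_S3 f : S3 f -> measurable_fun setT (f : borel V -> R).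
Proof. by move=> sf; apply: continuous_borel; exact: S3_continuous. Qed.

Lemma measurable_tube rho h : 0 < rho ->
  measurable (mulmx Q @` tube rho h : set (borel V)).
Proof. by move=> rho0; apply: borel_open; exact: open_tube. Qed.

Lemma measurable_shell rho r h : 0 < rho -> 0 < r ->
  measurable (mulmx Q @` shell rho r h : set (borel V)).
Proof.
move=> rho0 r0.
have -> : mulmx Q @` shell rho r h = (mulmx Q @` tube rho h) `&`
    rad2 @^-1` [set s | r ^+ 2 <= s].
  apply/seteqP; split => x.
    move=> /(shellP _ _ rho0 r0)[/andP[h1 h2] h3]; split => //=.
    by apply/tubeP.
  by move=> [/(tubeP _ _ rho0)[h1 h2] h3]; apply/shellP; rewrite // h3 h1.
apply: measurableI; first exact: measurable_tube.
apply: borel_closed; apply: preimage_closed; last exact: closed_ge.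
by move=> x _; exact: (S3_continuous S3_rad2).
Qed.

Lemma SO3_entry i k : `|Q i k| <= 1.
Proof.
have : (Q *m Q^T) i i = 1 by rewrite (proj1 QSO) mxE eqxx.
rewrite mxE => H.
have : Q i k ^+ 2 <= 1.
  rewrite -H (bigD1 k)//= mxE -expr2 lerDl sumr_ge0// => j _.
  by rewrite mxE -expr2 sqr_ge0.
by rewrite -real_normK ?num_real// -[X in _ <= X](expr1n _ 2) ler_pXn2r ?nnegrE.
Qed.

Lemma cyl_compact c z0 z1 :
  compact [set x | rad2 x <= c /\ z0 <= yc 2 x <= z1].
Proof.
set K := [set x | _].
have cK : closed K.
  have -> : K = rad2 @^-1` [set s | s <= c] `&` yc 2 @^-1` `[z0, z1].
    by apply/seteqP; split => x; rewrite /K /= in_itv.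
  apply: closedI; apply: preimage_closed.
  - by move=> x _; exact: (S3_continuous S3_rad2).
  - exact: closed_le.
  - by move=> x _; exact: (S3_continuous (S3_yc 2)).
  - exact: interval_closed.
apply: (@subclosed_compact _ _ _ cK (@cV_box_compact R 3 (2 * (1 + c) + (`|z0| + `|z1|)))) => //.
move=> x [rc /andP[yz0 yz1]] i /=.
have le1 k : `|Q i k * yc k x| <= `|yc k x|.
  by rewrite normrM ler_piMl// SO3_entry.
have y2 : `|yc 2 x| <= `|z0| + `|z1|.
  rewrite ler_norml; have := ler_norm z1; have := ler_norm (- z0).
  rewrite normrN; have := normr_ge0 z0; have := normr_ge0 z1; lra.
have yb k : yc k x ^+ 2 <= c -> `|yc k x| <= 1 + c.
  rewrite -real_normK ?num_real//; have := normr_ge0 (yc k x).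
  by move: `|_| => u; nra.
have y0 := yb 0 _; have y1 := yb 1 _.
rewrite coord_yc sum3 (le_trans (ler_normD _ _))//.
rewrite mulr2n mulrDl mul1r; apply: lerD; last by rewrite (le_trans (le1 _)).
rewrite (le_trans (ler_normD _ _))//; apply: lerD; apply: le_trans (le1 _) _.
  by apply: y0; apply: le_trans rc; rewrite lerDl sqr_ge0.
by apply: y1; apply: le_trans rc; rewrite lerDr sqr_ge0.
Qed.

Lemma test_functionP rho h c z0 z1 f : 0 < rho -> S3 f ->
  c < rho ^+ 2 -> 0 < z0 -> z1 < h ->
  (forall x, f x != 0 -> rad2 x <= c /\ z0 <= yc 2 x <= z1) ->
  test_function (mulmx Q @` tube rho h) f.
Proof.
move=> rho0 sf crho z00 z1h fK.
have cK := @cyl_compact c z0 z1.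
have sub : closure [set x | f x != 0] `<=` [set x | rad2 x <= c /\ z0 <= yc 2 x <= z1].
  have /closure_id KE := compact_closed (@norm_hausdorff _ _) cK.
  by rewrite KE; apply: closureS => x /fK.
split; first exact: S3_smooth.
  by apply: (subclosed_compact _ cK sub); exact: closed_closure.
move=> x /sub[xc /andP[x0 x1]]; apply/tubeP => //; split.
  exact: le_lt_trans crho.
by rewrite (lt_le_trans z00 x0) (le_lt_trans x1 z1h).
Qed.

Lemma test_pderiv_bounded Omega f k : test_function Omega f -> S3 f ->
  exists M : R, forall x, `|pderiv k f x| <= M.
Proof.
move=> [_ cS _] sf.
have sk := S3_pderiv k sf.
have : compact (pderiv k f @` closure [set x | f x != 0]).
  apply: continuous_compact cS; apply: continuous_subspaceT.
  exact: S3_continuous.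
move=> /compact_bounded[M [_ MP]].
exists (Num.max 0 (M + 1)) => x.
have [xS|xS] := pselect (closure [set x | f x != 0] x).
  rewrite le_max; apply/orP; right.
  by apply: (MP (M + 1) _ (pderiv k f x)); [rewrite ltrDl|exists x].
suff -> : pderiv k f x = 0 by rewrite normr0 le_max lexx.
rewrite /pderiv (@near_eq_derive _ _ _ _ (fun=> 0)) ?derive_cst//.
have : nbhs x (~` closure [set x | f x != 0]).
  by apply: open_nbhs_nbhs; split => //; exact/closed_openC/closed_closure.
apply: filterS => z zS; apply/eqP; apply: contrapT => fz.
by apply: zS; apply: subset_closure; exact/negP.
Qed.

End rotation.

(** * The curl in a rotated frame *)

Section curl_frame.
Variable R : realType.
Local Notation V := ('cV[R]_3).
Variable Q : 'M[R]_3.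
Hypothesis QSO : SO3 Q.

Lemma triple_product (z d : 'I_3 -> R) (k : 'I_3) :
  \sum_j Q j k *
    ((\sum_m Q (j + 1) m * z m) * (\sum_m Q (j + 2) m * d m) -
     (\sum_m Q (j + 2) m * z m) * (\sum_m Q (j + 1) m * d m)) =
  z (k + 1) * d (k + 2) - z (k + 2) * d (k + 1).
Proof.
have dQ : \det Q = 1 by case: QSO.
rewrite det3 in dQ; rewrite -[RHS]mul1r -dQ.
by case: (ord3P k) => ->; rewrite !sum3 !add3E; ring.
Qed.

(** In the frame of a rotation the curl keeps its form: contracting with the
    columns of [Q] uses only that the triple products of the columns are the
    Levi-Civita symbols. *)
Lemma curl_frame Omega xi b t S (f : V -> R) :
  measurable (Omega : set (borel V)) -> L1_fun Omega xi ->
  Q *m e3 R = t ->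
  curl_eq_hausdorff1 Omega xi (otimes b t) S ->
  S3 f -> test_function Omega f -> forall i k : 'I_3,
  \int[@leb3 R]_(x in Omega)
    ((xi x *m Q) i (k + 1) * 'D_(col (k + 2) Q) f x -
     (xi x *m Q) i (k + 2) * 'D_(col (k + 1) Q) f x) =
  fine (integral (@hausdorff1 R) S (fun x => (f x)%:E)) * b i 0 * (k == 2)%:R.
Proof.
move=> mO L1 Qt cxi sf tf i k; set c := fine _.
have Ixi j : rintegrable (@leb3 R) Omega (fun x => xi x i j) by exact: L1.
have Ixf j l : rintegrable (@leb3 R) Omega (fun x => xi x i j * pderiv l f x).
  have [M HM] := test_pderiv_bounded l tf sf.
  apply: (@rintegrable_mulb _ _ _ _ _ mO M) => //.
  by apply: measurable_funTS; apply: measurable_S3; exact: S3_pderiv.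
pose w j x := xi x i (j + 1) * pderiv (j + 2) f x - xi x i (j + 2) * pderiv (j + 1) f x.
have Iw j : rintegrable (@leb3 R) Omega (w j) by exact: rintegrableB.
have curlj j : \int[@leb3 R]_(x in Omega) w j x = c * (b i 0 * t j 0).
  have := congr1 (fun M : 'M[R]_3 => M i j) (cxi f tf).
  rewrite !mxE /dist_pderiv -/c => <-.
  rewrite /w RintegralB//; [by rewrite opprK addrC|exact: Ixf|exact: Ixf].
transitivity (\int[@leb3 R]_(x in Omega) \sum_j Q j k * w j x).
  apply: eq_Rintegral => x _.
  pose z m := (xi x *m Q) i m; pose d m := 'D_(col m Q) f x.
  have xiE j : xi x i j = \sum_m Q j m * z m.
    have -> : xi x i j = (xi x *m Q *m Q^T) i j.
      by rewrite -mulmxA (proj1 QSO) mulmx1.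
    by rewrite mxE; apply: eq_bigr => m _; rewrite mulrC mxE.
  have dE j : pderiv j f x = \sum_m Q j m * d m.
    under eq_bigr do rewrite /d S3_derive_dir//.
    under eq_bigr do rewrite mulr_sumr.
    rewrite exchange_big /= (bigD1 j) //= -[LHS]addr0; congr (_ + _).
      have := congr1 (fun M : 'M[R]_3 => M j j) (proj1 QSO).
      rewrite !mxE eqxx => /esym QQ.
      rewrite -[LHS]mul1r [X in X * _]QQ mulr_suml; apply: eq_bigr => m _.
      by rewrite !mxE mulrA.
    apply/esym; apply: big1 => l lj.
    have := congr1 (fun M : 'M[R]_3 => M j l) (proj1 QSO).
    rewrite !mxE eq_sym (negPf lj) => QQ.
    rewrite -[RHS](mul0r (pderiv l f x)) -[X in X * _]QQ mulr_suml.
    by apply: eq_bigr => m _; rewrite !mxE mulrA.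
  rewrite -(triple_product z d k); apply: eq_bigr => j _.
  by rewrite /w !xiE !dE.
rewrite Rintegral_sum//; last by move=> j; exact: rintegrableZ.
under eq_bigr do rewrite RintegralZ// curlj.
have -> : (k == 2)%:R = \sum_j Q j k * t j 0 :> R.
  rewrite -ycE -Qt yc_mul// /e3; have [e0 e1 e2] := @vec3E R 0 0 1.
  by case: (ord3P k) => ->; rewrite ?e0 ?e1 ?e2.
by rewrite mulr_sumr; apply: eq_bigr => j _; ring.
Qed.

End curl_frame.

(** * Isometries preserve product measures *)

(** The image measure, bundled with the measurability proof that makes the
    pushforward a measure. *)
Definition image_measure d1 d2 (T1 : measurableType d1) (T2 : measurableType d2)
    (R : realType) (m : {measure set T1 -> \bar R}) (f : T1 -> T2)
    (mf : measurable_fun setT f) : {measure set T2 -> \bar R} :=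
  measure_function_pushforward__canonical__measure_function_Measure m mf.

Section image_measure_integral.
Context d1 d2 (T1 : measurableType d1) (T2 : measurableType d2) (R : realType).
Variables (m : {measure set T1 -> \bar R}) (n : {measure set T2 -> \bar R}).
Variables (phi : T1 -> T2) (mphi : measurable_fun setT phi).

Lemma ge0_integral_image (f : T2 -> \bar R) :
  (forall A, measurable A -> n A = m (phi @^-1` A)) ->
  measurable_fun setT f -> (forall x, 0 <= f x)%E ->
  (\int[n]_x f x = \int[m]_x f (phi x))%E.
Proof.
move=> nE mf f0; rewrite -[RHS](@ge0_integral_pushforward _ _ _ _ _ _ mphi m setT)//.
apply: (@eq_measure_integral _ _ _ _ (image_measure m mphi) n) => A mA _.
by rewrite nE.
Qed.

End image_measure_integral.

Section translation.
Variable R : realType.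
Local Notation M1 := (measurableTypeR R).
Local Notation mu := (@lebesgue_measure R).
Local Open Scope ereal_scope.

Lemma measurable_shift (c : R) : measurable_fun setT (fun x : M1 => (x + c)%R : M1).
Proof.
apply: (@continuous_measurable_fun R) => x.
by apply: cvgD; [exact: cvg_id|exact: cvg_cst].
Qed.

Lemma lebesgue_measure_shift (c : R) (A : set M1) : measurable A ->
  pushforward mu (fun x : M1 => (x + c)%R : M1) A = mu A.
Proof.
move=> mA; apply/esym.
apply: (@lebesgue_measure_unique _ (image_measure mu (measurable_shift c)) _ _ mA).
move=> _ [[a b]] _ <-; rewrite /= /pushforward.
have -> : (fun x : M1 => (x + c)%R : M1) @^-1` `]a, b] = `](a - c)%R, (b - c)%R]%classic.
  by apply/seteqP; split => x /=; rewrite !in_itv /= ltrBlDr lerBrDr.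
rewrite !lebesgue_measure_itv/= !lte_fin ltrD2r.
case: ifP => // _; rewrite -!EFinD; congr EFin; ring.
Qed.

Lemma integral_shift (c : R) (f : M1 -> \bar R) : measurable_fun setT f ->
  (forall x, 0 <= f x) -> \int[mu]_x f (x + c)%R = \int[mu]_x f x.
Proof.
move=> mf f0; apply/esym; apply: (ge0_integral_image (measurable_shift c)) => // A mA.
by rewrite -[LHS](lebesgue_measure_shift c).
Qed.

End translation.

Section product_invariance.
Context d1 d2 (T1 : measurableType d1) (T2 : measurableType d2) (R : realType).
Variables (m1 : {sigma_finite_measure set T1 -> \bar R}).
Variables (m2 : {sigma_finite_measure set T2 -> \bar R}).
Local Open Scope ereal_scope.

Lemma sigma_finite_product : sigma_finite setT (m1 \x m2).
Proof.
have /sigma_finiteP[F [FT Fnd Ffin]] := sigma_finiteT m1.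
have /sigma_finiteP[G [GT Gnd Gfin]] := sigma_finiteT m2.
exists (fun n => F n `*` G n).
  apply/seteqP; split => // -[x y] _.
  have [i _ Fix] : (\bigcup_n F n) x by rewrite -FT.
  have [j _ Gjy] : (\bigcup_n G n) y by rewrite -GT.
  exists (maxn i j) => //; split => /=.
    by move: x Fix; apply/subsetPset/Fnd/leq_maxl.
  by move: y Gjy; apply/subsetPset/Gnd/leq_maxr.
move=> n; have [mF Fn] := Ffin n; have [mG Gn] := Gfin n.
split; first exact: measurableX.
by rewrite product_measure1E// lte_mul_pinfty// ge0_fin_numE.
Qed.

Definition sf_product : {sigma_finite_measure set (T1 * T2)%type -> \bar R} :=
  HB.pack (m1 \x m2) (Measure_isSigmaFinite.Build _ _ _ (m1 \x m2) sigma_finite_product).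

Lemma sf_productE (A : set T1) (B : set T2) : measurable A -> measurable B ->
  sf_product (A `*` B) = m1 A * m2 B.
Proof. exact: product_measure1E. Qed.

Definition preserves d (T : measurableType d) (m : set T -> \bar R)
    (a : T -> T) : Prop :=
  forall f : T -> \bar R, measurable_fun setT f -> (forall x, 0 <= f x) ->
    \int[m]_x f (a x) = \int[m]_x f x.

Lemma preserves_prod (a : T1 -> T1) (b : T2 -> T2) :
  measurable_fun setT a -> measurable_fun setT b ->
  preserves m1 a -> preserves m2 b ->
  preserves (m1 \x m2) (fun p => (a p.1, b p.2)).
Proof.
move=> ma mb pa pb f mf f0.
have mab : measurable_fun setT (fun p : T1 * T2 => (a p.1, b p.2)).
  by apply: measurable_fun_pair; apply: measurableT_comp.
rewrite (@fubini_tonelli1 _ _ _ _ _ m1 m2 (fun p => f (a p.1, b p.2)))//; last first.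
  exact: (measurableT_comp mf mab).
have -> := @fubini_tonelli1 _ _ _ _ _ m1 m2 f mf f0.
rewrite /fubini_F.
transitivity (\int[m1]_x fubini_F m2 f (a x)).
  apply: eq_integral => x _; apply: (pb (fun y => f (a x, y))) => //.
  exact: measurableT_comp.
apply: pa; first exact: measurable_fun_fubini_tonelli_F.
by move=> x; apply: integral_ge0.
Qed.

End product_invariance.

Section isometry.
Context d (T : measurableType d) (R : realType).
Variable m : {sigma_finite_measure set T -> \bar R}.
Variables (add : T -> T -> T) (opp : T -> T).
Hypothesis madd2 : measurable_fun setT (fun w : T * T => add w.1 w.2).
Hypothesis mopp : measurable_fun setT opp.
Hypothesis madd_inv : forall v, preserves m (fun p => add p v).
Hypothesis addK : forall p q, add p (add q (opp p)) = q.
Hypothesis addNK : forall p q, add p (opp (add q p)) = opp q.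
Local Open Scope ereal_scope.

Let tonelli_sym (f : T * T -> R) : measurable_fun setT f -> (forall w, (0 <= f w)%R) ->
  \int[m]_x \int[m]_y (f (x, y))%:E = \int[m]_y \int[m]_x (f (x, y))%:E.
Proof.
move=> mf f0; apply: (@fubini_tonelli _ _ _ _ _ m m (EFin \o f)).
  exact/measurable_EFinP.
by move=> w; rewrite lee_fin.
Qed.

(** A linear isometry preserves the measure: in the product of the measures of
    the preimage of A and of a ball B, written as a double integral,
    translating each variable in turn moves the map from A to B, which it
    leaves invariant. *)
Lemma isometry_preserves (q : T -> T) (B : set T) :
  measurable_fun setT q ->
  (forall y, exists y', forall x, q (add x y') = add (q x) y) ->
  measurable B -> (forall x, B (opp (q x)) <-> B x) ->
  0 < m B -> m B < +oo ->
  preserves m q.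
Proof.
move=> mq qadd mB Bq B0 Boo.
have mq1 : measurable_fun setT (fun w : T * T => q w.1).
  exact: (measurableT_comp mq measurable_fst).
have mi (d' : measure_display) (T' : measurableType d') (C : set T) (g : T' -> T) :
    measurable C -> measurable_fun setT g ->
    measurable_fun setT (fun w => \1_C (g w) : R).
  move=> mC mg; exact: (measurableT_comp (measurable_indic mC) mg).
have i0 (C : set T) x : (0 <= \1_C x :> R)%R by rewrite indicE ler0n.
suff main A : measurable A -> m (q @^-1` A) = m A.
  move=> f mf f0; apply/esym.
  exact: (@ge0_integral_image _ _ _ _ _ m m q mq f (fun A mA => esym (main A mA)) mf f0).
move=> mA.
have mqA : measurable (q @^-1` A) by rewrite -[X in measurable X]setTI; exact: mq.
have madd (g h : T * T -> T) : measurable_fun setT g -> measurable_fun setT h ->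
    measurable_fun setT (fun w => add (g w) (h w)).
  move=> mg mh.
  exact: (measurableT_comp madd2 (measurable_fun_pair mg mh)).
have iB : \int[m]_y (\1_B y : R)%:E = m B by rewrite integral_indic// setIT.
have iA : \int[m]_y (\1_A y : R)%:E = m A by rewrite integral_indic// setIT.
have iqA : \int[m]_x (\1_A (q x) : R)%:E = m (q @^-1` A).
  rewrite -[X in m X]setIT -integral_indic//.
have : m (q @^-1` A) * m B = m A * m B; last first.
  have : m B \is a fin_num by rewrite ge0_fin_numE// ltW.
  move: B0; case: (m B) => // r; rewrite lte_fin => r0 _.
  move=> /(congr1 (fun z => z * (r^-1)%:E)).
  by rewrite -!muleA -EFinM divff ?gt_eqF// !mule1.
have m2 : measurable_fun setT (fun w : T * T => w.2) by exact: measurable_snd.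
have pull (C : set T) (c : R) : measurable C -> (0 <= c)%R ->
    \int[m]_y (c * \1_C y)%:E = c%:E * m C.
  move=> mC c0; under eq_integral do rewrite EFinM.
  rewrite -[X in _ * m X]setIT -integral_indic//; apply: ge0_integralZl => //.
  by apply/measurable_EFinP; exact: mi.
transitivity (\int[m]_x \int[m]_y (\1_A (q x) * \1_B y : R)%:E).
  under eq_integral do rewrite pull//.
  rewrite -iqA; apply/esym; apply: ge0_integralZr => //.
  by apply/measurable_EFinP; exact: mi.
rewrite (tonelli_sym (f := fun w => (\1_A (q w.1) * \1_B w.2)%R)); last 2 first.
- exact: (measurable_funM (mi _ _ A _ mA mq1) (mi _ _ B _ mB m2)).
- by move=> w; rewrite mulr_ge0.
transitivity (\int[m]_y \int[m]_x (\1_A (add (q x) y) * \1_B y : R)%:E).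
  apply: eq_integral => y _ /=; have [y' qy'] := qadd y.
  have := @madd_inv y' (fun x => (\1_A (q x) * \1_B y : R)%:E).
  move=> <-; last 2 first.
  - apply/measurable_EFinP; apply: measurable_funM => //; exact: mi.
  - by move=> x; rewrite lee_fin mulr_ge0.
  by apply: eq_integral => x _; rewrite qy'.
rewrite -(tonelli_sym (f := fun w => (\1_A (add (q w.1) w.2) * \1_B w.2)%R)); last 2 first.
- exact: (measurable_funM (mi _ _ A _ mA (madd _ _ mq1 m2)) (mi _ _ B _ mB m2)).
- by move=> w; rewrite mulr_ge0.
transitivity (\int[m]_x \int[m]_y (\1_A y * \1_B (add y (opp (q x))) : R)%:E).
  apply: eq_integral => x _ /=.
  have := @madd_inv (opp (q x)) (fun y => (\1_A (add (q x) y) * \1_B y : R)%:E).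
  move=> <-; last 2 first.
  - have ma := measurableT_comp madd2 (measurable_fun_pair (measurable_cst (q x)) (@measurable_id _ T setT)).
    apply/measurable_EFinP.
    exact: (measurable_funM (mi _ _ A _ mA ma) (mi _ _ B _ mB (@measurable_id _ T setT))).
  - by move=> y; rewrite lee_fin mulr_ge0.
  by apply: eq_integral => y _; rewrite addK.
rewrite (tonelli_sym (f := fun w => (\1_A w.2 * \1_B (add w.2 (opp (q w.1))))%R)); last 2 first.
- have mo := measurableT_comp mopp mq1.
  exact: (measurable_funM (mi _ _ A _ mA m2) (mi _ _ B _ mB (madd _ _ m2 mo))).
- by move=> w; rewrite mulr_ge0.
transitivity (\int[m]_y \int[m]_x (\1_A y * \1_B x : R)%:E).
  apply: eq_integral => y _ /=; have [y' qy'] := qadd y.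
  have := @madd_inv y' (fun x => (\1_A y * \1_B (add y (opp (q x))) : R)%:E).
  move=> <-; last 2 first.
  - have ma := measurableT_comp madd2
      (measurable_fun_pair (measurable_cst y) (measurableT_comp mopp mq)).
    apply/measurable_EFinP.
    exact: (measurable_funM (measurable_cst (\1_A y : R)) (mi _ _ B _ mB ma)).
  - by move=> x; rewrite lee_fin mulr_ge0.
  apply: eq_integral => x _; rewrite qy' addNK; congr (_ * _)%:E.
  rewrite !indicE; congr ((nat_of_bool _)%:R).
  by apply/idP/idP; rewrite !inE => /Bq.
under eq_integral do rewrite pull//.
rewrite -iA; apply: ge0_integralZr => //.
by apply/measurable_EFinP; exact: mi.
Qed.

End isometry.

Section space.
Variable R : realType.
Local Notation M1 := (measurableTypeR R).
Local Notation mu := (@lebesgue_measure R).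
Local Notation M3 := (M1 * M1 * M1)%type.
Local Notation mu3 := ((mu \x mu) \x mu)%E.
Local Open Scope ereal_scope.

Let sf1 : {sigma_finite_measure set M1 -> \bar R} := mu.
Let sf2 : {sigma_finite_measure set (M1 * M1)%type -> \bar R} := sf_product sf1 sf1.

Definition add3 (p q : M3) : M3 :=
  (((p.1.1 + q.1.1)%R, (p.1.2 + q.1.2)%R), (p.2 + q.2)%R).

Lemma preserves_add3 (v : M3) : preserves mu3 (fun p => add3 p v).
Proof.
have ms c := @measurable_shift R c.
have ps c : preserves mu (fun x : M1 => (x + c)%R : M1).
  by move=> f; exact: integral_shift.
have ms2 : measurable_fun setT
    (fun p : M1 * M1 => ((p.1 + v.1.1)%R : M1, (p.2 + v.1.2)%R : M1)).
  apply: measurable_fun_pair.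
    exact: (measurableT_comp (ms v.1.1) measurable_fst).
  exact: (measurableT_comp (ms v.1.2) measurable_snd).
have p2 := @preserves_prod _ _ _ _ R sf1 sf1 _ _ (ms v.1.1) (ms v.1.2)
  (ps v.1.1) (ps v.1.2).
exact: (@preserves_prod _ _ _ _ R sf2 sf1 _ _ ms2 (ms v.2) p2 (ps v.2)).
Qed.

Lemma measurable_add3 : measurable_fun setT (fun w : M3 * M3 => add3 w.1 w.2).
Proof.
have m1 : measurable_fun setT (fun w : M3 * M3 => w.1) := measurable_fst.
have m2 : measurable_fun setT (fun w : M3 * M3 => w.2) := measurable_snd.
have m11 : measurable_fun setT (fun p : M3 => p.1.1) :=
  measurableT_comp measurable_fst measurable_fst.
have m12 : measurable_fun setT (fun p : M3 => p.1.2) :=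
  measurableT_comp measurable_snd measurable_fst.
have m3 : measurable_fun setT (fun p : M3 => p.2) := measurable_snd.
apply: measurable_fun_pair; [apply: measurable_fun_pair|].
- exact: (measurable_funD (measurableT_comp m11 m1) (measurableT_comp m11 m2)).
- exact: (measurable_funD (measurableT_comp m12 m1) (measurableT_comp m12 m2)).
- exact: (measurable_funD (measurableT_comp m3 m1) (measurableT_comp m3 m2)).
Qed.

Definition opp3 (p : M3) : M3 := (((- p.1.1)%R, (- p.1.2)%R), (- p.2)%R).

Lemma measurable_opp3 : measurable_fun setT opp3.
Proof.
have mN : measurable_fun setT (fun x : M1 => (- x)%R : M1).
  by apply: (@continuous_measurable_fun R) => x; exact: opp_continuous.
apply: measurable_fun_pair; [apply: measurable_fun_pair|].
- exact: (measurableT_comp mN (measurableT_comp measurable_fst measurable_fst)).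
- exact: (measurableT_comp mN (measurableT_comp measurable_snd measurable_fst)).
- exact: (measurableT_comp mN measurable_snd).
Qed.

Lemma add3K (p q : M3) : add3 p (add3 q (opp3 p)) = q.
Proof.
case: p q => [[a b] c] [[a' b'] c']; rewrite /add3 /opp3 /=.
by congr (_, _, _); ring.
Qed.

Lemma add3NK (p q : M3) : add3 p (opp3 (add3 q p)) = opp3 q.
Proof.
case: p q => [[a b] c] [[a' b'] c']; rewrite /add3 /opp3 /=.
by congr (_, _, _); ring.
Qed.

Definition lebesgue3 : {sigma_finite_measure set M3 -> \bar R} := sf_product sf2 sf1.

Lemma lebesgue3_box (A B C : set M1) : measurable A -> measurable B -> measurable C ->
  lebesgue3 (A `*` B `*` C) = (mu A * mu B * mu C)%E.
Proof.
move=> mA mB mC; have e3 := @sf_productE _ _ _ _ _ sf2 sf1 _ _ (measurableX mA mB) mC.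
have e2 := @sf_productE _ _ _ _ _ sf1 sf1 _ _ mA mB.
by rewrite -[X in (X * _)%E]e2 -[RHS]e3.
Qed.

End space.

(** * Rotation invariance of the volume *)

Section rotation_invariance.
Variable R : realType.
Local Notation M1 := (measurableTypeR R).
Local Notation mu := (@lebesgue_measure R).
Local Notation M3 := (M1 * M1 * M1)%type.
Local Notation V := ('cV[R]_3).

Lemma leb3E (A : set (borel V)) : @leb3 R A = lebesgue3 R (@vec3 R @^-1` A).
Proof. by []. Qed.

Lemma ge0_integral_leb3 (f : borel V -> \bar R) : measurable_fun setT f ->
  (forall x, 0 <= f x)%E ->
  (\int[@leb3 R]_x f x = \int[lebesgue3 R]_p f (vec3 p))%E.
Proof.
move=> mf f0; apply: (@ge0_integral_image _ _ M3 (borel V) R (lebesgue3 R)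
  (@leb3 R) (@vec3 R) (@measurable_vec3 R) f _ mf f0) => A mA.
exact: leb3E.
Qed.

Definition coords (v : V) : M3 := (v 0 0, v 1 0, v 2 0).

Lemma coordsK v : vec3 (coords v) = v.
Proof. by rewrite [RHS]vec3_col. Qed.

Lemma vec3K p : coords (vec3 p) = p.
Proof. by case: p => [[a b] c]; rewrite /coords; have [-> -> ->] := vec3E a b c. Qed.

Lemma vec3_add3 p q : vec3 (add3 p q) = vec3 p + vec3 q :> V.
Proof.
apply/matrixP => i j; rewrite !mxE /=.
by case: (ord3P i) => ->.
Qed.

Lemma coordsD v w : coords (v + w) = add3 (coords v) (coords w).
Proof. by rewrite /coords /add3 !mxE. Qed.

Lemma coordsN v : coords (- v) = opp3 (coords v).
Proof. by rewrite /coords /opp3 !mxE. Qed.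

Lemma measurable_rotation (Q : 'M[R]_3) :
  measurable_fun setT (fun x : borel V => Q *m x : borel V).
Proof.
have mQi i : measurable_fun setT (fun x : borel V => (Q *m x) i 0 : M1).
  apply: measurable_S3; rewrite (_ : (fun x : V => (Q *m x) i 0) =
    (fun x : V => Q i 0 * x 0 0 + Q i 1 * x 1 0 + Q i 2 * x 2 0)); last first.
    by apply/funext => x; rewrite mxE sum3.
  by do 2?apply: S3_add; apply: S3_scale; exact: S3_coord.
rewrite (_ : (fun x : borel V => _) = (fun x : borel V => vec3 (coords (Q *m x)) : borel V)).
  exact: (measurableT_comp (@measurable_vec3 R)
    (measurable_fun_pair (measurable_fun_pair (mQi 0) (mQi 1)) (mQi 2))).
by apply/funext => x; rewrite coordsK.
Qed.

Lemma preserves_rotation (Q : 'M[R]_3) : SO3 Q ->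
  preserves (@leb3 R) (fun x : borel V => Q *m x : borel V).
Proof.
move=> QSO f mf f0.
pose q (p : M3) := coords (Q *m vec3 p).
have mcoord (i : 'I_3) : measurable_fun setT (fun p : M3 => vec3 p i 0 : M1).
  case: (ord3P i) => ->.
  - rewrite (_ : (fun p => _) = (fun p : M3 => p.1.1)).
      exact: (measurableT_comp measurable_fst measurable_fst).
    by apply/funext => -[[a b] c]; have [-> _ _] := vec3E a b c.
  - rewrite (_ : (fun p => _) = (fun p : M3 => p.1.2)).
      exact: (measurableT_comp measurable_snd measurable_fst).
    by apply/funext => -[[a b] c]; have [_ -> _] := vec3E a b c.
  - rewrite (_ : (fun p => _) = (fun p : M3 => p.2)); first exact: measurable_snd.
    by apply/funext => -[[a b] c]; have [_ _ ->] := vec3E a b c.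
have mq : measurable_fun setT q.
  have mi (i : 'I_3) : measurable_fun setT (fun p : M3 => (Q *m vec3 p) i 0 : M1).
    rewrite (_ : (fun p => _) = (fun p : M3 =>
      Q i 0 * vec3 p 0 0 + Q i 1 * vec3 p 1 0 + Q i 2 * vec3 p 2 0)); last first.
      by apply/funext => p; rewrite mxE sum3.
    have mz k := measurable_funM (measurable_cst (Q i k : M1)) (mcoord k).
    exact: (measurable_funD (measurable_funD (mz 0) (mz 1)) (mz 2)).
  exact: (measurable_fun_pair (measurable_fun_pair (mi 0) (mi 1)) (mi 2)).
have vq p : vec3 (q p) = Q *m vec3 p by rewrite coordsK.
have mNf : measurable_fun setT (fun x : borel V => f (Q *m x)).
  exact: (measurableT_comp mf (measurable_rotation Q)).
rewrite !ge0_integral_leb3//.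
under eq_integral do rewrite -vq.
have mfv : measurable_fun setT (fun p : M3 => f (vec3 p)).
  exact: (measurableT_comp mf (@measurable_vec3 R)).
pose n2 (p : M3) : R := p.1.1 ^+ 2 + p.1.2 ^+ 2 + p.2 ^+ 2.
have n2E p : n2 p = mdot (vec3 p : V) (vec3 p).
  case: p => [[a b] c]; rewrite /n2 /mdot sum3 !big_ord1.
  by have [-> -> ->] := vec3E a b c; rewrite /= !expr2.
have n2q p : n2 (opp3 (q p)) = n2 p.
  have mdE (v : V) : mdot v v = (v^T *m v) 0 0.
    by rewrite /mdot mxE; apply: eq_bigr => i _; rewrite big_ord1 mxE.
  have vN : vec3 (opp3 (q p)) = - (Q *m vec3 p) by rewrite -coordsN coordsK.
  rewrite !n2E vN !mdE [(- _)^T]raddfN /= mulNmx mulmxN opprK.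
  by rewrite trmx_mul mulmxA -(mulmxA _ Q^T) (SO3_trmul QSO) mulmx1.
have m11 : measurable_fun setT (fun p : M3 => p.1.1) :=
  measurableT_comp measurable_fst measurable_fst.
have m12 : measurable_fun setT (fun p : M3 => p.1.2) :=
  measurableT_comp measurable_snd measurable_fst.
have m22 : measurable_fun setT (fun p : M3 => p.2) := measurable_snd.
have mn2 : measurable_fun setT (n2 : M3 -> M1).
  exact: (measurable_funD (measurable_funD (measurable_funX 2 m11)
    (measurable_funX 2 m12)) (measurable_funX 2 m22)).
have mB : measurable [set p : M3 | n2 p < 1].
  rewrite (_ : [set p | _] = n2 @^-1` `]-oo, 1[); last first.
    by apply/seteqP; split => p /=; rewrite in_itv.
  by rewrite -[X in measurable X]setTI; apply: mn2.
have box (c : R) : 0 < c -> lebesgue3 R (`[(-c), c] `*` `[(-c), c] `*` `[(-c), c]) =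
    ((2 * c) ^+ 3)%:E.
  move=> c0; rewrite lebesgue3_box// lebesgue_measure_itv /= lte_fin gtrN//.
  by rewrite -EFinD -!EFinM; congr EFin; ring.
apply: (@isometry_preserves _ _ _ (lebesgue3 R) (@add3 R) (@opp3 R)
  (@measurable_add3 R) (@measurable_opp3 R) (@preserves_add3 R) (@add3K R) (@add3NK R)
  q [set p | n2 p < 1]) => //.
- move=> y; exists (coords (Q^T *m vec3 y)) => x.
  rewrite /q vec3_add3 coordsK mulmxDr mulmxA (proj1 QSO) mul1mx coordsD.
  by rewrite vec3K.
- by move=> x /=; rewrite n2q.
- apply: (@lt_le_trans _ _ (lebesgue3 R (`[(- 2^-1), 2^-1] `*` `[(- 2^-1), 2^-1] `*` `[(- 2^-1), 2^-1]))).
    by rewrite box// lte_fin exprn_gt0.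
  apply: le_measure; rewrite ?inE //.
    by do 2?apply: measurableX; exact: measurable_itv.
  move=> [[a b] c] /=; rewrite !in_itv /= /n2 /= => -[[/andP[? ?] /andP[? ?]] /andP[? ?]].
  have sq (x : R) : - 2^-1 <= x -> x <= 2^-1 -> x ^+ 2 <= 4^-1 by move=> ? ?; nra.
  by have := sq a; have := sq b; have := sq c; lra.
- apply: (@le_lt_trans _ _ (lebesgue3 R (`[(- 1), 1] `*` `[(- 1), 1] `*` `[(- 1), 1]))); last first.
    by rewrite box// ltry.
  apply: le_measure; rewrite ?inE //.
    by do 2?apply: measurableX; exact: measurable_itv.
  move=> [[a b] c] /=; rewrite !in_itv /= /n2 /= => ?.
  have sq (x : R) : x ^+ 2 < 1 -> -1 <= x <= 1 by move=> ?; apply/andP; split; nra.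
  have := sqr_ge0 a; have := sqr_ge0 b; have := sqr_ge0 c => ? ? ?.
  by split; [split|]; apply: sq; lra.
Qed.

End rotation_invariance.

(** * The area of a disk *)

Section disk_area.
Variable R : realType.
Local Notation M1 := (measurableTypeR R).
Local Notation mu := (@lebesgue_measure R).

Lemma continuous_FTC2_everywhere (f F : R -> R) (a b : R) : a < b ->
  continuous f -> (forall x : R, is_derive x 1 F (f x)) ->
  (\int[mu]_(x in `[a, b]) (f x)%:E = (F b - F a)%:E)%E.
Proof.
move=> ab cf dF.
have dF1 x : derivable F x 1 by exact: (@ex_derive _ _ _ _ _ _ _ (dF x)).
have cF : continuous F.
  by move=> x; apply/differentiable_continuous/derivable1_diffP.
rewrite (@continuous_FTC2 _ f F)//.
- exact: continuous_subspaceT.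
- split => [x _||] //.
  + exact/cvg_at_right_filter/cF.
  + exact/cvg_at_left_filter/cF.
- by move=> x _; rewrite derive1E (@derive_val _ _ _ _ _ _ _ (dF x)).
Qed.

Lemma integral_half_circle (rho : R) : 0 < rho ->
  (\int[mu]_(x in `[(- rho)%R, rho]) (2 * Num.sqrt (rho ^+ 2 - x ^+ 2))%:E =
   (pi * rho ^+ 2)%:E)%E.
Proof.
move=> rho0.
pose F (x : R) := rho * sin x.
have dF (x : R) : is_derive x 1 F (rho * cos x).
  exact: (is_deriveZ rho (is_derive_sin x)).
have F1 : derive1 F = (fun x => rho * cos x).
  by apply/funext => x; rewrite derive1E (@derive_val _ _ _ _ _ _ _ (dF x)).
have cF1 : continuous (fun x => rho * cos x).
  move=> x; apply: cvgM; [exact: cvg_cst|exact: continuous_cos].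
have cF : continuous F.
  move=> x; apply: cvgM; [exact: cvg_cst|exact: continuous_sin].
have Fa : F (- (pi / 2)) = - rho by rewrite /F sinN sin_pihalf mulrN1.
have Fb : F (pi / 2) = rho by rewrite /F sin_pihalf mulr1.
have pi2 : - (pi / 2) < pi / 2 :> R.
  by rewrite gtrN// divr_gt0// pi_gt0.
rewrite -Fa -[X in `[_, X]]Fb.
rewrite (@integration_by_substitution_increasing _ F
  (fun x => 2 * Num.sqrt (rho ^+ 2 - x ^+ 2)))//; last first.
- apply: continuous_subspaceT => x; apply: cvgM; first exact: cvg_cst.
  have cp : {for x, continuous (fun x : R => rho ^+ 2 - x ^+ 2)}.
    by apply: cvgB; [exact: cvg_cst|exact: exprn_continuous].
  exact: (continuous_comp cp (@sqrt_continuous R _)).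
- split => [x _||]; first exact: (@ex_derive _ _ _ _ _ _ _ (dF x)).
  + exact/cvg_at_right_filter/cF.
  + exact/cvg_at_left_filter/cF.
- rewrite F1; apply/cvg_ex; exists (rho * cos (pi / 2)).
  exact/cvg_at_left_filter/cF1.
- rewrite F1; apply/cvg_ex; exists (rho * cos (- (pi / 2))).
  exact/cvg_at_right_filter/cF1.
- by rewrite F1 => x _; exact: cF1.
- by move=> x y xI yI xy; rewrite /F ltr_pM2l// ltr_sin.
- exact: ltW.
pose H (x : R) := rho ^+ 2 * (x + sin x * cos x).
transitivity (\int[mu]_(x in `[(- (pi / 2))%R, (pi / 2)%R]) (2 * rho ^+ 2 * cos x ^+ 2)%:E)%E.
  apply: eq_integral => x; rewrite inE /= in_itv /= => xI; congr EFin.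
  rewrite F1 /= /GRing.mul /= -!/(GRing.mul _ _).
  have -> : rho ^+ 2 - F x ^+ 2 = (rho * cos x) ^+ 2.
    by rewrite /F !exprMn sin2cos2; ring.
  rewrite sqrtr_sqr ger0_norm; last by rewrite mulr_ge0 ?(ltW rho0)// cos_ge0_pihalf.
  by ring.
have dH (x : R) : is_derive x 1 H (2 * rho ^+ 2 * cos x ^+ 2).
  have D := is_deriveZ (rho ^+ 2) (is_deriveD (is_derive_id x 1)
    (is_deriveM (is_derive_sin x) (is_derive_cos x))).
  apply: (is_derive_eq D); rewrite /GRing.scale /=.
  have := cos2Dsin2 x; rewrite !expr2 => cs.
  by rewrite -[X in _ * (X + _)]cs; ring.
rewrite (continuous_FTC2_everywhere pi2 _ dH).
- rewrite /H sinN cosN sin_pihalf cos_pihalf; congr EFin.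
  by rewrite !mulr0; field.
- move=> x; have c2 := continuous_comp (@continuous_cos R x) (@exprn_continuous R 2 _).
  exact: (@continuousM _ _ (cst (2 * rho ^+ 2)) _ x (cvg_cst _) c2).
Qed.

Lemma measurable_disk (rho : R) : 0 < rho -> measurable (disk rho : set (M1 * M1)).
Proof.
move=> rho0; pose n2 (p : M1 * M1) : M1 := p.1 ^+ 2 + p.2 ^+ 2.
have mn2 : measurable_fun setT n2.
  exact: (measurable_funD (measurable_funX 2 (@measurable_fst _ _ M1 M1))
    (measurable_funX 2 (@measurable_snd _ _ M1 M1))).
rewrite (_ : disk rho = n2 @^-1` `]-oo, (rho ^+ 2)[); last first.
  apply/seteqP; split => p; rewrite /disk /= in_itv /= lt_sqrt ?addr_ge0 ?sqr_ge0//.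
by rewrite -[X in measurable X]setTI; apply: mn2.
Qed.

Lemma disk_area (rho : R) : 0 < rho ->
  (mu \x mu)%E (disk rho : set (M1 * M1)) = (pi * rho ^+ 2)%:E.
Proof.
move=> rho0; rewrite /product_measure1 /=.
rewrite -(integral_half_circle rho0).
rewrite [RHS]integral_mkcond; apply: eq_integral => x _ /=.
have secE : xsection (disk rho : set (M1 * M1)) x = [set y | x ^+ 2 + y ^+ 2 < rho ^+ 2].
  apply/seteqP; split => y; rewrite /xsection /= inE /disk /= lt_sqrt ?addr_ge0 ?sqr_ge0//.
have mE : (x \in `[- rho, rho]%classic) = (- rho <= x <= rho).
  by apply/idP/idP; rewrite inE /= in_itv.
rewrite secE patchE mE; case: ifPn => xI.
  set s := Num.sqrt _.
  have s2 : s ^+ 2 = rho ^+ 2 - x ^+ 2.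
    rewrite sqr_sqrtr// subr_ge0; move/andP: xI => [? ?]; nra.
  have s0 : 0 <= s by exact: sqrtr_ge0.
  rewrite (_ : [set y | _] = `]- s, s[%classic); last first.
    apply/seteqP; split => y /=; rewrite in_itv /=.
      move=> H; have {}H : y ^+ 2 < s ^+ 2 by rewrite s2; lra.
      by apply/andP; split; nra.
    move=> /andP[? ?]; have : y ^+ 2 < s ^+ 2 by nra.
    by rewrite s2; lra.
  rewrite lebesgue_measure_itv /= lte_fin; case: ifPn => [_|].
    by rewrite -EFinD opprK mulr2n mulrDl mul1r.
  by rewrite -leNgt => H; congr EFin; lra.
rewrite (_ : [set y | _] = set0) ?measure0//.
apply/seteqP; split => y //= H; move/negP: xI; apply.
by have := sqr_ge0 y => ?; apply/andP; split; nra.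
Qed.

End disk_area.

(** * Volume and logarithmic integral of a shell *)

Section shell_volume.
Variable R : realType.
Local Notation M1 := (measurableTypeR R).
Local Notation mu := (@lebesgue_measure R).
Local Notation V := ('cV[R]_3).
Variable Q : 'M[R]_3.
Hypothesis QSO : SO3 Q.

Lemma leb3_rotation (B : set (borel V)) : measurable B ->
  @leb3 R ((fun x : V => Q *m x) @^-1` B) = @leb3 R B.
Proof.
move=> mB.
have mi : measurable_fun setT (fun x : borel V => (\1_B x : R)%:E).
  by apply/measurable_EFinP; exact: measurable_indic.
have i0 (x : borel V) : (0 <= (\1_B x : R)%:E)%E by rewrite lee_fin.
have mQB : measurable ((fun x : V => Q *m x) @^-1` B : set (borel V)).
  by rewrite -[X in measurable X]setTI; exact: measurable_rotation.
have e1 : (\int[@leb3 R]_x (\1_B x : R)%:E)%E = @leb3 R B.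
  by rewrite -[RHS]/(leb3 B) -[B in RHS]setIT; exact: integral_indic.
have e2 : (\int[@leb3 R]_x (\1_B (Q *m x) : R)%:E)%E =
    @leb3 R ((fun x : V => Q *m x) @^-1` B).
  by rewrite -[X in _ = leb3 X]setIT; exact: integral_indic.
by rewrite -e1 -e2; exact: (preserves_rotation QSO mi i0).
Qed.

Lemma leb3_tube (rho h : R) : 0 < rho -> 0 < h ->
  @leb3 R (mulmx Q @` tube rho h) = (pi * rho ^+ 2 * h)%:E.
Proof.
move=> rho0 h0; rewrite -leb3_rotation; last exact: measurable_tube.
rewrite leb3E (_ : _ @^-1` _ = (disk rho : set (M1 * M1)) `*` `]0, h[); last first.
  apply/seteqP; split => -[[a b] c] /=.
    move=> /image_vec3P => /(_ QSO)[]; rewrite !yc_mul//.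
    by have [-> -> ->] := vec3E a b c.
  move=> [ab c0h]; exists (vec3 (a, b, c)) => //.
  by exists ((a, b), c).
rewrite /lebesgue3 sf_productE//; last exact: measurable_disk.
have eh : mu (`]0, h[%classic : set M1) = h%:E.
  by rewrite lebesgue_measure_itv /= lte_fin h0 -EFinD subr0.
rewrite EFinM -eh -(disk_area rho0); exact: erefl.
Qed.

Lemma shell_setD (rho r h : R) : 0 < r -> r <= rho ->
  mulmx Q @` shell rho r h = mulmx Q @` tube rho h `\` mulmx Q @` tube r h.
Proof.
move=> r0 rrho; have rho0 := lt_le_trans r0 rrho.
apply/seteqP; split => x.
  move=> /(shellP QSO _ _ rho0 r0)[/andP[h1 h2] h3]; split; first exact/(tubeP QSO).
  by move=> /(tubeP QSO _ _ r0)[]; rewrite ltNge h1.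
move=> [/(tubeP QSO _ _ rho0)[h1 h2] h3]; apply/(shellP QSO) => //; split => //.
by rewrite h1 andbT leNgt; apply/negP => h4; apply: h3; apply/(tubeP QSO).
Qed.

Lemma leb3_shell (rho r h : R) : 0 < r -> r <= rho -> 0 < h ->
  @leb3 R (mulmx Q @` shell rho r h) = (pi * (rho ^+ 2 - r ^+ 2) * h)%:E.
Proof.
move=> r0 rrho h0; have rho0 := lt_le_trans r0 rrho.
have fin : (@leb3 R (mulmx Q @` tube rho h) < +oo)%E by rewrite leb3_tube// ltry.
rewrite shell_setD// (measureD (measurable_tube QSO h rho0) (measurable_tube QSO h r0) fin).
rewrite (_ : _ `&` _ = mulmx Q @` tube r h); last first.
  apply/setIidr => x /(tubeP QSO _ _ r0)[h1 h2]; apply/(tubeP QSO) => //; split => //.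
  by apply: lt_le_trans h1 _; rewrite ler_pXn2r ?nnegrE ?(ltW r0) ?(ltW rho0).
transitivity ((pi * rho ^+ 2 * h)%:E - (pi * r ^+ 2 * h)%:E)%E.
  by congr (_ - _)%E; exact: leb3_tube.
by rewrite -EFinD; congr EFin; ring.
Qed.

Definition shell_log (a b h : R) : \bar R :=
  (\int[@leb3 R]_(x in mulmx Q @` shell b a h) ((rad2 Q x)^-1)%:E)%E.

Lemma measurable_rad2V : measurable_fun setT (fun x : borel V => (rad2 Q x)^-1).
Proof.
have mV : measurable_fun setT (fun x : R => x^-1).
  rewrite -(setUv [set 0]); apply/measurable_funU => //; first exact: measurableC.
  split; first exact: measurable_fun_set1.
  apply: open_continuous_measurable_fun.
    by apply: closed_openC; exact: closed_eq.
  by move=> x; rewrite inE /= => /eqP x0; exact: inv_continuous.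
exact: (measurableT_comp mV (measurable_S3 (S3_rad2 Q))).
Qed.

Lemma shell_log_le (a b h : R) : 0 < a -> a <= b -> 0 < h ->
  (shell_log a b h <= (pi * h * ((b / a) ^+ 2 - 1))%:E)%E.
Proof.
move=> a0 ab h0; have b0 := lt_le_trans a0 ab.
have mS := measurable_shell QSO h b0 a0.
apply: (@le_trans _ _ (\int[@leb3 R]_(x in mulmx Q @` shell b a h) (a ^- 2)%:E)%E).
  apply: ge0_le_integral => //.
  - by move=> x _; rewrite lee_fin invr_ge0 rad2_ge0.
  - by apply: measurable_funTS; apply/measurable_EFinP; exact: measurable_rad2V.
  - move=> x /(shellP QSO _ _ b0 a0)[/andP[h1 h2] h3].
    rewrite lee_fin lef_pV2 ?posrE ?exprn_gt0//.
    by apply: lt_le_trans h1; rewrite exprn_gt0.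
have -> : (\int[@leb3 R]_(x in mulmx Q @` shell b a h) (a ^- 2)%:E =
    (a ^- 2)%:E * (pi * (b ^+ 2 - a ^+ 2) * h)%:E)%E.
  by rewrite integral_cst//; congr (_ * _)%E; exact: leb3_shell.
rewrite -EFinM lee_fin le_eqVlt; apply/orP; left.
by apply/eqP; field; rewrite gt_eqF.
Qed.

Lemma shell_log_add (a b c h : R) : 0 < a -> a <= b -> b <= c ->
  shell_log a c h = (shell_log a b h + shell_log b c h)%E.
Proof.
move=> a0 ab bc; have b0 := lt_le_trans a0 ab; have c0 := lt_le_trans b0 bc.
rewrite /shell_log (_ : mulmx Q @` shell c a h =
    mulmx Q @` shell b a h `|` mulmx Q @` shell c b h); last first.
  apply/seteqP; split => x.
    move=> /(shellP QSO _ _ c0 a0)[/andP[h1 h2] h3].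
    have [xb|xb] := ltP (rad2 Q x) (b ^+ 2); [left|right]; apply/(shellP QSO) => //; split => //.
      by rewrite h1.
    by rewrite xb.
  have sq (u v : R) : 0 < u -> u <= v -> u ^+ 2 <= v ^+ 2.
    by move=> u0 uv; rewrite ler_pXn2r ?nnegrE ?(ltW u0) ?(ltW (lt_le_trans u0 uv)).
  move=> [/(shellP QSO _ _ b0 a0)|/(shellP QSO _ _ c0 b0)] [/andP[h1 h2] h3];
    apply/(shellP QSO) => //; split => //; apply/andP; split => //.
    by apply: lt_le_trans h2 _; exact: sq.
  by apply: le_trans h1; exact: sq.
rewrite ge0_integral_setU//.
- exact: measurable_shell.
- exact: measurable_shell.
- by apply: measurable_funTS; apply/measurable_EFinP; exact: measurable_rad2V.
- by move=> x _; rewrite lee_fin invr_ge0 rad2_ge0.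
- apply/disj_setPS => x [/(shellP QSO _ _ b0 a0)[/andP[_ h2] _]].
  by move=> /(shellP QSO _ _ c0 b0)[/andP[]]; rewrite leNgt h2.
Qed.

Lemma shell_log_iter (a q h : R) n : 0 < a -> 1 <= q -> 0 < h ->
  (shell_log a (a * q ^+ n) h <= (n%:R * (pi * h * (q ^+ 2 - 1)))%:E)%E.
Proof.
move=> a0 q1 h0; elim: n => [|n IH].
  apply: le_trans (shell_log_le a0 _ h0) _; rewrite ?expr0 ?mulr1//.
  by rewrite divff ?gt_eqF// expr1n subrr mulr0 mul0r.
have qn : 1 <= q ^+ n by exact: exprn_ege1.
have aq0 : 0 < a * q ^+ n by rewrite mulr_gt0// (lt_le_trans _ qn).
have aqS : a * q ^+ n <= a * q ^+ n.+1 by rewrite exprSr mulrA ler_peMr// ltW.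
have aq : a <= a * q ^+ n by rewrite ler_peMr// ltW.
rewrite (shell_log_add _ a0 aq aqS).
rewrite -natr1 mulrDl mul1r EFinD; apply: leeD => //.
apply: le_trans (shell_log_le aq0 aqS h0) _.
have -> : a * q ^+ n.+1 / (a * q ^+ n) = q.
  by rewrite exprSr mulrA [X in X / _]mulrC mulfK// gt_eqF.
by [].
Qed.

(** The annulus is cut into n annuli of equal ratio, on each of which the
    integrand is almost constant. *)
Lemma shell_log_bound (r rho h : R) : 0 < r -> r <= rho -> 0 < h ->
  (shell_log r rho h <= (2 * pi * h * ln (rho / r))%:E)%E.
Proof.
move=> r0 rrho h0; have rho0 := lt_le_trans r0 rrho.
set L := ln (rho / r).
have L0 : 0 <= L by rewrite ln_ge0// ler_pdivlMr// mul1r.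
have H n : 4 * L <= n.+1%:R ->
    (shell_log r rho h <= (2 * pi * h * L * (1 + 4 * L / n.+1%:R))%:E)%E.
  move=> nL; set N : R := n.+1%:R.
  have N0 : 0 < N by rewrite ltr0n.
  pose q := expR (L / N).
  have rq : rho = r * q ^+ n.+1.
    rewrite /q -expRM_natl -/N mulrC mulrC [N * _]mulrC divfK ?gt_eqF//.
    by rewrite lnK ?posrE ?divr_gt0// mulrC divfK// gt_eqF.
  have q1 : 1 <= q by rewrite -expR0 ler_expR divr_ge0// ltW.
  rewrite {1}rq; apply: le_trans (shell_log_iter n.+1 r0 q1 h0) _.
  rewrite -/N lee_fin.
  pose x := 2 * L / N.
  have x0 : 0 <= x by rewrite divr_ge0 ?mulr_ge0// ltW.
  have x1 : x <= 2^-1 by rewrite ler_pdivrMr//; lra.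
  have q2 : q ^+ 2 = expR x by rewrite /q -expRM_natl; congr expR; rewrite /x; ring.
  have ex : expR x <= 1 + x * (1 + 2 * x).
    have e1 : 1 - x <= expR (- x) by exact: expR_ge1Dx.
    have e2 : expR x * expR (- x) = 1 by rewrite expRxMexpNx_1.
    have := expR_gt0 x; move: e1 e2; set u := expR x; set v := expR (- x) => ? ? ?.
    have : u * (1 - x) <= 1 by nra.
    nra.
  have -> : 2 * pi * h * L * (1 + 4 * L / N) = N * (pi * h * (x * (1 + 2 * x))).
    by rewrite /x; field; rewrite gt_eqF.
  rewrite ler_pM2l// ler_pM2l ?mulr_gt0 ?pi_gt0//; rewrite q2; lra.
apply/lee_addgt0Pr => e e0.
have [n nbig] : exists n, 4 * L + 8 * pi * h * L ^+ 2 / e <= n.+1%:R.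
  exists (Num.truncn (4 * L + 8 * pi * h * L ^+ 2 / e)).
  exact/ltW/truncnS_gt.
have p0 : 0 <= 8 * pi * h * L ^+ 2 / e.
  by rewrite !mulr_ge0 ?invr_ge0 ?(ltW e0) ?pi_ge0 ?(ltW h0)// sqr_ge0.
apply: le_trans (H n _) _; first lra.
rewrite -EFinD lee_fin mulrDr mulr1 lerD2l.
have -> : 2 * pi * h * L * (4 * L / n.+1%:R) = (8 * pi * h * L ^+ 2) / n.+1%:R.
  have : (n.+1%:R : R) != 0 by rewrite pnatr_eq0.
  by move: n.+1%:R => N N0; field.
rewrite ler_pdivrMr ?ltr0n// (mulrC e) -ler_pdivrMr//.
by apply: le_trans nbig; rewrite lerDr mulr_ge0.
Qed.

End shell_volume.

(** * One-dimensional Hausdorff measure on a line *)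

Section hausdorff_line.
Variable R : realType.
Local Notation M1 := (measurableTypeR R).
Local Notation mu := (@lebesgue_measure R).
Local Notation V := ('cV[R]_3).
Variable t : V.
Hypothesis t1 : enorm t = 1.
Local Open Scope ereal_scope.

Lemma enormZ (s : R) : enorm (s *: t) = `|s|%R.
Proof.
have tt : mdot t t = 1%R.
  have : (Num.sqrt (mdot t t) ^+ 2 = 1)%R by rewrite -/(enorm t) t1 expr1n.
  rewrite sqr_sqrtr// /mdot; apply: sumr_ge0 => i _; apply: sumr_ge0 => j _.
  by rewrite -expr2 sqr_ge0.
rewrite /enorm (_ : mdot (s *: t) (s *: t) = s ^+ 2)%R ?sqrtr_sqr//.
rewrite -[RHS]mulr1 -tt /mdot mulr_sumr; apply: eq_bigr => i _.
by rewrite mulr_sumr; apply: eq_bigr => j _; rewrite !mxE; ring.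
Qed.

Lemma diam_ge0 (A : set V) : 0 <= diam A.
Proof. by rewrite /diam le_max lexx. Qed.

Lemma diam0 : diam (set0 : set V) = 0.
Proof.
by rewrite /diam set0X image_set0 ereal_sup0; apply/max_idPl; rewrite leNye.
Qed.

Lemma diam_segment (I : set R) (d : R) : (0 <= d)%R ->
  (forall s s', I s -> I s' -> (`|s - s'| <= d)%R) ->
  diam [set s *: t | s in I] <= d%:E.
Proof.
move=> d0 Id; rewrite /diam ge_max lee_fin d0; apply: ge_ereal_sup.
move=> _ [[_ _] [[s Is <-] [s' Is' <-]] <-] /=.
by rewrite -scalerBl enormZ lee_fin Id.
Qed.

(** A set of the line of small diameter lies in an interval of that length,
    so a cover of a segment has total diameter at least the length of the
    segment. *)
Lemma hausdorff1_segment (a b : R) : (a <= b)%R ->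
  ((b - a)%:E <= @hausdorff1 R [set s *: t | s in `[a, b]])%E.
Proof.
move=> ab; rewrite /hausdorff1.
apply: le_trans (ereal_sup_ubound _); last by exists 1%R => //=.
apply: le_ereal_inf_tmp => _ [C [Cd AC] <-].
pose I k := [set s : R | C k (s *: t)].
pose J k : set M1 := if pselect (I k !=set0) then `[inf (I k), sup (I k)]%classic else set0.
have mJ k : measurable (J k).
  by rewrite /J; case: pselect => [?|?]; [exact: measurable_itv|exact: measurable0].
have Ibd k : exists2 d : R, (0 <= d)%R & diam (C k) = d%:E.
  have := Cd k; have := diam_ge0 (C k); case: (diam (C k)) => // d.
  by rewrite lee_fin => d0 _; exists d.
have Idist k s s' : I k s -> I k s' -> (`|s - s'|)%:E <= diam (C k).
  move=> Is Is'; rewrite /diam le_max; apply/orP; right.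
  apply: ereal_sup_ubound; exists (s *: t, s' *: t) => //=.
  by rewrite -scalerBl enormZ.
have IJ k : I k `<=` J k.
  move=> s Is; rewrite /J; case: pselect => [?|]; last by case; exists s.
  have [d d0 dE] := Ibd k.
  rewrite /= in_itv /=; apply/andP; split.
    apply: ge_inf => //; exists (s - d)%R => s' Is'.
    have := Idist _ _ _ Is Is'; rewrite dE lee_fin ler_norml => /andP[_]; lra.
  apply: ub_le_sup => //; exists (s + d)%R => s' Is'.
  have := Idist _ _ _ Is Is'; rewrite dE lee_fin ler_norml => /andP[]; lra.
have muJ k : mu (J k) <= diam (C k).
  rewrite /J; case: pselect => [I0|?]; last by rewrite measure0 diam_ge0.
  have [d d0 dE] := Ibd k.
  rewrite lebesgue_measure_itv /= dE; case: ifP => _; rewrite -?EFinD lee_fin//.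
  rewrite lerBlDr; apply: ge_sup => // s Is; rewrite -lerBlDl.
  apply: lb_le_inf => // s' Is'.
  by have := Idist _ _ _ Is Is'; rewrite dE lee_fin ler_norml => /andP[]; lra.
apply: (@le_trans _ _ (mu (`[a, b]%classic : set M1))).
  rewrite lebesgue_measure_itv /= lte_fin; case: ifPn; rewrite -?EFinD//.
  by rewrite -leNgt => ba; rewrite lee_fin; lra.
apply: (@le_trans _ _ (\sum_(k <oo) mu (J k))); last first.
  by apply: lee_nneseries => // k _; exact: muJ.
apply: (measure_sigma_subadditive _ mJ (measurable_itv `[a, b])).
move=> s sab; have [k _ Ck] := AC (s *: t) (ex_intro2 _ _ s sab erefl).
by exists k => //; exact: IJ.
Qed.

Let D := g_sigma_algebraType [set: set V].

Let all_measurable (A : set D) : measurable A.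
Proof. exact: sub_sigma_algebra. Qed.

Definition gauge (delta : R) (C : set D) : \bar R :=
  if diam C <= delta%:E then diam C else +oo.

Lemma gauge_ge0 delta C : 0 <= gauge delta C.
Proof. by rewrite /gauge; case: ifP => // _; exact: diam_ge0. Qed.

Lemma gauge0 delta : (0 < delta)%R -> gauge delta set0 = 0.
Proof. by move=> d0; rewrite /gauge diam0 lee_fin ltW. Qed.

Lemma hausdorff1_size_le (delta : R) (A : set V) :
  hausdorff1_size delta A <= mu_ext (gauge delta) (A : set D).
Proof.
apply: le_ereal_inf_tmp => _ [F [_ AF] <-].
have [H|/existsNP[k Hk]] := pselect (forall k, diam (F k : set V) <= delta%:E).
  apply: ereal_inf_lbound; exists F => //.
  by apply: eq_eseriesr => k _; rewrite /gauge H.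
suff -> : \sum_(k <oo) gauge delta (F k) = +oo by rewrite leey.
apply: (@eseries_pinfty _ _ xpredT k) => //.
  by move=> n _; rewrite gt_eqF// (lt_le_trans _ (gauge_ge0 _ _)).
by rewrite /gauge; case: ifP => // /Hk.
Qed.

Lemma mu_ext_gauge_le (delta : R) (C : set D) : (0 < delta)%R ->
  mu_ext (gauge delta) C <= gauge delta C.
Proof.
move=> d0; apply: ereal_inf_lbound.
exists (fun k => if k is 0%N then C else set0).
  by split => // x Cx; exists 0%N.
rewrite (@nneseries_split _ _ 0 1)//; last by move=> k _; exact: gauge_ge0.
rewrite add0n big_nat1 /= eseries0 ?adde0// => -[|k] //= _ _; exact: gauge0.
Qed.

Lemma mu_ext_gauge_segment (delta : R) (I : set R) (a b : R) : (0 < delta)%R ->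
  (a <= b)%R -> I `<=` `[a, b] ->
  mu_ext (gauge delta) ([set s *: t | s in I] : set D) <= (b - a)%:E.
Proof.
move=> d0.
have [n] : exists n, (b - a <= n.+1%:R * delta)%R.
  exists (Num.truncn ((b - a) / delta)); rewrite -ler_pdivrMr//.
  exact/ltW/truncnS_gt.
elim: n a I => [|n IH] a I nb ab Iab.
  apply: le_trans (mu_ext_gauge_le _ d0) _.
  have dI : diam [set s *: t | s in I] <= (b - a)%:E.
    apply: diam_segment; first lra.
    move=> s s' /Iab + /Iab; rewrite /= !in_itv /= ler_norml => /andP[? ?] /andP[? ?].
    by apply/andP; split; lra.
  rewrite /gauge ifT//; apply: le_trans dI _; rewrite lee_fin; lra.
have [ba|ba] := leP (b - a)%R (n.+1%:R * delta)%R; first exact: IH.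
have ad : (a + delta <= b)%R.
  rewrite -[X in (_ <= X)%R](subrK a) addrC lerD2r; apply: ltW; apply: le_lt_trans ba.
  by rewrite ler_peMl ?(ltW d0) ?ler1n.
rewrite (_ : [set s *: t | s in I] = [set s *: t | s in I `&` `[a, (a + delta)%R]] `|`
   [set s *: t | s in I `&` `[(a + delta)%R, b]]); last first.
  apply/seteqP; split => x.
    move=> [s Is <-]; have := Iab _ Is; rewrite /= in_itv /= => /andP[s1 s2].
    have [sd|/ltW sd] := leP s (a + delta)%R.
      by left; exists s => //; split => //; rewrite /= in_itv /= s1.
    by right; exists s => //; split => //; rewrite /= in_itv /= s2 sd.
  by move=> [] [s [Is _] <-]; exists s.
have subU (A B : set D) : mu_ext (gauge delta) (A `|` B) <=
    mu_ext (gauge delta) A + mu_ext (gauge delta) B.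
  have := @mu_ext_sigma_subadditive _ _ _ (gauge delta) (gauge_ge0 delta) (bigcup2 A B).
  rewrite -bigcup2E.
  have g0 k : 0 <= mu_ext (gauge delta) (bigcup2 A B k).
    by apply: mu_ext_ge0; exact: gauge_ge0.
  rewrite (@nneseries_split _ _ 0 2)// big_nat_recr//= big_nat1 /= add0n.
  rewrite eseries0 ?adde0// => -[|[|k]] //= _ _.
  by apply: mu_ext0; [exact: gauge0|exact: gauge_ge0].
apply: le_trans (subU _ _) _.
have -> : (b - a)%:E = (a + delta - a)%:E + (b - (a + delta))%:E :> \bar R.
  by rewrite -EFinD; congr EFin; ring.
apply: leeD.
  apply: le_trans (mu_ext_gauge_le _ d0) _.
  have dI : diam [set s *: t | s in I `&` `[a, (a + delta)%R]] <= (a + delta - a)%:E.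
    apply: diam_segment; first lra.
    move=> s s' [_ +] [_]; rewrite /= !in_itv /= ler_norml => /andP[? ?] /andP[? ?].
    by apply/andP; split; lra.
  by rewrite /gauge ifT//; apply: le_trans dI _; rewrite lee_fin; lra.
apply: IH => //.
by move: nb; rewrite -natr1 mulrDl mul1r; lra.
Qed.

Lemma hausdorff1_le (A : set (borel V)) (B : set M1) : measurable B ->
  A `<=` [set s *: t | s in B] -> @hausdorff1 R A <= mu B.
Proof.
move=> mB AB; apply: ge_ereal_sup => _ [delta /= d0 <-].
apply: le_trans (hausdorff1_size_le _ _) _.
rewrite /lebesgue_measure /lebesgue_stieltjes_measure /= /measure_extension.
apply: le_ereal_inf_tmp => _ [F [mF BF] <-].
have g0 k : 0 <= mu_ext (gauge delta) ([set s *: t | s in (F k : set R)] : set D).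
  by apply: mu_ext_ge0; exact: gauge_ge0.
apply: (@le_trans _ _ (\sum_(k <oo) mu_ext (gauge delta) ([set s *: t | s in (F k : set R)] : set D))).
  apply: (@le_trans _ _ (mu_ext (gauge delta) (\bigcup_k ([set s *: t | s in (F k : set R)] : set D)))).
    apply: le_mu_ext => x /AB [s /BF[k _ Fks] <-].
    by exists k => //; exists s.
  by apply: mu_ext_sigma_subadditive; exact: gauge_ge0.
apply: lee_nneseries => // k _.
have [[a b] _ <-] := mF k.
rewrite [X in _ <= X]wlength_itv /= lte_fin; case: ifPn => ab.
  rewrite -EFinD; apply: mu_ext_gauge_segment => //; first exact: ltW.
  exact: subset_itv_oc_cc.
rewrite set_itv_ge ?bnd_simp// image_set0 mu_ext0//; [exact: gauge0|exact: gauge_ge0].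
Qed.

Lemma measurable_line : measurable_fun setT (fun s : M1 => s *: t : borel V).
Proof.
apply: (@measurability _ _ _ (borel V) setT _ (@open V)) => //.
move=> _ [U oU <-]; rewrite setTI; apply: open_measurable.
apply: open_comp oU => s _; exact: (@scalel_continuous _ _ t).
Qed.

Let nu : {measure set (borel V) -> \bar R} := image_measure mu measurable_line.

Lemma hausdorff1_set0 : @hausdorff1 R set0 = 0.
Proof.
apply/eqP; rewrite eq_le; apply/andP; split.
  have := @hausdorff1_le set0 set0 measurable0.
  by rewrite measure0; apply.
apply: le_trans (ereal_sup_ubound _); last by exists 1%R => //=.
by apply: le_ereal_inf_tmp => _ [C _ <-]; apply: nneseries_ge0 => k _ _; exact: diam_ge0.
Qed.

Import HBNNSimple.

Lemma sintegral_hausdorff1_range (h : {nnsfun (borel V) >-> R}) :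
  sintegral (@hausdorff1 R) h =
  \sum_(x \in range h) x%:E * @hausdorff1 R (h @^-1` [set x]).
Proof.
rewrite /sintegral (fsbig_widen (range h) setT)//= => x [_ Nfx] /=.
by rewrite preimage10// hausdorff1_set0 mule0.
Qed.

(** A lower bound for the line integral suffices below: the test functions are
    nonnegative and constant on most of the axis. *)
Lemma hausdorff1_integral_ge (S : set (borel V)) (f : V -> R) (m M a b N : R) :
  (forall x, 0 <= f x <= M)%R -> (0 < m)%R -> (a <= b)%R -> (0 <= N)%R ->
  S `<=` [set s *: t | s in `[(- N)%R, N]%classic] ->
  (forall s, (a <= s <= b)%R -> S (s *: t) /\ (m <= f (s *: t))%R) ->
  (m * (b - a) <= fine (integral (@hausdorff1 R) S (fun x => (f x)%:E)))%R.
Proof.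
move=> fM m0 ab N0 SN Sab.
have f0 x : (0 <= f x)%R by have /andP[] := fM x.
have M0 : (0 <= M)%R by have /andP[] := fM 0%R; apply: le_trans.
rewrite /integral.
set g := (fun x => (f x)%:E) \_ S.
have gE x : S x -> g x = (f x)%:E by move=> Sx; rewrite /g patchE mem_set.
have gN x : ~ S x -> g x = 0 by move=> Sx; rewrite /g patchE memNset.
have g0 x : 0 <= g x.
  by have [/gE ->|/gN ->] := pselect (S x); rewrite ?lee_fin.
have -> : g^\+ = g by apply/funext => x; rewrite funeposE; apply/max_idPl.
have -> : g^\- = cst 0.
  by apply/funext => x; rewrite funenegE; apply/max_idPr; rewrite oppe_le0.
have -> : ereal_sup [set sintegral (@hausdorff1 R) h | h in
    [set h : {nnsfun (borel V) >-> R} | forall x, (h x)%:E <= (cst 0 : borel V -> \bar R) x]] = 0.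
  have s0 (h : {nnsfun (borel V) >-> R}) : (forall x, h x = 0%R) ->
      sintegral (@hausdorff1 R) h = 0.
    move=> h0; rewrite sintegral_hausdorff1_range fsbig1// => _ [x _ <-].
    by rewrite h0 mul0e.
  apply/eqP; rewrite eq_le; apply/andP; split.
    apply: ge_ereal_sup => _ [h /= h0 <-]; rewrite s0// => x.
    by apply/eqP; rewrite eq_le -lee_fin h0/=.
  by apply: ereal_sup_ubound; exists nnsfun0 => //; exact: s0.
rewrite sube0.
set K := [set s *: t | s in `[(- N)%R, N]%classic].
have cK (c d : R) : measurable ([set s *: t | s in `[c, d]%classic] : set (borel V)).
  apply: borel_closed; apply: compact_closed; first exact: norm_hausdorff.
  apply: continuous_compact; last exact: segment_compact.
  by apply: continuous_subspaceT => s; exact: (@scalel_continuous _ _ t).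
have scal_inj (s s' : R) : s *: t = s' *: t -> s = s'.
  move=> /eqP; rewrite -subr_eq0 -scalerBl => /eqP e.
  have := enormZ (s - s'); rewrite e /enorm /mdot.
  rewrite big1 ?sqrtr0; last by move=> i _; rewrite big1// => j _; rewrite mxE mul0r.
  by move/esym/eqP; rewrite normr_eq0 subr_eq0 => /eqP.
have nuK : nu K <= (N + N)%:E.
  rewrite /= /pushforward (_ : _ @^-1` _ = `[(- N)%R, N]%classic); last first.
    by apply/seteqP; split => [s [s' ? /scal_inj <-]//|s ?]; exists s.
  rewrite lebesgue_measure_itv /= lte_fin.
  by case: ifP => _; rewrite -?EFinD ?opprK// lee_fin addr_ge0.
have upper : ereal_sup [set sintegral (@hausdorff1 R) h | h in
    [set h : {nnsfun (borel V) >-> R} | forall x, (h x)%:E <= g x]] <= (M * (N + N))%:E.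
  apply: ge_ereal_sup => _ [h /= hg <-].
  have hS x : ~ S x -> h x = 0%R.
    move=> Sx; apply/eqP; rewrite eq_le; apply/andP; split; last exact: fun_ge0.
    by rewrite -lee_fin -[X in _ <= X](gN _ Sx).
  apply: (@le_trans _ _ (sintegral nu h)).
    rewrite sintegral_hausdorff1_range sintegralE.
    apply: lee_fsum => // _ [x _ <-].
    have [h0|hx] := eqVneq (h x) 0%R; first by rewrite h0 !mul0e.
    apply: lee_wpmul2l; first by rewrite lee_fin.
    apply: hausdorff1_le.
      rewrite -[X in measurable X]setTI; exact: (measurable_line measurableT (measurable_funPTI h (measurable_set1 _))).
    move=> y /= hy; have Sy : S y.
      by apply: contrapT => /hS; rewrite hy => e; move: hx; rewrite e eqxx.
    have [s _ sy] := SN _ Sy; exists s => //=; by rewrite sy.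
  rewrite -integralT_nnsfun.
  apply: (@le_trans _ _ (\int[nu]_x (M * \1_K x)%:E)).
    apply: ge0_le_integral => //.
    - by move=> x _; rewrite lee_fin.
    - exact/measurable_EFinP.
    - apply/measurable_EFinP; apply: measurable_funM => //.
      exact: (measurable_indic (cK (- N)%R N)).
    - move=> x _; have [Sx|/hS ->] := pselect (S x).
        rewrite indicE mem_set ?mulr1; last exact: SN.
        by apply: le_trans (hg x) _; rewrite gE// lee_fin; have /andP[] := fM x.
      by rewrite lee_fin mulr_ge0.
  under eq_integral do rewrite EFinM.
  rewrite ge0_integralZl//.
  - apply: (@le_trans _ _ (M%:E * (N + N)%:E)); last by rewrite -EFinM.
    apply: lee_wpmul2l; first by rewrite lee_fin.
    apply: le_trans nuK; rewrite -[X in _ <= nu X]setIT.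
    by rewrite (integral_indic nu measurableT (cK (- N)%R N)).
  - by apply/measurable_EFinP; exact: (measurable_indic (cK (- N)%R N)).
have lower : (m * (b - a))%:E <= ereal_sup [set sintegral (@hausdorff1 R) h | h in
    [set h : {nnsfun (borel V) >-> R} | forall x, (h x)%:E <= g x]].
  pose h : {nnsfun (borel V) >-> R} := scale_nnsfun (indic_nnsfun R (cK a b)) (ltW m0).
  have hE x : h x = (m * \1_([set s *: t | s in `[a, b]%classic]) x)%R by [].
  apply: le_trans (ereal_sup_ubound _); last first.
    exists h => // x; change ((h x)%:E <= g x); rewrite hE indicE.
    have [|xs] := boolP (x \in _); last by rewrite mulr0.
    rewrite inE => -[s sab <-]; rewrite mulr1.
    have [|Ss ms] := Sab s; first by move: sab; rewrite /= in_itv.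
    by rewrite gE// lee_fin.
  have hK x : h x = m <-> [set s *: t | s in `[a, b]%classic] x.
    rewrite hE indicE; split => [|xK]; last by rewrite mem_set// mulr1.
    have [|_] := boolP (x \in _); first by rewrite inE.
    by rewrite mulr0 => m0'; have := m0; rewrite -m0' ltxx.
  rewrite /sintegral -(@fsbig_widen _ _ _ _ [set m] setT)//; last first.
    move=> x [_ /= xm]; have [->|x0] := eqVneq x 0%R; first by rewrite mul0e.
    rewrite preimage10 ?hausdorff1_set0 ?mule0// => -[y _ yx]; apply: xm.
    move: yx; rewrite hE indicE; case: (_ \in _); first by rewrite mulr1 => <-.
    by rewrite mulr0 => x0'; move: x0; rewrite -x0' eqxx.
  rewrite fsbig_set1 EFinM; apply: lee_wpmul2l; first by rewrite lee_fin ltW.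
  rewrite (_ : h @^-1` [set m] = [set s *: t | s in `[a, b]%classic]); last first.
    by apply/seteqP; split => x /hK.
  exact: hausdorff1_segment.
by move: lower upper; case: (ereal_sup _) => //= r; rewrite lee_fin.
Qed.

End hausdorff_line.

(** * The Frobenius norm *)

Section frobenius.
Variable R : realType.
Local Notation M := ('M[R]_3).
Implicit Types A B : M.

Definition nrm2 A : R := mdot A A.

Lemma nrm2_ge0 A : 0 <= nrm2 A.
Proof. by apply: sumr_ge0 => i _; apply: sumr_ge0 => j _; rewrite -expr2 sqr_ge0. Qed.

Lemma sqr_enorm A : enorm A ^+ 2 = nrm2 A.
Proof. by rewrite sqr_sqrtr// nrm2_ge0. Qed.

Lemma enorm_ge0 A : 0 <= enorm A.
Proof. exact: sqrtr_ge0. Qed.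

Lemma mdotC A B : mdot A B = mdot B A.
Proof. by apply: eq_bigr => i _; apply: eq_bigr => j _; rewrite mulrC. Qed.

Lemma mdotDl A B C : mdot (A + B) C = mdot A C + mdot B C.
Proof.
rewrite /mdot -big_split; apply: eq_bigr => i _; rewrite -big_split.
by apply: eq_bigr => j _; rewrite mxE mulrDl.
Qed.

Lemma mdotZl (a : R) A B : mdot (a *: A) B = a * mdot A B.
Proof.
rewrite /mdot mulr_sumr; apply: eq_bigr => i _; rewrite mulr_sumr.
by apply: eq_bigr => j _; rewrite mxE mulrA.
Qed.

Lemma mdotDr A B C : mdot A (B + C) = mdot A B + mdot A C.
Proof. by rewrite mdotC mdotDl !(mdotC A). Qed.

Lemma mdotZr (a : R) A B : mdot A (a *: B) = a * mdot A B.
Proof. by rewrite mdotC mdotZl mdotC. Qed.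

Lemma mdot_tr A B : mdot A B = \tr (A *m B^T).
Proof.
by apply: eq_bigr => i _; rewrite mxE; apply: eq_bigr => j _; rewrite mxE.
Qed.

Lemma nrm2Z (a : R) A : nrm2 (a *: A) = a ^+ 2 * nrm2 A.
Proof. by rewrite /nrm2 mdotZl mdotZr; ring. Qed.

Lemma enormZr (a : R) A : enorm (a *: A) = `|a| * enorm A.
Proof. by rewrite /enorm -/(nrm2 _) nrm2Z sqrtrM ?sqr_ge0// sqrtr_sqr. Qed.

Lemma cauchy_schwarz A B : mdot A B <= enorm A * enorm B.
Proof.
have P s : 0 <= s ^+ 2 * nrm2 A + 2 * s * mdot A B + nrm2 B.
  have := nrm2_ge0 (s *: A + B); rewrite /nrm2 !(mdotDl, mdotDr, mdotZl, mdotZr) (mdotC B A).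
  by move=> H; apply: (le_trans H); rewrite /nrm2 le_eqVlt; apply/orP; left; apply/eqP; ring.
rewrite leNgt; apply/negP => lt_m.
have m0 : 0 < mdot A B by apply: le_lt_trans lt_m; rewrite mulr_ge0 ?enorm_ge0.
have lt2 : nrm2 A * nrm2 B < mdot A B ^+ 2.
  by rewrite -!sqr_enorm -exprMn ltr_pXn2r ?nnegrE ?mulr_ge0 ?enorm_ge0// ltW.
have [a0|a0] := eqVneq (nrm2 A) 0.
  have := P (- (nrm2 B + 1) / (2 * mdot A B)); rewrite a0 mulr0 add0r.
  have -> : 2 * (- (nrm2 B + 1) / (2 * mdot A B)) * mdot A B = - (nrm2 B + 1).
    by field; rewrite gt_eqF.
  lra.
have {}a0 : 0 < nrm2 A by rewrite lt_def a0 nrm2_ge0.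
have := P (- mdot A B / nrm2 A).
have -> : (- mdot A B / nrm2 A) ^+ 2 * nrm2 A + 2 * (- mdot A B / nrm2 A) * mdot A B
    + nrm2 B = (nrm2 A * nrm2 B - mdot A B ^+ 2) / nrm2 A.
  by field; rewrite gt_eqF.
rewrite pmulr_lge0 ?invr_gt0//; lra.
Qed.

Lemma enorm_triangle A B : enorm (A + B) <= enorm A + enorm B.
Proof.
rewrite -(@ler_pXn2r _ 2) ?nnegrE ?addr_ge0 ?enorm_ge0// sqr_enorm /nrm2.
rewrite !(mdotDl, mdotDr) (mdotC B A) -!/(nrm2 _) -!sqr_enorm.
have := cauchy_schwarz A B; lra.
Qed.

Lemma enormN A : enorm (- A) = enorm A.
Proof. by rewrite -scaleN1r enormZr normrN1 mul1r. Qed.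

Lemma enorm_tr A : enorm A^T = enorm A.
Proof.
rewrite /enorm /mdot exchange_big; congr Num.sqrt.
by apply: eq_bigr => i _; apply: eq_bigr => j _; rewrite !mxE.
Qed.

Lemma mdot_rotl Q A : SO3 Q -> mdot (Q *m A) (Q *m A) = mdot A A.
Proof.
move=> QSO; rewrite !mdot_tr trmx_mul mxtrace_mulC !mulmxA -(mulmxA _ Q^T).
by rewrite (SO3_trmul QSO) mulmx1 mxtrace_mulC.
Qed.

Lemma mdot_rotr Q A : SO3 Q -> mdot (A *m Q) (A *m Q) = mdot A A.
Proof. by move=> [QQ _]; rewrite !mdot_tr trmx_mul mulmxA -(mulmxA A) QQ mulmx1. Qed.

Lemma SO3_trmx (Q : M) : SO3 Q -> SO3 Q^T.
Proof. by move=> QSO; split; rewrite ?trmxK ?det_tr; [exact: SO3_trmul|case: QSO]. Qed.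

Lemma enorm_mul A B : enorm (A *m B) <= enorm A * enorm B.
Proof.
rewrite -(@ler_pXn2r _ 2) ?nnegrE ?mulr_ge0 ?enorm_ge0// exprMn !sqr_enorm.
rewrite /nrm2 /mdot !sum3 !mxE !sum3 -subr_ge0.
set x := (X in 0 <= X).
pose l i j (k m : 'I_3) := (A i k * B m j - A i m * B k j) ^+ 2.
have -> : x = \sum_i \sum_j (l i j 0 1 + l i j 0 2 + l i j 1 2).
  by rewrite /x /l !sum3; ring.
by apply: sumr_ge0 => i _; apply: sumr_ge0 => j _; rewrite !addr_ge0 ?sqr_ge0.
Qed.

Lemma entry_le A i j : `|A i j| <= enorm A.
Proof.
rewrite -(@ler_pXn2r _ 2) ?nnegrE ?enorm_ge0// sqr_enorm real_normK ?num_real//.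
rewrite /nrm2 /mdot (bigD1 i)//= (bigD1 j)//= -expr2 -addrA lerDl.
apply: addr_ge0; apply: sumr_ge0 => k _; first by rewrite -expr2 sqr_ge0.
by apply: sumr_ge0 => m _; rewrite -expr2 sqr_ge0.
Qed.

Lemma norm_le_enorm A : `|A| <= enorm A.
Proof.
rewrite /Num.norm /= mx_normrE; apply: bigmax_le; first exact: enorm_ge0.
by move=> [i j] _; exact: entry_le.
Qed.

End frobenius.

(** * Second-order expansion at the minimum *)

Lemma sum_delta_mx (R : realType) (f : 'I_3 -> 'I_3 -> R) i j :
  \sum_k \sum_m (delta_mx i j : 'M[R]_3) k m * f k m = f i j.
Proof.
rewrite (bigD1 i)//= (bigD1 j)//= !mxE !eqxx mul1r !big1 ?addr0//.
  by move=> k /negPf ki; rewrite big1// => m _; rewrite !mxE ki mul0r.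
by move=> m /negPf mj; rewrite !mxE mj andbF mul0r.
Qed.

Section taylor.
Variable R : realType.
Local Notation M := ('M[R]_3).
Variable V : M -> R.
Hypothesis V0 : V 0 = 0.
Hypothesis V_ge0 : forall F, 0 <= V F.
Hypothesis V2 : twice_differentiable_near V 0.

Let g (i j : 'I_3) (F : M) : R := 'D_(delta_mx i j) V F.

Definition quad (A : M) : R := mdot (hessian V 0 A) A.

Let dg i j : differentiable (g i j) 0.
Proof. by have [_ ] := nbhs_singleton V2; apply. Qed.

Lemma hessianE A i j : hessian V 0 A i j = 'd (g i j) 0 A.
Proof. by rewrite mxE -/(g i j) deriveE. Qed.

Lemma hessianD A B : hessian V 0 (A + B) = hessian V 0 A + hessian V 0 B.
Proof.
apply/matrixP => i j; rewrite [RHS]mxE; have D := linearD ('d (g i j) 0) A B.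
exact (etrans (hessianE _ i j)
  (etrans D (esym (congr2 +%R (hessianE A i j) (hessianE B i j))))).
Qed.

Lemma hessianZ (a : R) A : hessian V 0 (a *: A) = a *: hessian V 0 A.
Proof.
apply/matrixP => i j; rewrite [RHS]mxE; have D : 'd (g i j) 0 (a *: A) = a * 'd (g i j) 0 A by rewrite linearZ.
exact (etrans (hessianE _ i j) (etrans D (esym (congr1 ( *%R a) (hessianE A i j))))).
Qed.

Lemma quadZ (a : R) A : quad (a *: A) = a ^+ 2 * quad A.
Proof. by rewrite /quad hessianZ mdotZl mdotZr; ring. Qed.

Let gradient (F G : M) : differentiable V F ->
  'd V F G = \sum_i \sum_j G i j * g i j F.
Proof.
move=> dV; rewrite {1}(matrix_sum_delta G) linear_sum; apply: eq_bigr => i _.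
rewrite linear_sum; apply: eq_bigr => j _.
by rewrite linearZ /= /g deriveE.
Qed.

Let is_derive_ray (F : M) (s : R) : differentiable V (s *: F) ->
  is_derive s 1 (fun s => V (s *: F)) (\sum_i \sum_j F i j * g i j (s *: F)).
Proof.
move=> dV; have [dl lE] : is_diff (s : R) ( *:%R ^~ F) ( *:%R ^~ F).
  exact: is_diff_scalel.
have dc := @differentiable_comp _ _ _ _ (fun s : R => s *: F) V _ dl dV.
apply: DeriveDef; first exact: diff_derivable.
rewrite (deriveE _ dc) diff_comp//= lE /=.
by rewrite scale1r gradient.
Qed.

Let small_ball (P : M -> Prop) : (\forall F \near (0 : M), P F) ->
  exists2 d : R, 0 < d & forall F, enorm F < d -> P F.
Proof.
move=> /nbhs_ballP[d /= d0 Pd]; exists d => // F Fd; apply: Pd.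
rewrite -ball_normE /= sub0r normrN; apply: le_lt_trans Fd; exact: norm_le_enorm.
Qed.

Let grad0 i j : g i j 0 = 0.
Proof.
have [d d0 dP] := small_ball V2.
pose E : M := delta_mx i j.
have eE : enorm E <= 1.
  rewrite -(@ler_pXn2r _ 2) ?nnegrE ?enorm_ge0// sqr_enorm expr1n /nrm2 /mdot.
  by rewrite sum_delta_mx mxE !eqxx.
have dV (s : R) : `|s| < d -> differentiable V (s *: E).
  move=> sd; apply: (dP _ _).1; rewrite enormZr; apply: le_lt_trans sd.
  by rewrite ler_piMr.
have := @derive1_at_min R (fun s => V (s *: E)) (- d) d 0.
move=> /(_ _ _ _ _)[].
- by rewrite ge0_cp// ltW.
- move=> s; rewrite in_itv /= -ltr_norml => sd.
  exact: (@ex_derive _ _ _ _ _ _ _ (is_derive_ray (dV s sd))).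
- by rewrite in_itv /= oppr_lt0 d0.
- by move=> s _; rewrite scale0r V0 V_ge0.
move=> _ D0.
have := is_derive_ray (dV 0 _); rewrite normr0 => /(_ d0) D1.
have := @derive_val _ _ _ _ _ _ _ D1; rewrite D0 scale0r => /esym.
by rewrite (sum_delta_mx (fun k m => g k m 0)).
Qed.

(** The value and the gradient of [V] vanish at the minimum; the gradient is
    differentiable at 0 and is compared with the Hessian along the ray to [F]. *)
Lemma taylor (w : R) : 0 < w ->
  exists2 d : R, 0 < d & forall F, enorm F < d -> `|V F - 2^-1 * quad F| <= w * nrm2 F.
Proof.
move=> w0; pose w' := w / 9.
have w'0 : 0 < w' by rewrite divr_gt0.
have : \forall F \near (0 : M), [/\ differentiable V F &
    forall ij : 'I_3 * 'I_3, `|g ij.1 ij.2 F - 'd (g ij.1 ij.2) 0 F| <= w' * `|F| ].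
  have : \forall F \near (0 : M), forall ij : 'I_3 * 'I_3,
      `|g ij.1 ij.2 F - 'd (g ij.1 ij.2) 0 F| <= w' * `|F|.
    suff H (ij : 'I_3 * 'I_3) : \forall F \near (0 : M),
        `|g ij.1 ij.2 F - 'd (g ij.1 ij.2) 0 F| <= w' * `|F|.
      exact: (@filter_forall _ _ _ (nbhs (0 : M)) _ H).
    case: ij => i j /=.
    have := diff_locally (dg i j) => /eqaddoP /(_ _ w'0).
    apply: filterS => F; rewrite !fctE /=.
    by rewrite (addr0 F) grad0 add0r.
  by move: V2; apply: filterS2 => F [].
move=> /small_ball[d d0 dP]; exists d => // F Fd.
have dPs s : 0 <= s <= 1 -> enorm (s *: F) < d.
  move=> /andP[s0 s1]; rewrite enormZr ger0_norm//; apply: le_lt_trans Fd.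
  by rewrite ler_piMl// enorm_ge0.
pose phi (s : R) := V (s *: F) - 2^-1 * quad F * s ^+ 2.
pose phi' (s : R) := \sum_i \sum_j F i j * g i j (s *: F) - quad F * s.
have dphi (s : R) : 0 <= s <= 1 -> is_derive s 1 phi (phi' s).
  move=> s01; have [dVs _] := dP _ (dPs s s01).
  have D := is_deriveB (is_derive_ray dVs)
    (is_deriveZ (2^-1 * quad F) (is_deriveX 2 (is_derive_id s 1))).
  apply: (is_derive_eq D); rewrite /GRing.scale /= expr1 mulr1 /phi'.
  by congr (_ - _); field.
have phi'_le s : 0 <= s <= 1 -> `|phi' s| <= w * nrm2 F.
  move=> s01; have [_ gP] := dP _ (dPs s s01).
  have -> : phi' s = \sum_i \sum_j F i j * (g i j (s *: F) - 'd (g i j) 0 (s *: F)).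
    rewrite /phi' (_ : quad F * s = \sum_i \sum_j F i j * 'd (g i j) 0 (s *: F)).
      rewrite -sumrB; apply: eq_bigr => i _; rewrite -sumrB; apply: eq_bigr => j _.
      by rewrite mulrBr.
    rewrite mulrC /quad /mdot mulr_sumr; apply: eq_bigr => i _.
    rewrite mulr_sumr; apply: eq_bigr => j _.
    by rewrite hessianE linearZ /= /GRing.scale /=; ring.
  have bd i j : `|F i j * (g i j (s *: F) - 'd (g i j) 0 (s *: F))| <= w' * nrm2 F.
    rewrite normrM -sqr_enorm expr2 mulrCA.
    apply: ler_pM => //; first exact: entry_le.
    apply: le_trans (gP (i, j)) _ => /=; rewrite ler_pM2l//.
    apply: le_trans (norm_le_enorm _) _; rewrite enormZr.
    by move/andP: s01 => [s0 s1]; rewrite ger0_norm// ler_piMl// enorm_ge0.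
  have -> : w * nrm2 F = \sum_(i < 3) \sum_(j < 3) w' * nrm2 F.
    by rewrite !sum3 /w'; field.
  apply: le_trans (ler_norm_sum _ _ _) _; apply: ler_sum => i _.
  by apply: le_trans (ler_norm_sum _ _ _) _; apply: ler_sum => j _.
have D1 (s : R) : s \in `]0, 1[%R -> is_derive s 1 phi (phi' s).
  by rewrite in_itv /= => /andP[s0 s1]; apply: dphi; rewrite !ltW.
have D2 : {within `[0, 1], continuous phi}.
  apply: derivable_within_continuous => s; rewrite in_itv /= => s01.
  exact: (@ex_derive _ _ _ _ _ _ _ (dphi s s01)).
have [c] := MVT ltr01 D1 D2.
rewrite in_itv /= => /andP[c0 c1]; rewrite subr0 mulr1 /phi scale1r scale0r V0.
rewrite expr1n mulr1 expr0n /= mulr0 subrr subr0 => ->.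
by apply: phi'_le; rewrite !ltW.
Qed.

Lemma quad_le : exists2 K : R, 0 < K & forall A, quad A <= K * nrm2 A.
Proof.
pose c (i j k l : 'I_3) := 'd (g i j) 0 (delta_mx k l).
exists (1 + \sum_i \sum_j \sum_k \sum_l `|c i j k l|).
  apply: ltr_pwDl => //; do 4!(apply: sumr_ge0 => ? _); exact: normr_ge0.
move=> A; rewrite mulrDl mul1r -[X in X <= _]add0r; apply: lerD; first exact: nrm2_ge0.
rewrite /quad /mdot mulr_suml; apply: ler_sum => i _.
rewrite mulr_suml; apply: ler_sum => j _.
have -> : hessian V 0 A i j = \sum_k \sum_l A k l * c i j k l.
  rewrite hessianE {1}(matrix_sum_delta A) linear_sum; apply: eq_bigr => k _.
  by rewrite linear_sum; apply: eq_bigr => l _; rewrite linearZ.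
rewrite !mulr_suml; apply: ler_sum => k _; rewrite !mulr_suml; apply: ler_sum => l _.
rewrite mulrAC mulrC; apply: le_trans (ler_norm _) _; rewrite normrM ler_wpM2l//.
rewrite normrM -sqr_enorm expr2; apply: ler_pM => //; exact: entry_le.
Qed.

End taylor.

(** * The two classes of energy densities *)

Section power_law.
Variables (R : realType) (p : R).
Hypothesis hp : 1 < p <= 2.

Lemma Phi_ge0 s : 0 <= Phi p s.
Proof. by rewrite /Phi le_min powR_ge0 sqr_ge0. Qed.

Lemma Phi0 : Phi p 0 = 0.
Proof.
rewrite /Phi powR0; last by move/andP: hp => [? _]; rewrite gt_eqF// (lt_trans ltr01).
by rewrite expr0n /= minxx.
Qed.

Lemma Phi_small s : 0 <= s <= 1 -> Phi p s = s ^+ 2.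
Proof.
move=> /andP[s0 s1]; apply/min_idPr; have [->|sn0] := eqVneq s 0.
  by rewrite expr0n powR_ge0.
have {sn0}s0 : 0 < s by rewrite lt_def sn0.
rewrite -powR_mulrn ?(ltW s0)//; move/andP: hp => [_ p2].
by rewrite ger_powR ?s0.
Qed.

Lemma Phi_large s : 1 <= s -> s <= Phi p s.
Proof.
move=> s1; rewrite /Phi le_min; apply/andP; split.
  rewrite -{1}(powRr1 (le_trans ler01 s1)) ler_powR//.
  by move/andP: hp => [/ltW].
by rewrite expr2 ler_peMr// (le_trans ler01).
Qed.

Lemma Phi_mono s s' : 0 <= s -> s <= s' -> Phi p s <= Phi p s'.
Proof.
move=> s0 ss'; rewrite /Phi le_min; apply/andP; split.
  rewrite ge_min; apply/orP; left; apply: ge0_ler_powR => //.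
  - by move/andP: hp => [/ltW h _]; rewrite (le_trans ler01).
  - by rewrite nnegrE (le_trans s0).
by rewrite ge_min; apply/orP; right; rewrite ler_pXn2r// nnegrE (le_trans s0).
Qed.

End power_law.

Section energy.
Variable R : realType.
Local Notation M := ('M[R]_3).

Lemma near_eq_differentiable (f g : M -> R) (x : M) :
  (\forall y \near x, f y = g y) -> differentiable g x -> differentiable f x.
Proof.
move=> fg dg; have fgx := nbhs_singleton fg.
have loc : f \o shift x = cst (f x) + 'd g x +o_ (0 : M) id.
  apply/eqaddoP => e e0; have := diff_locally dg => /eqaddoP /(_ e e0).
  have : \forall h \near (0 : M), f (h + x) = g (h + x).
    have := @near_shift _ M 0 x (fun y => f y = g y).
    rewrite /prop_near1 => /(_) E.
    by move: fg; rewrite (near_shift 0 x) /=; apply: filterS => h; rewrite /shift /= subr0.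
  by apply: filterS2 => h e1; rewrite !fctE /= /shift /= e1 fgx.
have dfg := diff_unique (diff_continuous dg) loc.
by apply/diff_locallyP; split; rewrite dfg //; exact: diff_continuous.
Qed.


Let Lm (Qt F : M) : M := Qt *m F *m Qt^T.

Let Lm_linear Qt : linear (Lm Qt).
Proof. by move=> a A B; rewrite /Lm mulmxDr mulmxDl -scalemxAr -scalemxAl. Qed.
HB.instance Definition _ Qt := GRing.isLinear.Build R M M _ (Lm Qt) (Lm_linear Qt).

Let Lm_continuous Qt : continuous (Lm Qt).
Proof.
have -> : Lm Qt = fun F => \sum_k \sum_l F k l *: Lm Qt (delta_mx k l).
  apply/funext => F; rewrite {1}(matrix_sum_delta F) linear_sum; apply: eq_bigr => k _.
  by rewrite linear_sum; apply: eq_bigr => l _; rewrite linearZ.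
move=> F; apply: differentiable_continuous.
rewrite (_ : (fun F => _) = \sum_k \sum_l (fun F : M => F k l *: Lm Qt (delta_mx k l))).
  apply: differentiable_sum => k; apply: differentiable_sum => l.
  apply: differentiableZl; exact: differentiable_coord.
by apply/funext => G; rewrite fct_sumE; apply: eq_bigr => k _; rewrite fct_sumE.
Qed.

Let Lp (Qt F : M) : M := 1%:M + Lm Qt F.

Let Lp_differentiable Qt F : differentiable (Lp Qt) F.
Proof.
by apply: differentiableD => //; apply: linear_differentiable; exact: Lm_continuous.
Qed.

Let Lp_diff Qt F : 'd (Lp Qt) F = Lm Qt :> (M -> M).
Proof.
have i1 := @is_diff_cst R M M 1%:M F.
have i2 : is_diff F (Lm Qt) (Lm Qt).
  by apply: DiffDef; [exact/linear_differentiable/Lm_continuous|exact/diff_lin/Lm_continuous].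
have := @diff_val _ _ _ _ _ _ _ (is_diffD i1 i2); rewrite add0r; exact.
Qed.

Lemma twice_differentiable_conjugate (W : M -> R) (Qt : M) :
  twice_differentiable_near W 1%:M ->
  twice_differentiable_near (fun F => W (1%:M + Qt *m F *m Qt^T)) 0.
Proof.
rewrite /twice_differentiable_near -/(Lp Qt) => dW.
have Lc : {for 0, continuous (Lp Qt)} by exact/differentiable_continuous/Lp_differentiable.
have L0 : Lp Qt 0 = 1%:M by rewrite /Lp linear0 addr0.
have Wn : \forall F \near (0 : M), differentiable W (Lp Qt F) /\
    forall i j, differentiable (fun G => 'D_(delta_mx i j) W G) (Lp Qt F).
  have := Lc (fun G => differentiable W G /\
    forall i j, differentiable (fun G => 'D_(delta_mx i j) W G) G).
  by rewrite L0 => /(_ dW).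
have [dV dWL] : (\forall F \near (0 : M), differentiable (W \o Lp Qt) F) /\
    (\forall F \near (0 : M), forall i j,
      differentiable (fun G => 'D_(delta_mx i j) W (Lp Qt G)) F).
  split; apply: filterS Wn => F [d1 d2].
    exact: differentiable_comp.
  move=> i j; exact: (@differentiable_comp _ _ _ _ (Lp Qt)  (fun G => 'D_(delta_mx i j) W G)).
have DV : \forall F \near (0 : M), forall i j, 'D_(delta_mx i j) (W \o Lp Qt) F =
    \sum_k \sum_l Lm Qt (delta_mx i j) k l * 'D_(delta_mx k l) W (Lp Qt F).
  apply: filterS Wn => F [d1 _] i j.
  rewrite deriveE; last exact: differentiable_comp.
  rewrite diff_comp// /= Lp_diff.
  rewrite {1}(matrix_sum_delta (Lm Qt _)) linear_sum; apply: eq_bigr => k _.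
  rewrite linear_sum; apply: eq_bigr => l _.
  by rewrite linearZ /= deriveE.
move/near_join: DV => DV.
near=> F; split; first by near: F.
move=> i j; apply: (@near_eq_differentiable _ (fun F => \sum_k \sum_l Lm Qt (delta_mx i j) k l * 'D_(delta_mx k l) W (Lp Qt F))).
  have : \forall y \near F, forall i j, 'D_(delta_mx i j) (W \o Lp Qt) y =
    \sum_k \sum_l Lm Qt (delta_mx i j) k l * 'D_(delta_mx k l) W (Lp Qt y) by near: F.
  by apply: filterS => y; exact.
have dW' : forall i j, differentiable (fun G => 'D_(delta_mx i j) W (Lp Qt G)) F by near: F.
rewrite (_ : (fun F => _) = \sum_k \sum_l (Lm Qt (delta_mx i j) k l *: (fun F => 'D_(delta_mx k l) W (Lp Qt F)))); last first.
  apply/funext => G; rewrite fct_sumE; apply: eq_bigr => k _; rewrite fct_sumE; apply: eq_bigr => l _ //.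
rewrite big_mkcond /=.
by apply: differentiable_sum => k; apply: differentiable_sum => l; apply: differentiableZ.
Unshelve. all: by end_near.
Qed.

(** Compare the Gram matrices of [1 + G] and of [Q + E], the same matrix split at a
    rotation: the first is 1 + G + G^T up to squares, the second is 1 up to a term
    of the size of [E]. *)
Lemma dist_SO3_lower (G : M) :
  Num.min 1 ((enorm (G + G^T) - enorm G ^+ 2) / 3) <= dist_SO3 (1%:M + G).
Proof.
apply: lb_le_inf; first by exists (enorm (1%:M + G - 1%:M)), 1%:M => //; split; rewrite ?trmx1 ?mulmx1 ?det1.
move=> _ [Q QSO <-]; set E := 1%:M + G - Q.
have GE : G + G^T = Q^T *m E + E^T *m Q + E^T *m E - G^T *m G.
  have QE : Q = 1%:M + G - E by rewrite /E subKr.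
  have QQ := SO3_trmul QSO.
  have : (1%:M + G)^T *m (1%:M + G) = (Q + E)^T *m (Q + E).
    by have -> : Q + E = 1%:M + G by rewrite /E addrC subrK.
  have trD (A B : M) : (A + B)^T = A^T + B^T by exact: linearD.
  rewrite !trD trmx1 !mulmxDl !mulmxDr QQ !mul1mx !mulmx1.
  move: (G^T *m G) (Q^T *m E) (E^T *m Q) (E^T *m E) => X1 X2 X3 X4 H.
  by apply/matrixP => i j; move/matrixP: H => /(_ i j); rewrite !mxE; lra.
have Q1 (A : M) : enorm (Q^T *m A) = enorm A.
  by rewrite /enorm mdot_rotl//; exact: SO3_trmx.
have Q2 : enorm (E^T *m Q) = enorm E by rewrite -(enorm_tr E) /enorm mdot_rotr.
have := enorm_triangle (Q^T *m E + E^T *m Q + E^T *m E) (- (G^T *m G)).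
have := enorm_triangle (Q^T *m E + E^T *m Q) (E^T *m E).
have := enorm_triangle (Q^T *m E) (E^T *m Q).
have := enorm_mul E^T E; have := enorm_mul G^T G.
rewrite -GE enormN Q1 Q2 !enorm_tr -!expr2 => h1 h2 h3 h4 h5.
rewrite ge_min; have [|E1] := leP 1 (enorm E); first by [].
have E0 := enorm_ge0 E; have : enorm E ^+ 2 <= enorm E by rewrite expr2 ler_piMl// ltW.
by move=> h6; rewrite /= ler_pdivrMr//; lra.
Qed.

Variables (p : R) (V : M -> R).
Hypothesis hp : 1 < p <= 2.
Hypothesis hV : exists W : M -> R,
       (HFinite p W /\ exists Qt : M, SO3 Qt /\
          V = (fun F => W (1%:M + Qt *m F *m Qt^T)))
       \/ (HLin p W /\ V = W).

Lemma energy_ge0 F : 0 <= V F.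
Proof. by case: hV => W [[[[]+ _ _ _] _ [Qt [_ ->]]]|[[[]+ _ _ _] _ ->]]; exact. Qed.

Lemma dist_SO3_1 : dist_SO3 (1%:M : M) = 0.
Proof.
apply/eqP; rewrite eq_le; apply/andP; split.
  apply: ge_inf; first by exists 0 => _ [Q _ <-]; exact: enorm_ge0.
  exists 1%:M; first by split; rewrite ?trmx1 ?mulmx1 ?det1.
  by rewrite subrr /enorm /mdot big1 ?sqrtr0// => i _; rewrite big1// => j _; rewrite mxE mul0r.
apply: lb_le_inf.
  by exists (enorm (1%:M - 1%:M : M)), 1%:M => //; split; rewrite ?trmx1 ?mulmx1 ?det1.
by move=> _ [Q _ <-]; exact: enorm_ge0.
Qed.

Lemma enorm0 : enorm (0 : M) = 0.
Proof. by rewrite /enorm /mdot big1 ?sqrtr0// => i _; rewrite big1// => j _; rewrite mxE mul0r. Qed.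

Lemma energy_0 : V 0 = 0.
Proof.
apply/eqP; rewrite eq_le energy_ge0 andbT.
case: hV => W [[[_ [_ [c c0 +]]] [Qt [_ ->]]]|[[_ [_ [c c0 +]]] ->]].
  by move=> /(_ (1%:M + Qt *m 0 *m Qt^T)) /andP[_]; rewrite mulmx0 mul0mx addr0 dist_SO3_1 (Phi0 hp) mulr0.
by move=> /(_ 0) /andP[_]; rewrite trmx0 addr0 enorm0 (Phi0 hp) mulr0.
Qed.

Lemma energy_differentiable : twice_differentiable_near V 0.
Proof.
case: hV => W [[[[_ _ _ +] _] [Qt [_ ->]]]|[[[_ _ _ +] _] ->//]].
exact: twice_differentiable_conjugate.
Qed.

Lemma energy_lower : exists2 c : R, 0 < c & forall G : M,
  enorm (G + G^T) <= 1 -> enorm G ^+ 2 <= enorm (G + G^T) ->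
  c * (enorm (G + G^T) - enorm G ^+ 2) ^+ 2 <= V G.
Proof.
case: hV => W [[[_ [_ [c c0 hW]]] [Qt [QSO ->]]]|[[_ [_ [c c0 hW]]] ->]].
  exists (c^-1 / 9); first by rewrite divr_gt0 ?invr_gt0.
  move=> G G1 G2; pose H := Qt *m G *m Qt^T.
  have QtSO := SO3_trmx QSO.
  have nH (A : M) : enorm (Qt *m A *m Qt^T) = enorm A.
    by rewrite /enorm mdot_rotr// mdot_rotl.
  have HT : H + H^T = Qt *m (G + G^T) *m Qt^T.
    by rewrite /H !trmx_mul trmxK mulmxDr mulmxDl mulmxA.
  have /andP[+ _] := hW (1%:M + H); apply: le_trans.
  rewrite -mulrA ler_pM2l ?invr_gt0//.
  set z := (enorm (G + G^T) - enorm G ^+ 2).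
  have z0 : 0 <= z by rewrite subr_ge0.
  have z1 : z / 3 <= 1 by rewrite ler_pdivrMr//; have := sqr_ge0 (enorm G); rewrite /z; lra.
  have -> : 9^-1 * z ^+ 2 = Phi p (z / 3).
    by rewrite (Phi_small hp) ?z1 ?divr_ge0//; field.
  apply: (Phi_mono hp); first by rewrite divr_ge0.
  by have := dist_SO3_lower H; rewrite HT !nH -/z min_r.
exists c^-1; first by rewrite invr_gt0.
move=> G G1 G2; have /andP[+ _] := hW G; apply: le_trans.
rewrite (Phi_small hp) ?enorm_ge0// ler_pM2l ?invr_gt0// ler_pXn2r ?nnegrE ?subr_ge0 ?enorm_ge0//.
by rewrite gerBl sqr_ge0.
Qed.

(** Divide the lower growth bound at [s A] by [s ^ 2] and let [s] tend to 0. *)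
Lemma quad_coercive : exists2 c : R, 0 < c & forall A, c * nrm2 (A + A^T) <= quad V A.
Proof.
have [c c0 hc] := energy_lower; exists (c / 2); first by rewrite divr_gt0.
move=> A; apply/ler_addgt0Pr => e e0.
pose S := enorm (A + A^T); pose N := nrm2 A.
have N0 : 0 <= N by exact: nrm2_ge0.
have S0 : 0 <= S by exact: enorm_ge0.
pose w := e / 2 / (N + 1).
have w0 : 0 < w by rewrite !divr_gt0 ?ltr_pwDr.
have wN : w * N <= e / 2.
  by rewrite /w -mulrA ler_piMr ?divr_ge0 ?(ltW e0)// mulrC ler_pdivrMr ?mul1r ?lerDl ?ltr_pwDr.
have [d d0 hd] := taylor energy_0 energy_ge0 energy_differentiable w0.
suff [s [s0 sd sV]] : exists s : R, [/\ 0 < s, s * enorm A < d & c / 4 * (s ^+ 2 * S ^+ 2) <= V (s *: A)].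
  have := hd (s *: A); rewrite enormZr gtr0_norm// => /(_ sd); rewrite (quadZ energy_differentiable) nrm2Z.
  rewrite ler_distl => /andP[_ h].
  have : s ^+ 2 * (c / 4 * S ^+ 2) <= s ^+ 2 * (2^-1 * quad V A + w * N).
    rewrite -/N in h; have := le_trans sV h; lra.
  rewrite ler_pM2l ?exprn_gt0// -sqr_enorm -/S; lra.
have sm (a b c' : R) : 0 < a -> 0 <= b -> exists2 s, 0 < s & s * b < a.
  move=> a0 b0; exists (a / (b + 1)); first by rewrite divr_gt0 ?ltr_pwDr.
  by rewrite mulrAC ltr_pdivrMr ?ltr_pwDr// ltr_pM2l// ltrDl.
have [S00|Sn0] := eqVneq S 0.
  have [s s0 sd] := sm d (enorm A) 0 d0 (enorm_ge0 A); exists s; split => //.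
  by rewrite S00 expr0n !mulr0 energy_ge0.
have Sp : 0 < S by rewrite lt_def Sn0.
have [s1 s10 h1] := sm d (enorm A) 0 d0 (enorm_ge0 A).
have [s2 s20 h2] := sm 1 S 0 ltr01 S0.
have [s3 s30 h3] := sm (S / 2) N 0 (divr_gt0 Sp (ltr0n R 2)) N0.
pose s := Num.min s1 (Num.min s2 s3).
have s0 : 0 < s by rewrite !lt_min s10 s20.
have le (s' b a : R) : s <= s' -> 0 <= b -> s' * b < a -> s * b < a.
  by move=> ss b0; apply: le_lt_trans; rewrite ler_wpM2r.
have {}h1 : s * enorm A < d by apply: le h1; rewrite ?enorm_ge0// ge_min lexx.
have {}h2 : s * S < 1 by apply: le h2 => //; rewrite !ge_min lexx orbT.
have {}h3 : s * N < S / 2 by apply: le h3 => //; rewrite !ge_min lexx !orbT.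
exists s; split=> //.
have E : s *: A + (s *: A)^T = s *: (A + A^T) by rewrite linearZ /= scalerDr.
have := hc (s *: A); rewrite E !enormZr (gtr0_norm s0) -/S exprMn sqr_enorm -/N.
have sN : s ^+ 2 * N <= s * (S / 2) by rewrite expr2 -mulrA ler_pM2l// ltW.
have sS : s * (S / 2) <= s * S by rewrite ler_pM2l//; lra.
move=> /(_ (ltW h2) (le_trans sN sS)); apply: le_trans.
rewrite -mulrA ler_pM2l// (_ : 4^-1 * _ = (s * (S / 2)) ^+ 2); last by field.
rewrite ler_pXn2r ?nnegrE ?mulr_ge0 ?divr_ge0 ?(ltW s0)//; lra.
Qed.

End energy.

(** * Smooth periodic functions and the angle *)

Section circle.
Variable R : realType.

Lemma continuous_norm_bounded (f : R -> R) (a b : R) : a <= b -> continuous f ->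
  exists2 C, 0 <= C & forall x, a <= x <= b -> `|f x| <= C.
Proof.
move=> ab cf.
have [c _ hc] := @EVT_max R (fun x => `|f x|) a b ab (continuous_subspaceT (fun x => cvg_norm (cf x))).
by exists `|f c| => // x xab; apply: hc; rewrite in_itv.
Qed.

Lemma near_eq_derive1 (f g : R -> R) (x d d' : R) : is_derive x 1 f d ->
  is_derive x 1 g d' -> (\forall y \near x, f y = g y) -> d = d'.
Proof.
move=> df dg fg; have dg' := near_eq_is_derive fg df.
by move: dg' dg => [_ <-] [_ <-].
Qed.

(** One fixed profile: all the cutoffs below are rescalings of it, whence the
    uniformity of their constants in r, R and h. *)
Lemma smooth_cutoff : exists s s' : R -> R, exists C : R,
  [/\ Cinf s, forall x, 0 <= s x <= 1, forall x, x <= 0 -> s x = 0 & forall x, 1 <= x -> s x = 1] /\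
  [/\ forall x : R, is_derive x 1 s (s' x), continuous s', forall x, x <= 0 -> s' x = 0,
      forall x, 1 <= x -> s' x = 0 & 0 <= C /\ forall x, `|s' x| <= C].
Proof.
have [s [Cs s01 s0 s1 _]] := smooth_step R.
(* composing with an affine map leaves room around the transition interval *)
pose f x := s (2 * x + (- 2^-1)).
have Cf : Cinf f by apply: Cinf_comp => //; exact: Cinf_affine.
have [f' Cf' df] := CinfP Cf.
have f'0 x : x <= 0 -> f' x = 0.
  move=> x0; apply: near_eq_derive1 (df x) (is_derive_cst (0 : R) x 1) _.
  by near=> y; rewrite /f s0//; have : y < 4^-1 by [near: y; apply: lt_nbhsl; lra]; lra.
have f'1 x : 1 <= x -> f' x = 0.
  move=> x1; apply: near_eq_derive1 (df x) (is_derive_cst (1 : R) x 1) _.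
  near=> y; rewrite /f s1//; have : 3 / 4 < y by near: y; apply: lt_nbhsr; lra.
  lra.
have cf' : continuous f' by exact: Cinf_continuous.
have [C C0 hC] := continuous_norm_bounded ler01 cf'.
exists f, f', C; split.
  split=> //; first by move=> x; exact: s01.
  - by move=> x x0; rewrite /f s0//; lra.
  - by move=> x x0; rewrite /f s1//; lra.
split=> //; split=> // x; have [x0|x0] := leP x 0; first by rewrite f'0 ?normr0.
have [x1|x1] := leP 1 x; first by rewrite f'1 ?normr0.
by apply: hC; rewrite !ltW.
Unshelve. all: by end_near. Qed.

Lemma unit_angle (c s : R) : c ^+ 2 + s ^+ 2 = 1 ->
  exists2 th : R, 0 <= th <= 2 * pi & c = cos th /\ s = sin th.
Proof.
move=> cs; have c1 : -1 <= c <= 1.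
  by have := sqr_ge0 s; have := sqr_ge0 (c - 1); have := sqr_ge0 (c + 1); nra.
have s2 : 1 - c ^+ 2 = s ^+ 2 by lra.
have := acos_ge0 c1; have := acos_lepi c1 => a1 a0.
have [s0|s0] := leP 0 s.
  exists (acos c); first by lra.
  by rewrite acosK ?sin_acos ?s2 ?sqrtr_sqr ?ger0_norm.
exists (2 * pi - acos c); first by lra.
have -> : 2 * pi - acos c = - acos c + pi *+ 2 by ring.
rewrite cosD2pi sinD2pi cosN sinN acosK ?sin_acos ?s2 ?sqrtr_sqr ?ltr0_norm//.
by rewrite opprK.
Qed.

Lemma smooth_inv : exists w w' : R -> R, [/\ Cinf w, forall x : R, is_derive x 1 w (w' x) &
  forall x, 2^-1 <= x -> w x = x^-1 /\ w' x = - x^-1 ^+ 2].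
Proof.
have [i Ci hi] := @smooth_invsqrt R 4^-1 ltac:(lra).
pose w x := i x * i x; have Cw : Cinf w by exact: CinfM.
have [w' _ dw] := CinfP Cw; exists w, w'; split=> // x x2.
have wE y : 4^-1 <= y -> w y = y^-1.
  by move=> y4; rewrite /w !hi// -expr2 exprVn sqr_sqrtr//; lra.
have x0 : x != 0 by lra.
split; first by rewrite wE//; lra.
have d1 : is_derive x 1 (fun y => y^-1) (- x^-1 ^+ 2).
  apply: is_derive_eq; first by apply: is_deriveV.
  by rewrite exprVn /GRing.scale /= mulr1.
apply: near_eq_derive1 (dw x) d1 _.
by near=> y; rewrite wE//; have : 4^-1 < y by [near: y; apply: lt_nbhsr; lra]; lra.
Unshelve. all: by end_near. Qed.


Definition periodic2pi (F : R -> R) := forall th, F (th + 2 * pi) = F th.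

(* the inverse of the stereographic half-angle formula *)
Lemma half_angle (th : R) : - pi < th < pi -> 0 < 1 + cos th ->
  2 * atan (sin th / (1 + cos th)) = th.
Proof.
move=> th1 c0; have -> : sin th / (1 + cos th) = tan (th / 2).
  have -> : th = (th / 2) *+ 2 by rewrite mulr2n; lra.
  rewrite sin_mulr2n cos_mulr2n /tan.
  have h0 : 0 < cos (th / 2) by apply: cos_gt0_pihalf; lra.
  have -> : (th / 2) *+ 2 / 2 = th / 2 by rewrite mulr2n; lra.
  rewrite !mulr2n; field.
  by rewrite gt_eqF//= (_ : _ + _ = 2 * cos (th / 2) ^+ 2) ?gt_eqF ?mulr_gt0 ?exprn_gt0//; ring.
rewrite tanK; first by rewrite mulrC divfK ?pnatr_eq0.
by rewrite in_itv /= -mulNr !ltr_pM2r ?invr_gt0.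
Qed.

Lemma atan_Cinf : Cinf (@atan R).
Proof.
have [i Ci hi] := @smooth_invsqrt R 1 ltr01.
pose g (x : R) := i (x * x + 1) * i (x * x + 1).
have Cg : Cinf g.
  have Cx : Cinf (fun x : R => x * x + 1).
    have CX : Cinf (fun x : R => x).
      by have := @Cinf_affine R 1 0; congr (Cinf _); apply/funext => x; ring.
    by apply: CinfD; [exact: CinfM|exact: Cinf_cst].
  by apply: CinfM; exact: (Cinf_comp Ci Cx).
have gE x : g x = (1 + x ^+ 2)^-1.
  rewrite /g hi -expr2; last by rewrite lerDr sqr_ge0.
  by rewrite -expr2 exprVn sqr_sqrtr ?addr_ge0 ?sqr_ge0// addrC.
have [G CG dG] := Cinf_primitive Cg.
have dD (x : R) : is_derive x 1 (fun y => G y - atan y) 0.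
  by have := is_deriveB (dG x) (is_derive1_atan x); rewrite gE subrr.
have GE x : atan x = G x + (- G 0).
  have E0 : G 0 - atan 0 = G x - atan x.
    have [x0|/ltW x0] := leP 0 x.
      by apply: (is_derive_cst_seg dD).
    by apply/esym; apply: (is_derive_cst_seg dD).
  by move: E0; rewrite atan0; lra.
have -> : @atan R = fun x => G x + (- G 0) by apply/funext.
by apply: CinfD => //; exact: Cinf_cst.
Qed.

(** A smooth periodic function of the angle is a smooth function of the point of
    the unit circle, on each of two charts where the angle is an arctangent. The
    tests need functions of (cos, sin) rather than of a multivalued angle. *)
Lemma periodic_lift (F F' : R -> R) : Cinf F -> (forall th : R, is_derive th 1 F (F' th)) ->
  periodic2pi F ->
  exists H : R -> R -> R,
  [/\ forall th, 0 <= th <= 2 * pi -> H (cos th) (sin th) = F th,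
      measurable_fun setT (fun z : R * R => H z.1 z.2),
      forall f g : 'cV[R]_3 -> R, S3 f -> S3 g -> S3 (fun x => H (f x) (g x)) &
      forall (f g : 'cV[R]_3 -> R) x v th tau, S3 f -> S3 g -> 0 <= th <= 2 * pi ->
        f x = cos th -> g x = sin th ->
        is_derive x v f (- sin th * tau) -> is_derive x v g (cos th * tau) ->
        is_derive x v (fun x => H (f x) (g x)) (F' th * tau)].
Proof.
move=> CF dF pF.
have [s [s' [_ [[Cs _ s0 s1] [ds cs' s'0 s'1 _]]]]] := smooth_cutoff.
have [w [w' [Cw dw wE]]] := smooth_inv.
pose Z c t := t * w (1 + c).
pose A c t := F (2 * atan (Z c t)).
pose B c t := F (pi + - (2 * atan (Z (- 1 * c) t))).
pose H c t := s (c + 2^-1) * A c t + (1 + - s (c + 2^-1)) * B c t.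
have pi0 := pi_gt0 R.
have cpi (th : R) : 0 <= th <= 2 * pi -> 
    [/\ th = pi -> cos th = -1 & th = 0 \/ th = 2 * pi -> cos th = 1].
  move=> _; split; first by move=> ->; rewrite cospi.
  by case=> ->; rewrite ?cos0 // mulr_natl cos2pi.
have AE th : 0 <= th <= 2 * pi -> - 2^-1 <= cos th ->
    2 * atan (Z (cos th) (sin th)) = th \/ 2 * atan (Z (cos th) (sin th)) = th - 2 * pi.
  move=> th02 c2; rewrite /Z (wE _ _).1; last lra.
  have [thpi|thpi|thpi] := ltgtP th pi.
  - by left; rewrite half_angle//; lra.
  - right; pose b := th - 2 * pi; have thE : th = b + 2 * pi by rewrite /b; lra.
    have cb : cos th = cos b by rewrite thE mulr_natl cosD2pi.
    have sb : sin th = sin b by rewrite thE mulr_natl sinD2pi.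
    by rewrite cb sb half_angle// -?cb /b; lra.
  - by have [/(_ thpi) ? _] := cpi th th02; lra.
have BE th : 0 <= th <= 2 * pi -> cos th <= 2^-1 ->
    pi + - (2 * atan (Z (-1 * cos th) (sin th))) = th.
  move=> th02 c2; rewrite /Z (wE _ _).1; last lra.
  have cb : -1 * cos th = cos (pi - th) by rewrite cosB cospi sinpi; ring.
  have sb : sin th = sin (pi - th) by rewrite sinB cospi sinpi; ring.
  rewrite cb sb half_angle ?subKr//; last by rewrite -cb; lra.
  have [_ h] := cpi th th02.
  have : th != 0 by apply/eqP => /or_introl /h ?; lra.
  have : th != 2 * pi by apply/eqP => /or_intror /h ?; lra.
  by move=> h1 h2; lra.
have pF' : periodic2pi F'.
  move=> th; have d1 : is_derive th 1 (fun y => F (y + 2 * pi)) (F' (th + 2 * pi)).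
    have := @is_derive1_comp _ F (fun y : R => y + 2 * pi) th _ _ (dF _) _.
    move=> /(_ 1); rewrite mulr1; apply.
    by have := is_deriveD (is_derive_id th (1 : R)) (is_derive_cst (2 * pi : R) th 1); rewrite addr0.
  apply: near_eq_derive1 d1 (dF th) _.
  by near=> y; exact: pF.
have pFB th : F (th - 2 * pi) = F th by rewrite -(pF (th - _)) subrK.
have pFB' th : F' (th - 2 * pi) = F' th by rewrite -(pF' (th - _)) subrK.
have Cat : Cinf (fun z : R => 2 * atan z).
  by apply: CinfM; [exact: Cinf_cst|exact: atan_Cinf].
have CX : Cinf (fun x : R => x).
  by have := @Cinf_affine R 1 0; congr (Cinf _); apply/funext => x; ring.
have cm (f : R -> R) : Cinf f -> measurable_fun setT f.
  by move=> /Cinf_continuous; exact: continuous_measurable_fun.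
exists H; split.
- move=> th th02; rewrite /H.
  have [c1|c1] := leP (- 2^-1) (cos th); last by rewrite s0 ?/B ?BE//; lra.
  have [c2|c2] := leP (cos th) (2^-1); last first.
    by rewrite s1 ?/A; [case: (AE _ th02 c1) => ->; rewrite ?pFB; ring|lra].
  by rewrite /A /B BE//; case: (AE _ th02 c1) => ->; rewrite ?pFB; ring.
- have m1 : measurable_fun setT (fun z : R * R => z.1) by exact: measurable_fst.
  have m2 : measurable_fun setT (fun z : R * R => z.2) by exact: measurable_snd.
  have mZ (f : R * R -> R) : measurable_fun setT f -> measurable_fun setT (fun z => 2 * atan (Z (f z) z.2)).
    move=> mf; apply: (measurableT_comp (cm _ Cat)); apply: measurable_funM => //.
    apply: (measurableT_comp (cm _ Cw)); exact: measurable_funD.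
  have mS : measurable_fun setT (fun z : R * R => s (z.1 + 2^-1)).
    by apply: (measurableT_comp (cm _ Cs)); exact: measurable_funD.
  apply: measurable_funD; apply: measurable_funM => //.
  + by apply: (measurableT_comp (cm _ CF)); exact: mZ.
  + by apply: measurable_funD => //; exact: measurableT_comp.
  + apply: (measurableT_comp (cm _ CF)); apply: measurable_funD => //.
    by apply: measurableT_comp => //; apply: mZ; exact: measurable_funM.
- move=> f g Sf Sg.
  have SN h : S3 h -> S3 (fun x : 'cV[R]_3 => - h x).
    move=> Sh; rewrite (_ : (fun x => _) = fun x => -1 * h x); last by apply/funext => x; ring.
    by apply: S3_mul => //; exact: S3_cst.
  have SZ h : S3 h -> S3 (fun x : 'cV[R]_3 => 2 * atan (Z (h x) (g x))).
    move=> Sh; apply: (S3_comp Cat); apply: S3_mul => //; apply: (S3_comp Cw).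
    by apply: S3_add => //; exact: S3_cst.
  have Ss : S3 (fun x : 'cV[R]_3 => s (f x + 2^-1)).
    by apply: (S3_comp Cs); apply: S3_add => //; exact: S3_cst.
  apply: S3_add; apply: S3_mul => //.
  + by apply: (S3_comp CF); exact: SZ.
  + by apply: S3_add; [exact: S3_cst|exact: SN].
  + apply: (S3_comp CF); apply: S3_add; first exact: S3_cst.
    by apply: SN; apply: SZ; apply: S3_mul => //; exact: S3_cst.
- move=> f g x v th tau Sf Sg th02 fx gx df dg.
  set c := cos th in fx dg; set u := sin th in gx df.
  have cu : c ^+ 2 + u ^+ 2 = 1 by exact: cos2Dsin2.
  have diff h : S3 h -> differentiable h x by move=> /S3_differentiable.
  have dat (z : R) : is_derive z 1 (fun z : R => 2 * atan z) (2 * (1 + z ^+ 2)^-1).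
    by have := is_deriveZ 2 (is_derive1_atan z).
  (* along either chart, the derivative of the angle is that of th up to sign *)
  have chart (k : 'cV[R]_3 -> R) (sg : R) : S3 k -> (sg = 1) \/ (sg = -1) -> k x = sg * c ->
      is_derive x v k (- (sg * u * tau)) -> - 2^-1 <= sg * c ->
      is_derive x v (fun y => 2 * atan (Z (k y) (g y))) (sg * tau).
    move=> Sk sg2 kx dk c2.
    have S1k : S3 (fun y : 'cV[R]_3 => 1 + k y) by apply: S3_add => //; exact: S3_cst.
    have d1k : is_derive x v (fun y => 1 + k y) (- (sg * u * tau)).
      by have := is_deriveD (is_derive_cst (1 : R) x v) dk; rewrite add0r.
    have dwk := is_derive_comp3 dw (diff _ S1k) d1k.
    have SZ : S3 (fun y : 'cV[R]_3 => Z (k y) (g y)).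
      by apply: S3_mul => //; exact: (S3_comp Cw S1k).
    have dZ := is_deriveM dg dwk.
    have dc := is_derive_comp3 dat (diff _ SZ) dZ; apply: (is_derive_eq dc).
    rewrite /Z kx gx (wE (1 + sg * c) _).1 ?(wE (1 + sg * c) _).2; [|lra|lra].
    set D := 1 + sg * c.
    have D0 : D != 0 by rewrite /D; lra.
    have u2 : u ^+ 2 = 1 - c ^+ 2 by lra.
    have DD : D ^+ 2 + u ^+ 2 = 2 * D by rewrite u2 /D; case: sg2 => ->; ring.
    have -> : 1 + (u * D^-1) ^+ 2 = 2 / D.
      by rewrite -[RHS](mulfK D0) mulrAC -{1}(mulfK D0 2) -DD; field.
    have -> : 2 * (2 / D)^-1 * (u *: (- D^-1 ^+ 2 * - (sg * u * tau)) + D^-1 *: (c * tau)) =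
        (sg * u ^+ 2 + D * c) * tau / D by rewrite /GRing.scale /=; field.
    have -> : sg * u ^+ 2 + D * c = sg * D by rewrite u2 /D; case: sg2 => ->; ring.
    by field.
  have S1 h : S3 h -> S3 (fun y : 'cV[R]_3 => 2 * atan (Z (h y) (g y))).
    move=> Sh; apply: (S3_comp Cat); apply: S3_mul => //; apply: (S3_comp Cw).
    by apply: S3_add => //; exact: S3_cst.
  have SNf : S3 (fun y : 'cV[R]_3 => -1 * f y) by apply: S3_mul => //; exact: S3_cst.
  have dNf : is_derive x v (fun y => -1 * f y) (- (-1 * u * tau)).
    by apply: (is_derive_eq (is_deriveZ (-1) df)); rewrite /GRing.scale /=; ring.
  have SB : S3 (fun y : 'cV[R]_3 => pi + - (2 * atan (Z (-1 * f y) (g y)))).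
    rewrite (_ : (fun y => _) = fun y => pi + -1 * (2 * atan (Z (-1 * f y) (g y)))); last first.
      by apply/funext => y; rewrite [-1 * (2 * _)]mulN1r.
    by apply: S3_add; [exact: S3_cst|apply: S3_mul; [exact: S3_cst|exact: S1]].
  have [A' _ dA] := S3_derive (S3_comp CF (S1 _ Sf)) v.
  have [B' _ dB] := S3_derive (S3_comp CF SB) v.
  have S12 : S3 (fun y : 'cV[R]_3 => f y + 2^-1) by apply: S3_add => //; exact: S3_cst.
  have d12 : is_derive x v (fun y => f y + 2^-1) (- u * tau).
    by have := is_deriveD df (is_derive_cst (2^-1 : R) x v); rewrite addr0.
  have dS := is_derive_comp3 ds (diff _ S12) d12.
  have d1S := is_deriveB (is_derive_cst (1 : R) x v) dS.
  apply: (is_derive_eq (is_deriveD (is_deriveM dS (dA x)) (is_deriveM d1S (dB x)))).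
  rewrite /GRing.scale /= !fctE /= fx gx sub0r.
  have EA : - 2^-1 <= c -> F (2 * atan (Z c u)) = F th /\ A' x = F' th * tau.
    move=> c2; have [F1 F2] : F (2 * atan (Z c u)) = F th /\ F' (2 * atan (Z c u)) = F' th.
      by case: (AE _ th02 c2) => ->.
    split=> //; rewrite -F2.
    have := chart f 1 Sf (or_introl erefl); rewrite !mul1r -mulNr => /(_ fx df c2) dc.
    have := is_derive_comp3 dF (diff _ (S1 _ Sf)) dc; rewrite fx gx.
    by case: (dA x) => _ <- [_ <-].
  have EB : c <= 2^-1 -> F (pi + - (2 * atan (Z (-1 * c) u))) = F th /\ B' x = F' th * tau.
    move=> c2; rewrite BE//; split=> //.
    have c2' : - 2^-1 <= -1 * c by lra.
    have k1 : -1 * f x = -1 * c by rewrite fx.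
    have dc := chart (fun y => -1 * f y) (-1) SNf (or_intror erefl) k1 dNf c2'.
    have dc' := is_deriveB (is_derive_cst (pi : R) x v) dc.
    have := is_derive_comp3 dF (diff _ SB) dc'; rewrite fx gx BE// sub0r mulN1r opprK.
    by case: (dB x) => _ <- [_ <-].
  have [c1|c1] := ltP c (- 2^-1).
    have /EB[EB1 EB2] : c <= 2^-1 by lra.
    by rewrite EB1 EB2 s0 ?s'0; [ring|lra|lra].
  have [EA1 EA2] := EA c1.
  have [c2|c2] := ltP 2^-1 c.
    by rewrite EA1 EA2 s1 ?s'1; [ring|lra|lra].
  have [EB1 EB2] := EB c2.
  by rewrite EA1 EA2 EB1 EB2; ring.
Unshelve. all: by end_near. Qed.

End circle.

(** * Integrals over the circle *)

Section circle_integral.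
Variable R : realType.
Notation mu := (@lebesgue_measure R).
Notation arc := ([set` `]0%R, (2 * pi)%R[] : set R).

Definition circ (F : R -> R) : R := \int[mu]_(th in arc) F th.
Definition cintegrable (F : R -> R) := rintegrable mu arc F.

Lemma pi2_gt0 : 0 < 2 * pi :> R.
Proof. by rewrite mulr_gt0 ?pi_gt0. Qed.

Lemma measurable_arc : measurable (arc : set (measurableTypeR R)).
Proof. exact: measurable_itv. Qed.

Lemma arc_itv th : arc th -> 0 <= th <= 2 * pi.
Proof. by rewrite /= in_itv /= => /andP[/ltW -> /ltW ->]. Qed.

Lemma continuous_measurable_arc (F : R -> R) : continuous F -> measurable_fun arc F.
Proof. by move=> cF; apply: measurable_funS (continuous_measurable_fun cF). Qed.

Lemma Cinf_cintegrable F : Cinf F -> cintegrable F.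
Proof.
move=> /Cinf_continuous cF.
have [C C0 hC] := continuous_norm_bounded (ltW pi2_gt0) cF.
apply: (@rintegrable_bounded _ _ _ mu _ measurable_arc C).
- have E := @lebesgue_measure_itv R `]0, (2 * pi)[.
  by apply: (eq_ind_r (fun z => (z < +oo)%E) _ E); rewrite /= lte_fin pi2_gt0 -EFinB ltry.
- exact: continuous_measurable_arc.
- by move=> x /arc_itv; exact: hC.
Qed.

Lemma circ_primitive F P : Cinf F -> (forall x : R, is_derive x 1 P (F x)) ->
  circ F = P (2 * pi) - P 0.
Proof.
move=> CF dP; rewrite /circ /Rintegral.
have mF : measurable_fun arc (EFin \o F).
  by apply/measurable_EFinP; apply: continuous_measurable_arc; exact: Cinf_continuous.
have E1 := @integral_itv_bndoo R 0 (2 * pi) (EFin \o F) true false mF.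
have E2 := continuous_FTC2_everywhere pi2_gt0 (Cinf_continuous CF) dP.
exact: (congr1 fine (etrans (esym E1) E2)).
Qed.

Lemma circ_cst (c : R) : circ (fun=> c) = 2 * pi * c.
Proof.
have d (x : R) : is_derive x 1 (fun x => c * x) c.
  by apply: (is_derive_eq (is_deriveZ c (is_derive_id x 1))); rewrite /GRing.scale /= mulr1.
by rewrite (circ_primitive (Cinf_cst c) d) mulr0 subr0 mulrC.
Qed.

Lemma circD F G : cintegrable F -> cintegrable G ->
  circ (fun x => F x + G x) = circ F + circ G.
Proof. by move=> iF iG; rewrite /circ RintegralD//; exact: measurable_arc. Qed.

Lemma circZ c F : cintegrable F -> circ (fun x => c * F x) = c * circ F.
Proof. by move=> iF; exact: (RintegralZ measurable_arc). Qed.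

Lemma circ_sum n (F : 'I_n -> R -> R) : (forall i, cintegrable (F i)) ->
  circ (fun x => \sum_i F i x) = \sum_i circ (F i).
Proof. by move=> iF; exact: (Rintegral_sum measurable_arc). Qed.

Lemma circ_le F G : cintegrable F -> cintegrable G -> (forall x, 0 <= x <= 2 * pi -> F x <= G x) ->
  circ F <= circ G.
Proof.
move=> iF iG FG; apply: (le_Rintegral measurable_arc iF iG).
by move=> x Dx; exact: (FG x (arc_itv Dx)).
Qed.

Lemma circ_ge0 F : (forall x, 0 <= F x) -> 0 <= circ F.
Proof. by move=> F0; apply: Rintegral_ge0 => x _; exact: F0. Qed.

Lemma eq_circ F G : (forall x, F x = G x) -> circ F = circ G.
Proof. by move=> FG; congr circ; exact/funext. Qed.

Lemma circ_eq0 F : Cinf F -> (forall x, 0 <= F x) -> circ F = 0 ->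
  forall x, 0 <= x <= 2 * pi -> F x = 0.
Proof.
move=> CF F0 F00; have [P _ dP] := Cinf_primitive CF.
have Pm a b : a <= b -> P a <= P b by move=> ab; apply: (is_derive_mono dP) => // x _; exact: F0.
have P2 : P (2 * pi) = P 0 by move: F00; rewrite (circ_primitive CF dP); lra.
have PE x : 0 <= x <= 2 * pi -> P x = P 0.
  move=> /andP[x0 x1]; apply/eqP; rewrite eq_le (Pm 0 x x0) andbT -P2; exact: Pm.
have Fin x : 0 < x < 2 * pi -> F x = 0.
  move=> /andP[x0 x1]; apply: near_eq_derive1 (dP x) (is_derive_cst (P 0) x 1) _.
  near=> y; apply: PE; apply/andP; split; apply: ltW; near: y; [exact: lt_nbhsr|exact: lt_nbhsl].
have pp := pi2_gt0.
move=> x /andP[x0 x1]; apply/eqP; rewrite eq_le F0 andbT leNgt; apply/negP => Fx.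
have : \forall y \near x, 0 < F y.
  exact: (@cvgr_gt _ _ _ _ F _ (@Cinf_continuous _ F CF x) 0 Fx).
move=> /nbhs_ballP[e /= e0 he].
pose y := if x < pi then x + Num.min (e / 2) (pi / 2) else x - Num.min (e / 2) (pi / 2).
have pi0 := pi_gt0 R.
have m1 : 0 < Num.min (e / 2) (pi / 2) by rewrite lt_min !divr_gt0.
have m2 : Num.min (e / 2) (pi / 2) < e by rewrite gt_min; apply/orP; left; lra.
have m3 : Num.min (e / 2) (pi / 2) <= pi / 2 by rewrite ge_min lexx orbT.
have : 0 < F y.
  apply: he; rewrite /ball /= /y; case: ifP => _; rewrite ltr_distl; apply/andP; split; lra.
rewrite Fin ?ltxx// /y; have [xp|xp] := ltP x pi; apply/andP; split; lra.
Unshelve. all: by end_near. Qed.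

Lemma circ_shift F a : Cinf F -> periodic2pi F -> circ (fun th => F (a + th)) = circ F.
Proof.
move=> CF pF; have [P CP dP] := Cinf_primitive CF.
have dPs (c x : R) : is_derive x 1 (fun y => P (c + y)) (F (c + x)).
  have := @is_derive1_comp _ P (fun y : R => c + y) x _ _ (dP _) _.
  move=> /(_ 1); rewrite mulr1; apply.
  by have := is_deriveD (is_derive_cst (c : R) x 1) (is_derive_id x (1 : R)); rewrite add0r.
have CFa : Cinf (fun th => F (a + th)).
  have := Cinf_comp CF (Cinf_affine 1 a).
  by congr Cinf; apply/funext => x /=; congr F; ring.
rewrite (circ_primitive CFa (dPs a)) (circ_primitive CF dP).
have dD (x : R) : is_derive x 1 (fun y => P (2 * pi + y) - P y) 0.
  have := is_deriveB (dPs (2 * pi) x) (dP x); rewrite (addrC _ x) pF subrr; exact.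
have E : P (2 * pi + 0) - P 0 = P (2 * pi + a) - P a.
  have [a0|/ltW a0] := leP 0 a; first exact: (is_derive_cst_seg dD).
  by apply/esym; exact: (is_derive_cst_seg dD).
by rewrite !addr0 (addrC a) -E !addr0.
Qed.

(** A primitive of a periodic function increases over a period by its mean, hence
    is periodic when the mean vanishes. *)
Lemma mean_zero_primitive F C : Cinf F -> periodic2pi F -> circ F = 0 -> (forall th, `|F th| <= C) ->
  exists2 K, Cinf K /\ periodic2pi K & (forall th : R, is_derive th 1 K (F th)) /\
    forall th, 0 <= th <= 2 * pi -> `|K th| <= 2 * pi * C.
Proof.
move=> CF pF F0 FC; have [P CP dP] := Cinf_primitive CF.
have C0 : 0 <= C by apply: le_trans (FC 0).
have dsh (c x : R) : is_derive x 1 (fun y => P y + c) (F x).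
  by have := is_deriveD (dP x) (is_derive_cst c x 1); rewrite addr0.
exists (fun x => P x + (- P 0)); split.
- by apply: CinfD => //; exact: Cinf_cst.
- move=> th; congr (_ + _).
  have dPs (x : R) : is_derive x 1 (fun y => P (y + th)) (F (x + th)).
    have := @is_derive1_comp _ P (fun y : R => y + th) x _ _ (dP _) _.
    move=> /(_ 1); rewrite mulr1; apply.
    by have := is_deriveD (is_derive_id x (1 : R)) (is_derive_cst (th : R) x 1); rewrite addr0.
  have CFa : Cinf (fun x => F (x + th)).
    have := Cinf_comp CF (Cinf_affine 1 th).
    by congr Cinf; apply/funext => x /=; congr F; ring.
  have := circ_primitive CFa dPs; rewrite add0r (addrC th).
  have -> : circ (fun x => F (x + th)) = 0.
    by rewrite -F0 -(circ_shift th CF pF); apply: eq_circ => x; rewrite addrC.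
  lra.
- by move=> th; exact: dsh.
- move=> th /andP[th0 th1].
  have d1 (x : R) : is_derive x 1 (fun y => C * y - P y) (C - F x).
    apply: (is_derive_eq (is_deriveB (is_deriveZ C (is_derive_id x (1 : R))) (dP x))).
    by rewrite /GRing.scale /= mulr1.
  have d2 (x : R) : is_derive x 1 (fun y => C * y + P y) (C + F x).
    apply: (is_derive_eq (is_deriveD (is_deriveZ C (is_derive_id x (1 : R))) (dP x))).
    by rewrite /GRing.scale /= mulr1.
  have FC' x : - C <= F x <= C by rewrite -ler_norml.
  have h1 := @is_derive_mono _ _ _ 0 th d1 (fun x _ => ltac:(have := FC' x; lra)) th0.
  have h2 := @is_derive_mono _ _ _ 0 th d2 (fun x _ => ltac:(have := FC' x; lra)) th0.
  have h3 : C * th <= 2 * pi * C by rewrite mulrC ler_wpM2r.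
  rewrite ler_norml; move: h1 h2; rewrite mulr0; lra.
Qed.

End circle_integral.

(** * Trigonometric fields and the inequality of Korn on the cell *)

Section finite_smooth.
Variable R : realType.

Lemma Cinf_sum (I : Type) (r : seq I) (F : I -> R -> R) : (forall i, Cinf (F i)) ->
  Cinf (fun x => \sum_(i <- r) F i x).
Proof.
move=> CF; elim: r => [|i r IH].
  have := @Cinf_cst R 0; congr Cinf; apply/funext => x; rewrite big_nil//.
have := CinfD (CF i) IH; congr Cinf; apply/funext => x; rewrite big_cons//.
Qed.

Lemma Cinf_prod (I : Type) (r : seq I) (F : I -> R -> R) : (forall i, Cinf (F i)) ->
  Cinf (fun x => \prod_(i <- r) F i x).
Proof.
move=> CF; elim: r => [|i r IH].
  have := @Cinf_cst R 1; congr Cinf; apply/funext => x; rewrite big_nil//.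
have := CinfM (CF i) IH; congr Cinf; apply/funext => x; rewrite big_cons//.
Qed.

Lemma Cinf_det n (A : R -> 'M[R]_n) : (forall i j, Cinf (fun x => A x i j)) ->
  Cinf (fun x => \det (A x)).
Proof.
move=> CA; apply: Cinf_sum => s; apply: CinfM; first exact: Cinf_cst.
by apply: Cinf_prod => i; exact: CA.
Qed.

Lemma Cinf_adj n (A : R -> 'M[R]_n) i j : (forall i j, Cinf (fun x => A x i j)) ->
  Cinf (fun x => (\adj (A x)) i j).
Proof.
move=> CA; have : Cinf (fun x => cofactor (A x) j i).
  apply: CinfM; first exact: Cinf_cst.
  apply: (@Cinf_det _ (fun x => row' j (col' i (A x)))) => k l.
  have := CA (lift j k) (lift i l); congr Cinf; apply/funext => x; rewrite !mxE//.
by congr Cinf; apply/funext => x; rewrite mxE.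
Qed.

Lemma cos_Cinf_sin_Cinf : Cinf (@cos R) /\ Cinf (@sin R).
Proof.
pose S (f : R -> R) := exists a b : R, f = fun x => a * cos x + b * sin x.
have st : derive_stable S.
  move=> _ [a [b ->]]; exists (fun x => b * cos x + (- a) * sin x); first by exists b, (- a).
  move=> x; apply: (is_derive_eq (is_deriveD (is_deriveZ a (is_derive_cos x)) (is_deriveZ b (is_derive_sin x)))).
  by rewrite /GRing.scale /=; ring.
split; exists S => //.
  by exists 1, 0; apply/funext => x; ring.
by exists 0, 1; apply/funext => x; ring.
Qed.

Lemma periodic_trig th : (cos (th + 2 * pi) = cos th :> R) * (sin (th + 2 * pi) = sin th :> R).
Proof. by split; rewrite mulr_natl ?cosD2pi ?sinD2pi. Qed.

End finite_smooth.

Section cell.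
Variable R : realType.
Local Notation M := 'M[R]_3.
Local Notation V := 'cV[R]_3.
Implicit Types (A B : M) (v w : V).

Lemma frameE (th : R) : [/\ e_theta th 0 0 = - sin th, e_theta th 1 0 = cos th & e_theta th 2 0 = 0] /\
  [/\ e_r th 0 0 = cos th, e_r th 1 0 = sin th & e_r th 2 0 = 0].
Proof. by split; exact: vec3E. Qed.

Definition dotv (v w : V) : R := v 0 0 * w 0 0 + v 1 0 * w 1 0 + v 2 0 * w 2 0.

Lemma frame_decomposition A th : A = otimes (A *m e_theta th) (e_theta th) +
  otimes (A *m e_r th) (e_r th) + otimes (A *m e3 R) (e3 R).
Proof.
have cs := cos2Dsin2 th; have [[t0 t1 t2] [r0 r1 r2]] := frameE th.
have [] := vec3E (0 : R) 0 1; rewrite -/(e3 R); move: (e3 R) => Z z0 z1 z2.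
move: (e_theta th) (e_r th) t0 t1 t2 r0 r1 r2 => T P t0 t1 t2 r0 r1 r2.
apply/matrixP => i j; rewrite !mxE !sum3 ?t0 ?t1 ?t2 ?r0 ?r1 ?r2 ?z0 ?z1 ?z2.
case: (ord3P j) => ->; rewrite ?t0 ?t1 ?t2 ?r0 ?r1 ?r2 ?z0 ?z1 ?z2.
- by rewrite -[LHS]mulr1 -cs; ring.
- by rewrite -[LHS]mulr1 -cs; ring.
- by ring.
Qed.

Lemma nrm2_cell v w th : nrm2 (otimes v (e_theta th) + otimes w (e_r th)) = dotv v v + dotv w w.
Proof.
have cs := cos2Dsin2 th; have [[t0 t1 t2] [r0 r1 r2]] := frameE th.
move: (e_theta th) (e_r th) t0 t1 t2 r0 r1 r2 => T P t0 t1 t2 r0 r1 r2.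
rewrite /nrm2 /mdot !sum3 !mxE ?t0 ?t1 ?t2 ?r0 ?r1 ?r2 /dotv -[RHS]mulr1 -cs; ring.
Qed.

(** Pointwise form of Korn's inequality on the cell; the last term has mean zero. *)
Lemma korn_cell v w th : let A := otimes v (e_theta th) + otimes w (e_r th) in
  dotv v v + 2^-1 * dotv w w + 2 * ((w 0 0 ^+ 2 - w 1 0 ^+ 2) * (cos th ^+ 2 - sin th ^+ 2)
    + 4 * (w 0 0 * w 1 0) * (cos th * sin th)) <= 3 / 2 * nrm2 (A + A^T).
Proof.
have cs := cos2Dsin2 th; have [[t0 t1 t2] [r0 r1 r2]] := frameE th.
rewrite /=; move: (e_theta th) (e_r th) t0 t1 t2 r0 r1 r2 => T P t0 t1 t2 r0 r1 r2.
rewrite /nrm2 /mdot !sum3 !mxE ?t0 ?t1 ?t2 ?r0 ?r1 ?r2 /dotv.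
move: cs; set c := cos th; set s := sin th => cs.
set a0 := v 0 0; set a1 := v 1 0; set a2 := v 2 0.
set b0 := w 0 0; set b1 := w 1 0; set b2 := w 2 0.
pose gr := b0 * c + b1 * s; pose gt := - b0 * s + b1 * c.
pose fr := a0 * c + a1 * s; pose ft := - a0 * s + a1 * c.
have E1 : a0 * a0 + a1 * a1 + a2 * a2 = fr ^+ 2 + ft ^+ 2 + a2 ^+ 2.
  by rewrite -[a0 * a0 + _]mulr1 -cs /fr /ft; ring.
have E2 : b0 * b0 + b1 * b1 + b2 * b2 = gr ^+ 2 + gt ^+ 2 + b2 ^+ 2.
  by rewrite -[b0 * b0 + _]mulr1 -cs /gr /gt; ring.
have E3 : 4 * (gr ^+ 2 + ft ^+ 2) + 2 * (fr + gt) ^+ 2 + 2 * ((b2 ^+ 2 + a2 ^+ 2) * (c ^+ 2 + s ^+ 2)) =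
  4 * (gr ^+ 2 + ft ^+ 2) + 2 * (fr + gt) ^+ 2 + 2 * (b2 ^+ 2 + a2 ^+ 2) by rewrite cs mulr1.
have E4 : (b0 ^+ 2 - b1 ^+ 2) * (c ^+ 2 - s ^+ 2) + 4 * (b0 * b1) * (c * s) = gr ^+ 2 - gt ^+ 2.
  by rewrite /gr /gt; ring.
rewrite E1 E2 E4.
have -> : forall X, X = 4 * (gr ^+ 2 + ft ^+ 2) + 2 * (fr + gt) ^+ 2 + 2 * ((b2 ^+ 2 + a2 ^+ 2) * (c ^+ 2 + s ^+ 2)) ->
    fr ^+ 2 + ft ^+ 2 + a2 ^+ 2 + 2^-1 * (gr ^+ 2 + gt ^+ 2 + b2 ^+ 2) + 2 * (gr ^+ 2 - gt ^+ 2) <= 3 / 2 * X.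
- move=> X ->; rewrite E3.
  have := sqr_ge0 gr; have := sqr_ge0 ft; have := sqr_ge0 b2; have := sqr_ge0 a2.
  by have := sqr_ge0 (fr + 3 / 2 * gt); lra.
- by [].
by rewrite /gr /gt /fr /ft; ring.
Qed.

End cell.

(** * The cell problem *)

Section cell_problem.
Variable R : realType.
Local Notation M := 'M[R]_3.
Local Notation V := 'cV[R]_3.
Variables (c0 K : R) (be : M -> M -> R).
Hypothesis c00 : 0 < c0.
Hypothesis K0 : 0 < K.
Hypothesis beD : forall A B C, be (A + B) C = be A C + be B C.
Hypothesis beZ : forall a A C, be (a *: A) C = a * be A C.
Hypothesis beC : forall A B, be A B = be B A.
Hypothesis be_low : forall A, c0 * nrm2 (A + A^T) <= be A A.
Hypothesis be_up : forall A, be A A <= K * nrm2 A.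

Lemma be_ge0 A : 0 <= be A A.
Proof. by apply: le_trans (be_low A); rewrite mulr_ge0 ?nrm2_ge0// ltW. Qed.

Lemma be0l A : be 0 A = 0.
Proof. by rewrite -(scale0r 0) beZ mul0r. Qed.

Lemma beDr A B C : be A (B + C) = be A B + be A C.
Proof. by rewrite beC beD !(beC A). Qed.

Lemma beZr a A B : be A (a *: B) = a * be A B.
Proof. by rewrite beC beZ beC. Qed.

Lemma be_young a A B : 0 < a -> 2 * be A B <= a * be A A + a^-1 * be B B.
Proof.
move=> a0; have := be_ge0 (a *: A - B); rewrite -scaleN1r !(beD, beDr, beZ, beZr) (beC B A) => h.
have E : a * (a * be A A + a^-1 * be B B) = a ^+ 2 * be A A + be B B by field; rewrite gt_eqF.
by rewrite -(ler_pM2l a0) E; lra.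
Qed.

Lemma be_sqr A B : be A B ^+ 2 <= be A A * be B B.
Proof.
have h a := be_ge0 (a *: A + B).
have {}h a : 0 <= a ^+ 2 * be A A + 2 * a * be A B + be B B.
  by have := h a; rewrite !(beD, beDr, beZ, beZr) (beC B A); lra.
have A0 := be_ge0 A; have [A00|An0] := eqVneq (be A A) 0.
  suff -> : be A B = 0 by rewrite expr0n /= A00 mul0r.
  have B0 := be_ge0 B; apply/eqP/negPn/negP => ab.
  have := h (- (be B B + 1) / (2 * be A B)); rewrite A00 mulr0 add0r.
  have -> : 2 * (- (be B B + 1) / (2 * be A B)) * be A B = - (be B B + 1) by field.
  lra.
have Ap : 0 < be A A by rewrite lt_def An0.
have := h (- be A B / be A A).
have -> : (- be A B / be A A) ^+ 2 * be A A + 2 * (- be A B / be A A) * be A B + be B B =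
  be B B - be A B ^+ 2 / be A A by field.
by rewrite subr_ge0 ler_pdivrMr// mulrC.
Qed.

Let dlt (i : 'I_3) : V := delta_mx i 0.

Lemma otimes_suml (v w : V) : otimes v w = \sum_i v i 0 *: otimes (dlt i) w.
Proof.
apply/matrixP => i j; rewrite summxE !sum3 !mxE eqxx.
by case: (ord3P i) => ->; rewrite /=; ring.
Qed.

Lemma be_sum n (F : 'I_n -> M) A : be (\sum_i F i) A = \sum_i be (F i) A.
Proof.
elim/big_ind2: _ => //; first exact: be0l.
by move=> ? ? ? ? <- <-; rewrite beD.
Qed.

Lemma be_otimesl v w A : be (otimes v w) A = \sum_i v i 0 * be (otimes (dlt i) w) A.
Proof. by rewrite otimes_suml be_sum; apply: eq_bigr => i _; rewrite beZ. Qed.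

Lemma be_otimesr v w A : be A (otimes v w) = \sum_i v i 0 * be A (otimes (dlt i) w).
Proof. by rewrite beC be_otimesl; apply: eq_bigr => i _; rewrite beC. Qed.

Lemma be_entries A' B' : be A' B' = \sum_i \sum_j A' i j * \sum_k \sum_l B' k l * be (delta_mx i j) (delta_mx k l).
Proof.
rewrite {1}(matrix_sum_delta A') be_sum; apply: eq_bigr => i _; rewrite be_sum.
apply: eq_bigr => j _; rewrite beZ; congr (_ * _).
rewrite beC {1}(matrix_sum_delta B') be_sum; apply: eq_bigr => k _; rewrite be_sum.
by apply: eq_bigr => l _; rewrite beZ beC.
Qed.

Lemma Cinf_be (A B : R -> M) : (forall i j, Cinf (fun x => A x i j)) ->
  (forall i j, Cinf (fun x => B x i j)) -> Cinf (fun x => be (A x) (B x)).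
Proof.
move=> CA CB.
have -> : (fun x => be (A x) (B x)) = fun x => \sum_i \sum_j A x i j * \sum_k \sum_l B x k l * be (delta_mx i j) (delta_mx k l).
  by apply/funext => x; rewrite be_entries.
do 2!(apply: Cinf_sum => ?); apply: CinfM => //; do 2!(apply: Cinf_sum => ?).
by apply: CinfM => //; exact: Cinf_cst.
Qed.

Let et := @e_theta R.
Let er := @e_r R.

Let et_per th : et (th + 2 * pi) = et th.
Proof. by rewrite /et /e_theta !periodic_trig. Qed.
Let er_per th : er (th + 2 * pi) = er th.
Proof. by rewrite /er /e_r !periodic_trig. Qed.

Let C_et i : Cinf (fun th => et th i 0).
Proof.
have [Cc Cs] := cos_Cinf_sin_Cinf R.
case: (ord3P i) => ->.
- by have := CinfN Cs; congr Cinf; apply/funext => th; have [[-> _ _] _] := frameE th.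
- by have := Cc; congr Cinf; apply/funext => th; have [[_ -> _] _] := frameE th.
- by have := @Cinf_cst R 0; congr Cinf; apply/funext => th; have [[_ _ ->] _] := frameE th.
Qed.

Let C_er i : Cinf (fun th => er th i 0).
Proof.
have [Cc Cs] := cos_Cinf_sin_Cinf R.
case: (ord3P i) => ->.
- by have := Cc; congr Cinf; apply/funext => th; have [_ [-> _ _]] := frameE th.
- by have := Cs; congr Cinf; apply/funext => th; have [_ [_ -> _]] := frameE th.
- by have := @Cinf_cst R 0; congr Cinf; apply/funext => th; have [_ [_ _ ->]] := frameE th.
Qed.

Let C_otimes (v w : R -> V) : (forall i, Cinf (fun x => v x i 0)) -> (forall i, Cinf (fun x => w x i 0)) ->
  forall i j, Cinf (fun x => otimes (v x) (w x) i j).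
Proof.
by move=> Cv Cw i j; have := CinfM (Cv i) (Cw j); congr Cinf; apply/funext => x; rewrite !mxE.
Qed.

Let acoustic th : M := \matrix_(i, j) be (otimes (dlt i) (et th)) (otimes (dlt j) (et th)).
Let coupling th i j := be (otimes (dlt i) (et th)) (otimes (dlt j) (er th)).

Let C_acoustic i j : Cinf (fun th => acoustic th i j).
Proof.
have : Cinf (fun th => be (otimes (dlt i) (et th)) (otimes (dlt j) (et th))).
  by apply: Cinf_be; apply: C_otimes => // ?; exact: Cinf_cst.
by congr Cinf; apply/funext => th; rewrite mxE.
Qed.

Let C_coupling i j : Cinf (fun th => coupling th i j).
Proof. by apply: Cinf_be; apply: C_otimes => // ?; exact: Cinf_cst. Qed.

Lemma be_otimes_low (v : V) th : 2 * c0 * dotv v v <= be (otimes v (et th)) (otimes v (et th)).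
Proof.
apply: le_trans (be_low _); rewrite (mulrC 2) -mulrA ler_pM2l//.
have cs := cos2Dsin2 th; have [[t0 t1 t2] _] := frameE th.
rewrite /et; move: (e_theta th) t0 t1 t2 => T t0 t1 t2.
have -> : dotv v v = dotv v v * (cos th ^+ 2 + sin th ^+ 2) by rewrite cs mulr1.
rewrite /nrm2 /mdot !sum3 !mxE t0 t1 t2 /dotv -subr_ge0.
have := sqr_ge0 (v 0 0 * - sin th + v 1 0 * cos th).
by move=> /(mulr_ge0 (ler0n R 2)); congr (0 <= _); ring.
Qed.

Let acousticE (v w : V) th : be (otimes v (et th)) (otimes w (et th)) = \sum_j (v^T *m acoustic th) 0 j * w j 0.
Proof.
rewrite be_otimesr; apply: eq_bigr => j _; rewrite mulrC; congr (_ * _).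
by rewrite be_otimesl mxE; apply: eq_bigr => i _; rewrite !mxE.
Qed.

Let det_acoustic th : \det (acoustic th) != 0.
Proof.
have : row_free (acoustic th).
  apply: inj_row_free => v v0; have := be_otimes_low v^T th.
  rewrite acousticE trmxK v0 big1 => [h|j _]; last by rewrite mxE mul0r.
  have : dotv v^T v^T <= 0 by rewrite -(pmulr_rle0 _ c00); lra.
  rewrite /dotv !mxE => h2; apply/matrixP => i j; rewrite (ord1 i) mxE.
  have := sqr_ge0 (v 0 0); have := sqr_ge0 (v 0 1); have := sqr_ge0 (v 0 2).
  move=> s2 s1 s0; have Z k : v 0 k ^+ 2 = 0 -> v 0 k = 0 by move/eqP; rewrite sqrf_eq0 => /eqP.
  by case: (ord3P j) => ->; apply: Z; lra.
by rewrite row_free_unit unitmxE unitfE.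
Qed.

Let acoustic_per th : acoustic (th + 2 * pi) = acoustic th.
Proof. by apply/matrixP => i j; rewrite !mxE et_per. Qed.

Let inv_acoustic : exists J : R -> M, [/\ forall i j, Cinf (fun th => J th i j),
  forall th, J (th + 2 * pi) = J th & forall th, J th *m acoustic th = 1%:M].
Proof.
pose d th := \det (acoustic th).
have Cd : Cinf d by exact: Cinf_det.
pose d2 th := d th * d th; have Cd2 : Cinf d2 by exact: CinfM.
have [x _ hx] := @EVT_min R d2 0 (2 * pi) (ltW (pi2_gt0 R)) (continuous_subspaceT (Cinf_continuous Cd2)).
have dx0 : 0 < d2 x by rewrite /d2 -expr2 lt_def sqr_ge0 sqrf_eq0 det_acoustic.
have dl th : d2 x <= d2 th.
  have [th' th'02 [cE sE]] := @unit_angle R (cos th) (sin th) (cos2Dsin2 th).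
  have -> : d2 th = d2 th'.
    have ee : et th = et th' by rewrite /et /e_theta cE sE.
    by rewrite /d2 /d /acoustic ee.
  by apply: hx; rewrite in_itv.
have [i Ci hi] := smooth_invsqrt dx0.
have Cv : Cinf (fun th => d th * (i (d2 th) * i (d2 th))).
  by apply: CinfM => //; apply: CinfM; exact: (Cinf_comp Ci Cd2).
have dV th : d th * (i (d2 th) * i (d2 th)) = (d th)^-1.
  rewrite hi ?dl// -expr2 exprVn sqr_sqrtr /d2 -?expr2 ?sqr_ge0// expr2 invfM mulrA divff ?mul1r//.
  exact: det_acoustic.
exists (fun th => (d th)^-1 *: \adj (acoustic th)); split.
- move=> k l; have := CinfM Cv (Cinf_adj k l C_acoustic); congr Cinf; apply/funext => th.
  by rewrite dV [RHS]mxE.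
- by move=> th; rewrite /d acoustic_per.
- by move=> th; rewrite -scalemxAl mul_adj_mx -mul_scalar_mx -scalar_mxM mulVf ?det_acoustic.
Qed.


Definition circ_mx (X : R -> M) : M := \matrix_(i, j) circ (fun th => X th i j).

Let Cinf_row_mx (l : 'rV[R]_3) (X : R -> M) j : (forall i j, Cinf (fun th => X th i j)) ->
  Cinf (fun th => (l *m X th) 0 j).
Proof.
move=> CX; have : Cinf (fun th => \sum_i l 0 i * X th i j).
  by apply: Cinf_sum => i; apply: CinfM => //; exact: Cinf_cst.
by congr Cinf; apply/funext => th; rewrite mxE.
Qed.

Let circ_row_mx (l : 'rV[R]_3) (X : R -> M) j : (forall i j, Cinf (fun th => X th i j)) ->
  circ (fun th => (l *m X th) 0 j) = (l *m circ_mx X) 0 j.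
Proof.
move=> CX; rewrite mxE.
rewrite (@eq_circ _ _ (fun th => \sum_i l 0 i * X th i j)); last by move=> th; rewrite mxE.
rewrite circ_sum; last by move=> i; apply: Cinf_cintegrable; apply: CinfM => //; exact: Cinf_cst.
by apply: eq_bigr => i _; rewrite circZ ?mxE//; exact: Cinf_cintegrable.
Qed.

Let C_mulmx (X Y : R -> M) : (forall i j, Cinf (fun th => X th i j)) ->
  (forall i j, Cinf (fun th => Y th i j)) -> forall i j, Cinf (fun th => (X th *m Y th) i j).
Proof.
move=> CX CY i j; have : Cinf (fun th => \sum_k X th i k * Y th k j).
  by apply: Cinf_sum => k; exact: CinfM.
by congr Cinf; apply/funext => th; rewrite mxE.
Qed.

(** The Euler-Lagrange equations are solved pointwise: the azimuthal acoustic matrix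
    is invertible, with a smooth inverse through the adjugate. *)
Lemma euler_lagrange : exists F1 F2 F3 F4 : R -> M,
  [/\ forall i j, [/\ Cinf (fun th => F1 th i j), Cinf (fun th => F2 th i j), Cinf (fun th => F3 th i j) & Cinf (fun th => F4 th i j)],
      forall th, [/\ F1 (th + 2 * pi) = F1 th, F2 (th + 2 * pi) = F2 th, F3 (th + 2 * pi) = F3 th & F4 (th + 2 * pi) = F4 th] &
      forall (l g : 'rV[R]_3) th j,
        let G := otimes (l *m F1 th + g *m F2 th)^T (et th) + otimes g^T (er th) in
        be G (otimes (dlt j) (et th)) = l 0 j /\
        be G (otimes (dlt j) (er th)) = (l *m F3 th + g *m F4 th) 0 j].
Proof.
have [J [CJ Jp JN]] := inv_acoustic.
pose Cp th : M := \matrix_(k, j) coupling th j k.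
pose S th : M := \matrix_(k, j) be (otimes (dlt k) (er th)) (otimes (dlt j) (er th)).
have Cpp th : Cp (th + 2 * pi) = Cp th by apply/matrixP => i j; rewrite !mxE /coupling et_per er_per.
have Sp th : S (th + 2 * pi) = S th by apply/matrixP => i j; rewrite !mxE er_per.
have CCp i j : Cinf (fun th => Cp th i j).
  by have := C_coupling j i; congr Cinf; apply/funext => th; rewrite mxE.
have CCpT i j : Cinf (fun th => (Cp th)^T i j).
  by have := C_coupling i j; congr Cinf; apply/funext => th; rewrite !mxE.
have CS i j : Cinf (fun th => S th i j).
  have : Cinf (fun th => be (otimes (dlt i) (er th)) (otimes (dlt j) (er th))).
    by apply: Cinf_be; apply: C_otimes => // ?; exact: Cinf_cst.
  by congr Cinf; apply/funext => th; rewrite mxE.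
have CN (X : R -> M) : (forall i j, Cinf (fun th => X th i j)) -> forall i j, Cinf (fun th => (- X th) i j).
  by move=> CX i j; have := CinfN (CX i j); congr Cinf; apply/funext => th; rewrite mxE.
exists J, (fun th => - (Cp th *m J th)), (fun th => J th *m (Cp th)^T),
  (fun th => S th - Cp th *m J th *m (Cp th)^T); split.
- move=> i j; split => //.
  + by apply: CN; exact: C_mulmx.
  + exact: C_mulmx.
  + have := CinfD (CS i j) (CN _ (C_mulmx (C_mulmx CCp CJ) CCpT) i j).
    by congr Cinf; apply/funext => th; rewrite [RHS]mxE.
- by move=> th; rewrite Jp Cpp Sp.
move=> l g th j; set f := (l *m _ + _); set G := (_ + _) => /=.
have fE : f = (l - g *m Cp th) *m J th.
  by rewrite /f mulmxN mulmxBl mulmxA.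
have gl A : be (otimes g^T (er th)) A = \sum_k g 0 k * be (otimes (dlt k) (er th)) A.
  by rewrite be_otimesl; apply: eq_bigr => k _; rewrite mxE.
have fl A : be (otimes f^T (et th)) A = \sum_k f 0 k * be (otimes (dlt k) (et th)) A.
  by rewrite be_otimesl; apply: eq_bigr => k _; rewrite mxE.
rewrite /G !beD; split.
- have -> : be (otimes f^T (et th)) (otimes (dlt j) (et th)) = (f *m acoustic th) 0 j.
    by rewrite fl mxE; apply: eq_bigr => k _; rewrite !mxE.
  have -> : be (otimes g^T (er th)) (otimes (dlt j) (et th)) = (g *m Cp th) 0 j.
    by rewrite gl mxE; apply: eq_bigr => k _; rewrite mxE /coupling beC.
  by rewrite fE -mulmxA JN mulmx1 !mxE subrK.
- have -> : be (otimes f^T (et th)) (otimes (dlt j) (er th)) = (f *m (Cp th)^T) 0 j.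
    by rewrite fl mxE; apply: eq_bigr => k _; rewrite !mxE.
  have -> : be (otimes g^T (er th)) (otimes (dlt j) (er th)) = (g *m S th) 0 j.
    by rewrite gl mxE; apply: eq_bigr => k _; rewrite mxE.
  rewrite fE mulmxBl mulmxBr !mulmxBl !mulmxA !mxE; ring.
Qed.

Lemma circ_korn (w : V) : circ (fun th => 2 * ((w 0 0 ^+ 2 - w 1 0 ^+ 2) * (cos th ^+ 2 - sin th ^+ 2)
    + 4 * (w 0 0 * w 1 0) * (cos th * sin th))) = 0.
Proof.
have [Cc Cs] := cos_Cinf_sin_Cinf R.
set u := w 0 0 ^+ 2 - _; set v := 4 * _.
have CF : Cinf (fun th => 2 * (u * (cos th ^+ 2 - sin th ^+ 2) + v * (cos th * sin th))).
  have := CinfD (CinfM (Cinf_cst (2 * u)) (CinfD (CinfM Cc Cc) (CinfN (CinfM Cs Cs)))) (CinfM (Cinf_cst (2 * v)) (CinfM Cc Cs)).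
  by congr Cinf; apply/funext => th; rewrite !expr2; ring.
have dP (x : R) : is_derive x 1 (fun th => 2 * (u * (sin th * cos th) + v * (2^-1 * (sin th * sin th))))
    (2 * (u * (cos x ^+ 2 - sin x ^+ 2) + v * (cos x * sin x))).
  have ds := is_derive_sin x; have dc := is_derive_cos x.
  apply: (is_derive_eq (is_deriveZ 2 (is_deriveD (is_deriveZ u (is_deriveM ds dc))
    (is_deriveZ v (is_deriveZ 2^-1 (is_deriveM ds ds)))))).
  by rewrite /GRing.scale /= ; field.
rewrite (circ_primitive CF dP).
by have [] := periodic_trig (0 : R); rewrite add0r sin0 => _ ->; ring.
Qed.

Let sqr_sum0 (v : V) : dotv v v = 0 -> v = 0.
Proof.
rewrite /dotv => h; apply/matrixP => i j; rewrite (ord1 j) mxE.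
have := sqr_ge0 (v 0 0); have := sqr_ge0 (v 1 0); have := sqr_ge0 (v 2 0) => s2 s1 s0.
have Z k : v k 0 ^+ 2 = 0 -> v k 0 = 0 by move/eqP; rewrite sqrf_eq0 => /eqP.
by case: (ord3P i) => ->; apply: Z; lra.
Qed.

Lemma dotv_ge0 (v : V) : 0 <= dotv v v.
Proof. by rewrite /dotv !addr_ge0// -expr2 sqr_ge0. Qed.

Lemma dotv_young (v w : V) a : 0 < a -> 2 * dotv v w <= a * dotv v v + a^-1 * dotv w w.
Proof.
move=> a0; have y (x z : R) : 2 * (x * z) <= a * (x * x) + a^-1 * (z * z).
  have := sqr_ge0 (a * x - z) => h.
  have E : a * (a * (x * x) + a^-1 * (z * z)) = a ^+ 2 * x ^+ 2 + z ^+ 2 by field; rewrite gt_eqF.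
  by rewrite -(ler_pM2l a0) E; lra.
have := y (v 0 0) (w 0 0); have := y (v 1 0) (w 1 0); have := y (v 2 0) (w 2 0).
rewrite /dotv; lra.
Qed.

(** For given (l, g) the Euler-Lagrange equation determines f pointwise, because the
    acoustic matrix of the azimuthal direction is invertible. The mean of f and
    the mean of the radial traction are then linear in (l, g), and this linear map
    is injective: a pair in its kernel has zero energy, hence vanishes by Korn.
    So (b, 0) has a preimage. *)
Lemma cell_solution (b : V) : exists (f m : R -> V) (l g : V),
  [/\ forall i, Cinf (fun th => f th i 0) /\ Cinf (fun th => m th i 0),
      forall th, f (th + 2 * pi) = f th /\ m (th + 2 * pi) = m th,
      (forall i, circ (fun th => f th i 0) = b i 0) /\ (forall i, circ (fun th => m th i 0) = 0),
      forall th i, let G := otimes (f th) (et th) + otimes g (er th) in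
        be G (otimes (dlt i) (et th)) = l i 0 /\ be G (otimes (dlt i) (er th)) = m th i 0 &
      circ (fun th => be (otimes (f th) (et th) + otimes g (er th)) (otimes (f th) (et th) + otimes g (er th))) = dotv l b /\
      [/\ dotv l l <= K ^+ 2 * dotv b b, dotv l b <= K * dotv b b &
        forall th, dotv (f th) (f th) + dotv g g <= (2 * K ^+ 2 / c0 ^+ 2 + K / c0) * dotv b b]].
Proof.
have [F1 [F2 [F3 [F4 [CF pF EL]]]]] := euler_lagrange.
have CF1 i j : Cinf (fun th => F1 th i j) by have [] := CF i j.
have CF2 i j : Cinf (fun th => F2 th i j) by have [] := CF i j.
have CF3 i j : Cinf (fun th => F3 th i j) by have [] := CF i j.
have CF4 i j : Cinf (fun th => F4 th i j) by have [] := CF i j.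
pose fr (l g : 'rV[R]_3) th := l *m F1 th + g *m F2 th.
pose mr (l g : 'rV[R]_3) th := l *m F3 th + g *m F4 th.
pose G l g th := otimes (fr l g th)^T (et th) + otimes g^T (er th).
have Cfr l g j : Cinf (fun th => fr l g th 0 j).
  have := CinfD (Cinf_row_mx l j CF1) (Cinf_row_mx g j CF2).
  by congr Cinf; apply/funext => th; rewrite [RHS]mxE.
have Cmr l g j : Cinf (fun th => mr l g th 0 j).
  have := CinfD (Cinf_row_mx l j CF3) (Cinf_row_mx g j CF4).
  by congr Cinf; apply/funext => th; rewrite [RHS]mxE.
have cfr l g j : circ (fun th => fr l g th 0 j) = (l *m circ_mx F1 + g *m circ_mx F2) 0 j.
  rewrite [RHS]mxE -!circ_row_mx// -circD; try exact/Cinf_cintegrable/Cinf_row_mx.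
  by apply: eq_circ => th; rewrite [LHS]mxE.
have cmr l g j : circ (fun th => mr l g th 0 j) = (l *m circ_mx F3 + g *m circ_mx F4) 0 j.
  rewrite [RHS]mxE -!circ_row_mx// -circD; try exact/Cinf_cintegrable/Cinf_row_mx.
  by apply: eq_circ => th; rewrite [LHS]mxE.
have GG l g th : be (G l g th) (G l g th) = \sum_j fr l g th 0 j * l 0 j + \sum_j mr l g th 0 j * g 0 j.
  rewrite {2}/G beDr !be_otimesr; congr (_ + _); apply: eq_bigr => j _.
    by have [-> _] := EL l g th j; rewrite mxE.
  by have [_ ->] := EL l g th j; rewrite mxE mulrC.
have cGG l g : circ (fun th => be (G l g th) (G l g th)) =
    \sum_j (l *m circ_mx F1 + g *m circ_mx F2) 0 j * l 0 j + \sum_j (l *m circ_mx F3 + g *m circ_mx F4) 0 j * g 0 j.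
  rewrite (eq_circ (GG l g)) circD; first last.
  - apply: Cinf_cintegrable; apply: Cinf_sum => j; apply: CinfM => //; exact: Cinf_cst.
  - apply: Cinf_cintegrable; apply: Cinf_sum => j; apply: CinfM => //; exact: Cinf_cst.
  have cs (F : 'I_3 -> R -> R) (c : 'rV[R]_3) : (forall j, Cinf (F j)) ->
      circ (fun th => \sum_j F j th * c 0 j) = \sum_j circ (F j) * c 0 j.
    move=> CF'; rewrite circ_sum; last by move=> j; apply/Cinf_cintegrable/CinfM => //; exact: Cinf_cst.
    apply: eq_bigr => j _; rewrite mulrC -circZ; last exact: Cinf_cintegrable.
    by apply: eq_circ => th; rewrite mulrC.
  rewrite (cs (fun j th => fr l g th 0 j))// (cs (fun j th => mr l g th 0 j))//.
  by congr (_ + _); apply: eq_bigr => j _; rewrite ?cfr ?cmr.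
have CG l g : Cinf (fun th => be (G l g th) (G l g th)).
  have CGij i j : Cinf (fun th => G l g th i j).
    have Cft k : Cinf (fun th => (fr l g th)^T k 0).
      by have := Cfr l g k; congr Cinf; apply/funext => th; rewrite [RHS]mxE.
    have h2 := @C_otimes (fun=> g^T) er (fun i => Cinf_cst _) C_er i j.
    have := CinfD (@C_otimes (fun th => (fr l g th)^T) et Cft C_et i j) h2.
    by congr Cinf; apply/funext => th; rewrite [RHS]mxE.
  exact: Cinf_be.
have CD l g : Cinf (fun th => dotv (fr l g th)^T (fr l g th)^T).
  have := CinfD (CinfD (CinfM (Cfr l g 0) (Cfr l g 0)) (CinfM (Cfr l g 1) (Cfr l g 1))) (CinfM (Cfr l g 2) (Cfr l g 2)).
  by congr Cinf; apply/funext => th; rewrite /dotv !mxE.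
have [Cc Cs] := cos_Cinf_sin_Cinf R.
have low l g : c0 * (2 / 3) * (circ (fun th => dotv (fr l g th)^T (fr l g th)^T) + pi * dotv g^T g^T) <=
    circ (fun th => be (G l g th) (G l g th)).
  pose w : V := g^T.
  pose osc th := 2 * ((w 0 0 ^+ 2 - w 1 0 ^+ 2) * (cos th ^+ 2 - sin th ^+ 2)
    + 4 * (w 0 0 * w 1 0) * (cos th * sin th)).
  have Cosc : Cinf osc.
    have := CinfM (Cinf_cst 2) (CinfD (CinfM (Cinf_cst (w 0 0 ^+ 2 - w 1 0 ^+ 2)) (CinfD (CinfM Cc Cc) (CinfN (CinfM Cs Cs))))
      (CinfM (Cinf_cst (4 * (w 0 0 * w 1 0))) (CinfM Cc Cs))).
    by congr Cinf; apply/funext => th; rewrite /osc !expr2.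
  have Cin := CinfD (CD l g) (CinfD (Cinf_cst (2^-1 * dotv w w)) Cosc).
  have <- : circ (fun th => c0 * (2 / 3) * (dotv (fr l g th)^T (fr l g th)^T + (2^-1 * dotv w w + osc th))) =
      c0 * (2 / 3) * (circ (fun th => dotv (fr l g th)^T (fr l g th)^T) + pi * dotv w w).
    rewrite circZ; last exact: Cinf_cintegrable.
    rewrite circD; [|exact: Cinf_cintegrable|exact: (Cinf_cintegrable (CinfD (Cinf_cst (2^-1 * dotv w w)) Cosc))].
    rewrite (@circD _ (fun=> 2^-1 * dotv w w) osc); [|exact: (Cinf_cintegrable (Cinf_cst (2^-1 * dotv w w)))|exact: Cinf_cintegrable].
    rewrite circ_cst (circ_korn w) addr0; congr (_ * (_ + _)); by field.
  apply: (circ_le (Cinf_cintegrable (CinfM (Cinf_cst (c0 * (2 / 3))) Cin)) (Cinf_cintegrable (CG l g))) => th _.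
  apply: le_trans (be_low _); rewrite -mulrA ler_pM2l//.
  have := korn_cell (fr l g th)^T w th; rewrite /= -/(osc th) -/et -/er -/(G l g th); lra.
pose BM : 'M[R]_(3 + 3) := block_mx (circ_mx F1) (circ_mx F3) (circ_mx F2) (circ_mx F4).
have BMu : BM \in unitmx.
  rewrite -row_free_unit; apply: inj_row_free => v; rewrite -(hsubmxK v).
  set l := lsubmx v; set g := rsubmx v.
  rewrite mul_row_block -[0](@hsubmxK _ 1 3 3) => /eq_row_mx[]; rewrite !linear0 => h1 h2.
  have := low l g; rewrite cGG h1 h2 !big1 ?addr0; [|by move=> j _; rewrite mxE mul0r..].
  have c23 : 0 < c0 * (2 / 3) by rewrite mulr_gt0.
  rewrite -[X in _ <= X](mulr0 (c0 * (2 / 3))) ler_pM2l// => h.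
  have f0 : 0 <= circ (fun th => dotv (fr l g th)^T (fr l g th)^T) by apply: circ_ge0 => th; exact: dotv_ge0.
  have pg : 0 <= pi * dotv g^T g^T by rewrite mulr_ge0 ?pi_ge0 ?dotv_ge0.
  have g0 : g^T = 0.
    apply: sqr_sum0; have : pi * dotv g^T g^T = 0 by lra.
    by move/eqP; rewrite mulf_eq0 gt_eqF ?pi_gt0//= => /eqP.
  have fz : (fr l g 0)^T = 0.
    apply: sqr_sum0; apply: (circ_eq0 (CD l g)); [by move=> th; exact: dotv_ge0|lra|].
    by rewrite lexx ltW ?pi2_gt0.
  have G0 : G l g 0 = 0.
    by rewrite /G fz g0; apply/matrixP => i j; rewrite !mxE !mul0r addr0.
  have -> : l = 0.
    apply/matrixP => i j; rewrite (ord1 i) [RHS]mxE.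
    by have [<- _] := EL l g 0 j; rewrite -/(G l g 0) G0 be0l.
  by rewrite -(trmxK g) g0 trmx0 row_mx0.
pose v := row_mx b^T 0 *m invmx BM.
pose l := lsubmx v; pose g := rsubmx v.
have [e1 e2] : l *m circ_mx F1 + g *m circ_mx F2 = b^T /\ l *m circ_mx F3 + g *m circ_mx F4 = 0.
  have : v *m BM = row_mx b^T 0 by rewrite /v mulmxKV.
  by rewrite -(hsubmxK v) mul_row_block => /eq_row_mx[].
have E : circ (fun th => be (G l g th) (G l g th)) = dotv l^T b.
  rewrite cGG e1 e2 [X in _ + X]big1 ?addr0; last by move=> j _; rewrite mxE mul0r.
  by rewrite sum3 /dotv !mxE; ring.
have tE (u : 'rV[R]_3) k : u^T k 0 = u 0 k by rewrite mxE.
exists (fun th => (fr l g th)^T), (fun th => (mr l g th)^T), l^T, g^T; split.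
- move=> i; split; [have := Cfr l g i|have := Cmr l g i]; by congr Cinf; apply/funext => th; rewrite [RHS]mxE.
- by move=> th; rewrite /fr /mr; have [-> -> -> ->] := pF th.
- split=> i.
  + transitivity (circ (fun th => fr l g th 0 i)); first by apply: eq_circ => th; rewrite [LHS]mxE.
    by rewrite cfr e1 mxE.
  + transitivity (circ (fun th => mr l g th 0 i)); first by apply: eq_circ => th; rewrite [LHS]mxE.
    by rewrite cmr e2 mxE.
- move=> th i; have [h1 h2] := EL l g th i; rewrite -(tE l) in h1; rewrite -/(mr l g th) -(tE (mr l g th)) in h2; by split.
split; first exact: E.
pose L := dotv l^T l^T; pose B := dotv b b.
have B0 : 0 <= B by exact: dotv_ge0.
have pi2 : 2 <= pi :> R by have := pihalf_ge1 R; lra.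
have lG i : 2 * pi * (l^T i 0 * l^T i 0) <= K * dotv l^T b.
  rewrite -E -circ_cst -circZ; last exact: Cinf_cintegrable.
  apply: circ_le => [||th _]; [exact/Cinf_cintegrable/Cinf_cst|exact: (Cinf_cintegrable (CinfM (Cinf_cst K) (CG l g)))|].
  have [h _] := EL l g th i; have := be_sqr (G l g th) (otimes (dlt i) (et th)).
  rewrite h tE -expr2 mulrC => /le_trans; apply; rewrite ler_wpM2r ?be_ge0//.
  apply: le_trans (be_up _) _; rewrite -[leRHS]mulr1 ler_pM2l//.
  have := nrm2_cell (dlt i) 0 th; have -> : otimes 0 (e_r th) = 0 :> M by apply/matrixP => i' j'; rewrite !mxE mul0r.
  rewrite addr0 -/et => ->; rewrite /dotv !mxE; case: (ord3P i) => -> /=; lra.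
have lsum : 2 * pi * L <= 3 * K * dotv l^T b.
  by have := lG 0; have := lG 1; have := lG 2; rewrite /L /dotv; lra.
have lb : 3 * K * (2 * dotv l^T b) <= pi * L + 9 * K ^+ 2 / 4 * 2 * B.
  have a0 : 0 < pi / (3 * K) by rewrite divr_gt0 ?pi_gt0// mulr_gt0.
  have := dotv_young l^T b a0; rewrite -/L -/B -(ler_pM2l (mulr_gt0 (ltr0n R 3) K0)) => /le_trans; apply.
  have -> : 3 * K * (pi / (3 * K) * L + (pi / (3 * K))^-1 * B) = pi * L + 9 * K ^+ 2 / pi * B.
    have pi0 : pi != 0 :> R by rewrite gt_eqF ?pi_gt0.
    have Kn0 : K != 0 by rewrite gt_eqF.
    rewrite invf_div mulrDr !mulrA [3 * K * pi / _]mulrAC divff ?mul1r; last by rewrite mulf_neq0.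
    by congr (_ + _); ring.
  rewrite lerD2l ler_wpM2r//.
  have K2 : 0 < K ^+ 2 by rewrite exprn_gt0.
  rewrite ler_pdivrMr ?pi_gt0//; have := ler_wpM2l (ltW K2) pi2; lra.
have L0 : 0 <= L by exact: dotv_ge0.
have LB : L <= K ^+ 2 * B.
  have pL : 2 * L <= pi * L by rewrite ler_wpM2r.
  have : 3 * pi * L <= 9 * K ^+ 2 / 4 * 2 * B by lra.
  have K2 : 0 <= K ^+ 2 * B by rewrite mulr_ge0 ?sqr_ge0.
  lra.
have lbB : dotv l^T b <= K * B.
  have KV : 0 < K^-1 by rewrite invr_gt0.
  have := dotv_young l^T b KV; rewrite invrK -/L -/B.
  have : K^-1 * L <= K * B by rewrite ler_pdivrMl// mulrA -expr2.
  lra.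
split=> // th.
pose g2 := dotv g^T g^T; have g20 : 0 <= g2 by exact: dotv_ge0.
have gB : g2 <= K / c0 * B.
  have := low l g; rewrite E -/g2 => h.
  have f0 : 0 <= circ (fun th => dotv (fr l g th)^T (fr l g th)^T) by apply: circ_ge0 => th'; exact: dotv_ge0.
  have pg : 2 * g2 <= pi * g2 by rewrite ler_wpM2r.
  have : c0 * (2 / 3) * (2 * g2) <= K * B.
    by apply: le_trans lbB; apply: le_trans h; rewrite ler_wpM2l ?mulr_ge0 ?(ltW c00)//; lra.
  have c0g : 0 <= c0 * g2 by exact: mulr_ge0 (ltW c00) g20.
  by move=> h2; rewrite mulrAC ler_pdivlMr// mulrC; lra.
pose f := (fr l g th)^T; pose f2 := dotv f f; pose X := be (otimes f (et th)) (otimes f (et th)).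
have f20 : 0 <= f2 by exact: dotv_ge0.
have X1 : 2 * c0 * f2 <= X by exact: be_otimes_low.
have X2 : X = dotv l^T f - be (otimes g^T (er th)) (otimes f (et th)).
  have -> : dotv l^T f = be (G l g th) (otimes f (et th)).
    rewrite be_otimesr sum3 /dotv; by rewrite ![be _ (otimes (dlt _) (et th))](EL l g th _).1 !tE; ring.
  by rewrite /G beD addrK.
have X3 := be_young (- otimes g^T (er th)) (otimes f (et th)) ltr01.
rewrite -scaleN1r !(beZ, beZr) invr1 -/X in X3.
have X4 : be (otimes g^T (er th)) (otimes g^T (er th)) <= K * g2.
  apply: le_trans (be_up _) _; rewrite ler_pM2l//.
  have := nrm2_cell 0 g^T th; have -> : otimes 0 (e_theta th) = 0 :> M by apply/matrixP => i' j'; rewrite !mxE mul0r.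
  have d0 : dotv 0 0 = 0 :> R by rewrite /dotv !mxE !mul0r !addr0.
  by rewrite add0r -/er => ->; rewrite d0 add0r.
have cV : 0 < c0^-1 by rewrite invr_gt0.
have X5 := dotv_young l^T f cV; rewrite invrK -/L -/f2 in X5.
have X6 : c0 * f2 <= c0^-1 * L + K * g2 by lra.
have X7 : f2 <= (c0^-1 * (K ^+ 2 * B) + K * (K / c0 * B)) / c0.
  rewrite ler_pdivlMr// mulrC; apply: (le_trans X6).
  by apply: lerD; [exact: (ler_wpM2l (ltW cV) LB)|exact: (ler_wpM2l (ltW K0) gB)].
rewrite -/f -/f2 -/g2 -/B.
have -> : (2 * K ^+ 2 / c0 ^+ 2 + K / c0) * B = (c0^-1 * (K ^+ 2 * B) + K * (K / c0 * B)) / c0 + K / c0 * B.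
  by field; rewrite gt_eqF.
exact: lerD.
Qed.

End cell_problem.

(** * Bounds on the line tension *)

Section rotated.
Variable R : realType.
Local Notation M := 'M[R]_3.
Local Notation V3 := 'cV[R]_3.
Implicit Types (Q : M) (v w b : V3).

Lemma otimesE v w : otimes v w = v *m w^T.
Proof. by apply/matrixP => i j; rewrite !mxE big_ord1 mxE. Qed.

Lemma dotvE v w : dotv v w = (v^T *m w) 0 0.
Proof. by rewrite mxE sum3 /dotv !mxE. Qed.

Lemma dotv_rot Q v w : dotv (Q *m v) w = dotv v (Q^T *m w).
Proof. by rewrite !dotvE trmx_mul mulmxA. Qed.

Lemma dotv_iso Q v w : SO3 Q -> dotv (Q *m v) (Q *m w) = dotv v w.
Proof. by move=> QSO; rewrite dotv_rot mulmxA (SO3_trmul QSO) mul1mx. Qed.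

Lemma sqr_enorm_dotv v : enorm v ^+ 2 = dotv v v.
Proof.
rewrite /enorm sqr_sqrtr; last by apply: sumr_ge0 => i _; apply: sumr_ge0 => j _; rewrite -expr2 sqr_ge0.
by rewrite /mdot sum3 !big_ord1.
Qed.

Lemma otimes_rot Q v w : otimes (Q *m v) (Q *m w) = Q *m otimes v w *m Q^T.
Proof. by rewrite !otimesE trmx_mul !mulmxA. Qed.

Lemma nrm2_rot Q A : SO3 Q -> nrm2 (Q *m A *m Q^T) = nrm2 A.
Proof. by move=> QSO; rewrite /nrm2 mdot_rotr ?mdot_rotl//; exact: SO3_trmx. Qed.

Lemma sym_rot Q (A : M) : Q *m A *m Q^T + (Q *m A *m Q^T)^T = Q *m (A + A^T) *m Q^T.
Proof. by rewrite !trmx_mul trmxK mulmxDr mulmxDl !mulmxA. Qed.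

End rotated.


Section psi_bounds.
Variable R : realType.
Local Notation M := 'M[R]_3.
Local Notation V3 := 'cV[R]_3.
Variable V : M -> R.
Hypothesis V2 : twice_differentiable_near V 0.
Variables (c0 K : R).
Hypothesis c00 : 0 < c0.
Hypothesis K0 : 0 < K.
Hypothesis low : forall A, c0 * nrm2 (A + A^T) <= quad V A.
Hypothesis up : forall A, quad V A <= K * nrm2 A.

Definition polar (A B : M) : R := (mdot (hessian V 0 A) B + mdot (hessian V 0 B) A) / 2.

Lemma polarD A B C : polar (A + B) C = polar A C + polar B C.
Proof. rewrite /polar; move: (hessianD V2); move: (hessian V 0) => H HD.
by rewrite HD mdotDl mdotDr; ring. Qed.

Lemma polarZ a A C : polar (a *: A) C = a * polar A C.
Proof. rewrite /polar; move: (hessianZ V2); move: (hessian V 0) => H HZ.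
by rewrite HZ mdotZl mdotZr; ring. Qed.

Lemma polarC A B : polar A B = polar B A.
Proof. by rewrite /polar addrC. Qed.

Lemma polarE A : polar A A = quad V A.
Proof. by rewrite /polar /quad; move: (mdot _ _) => z; field. Qed.

Lemma quad_ge0 A : 0 <= quad V A.
Proof. by apply: le_trans (low A); rewrite mulr_ge0 ?nrm2_ge0// ltW. Qed.

(** Young-Fenchel for the quadratic form: the difference is half of the form at
    [X - A]. *)
Lemma quad_duality X A : polar X A - 2^-1 * quad V X <= 2^-1 * quad V A.
Proof.
have := quad_ge0 (A - X); rewrite -polarE -scaleN1r polarD polarZ !(polarC _ (A + _)) !(polarD, polarZ).
by rewrite -(polarC A X) !polarE; lra.
Qed.

Notation mu := (@lebesgue_measure R).
Notation arc := ([set` `]0%R, (2 * pi)%R[] : set R).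

Let mulr_cintegrable (u v : R -> R) : measurable_fun arc u -> measurable_fun arc v ->
  cintegrable (fun x => u x ^+ 2) -> cintegrable (fun x => v x ^+ 2) -> cintegrable (fun x => u x * v x).
Proof.
move=> mu' mv iu iv.
have i2 : cintegrable (fun x => u x ^+ 2 + v x ^+ 2) := rintegrableD (@measurable_arc R) iu iv.
apply: (le_integrable (@measurable_arc R) _ _ i2).
- by apply/measurable_EFinP; exact: measurable_funM.
- move=> x _ /=; rewrite lee_fin [leRHS]ger0_norm ?addr_ge0 ?sqr_ge0// normrM.
  rewrite -(real_normK (num_real (u x))) -(real_normK (num_real (v x))).
  have := sqr_ge0 (`|u x| - `|v x|); have := sqr_ge0 (`|u x|); have := sqr_ge0 (`|v x|); lra.
Qed.

Let L2_sqr f i : L2_fun f -> cintegrable (fun th => f th i 0 ^+ 2 : R).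
Proof.
move=> /(_ i)[mf lf]; apply/integrableP; split; first by apply/measurable_EFinP; exact: measurable_funX.
by under eq_integral do rewrite /= ger0_norm ?sqr_ge0//.
Qed.

Lemma Cinf_trig_bound : [/\ Cinf (@cos R), Cinf (@sin R), forall th : R, `|cos th| <= 1 & forall th : R, `|sin th| <= 1].
Proof. by have [] := cos_Cinf_sin_Cinf R; split=> // th; rewrite ler_norml ?cos_geN1 ?cos_le1 ?sin_geN1 ?sin_le1. Qed.

Lemma cell_energy_low (Qf : V3 -> M) (b t : V3) f g : SO3 (Qf t) -> L2_fun f ->
  (forall i, \int[mu]_(theta in `]0, 2 * pi[) f theta i 0 = b i 0) ->
  c0 / (6 * pi) * dotv b b <= cell_energy (hessian V 0) (cell_field (Qf t) f g).
Proof.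
set Q := Qf t => QSO L2 fb.
have pi0 := pi_gt0 R.
pose w := Q^T *m g.
pose osc th := 2 * ((w 0 0 ^+ 2 - w 1 0 ^+ 2) * (cos th ^+ 2 - sin th ^+ 2)
    + 4 * (w 0 0 * w 1 0) * (cos th * sin th)).
have [Cc Cs _ _] := Cinf_trig_bound.
have Cosc : Cinf osc.
  have := CinfM (Cinf_cst 2) (CinfD (CinfM (Cinf_cst (w 0 0 ^+ 2 - w 1 0 ^+ 2)) (CinfD (CinfM Cc Cc) (CinfN (CinfM Cs Cs))))
      (CinfM (Cinf_cst (4 * (w 0 0 * w 1 0))) (CinfM Cc Cs))).
  by congr Cinf; apply/funext => th; rewrite /osc !expr2.
have ptw th : c0 / 3 * (pi^-1 * dotv (f th) b + (osc th - (4 * pi ^+ 2)^-1 * dotv b b)) <=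
    1 / 2 * quad V (cell_field Q f g th).
  have E : cell_field Q f g th = Q *m (otimes (Q^T *m f th) (e_theta th) + otimes w (e_r th)) *m Q^T.
    rewrite mulmxDr mulmxDl -!otimes_rot /w !mulmxA.
    by have [QQ _] := QSO; rewrite QQ !mul1mx.
  have := low (cell_field Q f g th); rewrite E sym_rot nrm2_rot// -E.
  have := korn_cell (Q^T *m f th) w th; rewrite /= -/(osc th).
  rewrite (dotv_iso _ _ (SO3_trmx QSO)) => k1 k2.
  have w0 := dotv_ge0 w.
  have y1 : 0 < (2 * pi)^-1 :> R by rewrite invr_gt0 mulr_gt0.
  have y := dotv_young b (f th) y1; rewrite invrK in y.
  have {}y : pi^-1 * dotv (f th) b - (4 * pi ^+ 2)^-1 * dotv b b <= dotv (f th) (f th).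
    have e : dotv b (f th) = dotv (f th) b by rewrite /dotv; ring.
    have yi := ltW y1.
    move/(ler_wpM2l yi): y; rewrite e.
    have h1 (q x : R) : q != 0 -> (2 * q)^-1 * (2 * x) = q^-1 * x by move=> q0; field.
    have h2 (q x y : R) : q != 0 -> (2 * q)^-1 * ((2 * q)^-1 * x + 2 * q * y) = (4 * q ^+ 2)^-1 * x + y.
      by move=> q0; field.
    rewrite (h1 pi) ?(h2 pi) ?gt_eqF//.
    lra.
  have : c0 * (pi^-1 * dotv (f th) b - (4 * pi ^+ 2)^-1 * dotv b b + osc th) <= c0 * (3 / 2 * nrm2 (otimes (Q^T *m f th) (e_theta th) + otimes w (e_r th) + (otimes (Q^T *m f th) (e_theta th) + otimes w (e_r th))^T)).
    by rewrite ler_pM2l//; lra.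
  lra.
have mf i : measurable_fun arc (fun th => f th i 0) by have [] := L2 i.
have if2 i : cintegrable (fun th => f th i 0 ^+ 2) := L2_sqr i L2.
have Cin (u a : R -> R) : cintegrable u -> Cinf a -> cintegrable (fun th => u th * a th).
  move=> iu Ca; have [C C_0 hC] := continuous_norm_bounded (ltW (pi2_gt0 R)) (Cinf_continuous Ca).
  apply: (rintegrable_mulb (@measurable_arc R) (M := C) iu).
    exact: (continuous_measurable_arc (Cinf_continuous Ca)).
  by move=> x /arc_itv; exact: hC.
have if1 i : cintegrable (fun th => f th i 0).
  have C1 : cintegrable (fun=> (1 : R) ^+ 2) by exact/Cinf_cintegrable/Cinf_cst.
  have := mulr_cintegrable (mf i) (measurable_cst (1 : R)) (if2 i) C1.
  by congr cintegrable; apply/funext => th; rewrite mulr1.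
have Cet j : Cinf (fun th => (Q *m e_theta th) j 0).
  have := CinfD (CinfM (Cinf_cst (- Q j 0)) Cs) (CinfM (Cinf_cst (Q j 1)) Cc).
  congr Cinf; apply/funext => th; have [[t0 t1 t2] _] := frameE th.
  by rewrite [RHS]mxE sum3 t0 t1 t2; ring.
have Cer j : Cinf (fun th => (Q *m e_r th) j 0).
  have := CinfD (CinfM (Cinf_cst (Q j 0)) Cc) (CinfM (Cinf_cst (Q j 1)) Cs).
  congr Cinf; apply/funext => th; have [_ [t0 t1 t2]] := frameE th.
  by rewrite [RHS]mxE sum3 t0 t1 t2; ring.
pose G := cell_field Q f g.
have GE i j : (fun th => G th i j) = fun th => f th i 0 * (Q *m e_theta th) j 0 + g i 0 * (Q *m e_r th) j 0.
  by apply/funext => th; rewrite /G /cell_field mxE /otimes [X in X + _ = _]mxE [X in _ + X = _]mxE.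
have mG i j : measurable_fun arc (fun th => G th i j).
  rewrite GE; apply: measurable_funD; apply: measurable_funM => //.
  - exact: (continuous_measurable_arc (Cinf_continuous (Cet j))).
  - exact: (continuous_measurable_arc (Cinf_continuous (Cer j))).
have iG2 i j : cintegrable (fun th => G th i j ^+ 2).
  have Cb := CinfM (Cinf_cst (g i 0)) (Cer j).
  have h1 := Cin _ _ (if2 i) (CinfM (Cet j) (Cet j)).
  have h2 := Cin _ _ (if1 i) (CinfM (Cinf_cst 2) (CinfM (Cet j) Cb)).
  have h3 := Cinf_cintegrable (CinfM Cb Cb).
  have := rintegrableD (@measurable_arc R) (rintegrableD (@measurable_arc R) h1 h2) h3.
  have GE' th : G th i j = f th i 0 * (Q *m e_theta th) j 0 + g i 0 * (Q *m e_r th) j 0 := congr1 (@^~ th) (GE i j).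
  by congr rintegrable; apply/funext => th; rewrite GE'; ring.
have iq : cintegrable (fun th => 1 / 2 * quad V (G th)).
  apply: (rintegrableZ (@measurable_arc R)).
  have -> : (fun th => quad V (G th)) = fun th => \sum_i \sum_j \sum_k \sum_l polar (delta_mx i j) (delta_mx k l) * (G th i j * G th k l).
    apply/funext => th; rewrite -polarE (be_entries polarD polarZ polarC).
    apply: eq_bigr => i _; apply: eq_bigr => j _; rewrite mulr_sumr; apply: eq_bigr => k _; rewrite mulr_sumr.
    by apply: eq_bigr => l _; ring.
  do 4!(apply: (rintegrable_sum (@measurable_arc R)) => ?).
  by apply: (rintegrableZ (@measurable_arc R)); exact: mulr_cintegrable.
have il : cintegrable (fun th => pi^-1 * dotv (f th) b).
  apply: (rintegrableZ (@measurable_arc R)).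
  have := rintegrableD (@measurable_arc R) (rintegrableD (@measurable_arc R) (Cin _ _ (if1 0) (Cinf_cst (b 0 0))) (Cin _ _ (if1 1) (Cinf_cst (b 1 0)))) (Cin _ _ (if1 2) (Cinf_cst (b 2 0))).
  exact.
have io := Cinf_cintegrable (CinfD Cosc (CinfN (Cinf_cst ((4 * pi ^+ 2)^-1 * dotv b b)))).
have il2 := rintegrableZ (@measurable_arc R) (c0 / 3) (rintegrableD (@measurable_arc R) il io).
have := circ_le il2 iq (fun th _ => ptw th); apply: le_trans.
rewrite circZ; last exact: (rintegrableD (@measurable_arc R) il io).
rewrite circD// circZ; last first.
  have := rintegrableD (@measurable_arc R) (rintegrableD (@measurable_arc R) (Cin _ _ (if1 0) (Cinf_cst (b 0 0))) (Cin _ _ (if1 1) (Cinf_cst (b 1 0)))) (Cin _ _ (if1 2) (Cinf_cst (b 2 0))).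
  exact.
have -> : circ (fun th => dotv (f th) b) = dotv b b.
  have E i : circ (fun th => f th i 0 * b i 0) = b i 0 * b i 0.
    have fb' : circ (fun th => f th i 0) = b i 0 := fb i.
    rewrite -[X in _ = X * _]fb' [RHS]mulrC -circZ//.
    by apply: eq_circ => th; rewrite mulrC.
  have i0 := Cin _ _ (if1 0) (Cinf_cst (b 0 0)); have i1 := Cin _ _ (if1 1) (Cinf_cst (b 1 0)).
  have i2 := Cin _ _ (if1 2) (Cinf_cst (b 2 0)).
  transitivity (circ (fun th => f th 0 0 * b 0 0 + f th 1 0 * b 1 0 + f th 2 0 * b 2 0)); first by [].
  rewrite (@circD _ (fun th => f th 0 0 * b 0 0 + f th 1 0 * b 1 0) _ (rintegrableD (@measurable_arc R) i0 i1) i2).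
  by rewrite (circD i0 i1) !E.
have -> : circ (fun th => osc th - (4 * pi ^+ 2)^-1 * dotv b b) = - (2 * pi * ((4 * pi ^+ 2)^-1 * dotv b b)).
  have iosc := Cinf_cintegrable Cosc; have icst := Cinf_cintegrable (Cinf_cst (- ((4 * pi ^+ 2)^-1 * dotv b b))).
  by rewrite (circD iosc icst) (circ_korn w) circ_cst add0r mulrN.
have h (q x : R) : q != 0 -> c0 / (6 * q) * x = c0 / 3 * (q^-1 * x + - (2 * q * ((4 * q ^+ 2)^-1 * x))).
  by move=> q0; field.
by rewrite (h pi) ?gt_eqF.
Qed.

Lemma cell_energy_ge0 Q f g : 0 <= cell_energy (hessian V 0) (cell_field Q f g).
Proof. by apply: Rintegral_ge0 => th _; rewrite mulr_ge0 ?divr_ge0//; exact: quad_ge0. Qed.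

Lemma psi_le (Qf : V3 -> M) (b t : V3) f g : L2_fun f ->
  (forall i, \int[mu]_(theta in `]0, 2 * pi[) f theta i 0 = b i 0) ->
  psi Qf (hessian V 0) b t <= cell_energy (hessian V 0) (cell_field (Qf t) f g).
Proof.
move=> L2 fb; apply: ge_inf; last by exists f, g.
by exists 0 => _ [f' [g' [_ _ ->]]]; exact: cell_energy_ge0.
Qed.

(** Korn on the cell bounds the energy by the square norm of f, and convexity bounds
    that by the square of its mean b. *)
Lemma psi_low (Qf : V3 -> M) (b t : V3) : SO3 (Qf t) ->
  c0 / (6 * pi) * dotv b b <= psi Qf (hessian V 0) b t.
Proof.
move=> QSO; apply: lb_le_inf; last by move=> _ [f [g [L2 fb ->]]]; exact: cell_energy_low.
pose f (th : R) : V3 := (2 * pi)^-1 *: b.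
have fE th i : f th i 0 = (2 * pi)^-1 * b i 0 by rewrite mxE.
exists (cell_energy (hessian V 0) (cell_field (Qf t) f 0)), f, 0; split=> // i.
- have C1 : Cinf (fun th => f th i 0).
    by have := Cinf_cst ((2 * pi)^-1 * b i 0); congr Cinf; apply/funext => th; rewrite fE.
  split; first exact: (continuous_measurable_arc (Cinf_continuous C1)).
  have /integrableP[_] := Cinf_cintegrable (CinfM C1 C1).
  by under eq_integral do rewrite /= -expr2 ger0_norm ?sqr_ge0//.
- have E : circ (fun th => f th i 0) = circ (fun=> (2 * pi)^-1 * b i 0) by apply: eq_circ => th; exact: fE.
  by move: E; rewrite circ_cst mulVKf ?gt_eqF ?pi2_gt0.
Qed.

End psi_bounds.

(** * The optimal cell field and its tractions *)

Lemma otimes_entry (R : realType) (v w : 'cV[R]_3) i j : otimes v w i j = v i 0 * w j 0.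
Proof. by rewrite mxE. Qed.

Section optimal_cell.
Variable R : realType.
Local Notation M := 'M[R]_3.
Local Notation V3 := 'cV[R]_3.
Variable V : M -> R.
Hypothesis V2 : twice_differentiable_near V 0.
Variables (c0 K : R).
Hypothesis c00 : 0 < c0.
Hypothesis K0 : 0 < K.
Hypothesis low : forall A, c0 * nrm2 (A + A^T) <= quad V A.
Hypothesis up : forall A, quad V A <= K * nrm2 A.

(** What the calibration needs from the solution of the cell problem, transported
    to the frame of the line. The constant [C] depends on the form alone, which is
    what makes the final error uniform in [b] and [t]. *)
Lemma optimal_cell_field : exists2 C : R, 0 <= C & forall (Qf : V3 -> M) (b t : V3), SO3 (Qf t) ->
  exists (E : R) (G : R -> M) (l : V3) (m n k : R -> V3),
  [/\ [/\ psi Qf (hessian V 0) b t <= E, 2 * E = dotv l b & E <= C * enorm b ^+ 2],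
      [/\ Cinf (fun th => quad V (G th)), periodic2pi (fun th => quad V (G th)),
          circ (fun th => quad V (G th)) = 2 * E &
          forall th, nrm2 (G th) <= (C * enorm b) ^+ 2],
      forall th A, polar V (G th) A = dotv l (A *m Qf t *m e_theta th) +
        dotv (m th) (A *m Qf t *m e_r th) + dotv (n th) (A *m Qf t *m e3 R) &
      forall i, [/\ `|l i 0| <= C * enorm b,
        [/\ Cinf (fun th => m th i 0), periodic2pi (fun th => m th i 0) & forall th, `|m th i 0| <= C * enorm b],
        [/\ Cinf (fun th => n th i 0), periodic2pi (fun th => n th i 0) & forall th, `|n th i 0| <= C * enorm b] &
        [/\ Cinf (fun th => k th i 0), periodic2pi (fun th => k th i 0),
            forall th : R, is_derive th 1 (fun th => k th i 0) (m th i 0) &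
            forall th, 0 <= th <= 2 * pi -> `|k th i 0| <= C * enorm b]]].
Proof.
pose C1 := 2 * K ^+ 2 / c0 ^+ 2 + K / c0.
have C10 : 0 <= C1 by rewrite addr_ge0 ?divr_ge0 ?mulr_ge0 ?sqr_ge0 ?(ltW K0) ?(ltW c00).
pose D := 1 + K ^+ 2 + K ^+ 2 * C1 + C1 + K.
have KC : 0 <= K ^+ 2 * C1 by rewrite mulr_ge0 ?sqr_ge0.
have K20 := sqr_ge0 K.
have D1 : 1 <= D by rewrite /D; have := ltW K0; lra.
have D0 : 0 <= D by lra.
have pi2 : 2 <= pi :> R by have := pihalf_ge1 R; lra.
have DC : 3 * D <= 6 * pi * D by have := ler_wpM2r D0 pi2; lra.
have C0 : 0 <= 6 * pi * D by lra.
exists (6 * pi * D) => // Qf b t; set Q := Qf t => QSO.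
have QTSO := SO3_trmx QSO.
have QQ : Q *m Q^T = 1%:M by case: QSO.
set B := enorm b; have B0 : 0 <= B by exact: sqrtr_ge0.
have BB : dotv b b = B ^+ 2 by rewrite sqr_enorm_dotv.
have sq (a c : R) : c <= D -> a ^+ 2 <= c * B ^+ 2 -> `|a| <= D * B.
  move=> cD aB; rewrite -(@ler_pXn2r _ 2) ?nnegrE ?mulr_ge0// real_normK ?num_real//.
  apply: (le_trans aB); rewrite exprMn ler_wpM2r ?sqr_ge0//; apply: (le_trans cD).
  by rewrite expr2 ler_peMr.
have sqC a : `|a| <= 3 * (D * B) -> `|a| <= 6 * pi * D * B.
  by move=> h; apply: (le_trans h); rewrite mulrA ler_wpM2r.
have rotB (w : V3) c i : (forall j, `|w j 0| <= c) -> `|(Q *m w) i 0| <= 3 * c.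
  move=> wc; have Qw j : `|Q i j * w j 0| <= c.
    rewrite normrM; apply: le_trans (wc j); rewrite ler_piMl//; exact: SO3_entry.
  rewrite mxE sum3; apply: le_trans (ler_normD _ _) _; have := ler_normD (Q i 0 * w 0 0) (Q i 1 * w 1 0).
  by have := Qw 0; have := Qw 1; have := Qw 2; lra.
pose be (A A' : M) := polar V (Q *m A *m Q^T) (Q *m A' *m Q^T).
have beD A A' A'' : be (A + A') A'' = be A A'' + be A' A''.
  by rewrite /be mulmxDr mulmxDl polarD.
have beZ a A A' : be (a *: A) A' = a * be A A'.
  by rewrite /be -scalemxAr -scalemxAl polarZ.
have beC A A' : be A A' = be A' A by exact: polarC.
have be_low A : c0 * nrm2 (A + A^T) <= be A A.
  by rewrite /be polarE; apply: le_trans (low _); rewrite sym_rot nrm2_rot.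
have be_up A : be A A <= K * nrm2 A.
  by rewrite /be polarE; apply: le_trans (up _) _; rewrite nrm2_rot.
have [f [m [l [g [CC per [cf cm] EL [eE [lL lB fB]]]]]]] := cell_solution c00 K0 beD beZ beC be_low be_up (Q^T *m b).
have b'b : dotv (Q^T *m b) (Q^T *m b) = B ^+ 2 by rewrite dotv_iso.
rewrite b'b in lL lB fB.
pose G' th := otimes (f th) (e_theta th) + otimes g (e_r th).
pose G th := Q *m G' th *m Q^T.
have GE th : G th = cell_field Q (fun th => Q *m f th) (Q *m g) th.
  by rewrite /G /G' /cell_field !otimes_rot mulmxDr mulmxDl.
have qG th : quad V (G th) = be (G' th) (G' th) by rewrite /be polarE.
have dE j : (fun th => (Q *m f th) j 0) = fun th => \sum_i Q j i * f th i 0.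
  by apply/funext => th; rewrite mxE.
have Cf i : Cinf (fun th => f th i 0) by have [] := CC i.
have Cm i : Cinf (fun th => m th i 0) by have [] := CC i.
have Crot (u : R -> V3) : (forall i, Cinf (fun th => u th i 0)) -> forall i, Cinf (fun th => (Q *m u th) i 0).
  move=> Cu i; have : Cinf (fun th => \sum_j Q i j * u th j 0).
    by apply: Cinf_sum => j; apply: CinfM => //; exact: Cinf_cst.
  by congr Cinf; apply/funext => th; rewrite mxE.
have crot (u : R -> V3) i : (forall i, Cinf (fun th => u th i 0)) ->
    circ (fun th => (Q *m u th) i 0) = \sum_j Q i j * circ (fun th => u th j 0).
  move=> Cu; rewrite (@eq_circ _ _ (fun th => \sum_j Q i j * u th j 0)); last by move=> th; rewrite mxE.
  rewrite circ_sum; last by move=> j; apply: Cinf_cintegrable; apply: CinfM => //; exact: Cinf_cst.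
  by apply: eq_bigr => j _; rewrite circZ//; exact: Cinf_cintegrable.
have CQf := Crot f Cf.
have L2 : L2_fun (fun th => Q *m f th).
  move=> i; split; first exact: (continuous_measurable_arc (Cinf_continuous (CQf i))).
  have /integrableP[_] := Cinf_cintegrable (CinfM (CQf i) (CQf i)).
  by under eq_integral do rewrite /= -expr2 ger0_norm ?sqr_ge0//.
have cQf i : circ (fun th => (Q *m f th) i 0) = b i 0.
  rewrite crot//; under eq_bigr do rewrite cf.
  by rewrite -[b in RHS]mul1mx -QQ -mulmxA [RHS]mxE.
have CG' i j : Cinf (fun th => G' th i j).
    have [Cc Cs _ _] := Cinf_trig_bound R.
    have Cet k : Cinf (fun th => @e_theta R th k 0).
      case: (ord3P k) => ->.
      - by have := CinfN Cs; congr Cinf; apply/funext => th; have [[-> _ _] _] := frameE th.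
      - by have := Cc; congr Cinf; apply/funext => th; have [[_ -> _] _] := frameE th.
      - by have := @Cinf_cst R 0; congr Cinf; apply/funext => th; have [[_ _ ->] _] := frameE th.
    have Cer k : Cinf (fun th => @e_r R th k 0).
      case: (ord3P k) => ->.
      - by have := Cc; congr Cinf; apply/funext => th; have [_ [-> _ _]] := frameE th.
      - by have := Cs; congr Cinf; apply/funext => th; have [_ [_ -> _]] := frameE th.
      - by have := @Cinf_cst R 0; congr Cinf; apply/funext => th; have [_ [_ _ ->]] := frameE th.
    have := CinfD (CinfM (Cf i) (Cet j)) (CinfM (Cinf_cst (g i 0)) (Cer j)).
    by congr Cinf; apply/funext => th; rewrite /G' [RHS]mxE !otimes_entry.
have CH : Cinf (fun th => quad V (G th)).
  have : Cinf (fun th => be (G' th) (G' th)).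
    exact: (Cinf_be beD beZ beC).
  by congr Cinf; apply/funext => th; rewrite qG.
pose E := 2^-1 * dotv l (Q^T *m b).
have cH : circ (fun th => quad V (G th)) = 2 * E.
  by rewrite (eq_circ qG) eE /E mulVKf.
have cellE : cell_energy (hessian V 0) (cell_field Q (fun th => Q *m f th) (Q *m g)) = E.
  transitivity (circ (fun th => 1 / 2 * quad V (G th))).
    by apply: eq_circ => th; rewrite GE.
  by rewrite circZ ?cH; [field|exact: Cinf_cintegrable].
pose n th : V3 := \col_i be (G' th) (otimes (delta_mx i 0) (e3 R)).
have eper th : (e_theta (th + 2 * pi) = e_theta th :> V3) * (e_r (th + 2 * pi) = e_r th :> V3).
  by rewrite /e_theta /e_r !periodic_trig.
have pG th : G' (th + 2 * pi) = G' th by rewrite /G' !eper; have [-> _] := per th.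
have nG th : nrm2 (G' th) <= C1 * B ^+ 2.
  by rewrite /G' nrm2_cell; exact: fB.
have mE th i : m th i 0 = be (G' th) (otimes (delta_mx i 0) (e_r th)) by have [_ ->] := EL th i.
have bnd th w : nrm2 w <= 1 -> `|be (G' th) w| <= D * B.
  move=> w1; apply: (sq _ (K ^+ 2 * C1)); first by rewrite /D; have := ltW K0; lra.
  apply: le_trans (be_sqr c00 beD beZ beC be_low _ _) _.
  have h1 : be (G' th) (G' th) <= K * (C1 * B ^+ 2).
    by apply: (le_trans (be_up _)); rewrite ler_pM2l.
  have h2 : be w w <= K by apply: (le_trans (be_up _)); rewrite -[leRHS]mulr1 ler_pM2l.
  have := ler_pM (be_ge0 c00 be_low (G' th)) (be_ge0 c00 be_low w) h1 h2.
  by move=> /le_trans; apply; rewrite le_eqVlt; apply/orP; left; apply/eqP; ring.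
have unit1 (w u : V3) : dotv w w <= 1 -> dotv u u = 1 -> nrm2 (otimes w u) <= 1.
  move=> w1 u1; suff -> : nrm2 (otimes w u) = dotv w w * dotv u u by rewrite u1 mulr1.
  rewrite /nrm2 /mdot !sum3 !mxE /dotv; ring.
have d1 i : dotv (delta_mx i 0) (delta_mx i 0) <= 1 :> R.
  rewrite /dotv !mxE; case: (ord3P i) => -> /=; lra.
have er1 th : dotv (e_r th) (e_r th) = 1 :> R.
  by have [_ [r0 r1 r2]] := frameE th; rewrite /dotv r0 r1 r2 mulr0 addr0 -!expr2 cos2Dsin2.
have e31 : dotv (e3 R) (e3 R) = 1.
  by have [z0 z1 z2] := vec3E (0 : R) 0 1; rewrite /dotv z0 z1 z2; ring.
have mB th i : `|m th i 0| <= D * B by rewrite mE; apply: bnd; exact: unit1.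
have nB th i : `|n th i 0| <= D * B by rewrite mxE; apply: bnd; exact: unit1.
have DBp : 0 <= D * B by rewrite mulr_ge0.
have prim i : exists2 k, Cinf k /\ periodic2pi k & (forall th : R, is_derive th 1 k (m th i 0)) /\
    forall th, 0 <= th <= 2 * pi -> `|k th| <= 2 * pi * (D * B).
  apply: mean_zero_primitive (cm i) _ => //.
  by move=> th; have [_ ->] := per th.
have [k0 [Ck0 pk0] [dk0 bk0]] := prim 0.
have [k1 [Ck1 pk1] [dk1 bk1]] := prim 1.
have [k2 [Ck2 pk2] [dk2 bk2]] := prim 2.
pose k th : V3 := vec3 (k0 th, k1 th, k2 th).
have kE th : [/\ k th 0 0 = k0 th, k th 1 0 = k1 th & k th 2 0 = k2 th] by exact: vec3E.
have Ck i : Cinf (fun th => k th i 0).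
  case: (ord3P i) => ->; [have := Ck0|have := Ck1|have := Ck2];
    by congr Cinf; apply/funext => th; have [e0 e1 e2] := kE th; rewrite ?e0 ?e1 ?e2.
have Cn i : Cinf (fun th => n th i 0).
  have : Cinf (fun th => be (G' th) (otimes (delta_mx i 0) (e3 R))).
    apply: (Cinf_be beD beZ beC) => // k' j; exact: (Cinf_cst (otimes (delta_mx i 0) (e3 R) k' j)).
  by congr Cinf; apply/funext => th; rewrite mxE.
exists E, G, (Q *m l), (fun th => Q *m m th), (fun th => Q *m n th), (fun th => Q *m k th); split.
- split.
  + by rewrite -cellE -/Q; exact: (psi_le c00 low).
  + by rewrite /E mulVKf// dotv_rot.
  + have h : K * B ^+ 2 <= 6 * pi * D * B ^+ 2.
      by rewrite ler_wpM2r ?sqr_ge0//; apply: le_trans DC; rewrite /D; have := ltW K0; lra.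
    have := mulr_ge0 (ltW K0) (sqr_ge0 B); rewrite /E; lra.
- split => //.
  + by move=> th; rewrite !qG pG.
  + move=> th; rewrite /G nrm2_rot//; apply: (le_trans (nG th)).
    rewrite exprMn ler_wpM2r ?sqr_ge0//; have C1D : C1 <= D by rewrite /D; have := ltW K0; lra.
    have DD : D <= 6 * pi * D by lra.
    by apply: (le_trans C1D); apply: (le_trans DD); rewrite expr2 ler_peMr//; lra.
- move=> th A.
  have -> : polar V (G th) A = be (G' th) (Q^T *m A *m Q).
    by rewrite /be /G !mulmxA QQ mul1mx -!mulmxA QQ mulmx1.
  have [t0 r0] := EL th 0; have [t1 r1] := EL th 1; have [t2 r2] := EL th 2.
  rewrite /= -/(G' th) in t0 r0 t1 r1 t2 r2.
  have z i : n th i 0 = be (G' th) (otimes (delta_mx i 0) (e3 R)) by rewrite mxE.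
  have D3 w : be (G' th) (otimes w (e3 R)) = dotv (n th) w.
    by rewrite (be_otimesr beD beZ beC) sum3 -!z /dotv; ring.
  have D1' w : be (G' th) (otimes w (e_theta th)) = dotv l w.
    by rewrite (be_otimesr beD beZ beC) sum3 t0 t1 t2 /dotv; ring.
  have D2 w : be (G' th) (otimes w (e_r th)) = dotv (m th) w.
    by rewrite (be_otimesr beD beZ beC) sum3 r0 r1 r2 /dotv; ring.
  rewrite {1}(frame_decomposition (Q^T *m A *m Q) th) !(beDr beD beC) D1' D2 D3.
  by rewrite !dotv_rot !mulmxA.
move=> i; split.
- apply: sqC; apply: rotB => j; apply: (sq _ (K ^+ 2)); first by rewrite /D; have := ltW K0; lra.
  apply: le_trans lL; rewrite /dotv.
  have := sqr_ge0 (l 0 0); have := sqr_ge0 (l 1 0); have := sqr_ge0 (l 2 0).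
  by case: (ord3P j) => ->; lra.
- split; [exact: Crot| |by move=> th; apply: sqC; exact: rotB].
  by move=> th; have [_ ->] := per th.
- split; [exact: Crot| |by move=> th; apply: sqC; exact: rotB].
  by move=> th; have -> : n (th + 2 * pi) = n th by apply/matrixP => i' j'; rewrite !mxE pG.
- split; [exact: Crot| | |].
  + by move=> th; rewrite /k pk0 pk1 pk2.
  + move=> th; have kQ : (fun th => (Q *m k th) i 0) = fun th => Q i 0 * k0 th + Q i 1 * k1 th + Q i 2 * k2 th.
      by apply/funext => th'; have [e0 e1 e2] := kE th'; rewrite mxE sum3 e0 e1 e2.
    rewrite kQ; apply: (is_derive_eq (is_deriveD (is_deriveD (is_deriveZ (Q i 0) (dk0 th)) (is_deriveZ (Q i 1) (dk1 th))) (is_deriveZ (Q i 2) (dk2 th)))).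
    by rewrite [RHS]mxE sum3.
  + move=> th th02; have -> : 6 * pi * D * B = 3 * (2 * pi * (D * B)) by ring.
    apply: rotB => j; have [e0 e1 e2] := kE th.
    by case: (ord3P j) => ->; rewrite ?e0 ?e1 ?e2; [exact: bk0|exact: bk1|exact: bk2].
Qed.

End optimal_cell.

(** * Cutoff functions *)

Section cutoffs.
Variable R : realType.

Let is_derive_affine_comp (s s' : R -> R) (a b x : R) : (forall y : R, is_derive y 1 s (s' y)) ->
  is_derive x 1 (fun y => s (a * y + b)) (a * s' (a * x + b)).
Proof.
move=> ds; have dl : is_derive x 1 (fun y : R => a * y + b) a.
  apply: (is_derive_eq (is_deriveD (is_deriveZ a (is_derive_id x (1 : R))) (is_derive_cst b x 1))).
  by rewrite /GRing.scale /= mulr1 addr0.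
have := @is_derive1_comp _ s (fun y : R => a * y + b) x _ _ (ds _) dl.
by move=> h; apply: (is_derive_eq h); rewrite mulrC.
Qed.

(** A cutoff in the height: [k h] is the width of each transition layer. *)
Definition axial_spec (C k h : R) (e e' : R -> R) : Prop :=
  [/\ Cinf e, forall x : R, is_derive x 1 e (e' x), forall x, 0 <= e x <= 1,
    forall x, 2 * k * h <= x <= (1 - 2 * k) * h -> e x = 1 &
    (forall x, e x != 0 -> k * h <= x <= (1 - k) * h) /\ forall x, `|e' x| <= C / (k * h)].

Lemma axial_cutoff : exists2 C : R, 0 <= C & forall (k h : R), 0 < k -> 4 * k <= 1 -> 0 < h ->
  exists e e' : R -> R, axial_spec C k h e e'.
Proof.
have [s [s' [C [[Cs s01 s0 s1] [ds _ s'0 s'1 [C0 sC]]]]]] := smooth_cutoff R.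
exists (2 * C) => [|k h k0 k4 h0]; first lra.
have kh : 0 < k * h by rewrite mulr_gt0.
pose a := (k * h)^-1; have a0 : 0 < a by rewrite invr_gt0.
have akh : a * (k * h) = 1 by rewrite mulVf// gt_eqF.
pose u x := s (a * x + (- 1)); pose v x := s (- a * x + (1 - k) * h * a).
have du (x : R) := @is_derive_affine_comp s s' a (- 1) x ds.
have dv (x : R) := @is_derive_affine_comp s s' (- a) ((1 - k) * h * a) x ds.
exists (fun x => u x * v x), (fun x => u x * (- a * s' (- a * x + (1 - k) * h * a)) + v x * (a * s' (a * x + (- 1)))).
split.
- by apply: CinfM; apply: (Cinf_comp Cs); exact: Cinf_affine.
- move=> x; apply: (is_derive_eq (is_deriveM (du x) (dv x))).
  by rewrite /GRing.scale.
- move=> x; have /andP[u0 u1] := s01 (a * x + (- 1)); have /andP[v0 v1] := s01 (- a * x + (1 - k) * h * a).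
  by rewrite mulr_ge0//= mulr_ile1.
- move=> x /andP[x1 x2]; rewrite /u /v !s1 ?mulr1//.
    have := ler_wpM2l (ltW a0) x2.
    have -> : a * ((1 - 2 * k) * h) = (1 - k) * h * a - a * (k * h) by ring.
    by rewrite akh; lra.
  have := ler_wpM2l (ltW a0) x1; have -> : a * (2 * k * h) = 2 * (a * (k * h)) by ring.
  by rewrite akh; lra.
split.
  move=> x uv; apply/andP; split; rewrite leNgt; apply/negP => xk; move: uv.
    rewrite /u s0 ?mul0r ?eqxx//; have : a * x < a * (k * h) by rewrite ltr_pM2l.
    by rewrite akh; lra.
  rewrite /v s0 ?mulr0 ?eqxx//; have := ltW xk; rewrite -(ler_pM2l a0).
  have -> : a * ((1 - k) * h) = (1 - k) * h * a by ring.
  lra.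
move=> x; have -> : 2 * C / (k * h) = a * C + a * C by rewrite /a; ring.
have bd (y c : R) : 0 <= c <= 1 -> `|c * (a * s' y)| <= a * C.
  move=> /andP[c0 c1]; rewrite !normrM (ger0_norm c0) (gtr0_norm a0).
  apply: le_trans (_ : 1 * (a * C) <= _); last by rewrite mul1r.
  by apply: ler_pM => //; rewrite ?mulr_ge0 ?(ltW a0)// ler_pM2l.
apply: le_trans (ler_normD _ _) _; apply: lerD; last exact: (bd _ _ (s01 _)).
by rewrite mulNr mulrN normrN; exact: (bd _ _ (s01 _)).
Qed.

(** The radial functions take the squared radius as their argument, so that they
    stay smooth across the axis. [i] is the inverse radius off the core, [phi * i]
    the weight of the calibration. [P] is the radial primitive of that weight, the
    test function for the circulation. [D] is a primitive of the weight corrected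
    by [E], of size 1/rho, so that [D] has compact support; it is the potential for the axial traction. *)
Definition radial_spec (C r rho : R) (phi phi' i i' P D E : R -> R) : Prop :=
  [/\ [/\ Cinf phi, (forall x : R, is_derive x 1 phi (phi' x)), forall x, 0 <= phi x <= 1,
          (forall x, phi x != 0 -> r ^+ 2 <= x <= rho ^+ 2 / 2) /\ (forall x, phi' x != 0 -> r ^+ 2 <= x) &
          forall x, r ^+ 2 <= x -> `|phi' x| * Num.sqrt x <= (if x < 4 * r ^+ 2 then C / r else 0) + C / rho],
      [/\ Cinf i, forall x : R, is_derive x 1 i (i' x) & forall x, r ^+ 2 <= x ->
           i x = (Num.sqrt x)^-1 /\ i' x = - 2^-1 * i x ^+ 3],
      [/\ Cinf P, (forall x : R, is_derive x 1 P (- 2^-1 * (phi x * i x ^+ 2))),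
          (forall x, rho ^+ 2 / 2 <= x -> P x = 0),
          (forall x, 0 <= x -> 0 <= P x <= P 0) &
          2^-1 * (ln (rho ^+ 2 / 4) - ln (2 * r ^+ 2)) <= P 0] &
      [/\ Cinf D, Cinf E, (forall x : R, is_derive x 1 D (2^-1 * (phi x * i x - E x))) &
         [/\ forall x, r ^+ 2 <= x -> 0 <= D x * i x <= 1, forall x, 0 <= x <= r ^+ 2 -> D x = 0,
          forall x, 3 / 4 * rho ^+ 2 <= x -> D x = 0,
          forall x, 0 <= x -> `|E x| <= C / rho & forall x, 0 <= x <= r ^+ 2 -> E x = 0]]].

(** Two rescalings of the fixed profile, at the scales r and rho, give the two
    transition layers of [phi]; the other functions derive from them and from
    primitives. *)
Lemma radial_cutoffs : exists2 C : R, 0 <= C & forall r rho : R, 0 < r -> 2 * r <= rho ->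
  exists phi phi' i i' P D E : R -> R, radial_spec C r rho phi phi' i i' P D E.
Proof.
have [s [s' [C [[Cs s01 s0 s1] [ds _ s'0 s'1 [C0 sC]]]]]] := smooth_cutoff R.
exists (8 * C) => [|r rho r0 rrho]; first lra.
have rho0 : 0 < rho by lra.
pose q := r ^+ 2; pose Q := rho ^+ 2.
have q0 : 0 < q by rewrite exprn_gt0.
have Q0 : 0 < Q by rewrite exprn_gt0.
have qQ : 4 * q <= Q.
  have : (2 * r) ^+ 2 <= rho ^+ 2 by rewrite ler_pXn2r ?nnegrE ?mulr_ge0 ?(ltW r0) ?(ltW rho0).
  by rewrite exprMn /q /Q; lra.
have qV : q^-1 * q = 1 by rewrite mulVf// gt_eqF.
have QV : Q^-1 * Q = 1 by rewrite mulVf// gt_eqF.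
have qi : 0 < q^-1 by rewrite invr_gt0.
have Qi : 0 < Q^-1 by rewrite invr_gt0.
pose u x := s (q^-1 * x + (- 1)); pose v x := s (4 * Q^-1 * x + (- 1)).
pose u' x := q^-1 * s' (q^-1 * x + (- 1)); pose v' x := 4 * Q^-1 * s' (4 * Q^-1 * x + (- 1)).
have du (x : R) : is_derive x 1 u (u' x) by exact: is_derive_affine_comp.
have dv (x : R) : is_derive x 1 v (v' x) by exact: is_derive_affine_comp.
have Cu : Cinf u by apply: (Cinf_comp Cs); exact: Cinf_affine.
have Cv : Cinf v by apply: (Cinf_comp Cs); exact: Cinf_affine.
have u01 x : 0 <= u x <= 1 by exact: s01.
have v01 x : 0 <= v x <= 1 by exact: s01.
have uq x : x <= q -> q^-1 * x + (- 1) <= 0 by move=> /(ler_wpM2l (ltW qi)); rewrite qV; lra.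
have uq2 x : 2 * q <= x -> 1 <= q^-1 * x + (- 1) by move=> /(ler_wpM2l (ltW qi)); rewrite mulrCA qV; lra.
have vQ x : x <= Q / 4 -> 4 * Q^-1 * x + (- 1) <= 0.
  by move=> /(ler_wpM2l (ltW Qi)); rewrite mulrA QV; lra.
have vQ2 x : Q / 2 <= x -> 1 <= 4 * Q^-1 * x + (- 1).
  by move=> /(ler_wpM2l (ltW Qi)); rewrite mulrA QV; lra.
pose phi x := u x * (1 + (- v x)); pose phi' x := u x * (0 + (- v' x)) + (1 + (- v x)) * u' x.
have d1v (x : R) : is_derive x 1 (fun x => 1 + (- v x)) (0 + (- v' x)).
  exact: (is_deriveB (is_derive_cst (1 : R) x 1) (dv x)).
have C1v : Cinf (fun x => 1 + (- v x)) by apply: CinfD; [exact: Cinf_cst|exact: CinfN].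
have dphi (x : R) : is_derive x 1 phi (phi' x) by apply: (is_derive_eq (is_deriveM (du x) (d1v x))).
have Cphi : Cinf phi by exact: CinfM.
have phi01 x : 0 <= phi x <= 1.
  have /andP[u0 u1] := u01 x; have /andP[v0 v1] := v01 x.
  by rewrite mulr_ge0 ?mulr_ile1//; lra.
have phi_q x : x <= q -> phi x = 0 by move=> xq; rewrite /phi /u s0 ?mul0r//; exact: uq.
have phi_Q x : Q / 2 <= x -> phi x = 0 by move=> xQ; rewrite /phi /v s1 ?subrr ?mulr0//; exact: vQ2.
have phi'_q x : x <= q -> phi' x = 0.
  by move=> xq; rewrite /phi' /u /u' s0 ?s'0 ?uq// mul0r !mulr0 addr0.
have u'b x : `|u' x| <= q^-1 * C by rewrite /u' normrM (gtr0_norm qi) ler_pM2l.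
have v'b x : `|v' x| <= 4 * Q^-1 * C.
  by rewrite /v' normrM ger0_norm ?mulr_ge0 ?(ltW Qi)// ler_wpM2l ?mulr_ge0 ?(ltW Qi).
have [i0 Ci hi] := @smooth_invsqrt R (q / 2) (divr_gt0 q0 (ltr0n R 2)).
have [i' _ di] := CinfP Ci.
have iE x : q <= x -> i0 x = (Num.sqrt x)^-1 /\ i' x = - 2^-1 * i0 x ^+ 3.
  move=> qx; have x0 : 0 < x by exact: lt_le_trans qx.
  split; first by rewrite hi//; lra.
  have dx : is_derive x 1 (fun y => y * (i0 y * i0 y)) (x * (i0 x * i' x + i0 x * i' x) + i0 x * i0 x * 1).
    by apply: (is_derive_eq (is_deriveM (is_derive_id x (1 : R)) (is_deriveM (di x) (di x)))).
  have : x * (i0 x * i' x + i0 x * i' x) + i0 x * i0 x * 1 = 0.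
    apply: near_eq_derive1 dx (is_derive_cst (1 : R) x 1) _.
    near=> y; have y2 : q / 2 < y by near: y; apply: lt_nbhsr; lra.
    rewrite hi ?(ltW y2)// -expr2 exprVn sqr_sqrtr ?mulfV ?gt_eqF//; lra.
  have ii : i0 x * i0 x * x = 1.
    by rewrite hi -?expr2 ?exprVn ?sqr_sqrtr ?mulVf ?gt_eqF ?(ltW x0)//; lra.
  have in0 : i0 x != 0 by apply/eqP => z; move: ii; rewrite z !mul0r => /eqP; rewrite eq_sym oner_eq0.
  move=> h; have h2 : 2 * i' x + i0 x ^+ 3 = 0.
    have : i0 x * (x * (i0 x * i' x + i0 x * i' x) + i0 x * i0 x * 1) = 0 by rewrite h mulr0.
    have -> : i0 x * (x * (i0 x * i' x + i0 x * i' x) + i0 x * i0 x * 1) = i0 x * i0 x * x * (2 * i' x) + i0 x ^+ 3 by ring.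
    by rewrite ii mul1r.
  lra.
have sqrt_i x : q <= x -> i0 x * Num.sqrt x = 1 /\ 0 < i0 x.
  move=> qx; have x0 : 0 < x by exact: lt_le_trans qx.
  by rewrite (iE x qx).1 mulVf ?invr_gt0 ?sqrtr_gt0 ?gt_eqF ?sqrtr_gt0.
have Cs' : Cinf s'.
  have [s2 Cs2 ds2] := CinfP Cs; suff -> : s' = s2 by [].
  apply/funext => x; apply: near_eq_derive1 (ds x) (ds2 x) _; by near=> y.
have Qr : rho^-1 * rho = 1 by rewrite mulVf// gt_eqF.
have QVE : Q^-1 = rho^-1 * rho^-1 by rewrite /Q expr2 invfM.
have sqrt_le x c : 0 <= c -> x <= c ^+ 2 -> Num.sqrt x <= c.
  by move=> c_ge0 xc; rewrite -(ger0_norm c_ge0) -sqrtr_sqr ler_wsqrtr.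
have phi'_bound x : q <= x -> `|phi' x| * Num.sqrt x <= (if x < 4 * r ^+ 2 then 8 * C / r else 0) + 8 * C / rho.
  move=> qx; have x0 : 0 <= x by apply: le_trans qx; exact: ltW.
  have t1 : `|phi' x| <= `|v' x| + `|u' x|.
    have pl (y z : R) : 0 <= y <= 1 -> `|y * z| <= `|z|.
      by move=> /andP[y0 y1]; rewrite normrM (ger0_norm y0) ler_piMl.
    have h1 := pl _ (0 - v' x) (u01 x); rewrite sub0r normrN in h1.
    have h2 : `|(1 - v x) * u' x| <= `|u' x| by apply: pl; have := v01 x; lra.
    by apply: le_trans (ler_normD _ _) _; apply: lerD => //; rewrite sub0r.
  apply: le_trans (ler_wpM2r (sqrtr_ge0 x) t1) _; rewrite mulrDl addrC; apply: lerD.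
    case: ifP => xr.
      have h : Num.sqrt x <= 2 * r by apply: sqrt_le; [lra|rewrite exprMn; lra].
      apply: le_trans (ler_pM (normr_ge0 _) (sqrtr_ge0 x) (u'b x) h) _.
      have rr : r^-1 * r = 1 by rewrite mulVf// gt_eqF.
      have -> : q^-1 * C * (2 * r) = 2 * C * (r^-1 * (r^-1 * r)) by rewrite /q expr2 invfM; ring.
      rewrite rr mulr1; apply: ler_wpM2r; [by rewrite invr_ge0 ltW|lra].
    have h : 2 * q <= x by move: xr => /negbT; rewrite -leNgt /q; have := ltW q0; rewrite /q; lra.
    by rewrite /u' s'1 ?mulr0 ?normr0 ?mul0r//; exact: uq2.
  have [xQ|xQ] := leP (Q / 2) x.
    rewrite /v' s'1 ?mulr0 ?normr0 ?mul0r ?divr_ge0 ?mulr_ge0 ?(ltW rho0)//; exact: vQ2.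
  have h : Num.sqrt x <= rho by apply: sqrt_le; [exact: ltW|rewrite -/Q; lra].
  apply: le_trans (ler_pM (normr_ge0 _) (sqrtr_ge0 x) (v'b x) h) _.
  have -> : 4 * Q^-1 * C * rho = 4 * C * (rho^-1 * (rho^-1 * rho)) by rewrite QVE; ring.
  rewrite Qr mulr1; apply: ler_wpM2r; [by rewrite invr_ge0 ltW|lra].
have [W CW dW] := Cinf_primitive (CinfM (Cinf_cst 2^-1) (CinfM Cphi (CinfM Ci Ci))).
have g0 x : 0 <= 2^-1 * (phi x * (i0 x * i0 x)).
  by have /andP[p0 _] := phi01 x; have h := sqr_ge0 (i0 x); rewrite expr2 in h; apply: mulr_ge0; [rewrite invr_ge0|exact: mulr_ge0].
have Wm a b : a <= b -> W a <= W b by move=> ab; apply: (is_derive_mono dW).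
pose P x := W (Q / 2) + (- W x).
have P0 x : 0 <= x -> 0 <= P x.
  move=> x0; rewrite /P subr_ge0; have [xQ|xQ] := leP x (Q / 2); first exact: Wm.
  rewrite le_eqVlt; apply/orP; left; apply/eqP/esym; apply: (is_derive_cst_seg dW); last exact: ltW.
  by move=> y /andP[y1 _]; rewrite phi_Q ?mul0r ?mulr0// ltW.
have Plow : 2^-1 * (ln (Q / 4) - ln (2 * q)) <= P 0.
  have [qQ2|qQ2] := leP (2 * q) (Q / 4); last first.
    apply: le_trans (P0 0 (lexx 0)); have : ln (Q / 4) <= ln (2 * q).
      by rewrite ler_ln ?posrE ?divr_gt0 ?mulr_gt0// ltW.
    lra.
  have q2 : 0 < 2 * q by rewrite mulr_gt0.
  have Q4 : 0 < Q / 4 by rewrite divr_gt0.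
  have dF (y : R) : is_derive y 1 (fun y => W (expR y) - 2^-1 * y)
      (2^-1 * (phi (expR y) * (i0 (expR y) * i0 (expR y))) * expR y - 2^-1).
    have h := @is_derive1_comp _ W expR y _ _ (dW _) (is_derive_expR y).
    apply: (is_derive_eq (is_deriveB h (is_deriveZ 2^-1 (is_derive_id y (1 : R))))).
    by rewrite /GRing.scale /= mulr1.
  have lnm : ln (2 * q) <= ln (Q / 4) by rewrite ler_ln ?posrE.
  have F0 y : ln (2 * q) < y < ln (Q / 4) ->
      2^-1 * (phi (expR y) * (i0 (expR y) * i0 (expR y))) * expR y - 2^-1 = 0.
    move=> /andP[y1 y2]; have e1 : 2 * q < expR y by rewrite -(lnK q2) ltr_expR.
    have e2 : expR y < Q / 4 by rewrite -(lnK Q4) ltr_expR.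
    have -> : phi (expR y) = 1.
      by rewrite /phi /u /v s1 ?s0 ?mul1r ?oppr0 ?addr0// ?vQ ?uq2 ?ltW.
    have [h1 _] := sqrt_i (expR y) (ltac:(lra)).
    have -> : 2^-1 * (1 * (i0 (expR y) * i0 (expR y))) * expR y = 2^-1 * (i0 (expR y) * Num.sqrt (expR y)) ^+ 2.
      by rewrite exprMn sqr_sqrtr ?expR_ge0//; ring.
    by rewrite h1 expr1n; ring.
  have := is_derive_cst_seg dF F0 lnm; rewrite !lnK ?posrE// => h.
  have h1 := Wm (Q / 4) (Q / 2) (ltac:(lra)); have h2 := Wm 0 (2 * q) (ltW q2).
  by rewrite /P; lra.
have Cphii : Cinf (fun x => phi x * i0 x) by exact: CinfM.
have [J1 CJ1 dJ1] := Cinf_primitive Cphii.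
pose J x := J1 x + (- J1 0).
have CJ : Cinf J by apply: CinfD => //; exact: Cinf_cst.
have dJ (x : R) : is_derive x 1 J (phi x * i0 x).
  by apply: (is_derive_eq (is_deriveB (dJ1 x) (is_derive_cst (J1 0) x 1))); rewrite subr0.
have Jq x : 0 <= x <= q -> J x = 0.
  move=> /andP[x0 xq]; have <- : J 0 = 0 by rewrite /J subrr.
  apply/esym; apply: (is_derive_cst_seg dJ) => // y /andP[_ yx].
  by rewrite phi_q ?mul0r//; exact: le_trans (ltW yx) xq.
have phii0 y : q <= y -> 0 <= phi y * i0 y.
  by move=> qy; have [_ /ltW h] := sqrt_i y qy; have /andP[p0 _] := phi01 y; exact: mulr_ge0.
have J0 x : 0 <= x -> 0 <= J x.
  move=> x0; have [xq|xq] := leP x q; first by rewrite Jq ?x0.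
  rewrite -(Jq q) ?lexx ?(ltW q0)//; apply: (is_derive_mono dJ) => [y /andP[y1 _]|]; last exact: ltW.
  exact: phii0 (ltW y1).
have Jle x : q <= x -> J x <= 2 * (x * i0 x).
  move=> qx; have dK (y : R) : is_derive y 1 (fun y => 2 * (y * i0 y) - J y) (2 * (y * i' y + i0 y * 1) - phi y * i0 y).
    by apply: (is_derive_eq (is_deriveB (is_deriveZ 2 (is_deriveM (is_derive_id y (1 : R)) (di y))) (dJ y))).
  have K0 y : q < y < x -> 0 <= 2 * (y * i' y + i0 y * 1) - phi y * i0 y.
    move=> /andP[y1 _]; have qy := ltW y1; have [h1 h2] := sqrt_i y qy; rewrite (iE y qy).2.
    have h3 : y * i0 y ^+ 2 = 1.
      have y0 : 0 <= y by apply: le_trans qy; exact: ltW.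
      by rewrite -{1}(sqr_sqrtr y0) -exprMn mulrC h1 expr1n.
    have -> : 2 * (y * (- 2^-1 * i0 y ^+ 3) + i0 y * 1) - phi y * i0 y = (2 - y * i0 y ^+ 2 - phi y) * i0 y by field.
    by rewrite h3 mulr_ge0 ?(ltW h2)//; have /andP[_ p1] := phi01 y; lra.
  have := is_derive_mono dK K0 qx; rewrite (Jq q) ?lexx ?(ltW q0)//.
  have [_ /ltW h] := sqrt_i q (lexx q); have := mulr_ge0 (ltW q0) h; lra.
pose c x := s (4 * Q^-1 * x + (- 2)); pose c' x := 4 * Q^-1 * s' (4 * Q^-1 * x + (- 2)).
have dc (x : R) : is_derive x 1 c (c' x) by exact: is_derive_affine_comp.
have Cc : Cinf c by apply: (Cinf_comp Cs); exact: Cinf_affine.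
have Cc' : Cinf c' by apply: CinfM; [exact: Cinf_cst|apply: (Cinf_comp Cs'); exact: Cinf_affine].
have c01 x : 0 <= c x <= 1 by exact: s01.
have cle x : x <= Q / 2 -> 4 * Q^-1 * x + (- 2) <= 0.
  by move=> /(ler_wpM2l (ltW Qi)); rewrite mulrA QV; lra.
have cge x : 3 / 4 * Q <= x -> 1 <= 4 * Q^-1 * x + (- 2).
  by move=> /(ler_wpM2l (ltW Qi)); rewrite mulrCA QV; lra.
pose D x := 2^-1 * (J x * (1 + (- c x))).
have xi2 x : q <= x -> x * i0 x ^+ 2 = 1.
  move=> qx; have [h1 _] := sqrt_i x qx; have x0 : 0 <= x by apply: le_trans qx; exact: ltW.
  by rewrite -{1}(sqr_sqrtr x0) -exprMn mulrC h1 expr1n.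
exists phi, phi', i0, i', P, D, (fun x => J x * c' x); split.
- split=> //; split=> x.
    move=> px; apply/andP; split; rewrite leNgt; apply/negP => h; move: px.
      by rewrite phi_q ?eqxx// ltW.
    by rewrite phi_Q ?eqxx// ltW.
  by move=> px; rewrite leNgt; apply/negP => h; move: px; rewrite phi'_q ?eqxx// ltW.
- by split.
- split.
  + by apply: CinfD; [exact: Cinf_cst|exact: CinfN].
  + move=> x; apply: (is_derive_eq (is_deriveB (is_derive_cst (W (Q / 2)) x 1) (dW x))).
    by rewrite expr2; ring.
  + move=> x xQ; rewrite /P; suff -> : W (Q / 2) = W x by rewrite subrr.
    apply: (is_derive_cst_seg dW) => // y /andP[y1 _].
    by rewrite phi_Q ?mul0r ?mulr0// ltW.
  + by move=> x x0; rewrite P0//= /P lerD2l lerN2 Wm.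
  + exact: Plow.
- split.
  + by apply: CinfM; [exact: Cinf_cst|apply: CinfM => //; apply: CinfD; [exact: Cinf_cst|exact: CinfN]].
  + exact: CinfM.
  + move=> x; have d1 := is_deriveB (is_derive_cst (1 : R) x 1) (dc x).
    apply: (is_derive_eq (is_deriveZ 2^-1 (is_deriveM (dJ x) d1))); rewrite /GRing.scale /=.
    have phc : phi x * c x = 0.
      have [xQ|xQ] := leP x (Q / 2); first by rewrite /c s0 ?mulr0//; exact: cle.
      by rewrite phi_Q ?mul0r// ltW.
    have -> : 2^-1 * (J x * (0 - c' x) + (1 - c x) * (phi x * i0 x)) =
      2^-1 * (phi x * i0 x - J x * c' x) - 2^-1 * i0 x * (phi x * c x) by ring.
    by rewrite phc mulr0 subr0.
  split.
  + move=> x qx; have [_ /ltW i00] := sqrt_i x qx; have x0 : 0 <= x by apply: le_trans qx; exact: ltW.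
    have /andP[c0 c1] := c01 x; rewrite /D.
    have jj := J0 x x0; apply/andP; split; first by rewrite !mulr_ge0 ?invr_ge0//; lra.
    have h1 : J x * (1 - c x) <= J x by rewrite ler_piMr//; lra.
    have h2 := ler_wpM2r i00 (le_trans h1 (Jle x qx)).
    have h3 : 2 * (x * i0 x) * i0 x = 2 by rewrite -mulrA -mulrA -expr2 xi2// mulr1.
    by move: h2; rewrite h3 => h2; lra.
  + by move=> x x0; rewrite /D Jq// mul0r mulr0.
  + by move=> x xQ; rewrite /D /c s1 ?subrr ?mulr0//; exact: cge.
  + move=> x x0; rewrite normrM; have bC : 0 <= 8 * C / rho by rewrite divr_ge0 ?mulr_ge0 ?(ltW rho0).
    have [xQ|xQ] := leP x (Q / 2); first by rewrite /c' s'0 ?mulr0 ?normr0 ?mulr0//; exact: cle.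
    have [xQ2|xQ2] := leP (3 / 4 * Q) x; first by rewrite /c' s'1 ?mulr0 ?normr0 ?mulr0//; exact: cge.
    have qx : q <= x by lra.
    have [h1 /ltW i00] := sqrt_i x qx.
    have xs : x * i0 x = Num.sqrt x by rewrite -{1}(sqr_sqrtr x0) expr2 -mulrA [_ * i0 x]mulrC h1 mulr1.
    have Jr : `|J x| <= 2 * rho.
      rewrite ger0_norm ?J0//; apply: le_trans (Jle x qx) _; rewrite xs ler_pM2l//.
      by apply: sqrt_le; [exact: ltW|rewrite -/Q; lra].
    have cC : `|c' x| <= 4 * Q^-1 * C.
      by rewrite /c' normrM ger0_norm ?mulr_ge0 ?(ltW Qi)// ler_wpM2l ?mulr_ge0 ?(ltW Qi).
    apply: le_trans (ler_pM (normr_ge0 _) (normr_ge0 _) Jr cC) _.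
    have -> : 2 * rho * (4 * Q^-1 * C) = 8 * C * (rho^-1 * (rho^-1 * rho)) by rewrite QVE; ring.
    by rewrite Qr mulr1.
  + by move=> x x0; rewrite Jq// mul0r.
Unshelve. all: by end_near. Qed.

End cutoffs.

(** * Testing the curl *)

Section frame_tests.
Variable R : realType.
Local Notation V3 := 'cV[R]_3.
Variable Q : 'M[R]_3.
Hypothesis QSO : SO3 Q.
Notation y := (yc Q).
Notation P2 := (rad2 Q).

Lemma is_derive_rad2 l (x : V3) :
  is_derive x (col l Q) P2 (2 * (y 0 x * (0 == l)%:R + y 1 x * (1 == l)%:R)).
Proof.
have D k := is_deriveM (is_derive_yc QSO k l x) (is_derive_yc QSO k l x).
apply: (is_derive_eq (is_deriveD (D 0) (D 1))).
by rewrite /GRing.scale /=; ring.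
Qed.

Lemma is_derive_separated (al al' ga ga' : R -> R) (be : V3 -> R) (be' : R) l (x : V3) :
  (forall s : R, is_derive s 1 al (al' s)) -> (forall s : R, is_derive s 1 ga (ga' s)) ->
  is_derive x (col l Q) be be' ->
  'D_(col l Q) (fun z => al (P2 z) * be z * ga (y 2 z)) x =
  (al' (P2 x) * (2 * (y 0 x * (0 == l)%:R + y 1 x * (1 == l)%:R)) * be x + al (P2 x) * be') * ga (y 2 x)
   + al (P2 x) * be x * (ga' (y 2 x) * (2 == l)%:R).
Proof.
move=> dal dga dbe.
have da := is_derive_comp3 dal (S3_differentiable x (S3_rad2 Q)) (is_derive_rad2 l x).
have dg := is_derive_comp3 dga (S3_differentiable x (S3_yc Q 2)) (is_derive_yc QSO 2 l x).
have := is_deriveM (is_deriveM da dbe) dg; case=> _ ->.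
by rewrite /GRing.scale /= ?fctE /=; ring.
Qed.

Lemma S3_bounded_tube rho h (f : V3 -> R) : 0 < rho -> S3 f ->
  exists C, forall x, (mulmx Q @` tube rho h) x -> `|f x| <= C.
Proof.
move=> rho0 Sf; have cK := @cyl_compact _ _ QSO (rho ^+ 2) 0 h.
have : compact (f @` [set x | P2 x <= rho ^+ 2 /\ 0 <= y 2 x <= h]).
  by apply: continuous_compact cK; apply: continuous_subspaceT; exact: S3_continuous.
move=> /compact_bounded [M [_ hM]]; exists (M + 1) => x /(tubeP QSO _ _ rho0)[h1 /andP[h2 h3]].
by apply: (hM (M + 1)); [rewrite ltrDl|exists x => //; split; [exact: ltW|rewrite !ltW]].
Qed.

Lemma frame_integrable rho h (xi : V3 -> 'M[R]_3) f i k : 0 < rho -> S3 f ->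
  L1_fun (mulmx Q @` tube rho h) xi ->
  rintegrable (@leb3 R) (mulmx Q @` tube rho h) (fun x => (xi x *m Q) i k * f x).
Proof.
move=> rho0 Sf L1; have mT := measurable_tube QSO h rho0.
have [C hC] := S3_bounded_tube h rho0 Sf.
have h1 : rintegrable (@leb3 R) (mulmx Q @` tube rho h) (fun x => \sum_j Q j k * xi x i j).
  by apply: rintegrable_sum => // j; apply: rintegrableZ => //; exact: L1.
have -> : (fun x => (xi x *m Q) i k * f x) = fun x => (\sum_j Q j k * xi x i j) * f x.
  by apply/funext => x; rewrite mxE; congr (_ * _); apply: eq_bigr => j _; rewrite mulrC.
apply: (rintegrable_mulb mT (M := C) h1) => //.
by apply: measurable_funTS; exact: measurable_S3.
Qed.

Definition entry_sum (A : 'M[R]_3) : R := \sum_i \sum_j `|A i j|.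

Lemma entry_sum_ge0 A : 0 <= entry_sum A.
Proof. by apply: sumr_ge0 => i _; apply: sumr_ge0 => j _. Qed.

Lemma frame_entry_le (A : 'M[R]_3) i k : `|(A *m Q) i k| <= entry_sum A.
Proof.
rewrite mxE; apply: le_trans (ler_norm_sum _ _ _) _.
apply: (@le_trans _ _ (\sum_j `|A i j|)).
  by apply: ler_sum => j _; rewrite normrM ler_piMr//; exact: SO3_entry.
rewrite /entry_sum [leRHS](bigD1 i)//= lerDl.
by apply: sumr_ge0 => ? _; apply: sumr_ge0.
Qed.

Variables (r rho h eps : R) (b t : V3) (xi : V3 -> 'M[R]_3).
Hypothesis r0 : 0 < r.
Hypothesis rrho : 2 * r <= rho.
Hypothesis rhoh : rho <= h.
Hypothesis Qt : Q *m e3 R = t.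
Hypothesis t1 : enorm t = 1.
Notation T := (mulmx Q @` tube rho h).
Hypothesis L1xi : L1_fun T xi.
Hypothesis curlxi : curl_eq_hausdorff1 T xi (eps *: otimes b t) (line t `&` T).
Notation Xi x := (xi x *m Q).

(** A bound on the derivatives of the cutoffs: 1/r near the core, 1/rho
    elsewhere. *)
Definition transition_weight (x : V3) : R :=
  if r ^+ 2 <= P2 x then (if P2 x < 4 * r ^+ 2 then r^-1 else 0) + rho^-1 else 0.

Let rho0 : 0 < rho. Proof. by apply: lt_le_trans rrho; rewrite mulr_gt0. Qed.
Let h0 : 0 < h. Proof. exact: lt_le_trans rho0 rhoh. Qed.
Let mT : measurable (T : set (borel V3)) := measurable_tube QSO h rho0.

Let curl_test f : S3 f -> test_function T f -> forall i k : 'I_3,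
  \int[@leb3 R]_(x in T) (Xi x i (k + 1) * 'D_(col (k + 2) Q) f x - Xi x i (k + 2) * 'D_(col (k + 1) Q) f x) =
  fine (integral (@hausdorff1 R) (line t `&` T) (fun x => (f x)%:E)) * (eps * b i 0) * (k == 2)%:R.
Proof.
have E : eps *: otimes b t = otimes (eps *: b) t by apply/matrixP => i j; rewrite !mxE mulrA.
have cx := curlxi; rewrite E in cx; move=> Sf tf i k.
by have := curl_frame QSO mT L1xi Qt cx Sf tf i k; rewrite [X in _ * X * _]mxE.
Qed.

Let line_rad2 x : line t x -> P2 x = 0.
Proof.
move=> [s _ <-]; rewrite -Qt /rad2 !yc_scale !(yc_mul QSO).
by have [z0 z1 _] := vec3E (0 : R) 0 1; rewrite /e3 z0 z1 !mulr0 expr0n addr0.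
Qed.

Let curl_test0 f : S3 f -> test_function T f -> (forall x, line t x -> f x = 0) -> forall i k : 'I_3,
  \int[@leb3 R]_(x in T) (Xi x i (k + 1) * 'D_(col (k + 2) Q) f x - Xi x i (k + 2) * 'D_(col (k + 1) Q) f x) = 0.
Proof.
move=> Sf tf f0 i k; rewrite curl_test//.
have t0 : test_function T (fun=> 0).
  apply: (test_functionP QSO (c := 0) (z0 := h / 4) (z1 := h / 2)) => //; rewrite ?exprn_gt0 ?divr_gt0//.
  - exact: S3_cst.
  - by rewrite ltr_pdivrMr// ltr_pMr// ltr1n.
  - by move=> x; rewrite eqxx.
have := curl_test (S3_cst 0) t0 i k.
under eq_Rintegral do rewrite !derive_cst !mulr0 subrr.
rewrite /Rintegral integral0 /= => hz.
suff -> : integral (@hausdorff1 R) (line t `&` T) (fun x => (f x)%:E) = integral (@hausdorff1 R) (line t `&` T) (fun=> 0%:E) by rewrite -hz.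
have E : (fun x => (f x)%:E) \_ (line t `&` T) = (fun=> 0%:E) \_ (line t `&` T).
  apply/funext => x; rewrite !patchE; case: ifPn => // /set_mem[lx _]; by rewrite f0.
by rewrite /integral E.
Qed.

Let integrable_D f l i k : S3 f -> rintegrable (@leb3 R) T (fun x => Xi x i k * 'D_(col l Q) f x).
Proof.
move=> Sf; have [f' Sf' df] := S3_derive Sf (col l Q).
have -> : (fun x => Xi x i k * 'D_(col l Q) f x) = fun x => Xi x i k * f' x.
  by apply/funext => x; case: (df x) => _ ->.
exact: frame_integrable.
Qed.

(* a consequence of a test: the main part is the total up to the transition terms *)
Let compare (A X : V3 -> R) (c C : R) : rintegrable (@leb3 R) T A -> rintegrable (@leb3 R) T X ->
  \int[@leb3 R]_(x in T) X x = c ->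
  rintegrable (@leb3 R) T (fun x => C * (entry_sum (xi x) * transition_weight x)) ->
  (forall x, T x -> `|A x - X x| <= C * (entry_sum (xi x) * transition_weight x)) ->
  `|\int[@leb3 R]_(x in T) A x - c| <= \int[@leb3 R]_(x in T) (C * (entry_sum (xi x) * transition_weight x)).
Proof.
move=> iA iX <- iW AX.
rewrite -RintegralB//; apply: le_trans (le_normr_Rintegral mT (rintegrableB mT iA iX)) _.
apply: le_Rintegral => //.
by have := integrable_norm (rintegrableB mT iA iX).
Qed.

Lemma integrable_transition : rintegrable (@leb3 R) T (fun x => entry_sum (xi x) * transition_weight x).
Proof.
have iN : rintegrable (@leb3 R) T (fun x => entry_sum (xi x)).
  do 2!(apply: rintegrable_sum => // ?).
  have L1ij := L1xi; by apply: (integrable_norm (L1ij _ _)).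
apply: (rintegrable_mulb mT (M := r^-1 + rho^-1) iN).
  apply: measurable_funTS.
  have mP : measurable_fun setT (P2 : borel V3 -> R) by apply: measurable_S3; exact: S3_rad2.
  rewrite /transition_weight; apply: measurable_fun_ifT => //; last first.
    by apply: measurable_funD => //; apply: measurable_fun_ifT => //; exact: measurable_fun_ltr.
  exact: measurable_fun_ler.
move=> x _; rewrite /transition_weight.
have ri : 0 <= r^-1 by rewrite invr_ge0 ltW.
have rhoi : 0 <= rho^-1 by rewrite invr_ge0 ltW.
by case: ifP => _; [case: ifP => _|]; rewrite ?normr0 ?ger0_norm; lra.
Qed.


Variables (Ca Cr k : R) (phi phi' i i' PP D E e e' : R -> R).
Hypothesis Ca0 : 0 <= Ca.
Hypothesis Cr0 : 0 <= Cr.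
Hypothesis k0 : 0 < k.
Hypothesis k4 : 4 * k <= 1.
Hypothesis radial : radial_spec Cr r rho phi phi' i i' PP D E.
Hypothesis axial : axial_spec Ca k h e e'.

Let test_separated al be : Cinf al -> S3 be -> (forall s, 0 <= s -> al s != 0 -> s <= 3 / 4 * rho ^+ 2) ->
  S3 (fun z => al (P2 z) * be z * e (y 2 z)) /\ test_function T (fun z => al (P2 z) * be z * e (y 2 z)).
Proof.
have [Ce _ _ _ [supp_e _]] := axial.
move=> Cal Sbe al0.
have S : S3 (fun z => al (P2 z) * be z * e (y 2 z)).
  apply: S3_mul; last exact: (S3_comp Ce (S3_yc Q 2)).
  by apply: S3_mul => //; exact: (S3_comp Cal (S3_rad2 Q)).
split=> //; apply: (test_functionP QSO (c := 3 / 4 * rho ^+ 2) (z0 := k * h) (z1 := (1 - k) * h)) => //.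
- have := exprn_gt0 2 rho0; lra.
- by rewrite mulr_gt0.
- by have := mulr_gt0 k0 h0; rewrite mulrBl mul1r; lra.
move=> x; rewrite !mulf_eq0 !negb_or => /andP[/andP[a0 _] e0]; split.
  by apply: al0 => //; exact: rad2_ge0.
exact: supp_e.
Qed.

Definition e0 (x : V3) := y 0 x * i (P2 x).
Definition e1 (x : V3) := y 1 x * i (P2 x).

Let S3_e : S3 e0 /\ S3 e1.
Proof.
have [_ [Ci _ _] _ _] := radial.
by split; apply: S3_mul; [exact: S3_yc|exact: (S3_comp Ci (S3_rad2 Q))|exact: S3_yc|exact: (S3_comp Ci (S3_rad2 Q))].
Qed.

Lemma cutoff_invsqrt x : r ^+ 2 <= P2 x -> [/\ 0 < i (P2 x), i (P2 x) * Num.sqrt (P2 x) = 1,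
  i (P2 x) ^+ 2 * P2 x = 1 & e0 x ^+ 2 + e1 x ^+ 2 = 1].
Proof.
move=> rP; have [_ [_ _ hi] _ _] := radial; have [iE _] := hi _ rP.
have p0 : 0 < P2 x by apply: lt_le_trans rP; rewrite exprn_gt0.
have i0 : 0 < i (P2 x) by rewrite iE invr_gt0 sqrtr_gt0.
have h1 : i (P2 x) * Num.sqrt (P2 x) = 1 by rewrite iE mulVf// gt_eqF// sqrtr_gt0.
have h2 : i (P2 x) ^+ 2 * P2 x = 1 by rewrite -{2}(sqr_sqrtr (ltW p0)) -exprMn h1 expr1n.
split=> //; rewrite /e0 /e1 !exprMn -mulrDl -/(P2 x) mulrC; exact: h2.
Qed.

Lemma frame_angle x : r ^+ 2 <= P2 x -> exists2 th, 0 <= th <= 2 * pi & e0 x = cos th /\ e1 x = sin th.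
Proof. by move=> rP; have [_ _ _ h1] := cutoff_invsqrt rP; exact: unit_angle. Qed.

Let tau (l : 'I_3) x := i (P2 x) * (e0 x * (1 == l)%:R - e1 x * (0 == l)%:R).

Let derive_e l x : r ^+ 2 <= P2 x ->
  is_derive x (col l Q) e0 (- e1 x * tau l x) /\ is_derive x (col l Q) e1 (e0 x * tau l x).
Proof.
move=> rP; have [_ [Ci di hi] _ _] := radial; have [iE i'E] := hi _ rP.
have [i0 h1 h2 h3] := cutoff_invsqrt rP.
have dI := is_derive_comp3 di (S3_differentiable x (S3_rad2 Q)) (is_derive_rad2 l x).
have hI : i (P2 x) ^+ 2 * (y 0 x ^+ 2 + y 1 x ^+ 2) = 1 := h2.
split.
- apply: (is_derive_eq (is_deriveM (is_derive_yc QSO 0 l x) dI)); rewrite /GRing.scale /= i'E /tau /e0 /e1.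
  move: hI; case: (ord3P l) => -> /=; move: (i (P2 x)) (y 0 x) (y 1 x) => I a c hI.
  + have h4 : I * (I ^+ 2 * (a ^+ 2 + c ^+ 2)) = I by rewrite hI mulr1.
    by apply: (@etrans _ _ (- (a ^+ 2) * I ^+ 3 + I)); [by field|rewrite -[X in _ + X = _]h4; ring].
  + by field.
  + by ring.
- apply: (is_derive_eq (is_deriveM (is_derive_yc QSO 1 l x) dI)); rewrite /GRing.scale /= i'E /tau /e0 /e1.
  move: hI; case: (ord3P l) => -> /=; move: (i (P2 x)) (y 0 x) (y 1 x) => I a c hI.
  + by field.
  + have h4 : I * (I ^+ 2 * (a ^+ 2 + c ^+ 2)) = I by rewrite hI mulr1.
    by apply: (@etrans _ _ (- (c ^+ 2) * I ^+ 3 + I)); [by field|rewrite -[X in _ + X = _]h4; ring].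
  + by ring.
Qed.

Let out_of_shell x : T x -> ~~ (r ^+ 2 <= P2 x) -> transition_weight x = 0.
Proof. by move=> _ /negPf; rewrite /transition_weight => ->. Qed.

Let phi_support s : 0 <= s -> phi s != 0 -> s <= 3 / 4 * rho ^+ 2.
Proof.
have [[_ _ _ [h1 _] _] _ _ _] := radial.
by move=> _ /h1 /andP[_ hs]; have := sqr_ge0 rho; lra.
Qed.

(** The radial test function [P] measures the circulation around the line, which
    the source prescribes; the margin [4 k] is lost to the axial cutoff. *)
Lemma azimuthal_test : exists2 M : R,
  2^-1 * (ln (rho ^+ 2 / 4) - ln (2 * r ^+ 2)) * ((1 - 4 * k) * h) <= M & forall j : 'I_3,
  rintegrable (@leb3 R) T (fun x => phi (P2 x) * i (P2 x) * e (y 2 x) * (Xi x j 1 * e0 x - Xi x j 0 * e1 x)) /\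
  \int[@leb3 R]_(x in T) (phi (P2 x) * i (P2 x) * e (y 2 x) * (Xi x j 1 * e0 x - Xi x j 0 * e1 x)) = eps * b j 0 * M.
Proof.
have [[Cphi dphi phi01 [phis phi's] phib] [Ci di hi] [CP dP Pz P01 Plow] _] := radial.
have [Ce de e01 eone [supp_e e'b]] := axial.
pose f (z : V3) := PP (P2 z) * 1 * e (y 2 z).
have [Sf tf] : S3 f /\ test_function T f.
  apply: test_separated => //; first exact: S3_cst.
  move=> s s0 ps; rewrite leNgt; apply/negP => hs; move: ps; rewrite Pz ?eqxx//.
  by have := sqr_ge0 rho; lra.
have [Se0 Se1] := S3_e.
have Sw : S3 (fun x : V3 => phi (P2 x) * i (P2 x) * e (y 2 x)).
  apply: S3_mul; last exact: (S3_comp Ce (S3_yc Q 2)).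
  by apply: S3_mul; [exact: (S3_comp Cphi (S3_rad2 Q))|exact: (S3_comp Ci (S3_rad2 Q))].
have iA (j : 'I_3) : rintegrable (@leb3 R) T (fun x => phi (P2 x) * i (P2 x) * e (y 2 x) * (Xi x j 1 * e0 x - Xi x j 0 * e1 x)).
  have := rintegrableB mT (frame_integrable j 1 rho0 (S3_mul Sw Se0) L1xi) (frame_integrable j 0 rho0 (S3_mul Sw Se1) L1xi).
  by congr rintegrable; apply/funext => x; ring.
have EA (j : 'I_3) : \int[@leb3 R]_(x in T) (phi (P2 x) * i (P2 x) * e (y 2 x) * (Xi x j 1 * e0 x - Xi x j 0 * e1 x)) =
  \int[@leb3 R]_(x in T) (Xi x j (2 + 1) * 'D_(col (2 + 2) Q) f x - Xi x j (2 + 2) * 'D_(col (2 + 1) Q) f x).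
  apply: eq_Rintegral => x _; rewrite !add3E.
  rewrite (is_derive_separated dP de (is_derive_cst (1 : R) x (col 1 Q))).
  rewrite (is_derive_separated dP de (is_derive_cst (1 : R) x (col 0 Q))).
  by rewrite /= /e0 /e1; field.
have kh : 0 < k * h by rewrite mulr_gt0.
have k41 : 0 <= (1 - 4 * k) * h by apply: mulr_ge0; [rewrite subr_ge0|exact: ltW].
have P00 : 0 <= PP 0 by have /andP[] := P01 0 (lexx 0).
have f01 x : 0 <= f x <= PP 0.
  have /andP[a1 a2] := P01 _ (rad2_ge0 Q x); have /andP[b1 b2] := e01 (y 2 x).
  by rewrite /f mulr1 mulr_ge0//= -[leRHS]mulr1 ler_pM.
have [P0p|P0n] := ltP 0 (PP 0); last first.
  exists 0; first by apply: mulr_le0_ge0 => //; exact: le_trans Plow P0n.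
  move=> j; split=> //; rewrite mulr0 EA; apply: curl_test0 => // x _.
  by apply/eqP; rewrite eq_le; have /andP[-> h2] := f01 x; rewrite andbT (le_trans h2 P0n).
exists (fine (integral (@hausdorff1 R) (line t `&` T) (fun x => (f x)%:E))); last first.
  by move=> j; split=> //; rewrite EA (curl_test Sf tf j 2) eqxx mulr1 [RHS]mulrC.
apply: (@le_trans _ _ (PP 0 * ((1 - 2 * k) * h - 2 * k * h))).
  have -> : (1 - 2 * k) * h - 2 * k * h = (1 - 4 * k) * h by ring.
  exact: ler_wpM2r.
apply: (hausdorff1_integral_ge t1 (M := PP 0) (N := h)) => //.
- by rewrite -subr_ge0 (_ : (1 - 2 * k) * h - 2 * k * h = (1 - 4 * k) * h)//; ring.
- exact: ltW.
- move=> x [[s _ sx] /(tubeP QSO _ _ rho0)[_ hx]]; exists s => //.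
  rewrite /= in_itv /=; move: hx; rewrite -sx -Qt yc_scale (yc_mul QSO).
  have [_ _ z2] := vec3E (0 : R) 0 1; rewrite /e3 z2 mulr1 => /andP[s1 s2].
  by rewrite (ltW s2) andbT (le_trans _ (ltW s1))// oppr_le0 ltW.
- move=> s s12; have lts : line t (s *: t) by exists s.
  have y2 : y 2 (s *: t) = s.
    by rewrite -Qt yc_scale (yc_mul QSO); have [_ _ z2] := vec3E (0 : R) 0 1; rewrite /e3 z2 mulr1.
  have s0h : 0 < s < h.
    move/andP: s12 => [s1 s2]; rewrite (lt_le_trans _ s1) ?mulr_gt0//=.
    by apply: (le_lt_trans s2); rewrite mulrBl mul1r ltrBlDr ltrDl !mulr_gt0.
  split; first by split=> //; apply/(tubeP QSO) => //; rewrite (line_rad2 lts) y2 exprn_gt0.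
  by rewrite /f (line_rad2 lts) y2 eone// !mulr1.
Qed.

Let bound_weight x : T x -> r ^+ 2 <= P2 x ->
  [/\ transition_weight x = (if P2 x < 4 * r ^+ 2 then r^-1 else 0) + rho^-1, rho^-1 <= transition_weight x & h^-1 <= rho^-1].
Proof.
move=> Tx rP; rewrite /transition_weight rP; split=> //.
  by rewrite lerDr; case: ifP => // _; rewrite invr_ge0 ltW.
by rewrite lef_pV2 ?posrE.
Qed.

(** The radial traction has mean zero on the circle, hence is an angular
    derivative; only the transition layers of the cutoff contribute. *)
Lemma radial_test (Bd : R) (kap mm : R -> R) (Hk Hm : R -> R -> R) :
  Cinf kap -> Cinf mm -> (forall th : R, is_derive th 1 kap (mm th)) ->
  (forall th, 0 <= th <= 2 * pi -> `|kap th| <= Bd) -> 0 <= Bd ->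
  (forall th, 0 <= th <= 2 * pi -> Hk (cos th) (sin th) = kap th) ->
  (forall th, 0 <= th <= 2 * pi -> Hm (cos th) (sin th) = mm th) ->
  (forall f g : V3 -> R, S3 f -> S3 g -> S3 (fun x => Hk (f x) (g x))) ->
  (forall f g : V3 -> R, S3 f -> S3 g -> S3 (fun x => Hm (f x) (g x))) ->
  (forall (f g : V3 -> R) x v th tau, S3 f -> S3 g -> 0 <= th <= 2 * pi ->
        f x = cos th -> g x = sin th ->
        is_derive x v f (- sin th * tau) -> is_derive x v g (cos th * tau) ->
        is_derive x v (fun x => Hk (f x) (g x)) (mm th * tau)) ->
  forall j : 'I_3,
  rintegrable (@leb3 R) T (fun x => phi (P2 x) * i (P2 x) * e (y 2 x) * Hm (e0 x) (e1 x) * (Xi x j 0 * e0 x + Xi x j 1 * e1 x)) /\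
  `|\int[@leb3 R]_(x in T) (phi (P2 x) * i (P2 x) * e (y 2 x) * Hm (e0 x) (e1 x) * (Xi x j 0 * e0 x + Xi x j 1 * e1 x)) - 0| <=
  \int[@leb3 R]_(x in T) (4 * Cr * Bd * (entry_sum (xi x) * transition_weight x)).
Proof.
move=> Ckap Cmm dkap kB Bd0 HkE HmE Sk Sm dHk j.
have [[Cphi dphi phi01 [phis phi's] phib] [Ci di hi] _ _] := radial.
have [Ce de e01 eone [supp_e e'b]] := axial.
have [Se0 Se1] := S3_e.
have SHk := Sk _ _ Se0 Se1; have SHm := Sm _ _ Se0 Se1.
pose f (z : V3) := phi (P2 z) * Hk (e0 z) (e1 z) * e (y 2 z).
have [Sf tf] : S3 f /\ test_function T f.
  by apply: test_separated => //; exact: phi_support.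
have f0 x : line t x -> f x = 0.
  move=> lx; rewrite /f (line_rad2 lx); suff -> : phi 0 = 0 by rewrite !mul0r.
  apply/eqP/negPn/negP => /phis /andP[h1 _]; have := exprn_gt0 2 r0; lra.
have Sw : S3 (fun x : V3 => phi (P2 x) * i (P2 x) * e (y 2 x)).
  apply: S3_mul; last exact: (S3_comp Ce (S3_yc Q 2)).
  by apply: S3_mul; [exact: (S3_comp Cphi (S3_rad2 Q))|exact: (S3_comp Ci (S3_rad2 Q))].
have iA : rintegrable (@leb3 R) T (fun x => phi (P2 x) * i (P2 x) * e (y 2 x) * Hm (e0 x) (e1 x) * (Xi x j 0 * e0 x + Xi x j 1 * e1 x)).
  have := rintegrableD mT (frame_integrable j 0 rho0 (S3_mul (S3_mul Sw SHm) Se0) L1xi) (frame_integrable j 1 rho0 (S3_mul (S3_mul Sw SHm) Se1) L1xi).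
  by congr rintegrable; apply/funext => x; ring.
split=> //.
apply: (compare iA (rintegrableB mT (integrable_D 1 j 0 Sf) (integrable_D 0 j 1 Sf))).
- by have E2 := curl_test0 Sf tf f0 j 2; rewrite !add3E in E2; exact E2.
- by apply: rintegrableZ => //; exact: integrable_transition.
move=> x Tx.
have [dk0 _ dHk0] := S3_derive SHk (col 0 Q); have [dk1 _ dHk1] := S3_derive SHk (col 1 Q).
rewrite (is_derive_separated dphi de (dHk0 x)) (is_derive_separated dphi de (dHk1 x)) /= !mulr0 !mulr1 !addr0 !add0r.
have N0 := entry_sum_ge0 (xi x).
have [rP|rP] := boolP (r ^+ 2 <= P2 x); last first.
  have p0 : phi (P2 x) = 0 by apply/eqP/negPn/negP => /phis /andP[h1 _]; move: rP; rewrite h1.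
  have p1 : phi' (P2 x) = 0 by apply/eqP/negPn/negP => /phi's h1; move: rP; rewrite h1.
  by rewrite (out_of_shell Tx rP) p0 p1 !(mul0r, mulr0, add0r, subr0, oppr0, normr0).
have [th th02 [c0 s0]] := frame_angle rP; have [i0 iP _ cs] := cutoff_invsqrt rP.
have Ed l (d : V3 -> R) : is_derive x (col l Q) (fun x => Hk (e0 x) (e1 x)) (d x) -> d x = mm th * tau l x.
  have [d0 d1] := derive_e l rP; rewrite s0 c0 in d0 d1.
  by have := dHk e0 e1 x (col l Q) th (tau l x) Se0 Se1 th02 c0 s0 d0 d1; case=> _ <- [_ <-].
have HkE' : Hk (e0 x) (e1 x) = kap th by rewrite c0 s0 HkE.
have HmE' : Hm (e0 x) (e1 x) = mm th by rewrite c0 s0 HmE.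
rewrite (Ed 0 dk0 (dHk0 x)) (Ed 1 dk1 (dHk1 x)) HkE' HmE' /tau /= !mulr0 !mulr1 subr0 sub0r.
set X := (X in `|X| <= _).
have -> : X = 2 * (e (y 2 x) * (kap th * (phi' (P2 x) * (Xi x j 1 * y 0 x - Xi x j 0 * y 1 x)))).
  by rewrite /X; ring.
have /andP[ee0 ee1] := e01 (y 2 x).
have yP l : (l == 0) || (l == 1) -> `|y l x| <= Num.sqrt (P2 x).
  move=> l01; rewrite -sqrtr_sqr ler_wsqrtr// /rad2.
  have q0 := sqr_ge0 (y 0 x); have q1 := sqr_ge0 (y 1 x).
  by case/orP: l01 => /eqP ->; rewrite ?lerDl ?lerDr.
have t2 : `|Xi x j 1 * y 0 x - Xi x j 0 * y 1 x| <= 2 * entry_sum (xi x) * Num.sqrt (P2 x).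
  apply: le_trans (ler_normB _ _) _; rewrite !normrM.
  have := ler_pM (normr_ge0 _) (normr_ge0 _) (frame_entry_le (xi x) j 1) (yP 0 isT).
  have := ler_pM (normr_ge0 _) (normr_ge0 _) (frame_entry_le (xi x) j 0) (yP 1 isT).
  lra.
have pb := phib _ rP; have [wE w1 _] := bound_weight Tx rP.
have pw : `|phi' (P2 x)| * Num.sqrt (P2 x) <= Cr * transition_weight x.
  by apply: (le_trans pb); rewrite wE mulrDr; case: ifP => _; rewrite ?mulr0.
rewrite !normrM (ger0_norm ee0) [`|2|]ger0_norm//.
have t3 : `|phi' (P2 x)| * `|Xi x j 1 * y 0 x - Xi x j 0 * y 1 x| <= 2 * entry_sum (xi x) * (Cr * transition_weight x).
  apply: le_trans (ler_wpM2l (normr_ge0 _) t2) _; rewrite mulrCA.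
  by apply: ler_wpM2l => //; rewrite mulr_ge0.
have t4 := ler_pM (normr_ge0 _) (mulr_ge0 (normr_ge0 _) (normr_ge0 _)) (kB th th02) t3.
have t5 : 0 <= `|kap th| * (`|phi' (P2 x)| * `|Xi x j 1 * y 0 x - Xi x j 0 * y 1 x|) by rewrite !mulr_ge0.
have t6 := ler_piMl t5 ee1.
have -> : 4 * Cr * Bd * (entry_sum (xi x) * transition_weight x) = 2 * (Bd * (2 * entry_sum (xi x) * (Cr * transition_weight x))) by ring.
by rewrite ler_pM2l//; apply: (le_trans t6).
Qed.

(** The columns of the curl orthogonal to the line carry no source. Two of them
    combine into the planar divergence of a radial field, which is the weight of the
    calibration up to [E] and to the derivative of the axial cutoff. *)
Lemma axial_test (Bd : R) (nn nn' : R -> R) (Hn : R -> R -> R) :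
  Cinf nn -> (forall th : R, is_derive th 1 nn (nn' th)) ->
  (forall th, `|nn th| <= Bd) ->
  (forall th, 0 <= th <= 2 * pi -> Hn (cos th) (sin th) = nn th) ->
  (forall f g : V3 -> R, S3 f -> S3 g -> S3 (fun x => Hn (f x) (g x))) ->
  (forall (f g : V3 -> R) x v th tau, S3 f -> S3 g -> 0 <= th <= 2 * pi ->
        f x = cos th -> g x = sin th ->
        is_derive x v f (- sin th * tau) -> is_derive x v g (cos th * tau) ->
        is_derive x v (fun x => Hn (f x) (g x)) (nn' th * tau)) ->
  forall j : 'I_3,
  rintegrable (@leb3 R) T (fun x => phi (P2 x) * i (P2 x) * e (y 2 x) * Hn (e0 x) (e1 x) * Xi x j 2) /\
  `|\int[@leb3 R]_(x in T) (phi (P2 x) * i (P2 x) * e (y 2 x) * Hn (e0 x) (e1 x) * Xi x j 2) - 0| <=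
  \int[@leb3 R]_(x in T) ((Cr + 2 * Ca / k) * Bd * (entry_sum (xi x) * transition_weight x)).
Proof.
move=> Cnn dnn nB HnE Sn dHn j.
have Bd0 : 0 <= Bd by apply: le_trans (nB 0).
have [[Cphi dphi phi01 [phis phi's] phib] [Ci di hi] _ [CD CE dD [D01 Dq DQ Eb Eq]]] := radial.
have [Ce de e01 eone [supp_e e'b]] := axial.
have [Se0 Se1] := S3_e.
have SHn := Sn _ _ Se0 Se1.
pose a s := D s * i s.
have da (s : R) : is_derive s 1 a (D s * i' s + i s * (2^-1 * (phi s * i s - E s))).
  by apply: (is_derive_eq (is_deriveM (dD s) (di s))).
have Cia : Cinf a by exact: CinfM.
pose fc (c : V3 -> R) (z : V3) := a (P2 z) * (Hn (e0 z) (e1 z) * c z) * e (y 2 z).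
have tst c : S3 c -> S3 (fc c) /\ test_function T (fc c).
  move=> Sc; apply: test_separated => //; first exact: S3_mul.
  move=> s s0 as0; rewrite leNgt; apply/negP => hs; move: as0; rewrite /a DQ ?mul0r ?eqxx//; exact: ltW.
have f0 c x : line t x -> fc c x = 0.
  move=> lx; rewrite /fc (line_rad2 lx) /a Dq ?mul0r//.
  by rewrite lexx exprn_ge0// ltW.
have [Sa ta] := tst _ Se1; have [Sb tb] := tst _ Se0.
have Sw : S3 (fun x : V3 => phi (P2 x) * i (P2 x) * e (y 2 x)).
  apply: S3_mul; last exact: (S3_comp Ce (S3_yc Q 2)).
  by apply: S3_mul; [exact: (S3_comp Cphi (S3_rad2 Q))|exact: (S3_comp Ci (S3_rad2 Q))].
have iA : rintegrable (@leb3 R) T (fun x => phi (P2 x) * i (P2 x) * e (y 2 x) * Hn (e0 x) (e1 x) * Xi x j 2).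
  have := frame_integrable j 2 rho0 (S3_mul Sw SHn) L1xi.
  by congr rintegrable; apply/funext => x; ring.
split=> //.
have i1 := rintegrableB mT (integrable_D 0 j 2 Sb) (integrable_D 2 j 0 Sb).
have i0' := rintegrableB mT (integrable_D 2 j 1 Sa) (integrable_D 1 j 2 Sa).
apply: (compare iA (rintegrableB mT i1 i0')).
- have E1 := curl_test0 Sb tb (@f0 e0) j 1; rewrite !add3E in E1.
  have E0 := curl_test0 Sa ta (@f0 e1) j 0; rewrite !add3E in E0.
  by rewrite (RintegralB mT i1 i0') E1 E0 subr0.
- by apply: rintegrableZ => //; exact: integrable_transition.
move=> x Tx.
have dv c l (Sc : S3 c) := S3_derive (S3_mul SHn Sc) (col l Q).
have [db0 _ hb0] := dv _ 0 Se0; have [db2 _ hb2] := dv _ 2 Se0.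
have [da1 _ ha1] := dv _ 1 Se1; have [da2 _ ha2] := dv _ 2 Se1.
rewrite (is_derive_separated da de (hb0 x)) (is_derive_separated da de (hb2 x)).
rewrite (is_derive_separated da de (ha1 x)) (is_derive_separated da de (ha2 x)) /= !(mulr0, mulr1, addr0, add0r).
have N0 := entry_sum_ge0 (xi x).
have [rP|rP] := boolP (r ^+ 2 <= P2 x); last first.
  have p0 : phi (P2 x) = 0 by apply/eqP/negPn/negP => /phis /andP[h1 _]; move: rP; rewrite h1.
  have Pq : 0 <= P2 x <= r ^+ 2 by rewrite rad2_ge0 /= ltW// ltNge.
  by rewrite (out_of_shell Tx rP) /a p0 (Dq _ Pq) (Eq _ Pq) !(mul0r, mulr0, add0r, addr0, subr0, oppr0, normr0).
have [th th02 [c0 s0]] := frame_angle rP; have [i0 iP iP2 cs] := cutoff_invsqrt rP.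
have [_ i'E] := hi _ rP.
have Ed l (c : V3 -> R) (c' : R) (d : V3 -> R) : is_derive x (col l Q) c c' ->
    is_derive x (col l Q) (fun x => Hn (e0 x) (e1 x) * c x) (d x) ->
    d x = Hn (e0 x) (e1 x) * c' + c x * (nn' th * tau l x).
  move=> dc; have [d0 d1] := derive_e l rP; rewrite s0 c0 in d0 d1.
  have := is_deriveM (dHn e0 e1 x (col l Q) th (tau l x) Se0 Se1 th02 c0 s0 d0 d1) dc; case=> _ <- [_ <-].
  by [].
rewrite (Ed 0 _ _ _ (derive_e 0 rP).1 (hb0 x)) (Ed 2 _ _ _ (derive_e 2 rP).1 (hb2 x)).
rewrite (Ed 1 _ _ _ (derive_e 1 rP).2 (ha1 x)) (Ed 2 _ _ _ (derive_e 2 rP).2 (ha2 x)) {Ed}.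
have HB : `|Hn (e0 x) (e1 x)| <= Bd by rewrite c0 s0 HnE.
rewrite /tau /= !(mulr0, mulr1, addr0, add0r, subr0, sub0r) i'E.
move: (e'b (y 2 x)) (e01 (y 2 x)) (Eb _ (rad2_ge0 Q x)) (D01 _ rP) => eb /andP[ee0 ee1] EB /andP[a0 a1].
have [wE w1 hw] := bound_weight Tx rP.
have [y0E y1E] : y 0 x = e0 x * Num.sqrt (P2 x) /\ y 1 x = e1 x * Num.sqrt (P2 x).
  by rewrite /e0 /e1 -!mulrA iP !mulr1.
set H := Hn (e0 x) (e1 x) in HB *.
set X := (X in `|X| <= _).
have -> : X = (e (y 2 x) * H) * (E (P2 x) * Xi x j 2) + (D (P2 x) * i (P2 x)) * (H * (e' (y 2 x) * (Xi x j 0 * e0 x + Xi x j 1 * e1 x))).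
  rewrite /X /a y0E y1E; move: iP cs.
  move: (H) (e (y 2 x)) (e' (y 2 x)) (D (P2 x)) (E (P2 x)) (i (P2 x)) (phi (P2 x)) (Num.sqrt (P2 x)) (e0 x) (e1 x) (nn' th) (Xi x j 0) (Xi x j 1) (Xi x j 2) => HH E0 E1 D0 EE I ph S c s N X0 X1 X2 iP cs.
  transitivity ((E0 * HH) * (EE * X2) + (D0 * I) * (HH * (E1 * (X0 * c + X1 * s)))
    - X2 * E0 * HH * (ph * I - EE - D0 * I ^+ 2) * (I * S * (c ^+ 2 + s ^+ 2) - 1)
    - X2 * E0 * HH * D0 * I ^+ 2 * ((c ^+ 2 + s ^+ 2) - 1)); first by field.
  by rewrite cs iP mulr1 subrr !mulr0 !subr0.
have c1 : `|e0 x| <= 1 by rewrite c0 ler_norml cos_geN1 cos_le1.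
have s1 : `|e1 x| <= 1 by rewrite s0 ler_norml sin_geN1 sin_le1.
have X2N := frame_entry_le (xi x) j 2.
set N := entry_sum (xi x) in N0 X2N *; set w := transition_weight x in w1 wE *.
have tN : `|Xi x j 0 * e0 x + Xi x j 1 * e1 x| <= 2 * N.
  apply: le_trans (ler_normD _ _) _; rewrite (normrM (Xi x j 0)) (normrM (Xi x j 1)).
  have := ler_pM (normr_ge0 _) (normr_ge0 _) (frame_entry_le (xi x) j 0) c1.
  have := ler_pM (normr_ge0 _) (normr_ge0 _) (frame_entry_le (xi x) j 1) s1.
  rewrite -/N; lra.
have kV : 0 <= k^-1 by rewrite invr_ge0 ltW.
have g1 : `|e (y 2 x) * H * (E (P2 x) * Xi x j 2)| <= Bd * (Cr * w * N).
  have h1 : `|e (y 2 x) * H| <= Bd.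
    by rewrite normrM (ger0_norm ee0); apply: le_trans HB; rewrite ler_piMl.
  have h2 : `|E (P2 x) * Xi x j 2| <= Cr * w * N.
    rewrite normrM; apply: ler_pM => //; apply: (le_trans EB).
    exact: ler_wpM2l.
  by rewrite normrM; apply: ler_pM.
have g2 : `|D (P2 x) * i (P2 x) * (H * (e' (y 2 x) * (Xi x j 0 * e0 x + Xi x j 1 * e1 x)))| <= Bd * (Ca * (k^-1 * w) * (2 * N)).
  have h1 : `|D (P2 x) * i (P2 x)| <= 1 by rewrite ger0_norm.
  have h3 : `|e' (y 2 x)| <= Ca * (k^-1 * w).
    apply: (le_trans eb); rewrite invfM; apply: ler_wpM2l => //; apply: ler_wpM2l => //.
    exact: le_trans hw w1.
  have h4 : `|e' (y 2 x) * (Xi x j 0 * e0 x + Xi x j 1 * e1 x)| <= Ca * (k^-1 * w) * (2 * N).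
    by rewrite normrM; apply: ler_pM.
  have h5 : `|H * (e' (y 2 x) * (Xi x j 0 * e0 x + Xi x j 1 * e1 x))| <= Bd * (Ca * (k^-1 * w) * (2 * N)).
    by rewrite normrM; apply: ler_pM.
  by rewrite normrM -[leRHS]mul1r; apply: ler_pM.
apply: le_trans (ler_normD _ _) _; apply: le_trans (lerD g1 g2) _.
by rewrite le_eqVlt; apply/orP; left; apply/eqP; ring.
Qed.

End frame_tests.

(** * Averaging over rotations about the axis *)

Section rotation_average.
Variable R : realType.
Local Notation V3 := 'cV[R]_3.
Variable Q : 'M[R]_3.
Hypothesis QSO : SO3 Q.
Notation y := (yc Q).
Notation P2 := (rad2 Q).
Variables (r rho h : R).
Hypothesis r0 : 0 < r.
Hypothesis rrho : r <= rho.
Hypothesis h0 : 0 < h.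
Notation S := (mulmx Q @` shell rho r h).

Let rot (a : R) : 'M[R]_3 := \matrix_(i, j)
  (if i == 0 then (if j == 0 then cos a else if j == 1 then - sin a else 0)
   else if i == 1 then (if j == 0 then sin a else if j == 1 then cos a else 0)
   else (j == 2)%:R).

Let rotE a (v : V3) : [/\ (rot a *m v) 0 0 = cos a * v 0 0 - sin a * v 1 0,
  (rot a *m v) 1 0 = sin a * v 0 0 + cos a * v 1 0 & (rot a *m v) 2 0 = v 2 0].
Proof. by split; rewrite mxE sum3 !mxE /=; ring. Qed.

Let rot_SO a : SO3 (rot a).
Proof.
have cs := cos2Dsin2 a; split.
  apply/matrixP => i j; rewrite mxE sum3 !mxE.
  by case: (ord3P i) => ->; case: (ord3P j) => ->; rewrite /=; lra.
rewrite det3 !mxE /=; lra.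
Qed.

Let axis_rot a : 'M[R]_3 := Q *m rot a *m Q^T.

Let axis_rot_SO a : SO3 (axis_rot a).
Proof.
have [r1 r2] := rot_SO a; have [q1 q2] := QSO; split.
  rewrite /axis_rot !trmx_mul trmxK !mulmxA -(mulmxA _ Q^T Q) (SO3_trmul QSO) mulmx1.
  by rewrite -(mulmxA _ (rot a)) r1 mulmx1.
by rewrite /axis_rot !det_mulmx det_tr q2 r2 !mulr1.
Qed.

Let yc_rot a k x : y k (axis_rot a *m x) = (rot a *m (Q^T *m x)) k 0.
Proof. by rewrite /yc /axis_rot !mulmxA (SO3_trmul QSO) mul1mx. Qed.

Let yc_rotE a x : [/\ y 0 (axis_rot a *m x) = cos a * y 0 x - sin a * y 1 x,
  y 1 (axis_rot a *m x) = sin a * y 0 x + cos a * y 1 x & y 2 (axis_rot a *m x) = y 2 x].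
Proof. by rewrite !yc_rot; exact: rotE. Qed.

Let rad2_rot a x : P2 (axis_rot a *m x) = P2 x.
Proof.
have [e0 e1 _] := yc_rotE a x; rewrite /rad2 e0 e1.
transitivity ((cos a ^+ 2 + sin a ^+ 2) * (y 0 x ^+ 2 + y 1 x ^+ 2)); first by ring.
by rewrite cos2Dsin2 mul1r.
Qed.

Let rho0 : 0 < rho. Proof. exact: lt_le_trans rrho. Qed.

Let shell_rot a x : S (axis_rot a *m x) <-> S x.
Proof.
split=> /(shellP QSO _ _ rho0 r0) H; apply/(shellP QSO _ _ rho0 r0); move: H;
  by rewrite rad2_rot; have [_ _ ->] := yc_rotE a x.
Qed.

Variables (F i : R -> R) (HF : R -> R -> R).
Hypothesis CF : Cinf F.
Hypothesis pF : periodic2pi F.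
Hypothesis F0 : forall th, 0 <= F th.
Hypothesis Ci : Cinf i.
Hypothesis iE : forall s, r ^+ 2 <= s -> i s = (Num.sqrt s)^-1.
Hypothesis HFE : forall th, 0 <= th <= 2 * pi -> HF (cos th) (sin th) = F th.
Hypothesis mHF : measurable_fun setT (fun z : R * R => HF z.1 z.2).

Let HFall th : - (2 * pi) <= th <= 4 * pi -> 0 <= th -> HF (cos th) (sin th) = F th.
Proof.
move=> /andP[_ th4] th0; have [th2|th2] := leP th (2 * pi); first by rewrite HFE// th0.
have <- : F (th - 2 * pi) = F th by rewrite -(pF (th - _)) subrK.
rewrite -HFE; last by lra.
by have [c s] := periodic_trig (th - 2 * pi); rewrite subrK in c s; rewrite c s.
Qed.

Let f0 x := y 0 x * i (P2 x).
Let f1 x := y 1 x * i (P2 x).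

Let g (x : V3) : R := \1_S x * ((P2 x)^-1 * HF (f0 x) (f1 x)).

Let shell_angle x : S x -> exists2 th, 0 <= th <= 2 * pi & f0 x = cos th /\ f1 x = sin th.
Proof.
move=> /(shellP QSO _ _ rho0 r0)[/andP[rP _] _]; apply: unit_angle.
have p0 : 0 < P2 x by apply: lt_le_trans rP; rewrite exprn_gt0.
rewrite /f0 /f1 !exprMn -mulrDl -/(P2 x) iE// exprVn sqr_sqrtr ?(ltW p0)// mulfV// gt_eqF//.
Qed.

Let gb (b : R) (x : V3) : R := \1_S x * ((P2 x)^-1 *
  HF (cos b * f0 x - sin b * f1 x) (sin b * f0 x + cos b * f1 x)).

Let gbE b x : g (axis_rot b *m x) = gb b x.
Proof.
have [e0 e1 _] := yc_rotE b x; rewrite /g /gb /f0 /f1 rad2_rot e0 e1.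
have -> : \1_S (axis_rot b *m x) = \1_S x :> R.
  by rewrite !indicE; congr (_ %:R); congr nat_of_bool; apply/idP/idP => /set_mem/shell_rot H; exact/mem_set.
by congr (_ * (_ * HF _ _)); ring.
Qed.

Let gb_angle b x : 0 <= b <= 2 * pi -> forall th, 0 <= th <= 2 * pi -> f0 x = cos th -> f1 x = sin th ->
  gb b x = \1_S x * ((P2 x)^-1 * F (th + b)).
Proof.
move=> b2 th th2 c s; rewrite /gb c s.
have -> : cos b * cos th - sin b * sin th = cos (th + b) by rewrite cosD; ring.
have -> : sin b * cos th + cos b * sin th = sin (th + b) by rewrite sinD; ring.
by rewrite HFall//; lra.
Qed.

Let gb_ge0 b x : 0 <= b <= 2 * pi -> 0 <= gb b x.
Proof.
move=> b2; have [Sx|Sx] := pselect (S x); last first.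
  by rewrite /gb indicE memNset// mul0r.
have [th th2 [c s]] := shell_angle Sx; rewrite (gb_angle b2 th2 c s).
by rewrite !mulr_ge0// invr_ge0 rad2_ge0.
Qed.

Let g_ge0 x : 0 <= g x.
Proof.
have [Sx|Sx] := pselect (S x); last by rewrite /g indicE memNset// mul0r.
by have [th th2 [c s]] := shell_angle Sx; rewrite /g c s HFE// !mulr_ge0// invr_ge0 rad2_ge0.
Qed.

Let mS : measurable (S : set (borel V3)) := measurable_shell QSO h rho0 r0.

Let m_f : measurable_fun setT (f0 : borel V3 -> R) /\ measurable_fun setT (f1 : borel V3 -> R).
Proof.
by split; apply: measurable_S3; apply: S3_mul; [exact: S3_yc|exact: (S3_comp Ci (S3_rad2 Q))|exact: S3_yc|exact: (S3_comp Ci (S3_rad2 Q))].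
Qed.

Let m_base : measurable_fun setT (fun x : borel V3 => \1_S x * (P2 x)^-1 : R).
Proof. by apply: measurable_funM; [exact: measurable_indic|exact: measurable_rad2V]. Qed.

Let m_g : measurable_fun setT (g : borel V3 -> R).
Proof.
have [m0 m1] := m_f.
have -> : g = fun x => \1_S x * (P2 x)^-1 * HF (f0 x) (f1 x) by apply/funext => x; rewrite /g mulrA.
apply: measurable_funM => //.
exact: (measurableT_comp mHF (measurable_fun_pair m0 m1)).
Qed.

Notation mu := (@lebesgue_measure R).
Notation arc := ([set` `]0%R, (2 * pi)%R[] : set R).

Let joint (z : (measurableTypeR R) * ((measurableTypeR R) * (measurableTypeR R) * (measurableTypeR R))) : R :=
  \1_arc z.1 * gb z.1 (vec3 z.2).

Let m_joint : measurable_fun setT joint.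
Proof.
have [m0 m1] := m_f.
have v2 : measurable_fun setT (fun z : (measurableTypeR R) * ((measurableTypeR R) * (measurableTypeR R) * (measurableTypeR R)) => vec3 z.2 : borel V3).
  exact: (measurableT_comp (@measurable_vec3 R) measurable_snd).
have c1 : measurable_fun setT (fun z : (measurableTypeR R) * ((measurableTypeR R) * (measurableTypeR R) * (measurableTypeR R)) => cos z.1).
  apply: (measurableT_comp _ measurable_fst); apply: continuous_measurable_fun; exact: continuous_cos.
have s1 : measurable_fun setT (fun z : (measurableTypeR R) * ((measurableTypeR R) * (measurableTypeR R) * (measurableTypeR R)) => sin z.1).
  apply: (measurableT_comp _ measurable_fst); apply: continuous_measurable_fun; exact: continuous_sin.
have w0 := measurableT_comp m0 v2; have w1 := measurableT_comp m1 v2.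
have -> : joint = fun z => \1_arc z.1 * ((\1_S (vec3 z.2) * (P2 (vec3 z.2))^-1) *
    HF (cos z.1 * f0 (vec3 z.2) - sin z.1 * f1 (vec3 z.2)) (sin z.1 * f0 (vec3 z.2) + cos z.1 * f1 (vec3 z.2))).
  by apply/funext => z; rewrite /joint /gb; congr (_ * _); rewrite mulrA.
apply: measurable_funM.
  have mi : measurable_fun [set: measurableTypeR R] (\1_arc : measurableTypeR R -> R).
    by apply: measurable_indic; exact: (@measurable_arc R).
  by apply: (measurableT_comp mi); exact: measurable_fst.
apply: measurable_funM; first exact: (measurableT_comp m_base v2).
have p1 := measurable_funB (measurable_funM c1 w0) (measurable_funM s1 w1).
have p2 := measurable_funD (measurable_funM s1 w0) (measurable_funM c1 w1).
exact: (measurableT_comp mHF (measurable_fun_pair p1 p2)).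
Qed.

Let joint_ge0 z : 0 <= joint z.
Proof.
rewrite /joint; have [a1|a1] := pselect (arc z.1); last by rewrite indicE memNset// mul0r.
by rewrite mulr_ge0// gb_ge0//; exact: arc_itv.
Qed.

(** Average over all rotations about the axis and exchange the integrals: at each
    point of the shell the angular integral is that of [F] over a full period,
    whatever the angle at which it starts. *)
Lemma rotation_average :
  (\int[@leb3 R]_(x in S) ((P2 x)^-1 * HF (f0 x) (f1 x))%:E <= (circ F * h * ln (rho / r))%:E)%E.
Proof.
have E1 : (\int[@leb3 R]_(x in S) ((P2 x)^-1 * HF (f0 x) (f1 x))%:E = \int[@leb3 R]_x (g x)%:E)%E.
  rewrite integral_mkcond; apply: eq_integral => x _; rewrite patchE /g indicE.
  by case: (x \in S); rewrite ?mul1r ?mul0r.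
have mgE : measurable_fun setT (fun x : borel V3 => (g x)%:E) by exact/measurable_EFinP.
have Eb b : (\int[lebesgue3 R]_p (gb b (vec3 p))%:E = \int[@leb3 R]_x (g x)%:E)%E.
  rewrite -(preserves_rotation (axis_rot_SO b) mgE); last by move=> x; rewrite lee_fin g_ge0.
  rewrite ge0_integral_leb3.
  - by apply: eq_integral => p _; rewrite gbE.
  - have mr : measurable_fun setT (fun x : borel V3 => axis_rot b *m x : borel V3) by exact: measurable_rotation.
    exact: (measurableT_comp mgE mr).
  - by move=> x; rewrite lee_fin g_ge0.
set I := (\int[@leb3 R]_x (g x)%:E)%E in E1 Eb *.
have I0 : (0 <= I)%E by apply: integral_ge0 => x _; rewrite lee_fin g_ge0.
have ton := @fubini_tonelli _ _ _ _ _ (@lebesgue_measure R) (lebesgue3 R) (EFin \o joint) (proj2 (measurable_EFinP _ _) m_joint) (fun z => joint_ge0 z : (0 <= (joint z)%:E)%E).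
have Lt : (\int[mu]_b \int[lebesgue3 R]_p (joint (b, p))%:E = (2 * pi)%:E * I)%E.
  transitivity (\int[mu]_(b in arc) I)%E; last first.
    rewrite integral_cst//=.
    have E := @lebesgue_measure_itv R `]0, (2 * pi)[.
    rewrite muleC; congr (_ * _)%E; apply: (etrans E); by rewrite /= lte_fin pi2_gt0 -EFinB subr0.
  rewrite [RHS]integral_mkcond; apply: eq_integral => b _; rewrite patchE.
  case: ifPn => [/set_mem ab|ab].
    rewrite -(Eb b); apply: eq_integral => p _.
    by rewrite /joint /= indicE mem_set// mul1r.
  by apply: integral0_eq => p _; rewrite /joint /= indicE (negPf ab) mul0r.
have Rt : (\int[lebesgue3 R]_p \int[mu]_b (joint (b, p))%:E = (circ F)%:E * shell_log Q r rho h)%E.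
  have mB : measurable_fun setT (fun x : borel V3 => (\1_S x * (P2 x)^-1)%:E : \bar R) by exact/measurable_EFinP.
  have B0 x : (0 <= (\1_S x * (P2 x)^-1 : R)%:E)%E by rewrite lee_fin mulr_ge0// invr_ge0 rad2_ge0.
  have -> : shell_log Q r rho h = (\int[@leb3 R]_x (\1_S x * (P2 x)^-1)%:E)%E.
    rewrite /shell_log integral_mkcond; apply: eq_integral => x _; rewrite patchE indicE.
    by case: (x \in S); rewrite ?mul1r ?mul0r.
  rewrite (ge0_integral_leb3 mB B0).
  rewrite -ge0_integralZl//; last 2 first.
    exact: (measurableT_comp mB (@measurable_vec3 R)).
    by rewrite lee_fin circ_ge0.
  apply: eq_integral => p _.
  have [Sx|Sx] := pselect (S (vec3 p)); last first.
    rewrite [in RHS]indicE memNset// mul0r mule0; apply: integral0_eq => b _.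
    by rewrite /joint /gb /= [\1_S _]indicE memNset// mul0r mulr0.
  have [th th2 [c s]] := shell_angle Sx; rewrite [in RHS]indicE mem_set// mul1r.
  transitivity (\int[mu]_(b in arc) ((P2 (vec3 p))^-1 * F (th + b))%:E)%E.
    rewrite [RHS]integral_mkcond; apply: eq_integral => b _; rewrite patchE /joint /=.
    case: ifPn => [/set_mem ab|ab]; last by rewrite indicE (negPf ab) mul0r.
    by rewrite indicE mem_set// mul1r (gb_angle (arc_itv ab) th2 c s) indicE mem_set// mul1r.
  have CFt : Cinf (fun b => F (th + b)).
    have := Cinf_comp CF (Cinf_affine 1 th); congr Cinf; apply/funext => x /=; congr F; ring.
  have it := Cinf_cintegrable (CinfM (Cinf_cst (P2 (vec3 p))^-1) CFt).
  have FE := fineK (integrable_fin_num (@measurable_arc R) it).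
  transitivity ((circ (fun b => (P2 (vec3 p))^-1 * F (th + b)))%:E); first exact: (esym FE).
  by rewrite circZ ?(circ_shift th CF pF) -?EFinM 1?mulrC//; exact: Cinf_cintegrable.
have E2 : ((2 * pi)%:E * I = (circ F)%:E * shell_log Q r rho h)%E.
  by rewrite -Lt -Rt; exact: ton.
rewrite E1 -(@lee_pmul2l _ (2 * pi)%:E) ?lte_fin ?pi2_gt0// E2.
apply: (@le_trans _ _ ((circ F)%:E * (2 * pi * h * ln (rho / r))%:E)%E).
  apply: lee_wpmul2l; first by rewrite lee_fin circ_ge0.
  exact: shell_log_bound.
by rewrite -!EFinM lee_fin le_eqVlt; apply/orP; left; apply/eqP; ring.
Qed.

End rotation_average.

(** * The field on the transition layers *)

Section monotone.
Context d (T : measurableType d) (R : realType).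

Lemma ge0_integral_mono (mu : {measure set T -> \bar R}) (D : set T) (f g : T -> \bar R) :
  (forall x, (0 <= f x)%E) -> (forall x, (0 <= g x)%E) -> (forall x, D x -> (f x <= g x)%E) ->
  (\int[mu]_(x in D) f x <= \int[mu]_(x in D) g x)%E.
Proof.
move=> f0 g0 fg; rewrite !ge0_integralE//.
apply: le_ereal_sup => _ [h hf <-]; exists h => // x; apply: (le_trans (hf x)).
by rewrite !patchE; case: ifPn => // /set_mem; exact: fg.
Qed.

Lemma integral_ge_Rintegral (mu : {measure set T -> \bar R}) (D : set T) (g v : T -> R) : measurable D ->
  rintegrable mu D g -> (forall x, 0 <= v x) -> (forall x, D x -> g x <= v x) ->
  ((\int[mu]_(x in D) g x)%:E <= \int[mu]_(x in D) (v x)%:E)%E.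
Proof.
move=> mD ig v0 gv.
have E : (\int[mu]_(x in D) g x)%:E = (\int[mu]_(x in D) (EFin \o g) x)%E.
  by rewrite /Rintegral fineK//; exact: (integrable_fin_num mD ig).
rewrite E integralE.
apply: (@le_trans _ _ (\int[mu]_(x in D) ((EFin \o g)^\+ x))%E).
  rewrite leeBlDr; last by exact: (integrable_fin_num mD (integrable_funeneg mD ig)).
  by apply: leeDl; apply: integral_ge0 => x _; exact: funeneg_ge0.
apply: ge0_integral_mono => x; first exact: funepos_ge0.
  by rewrite lee_fin.
by move=> Dx; rewrite funeposE ge_max !lee_fin gv// v0.
Qed.

End monotone.

Section shell_estimate.
Variable R : realType.
Local Notation V3 := 'cV[R]_3.
Variable Q : 'M[R]_3.
Hypothesis QSO : SO3 Q.
Variables (p r rho h : R).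
Hypothesis hp : 1 < p <= 2.
Hypothesis r0 : 0 < r.
Hypothesis rrho : 2 * r <= rho.
Hypothesis rhoh : rho <= h.
Variable xi : V3 -> 'M[R]_3.
Notation P2 := (rad2 Q).
Notation T := (mulmx Q @` tube rho h).
Notation S := (mulmx Q @` shell rho r h).
Notation w := (transition_weight Q r rho).
Notation W x := (Phi p (enorm (xi x))).

Let rho0 : 0 < rho. Proof. by apply: lt_le_trans rrho; rewrite mulr_gt0. Qed.
Let h0 : 0 < h. Proof. exact: lt_le_trans rho0 rhoh. Qed.
Let mS : measurable (S : set (borel V3)) := measurable_shell QSO h rho0 r0.
Let mT : measurable (T : set (borel V3)) := measurable_tube QSO h rho0.
Hypothesis L1xi : L1_fun T xi.
Variable K0 : R.
Hypothesis PhiK : (L1_norm S (fun x => W x) <= K0%:E)%E.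

Lemma shell_sub_tube : S `<=` T.
Proof. by move=> x /(shellP QSO _ _ rho0 r0)[/andP[_ h1] h2]; exact/(tubeP QSO). Qed.

Lemma Rintegral_tube_shell (f : V3 -> R) : (forall x, T x -> ~ S x -> f x = 0) ->
  \int[@leb3 R]_(x in T) f x = \int[@leb3 R]_(x in S) f x.
Proof.
move=> f0; rewrite Rintegral_mkcond [RHS]Rintegral_mkcond; congr (Rintegral _ _ _).
apply/funext => x; rewrite !patchE.
have [Sx|nSx] := pselect (S x); first by rewrite !mem_set//; exact: shell_sub_tube.
rewrite [x \in S]memNset//; case: ifPn => // /set_mem Tx; exact: f0.
Qed.

Lemma rintegrable_shell (f : V3 -> R) : rintegrable (@leb3 R) T f -> rintegrable (@leb3 R) S f.
Proof. by move=> i; apply: integrableS i => //; exact: shell_sub_tube. Qed.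

Lemma measurable_energy : measurable_fun (S : set (borel V3)) (fun x : borel V3 => W x).
Proof.
have me : measurable_fun (S : set (borel V3)) (fun x : borel V3 => enorm (xi x)).
  have ms : measurable_fun (S : set (borel V3)) (fun x : borel V3 => \sum_i \sum_j xi x i j * xi x i j).
    apply: measurable_sum => i; apply: measurable_sum => j.
    have mij : measurable_fun (S : set (borel V3)) (fun x : borel V3 => xi x i j).
      have [+ _] := integrableP _ _ _ (rintegrable_shell (L1xi i j)).
      by move/measurable_EFinP.
    exact: measurable_funM.
  apply: (measurableT_comp _ ms); apply: continuous_measurable_fun => x; exact: sqrt_continuous.
apply: measurable_minr; last exact: measurable_funX.
exact: (measurableT_comp (measurable_powR p) me).
Qed.

Lemma integrable_energy : rintegrable (@leb3 R) S (fun x => W x) /\ \int[@leb3 R]_(x in S) W x <= K0.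
Proof.
have E : (L1_norm S (fun x => W x) = \int[@leb3 R]_(x in S) (W x)%:E)%E.
  by apply: eq_integral => x _; rewrite ger0_norm// Phi_ge0.
have i : rintegrable (@leb3 R) S (fun x => W x).
  apply/integrableP; split; first by apply/measurable_EFinP; exact: measurable_energy.
  by apply: le_lt_trans PhiK (ltry K0).
split=> //; rewrite -lee_fin; apply: le_trans PhiK; rewrite E /Rintegral fineK//.
exact: (integrable_fin_num mS i).
Qed.

Lemma enorm_le_Phi (s : R) de : 0 < de -> de <= 1 -> de < s -> s <= Phi p s / de.
Proof.
move=> d0 d1 ds; have s0 : 0 <= s by exact: le_trans (ltW d0) (ltW ds).
rewrite ler_pdivlMr//; have [s1|s1] := leP s 1.
  by rewrite (Phi_small hp) ?s0// expr2 ler_wpM2l// ltW.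
by apply: le_trans (Phi_large hp (ltW s1)); rewrite ler_piMr.
Qed.

Lemma entry_sum_enorm (A : 'M[R]_3) : entry_sum A <= 9 * enorm A.
Proof.
rewrite /entry_sum !sum3; have e := @entry_le R A.
have := e 0 0; have := e 0 1; have := e 0 2; have := e 1 0; have := e 1 1; have := e 1 2.
have := e 2 0; have := e 2 1; have := e 2 2; lra.
Qed.

(** Where |xi| <= 1 the energy is |xi|^2, and Young gives
    |xi| w <= a |xi|^2 / 2 + w^2 / (2 a); where |xi| >= 1 the energy dominates
    |xi|, and w <= 2/r. The integral of w^2 is of order h, since w is 1/r on a
    volume r^2 h and 1/rho on a volume rho^2 h. *)
Lemma transition_integral (a : R) : 0 < a ->
  \int[@leb3 R]_(x in T) (entry_sum (xi x) * w x) <= 9 * ((a / 2 + 2 / r) * K0 + 4 * pi * h / a).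
Proof.
move=> a0; have [iW WK] := integrable_energy.
have out x : T x -> ~ S x -> w x = 0.
  move=> /(tubeP QSO _ _ rho0)[h1 h2] nS; rewrite /transition_weight ifF//; apply/negP => rP.
  by apply: nS; apply/(shellP QSO _ _ rho0 r0); rewrite rP h1.
rewrite Rintegral_tube_shell; last by move=> x Tx nSx; rewrite out ?mulr0.
pose S2 := mulmx Q @` shell (2 * r) r h.
have mS2 : measurable (S2 : set (borel V3)) by apply: measurable_shell => //; rewrite mulr_gt0.
have r2 : 0 < 2 * r by rewrite mulr_gt0.
pose v (x : V3) := 2 * (r ^- 2 * \1_S2 x + rho ^- 2).
have finS : (@leb3 R S < +oo)%E.
  by rewrite leb3_shell ?ltry//; apply: le_trans rrho; rewrite ler_peMl ?(ltW r0)// ler1n.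
have mv : measurable_fun (S : set (borel V3)) (v : borel V3 -> R).
  apply: measurable_funTS; apply: measurable_funM => //; apply: measurable_funD => //.
  by apply: measurable_funM => //; exact: measurable_indic.
have ri2 : 0 <= r ^- 2 by rewrite invr_ge0 exprn_ge0// ltW.
have rhoi2 : 0 <= rho ^- 2 by rewrite invr_ge0 exprn_ge0// ltW.
have i1 : rintegrable (@leb3 R) S (\1_S2 : V3 -> R).
  have mi : measurable_fun (S : set (borel V3)) (\1_S2 : borel V3 -> R).
    by apply: measurable_funTS; exact: measurable_indic.
  apply: (rintegrable_bounded mS (M := 1) finS mi) => x _.
  by rewrite indicE; case: (_ \in _); rewrite ?normr1 ?normr0.
have ic (c : R) : rintegrable (@leb3 R) S (fun=> c).
  by apply: (rintegrable_bounded mS (M := `|c|)).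
have iz := rintegrableZ mS (r ^- 2) i1.
have iv : rintegrable (@leb3 R) S v := rintegrableZ mS 2 (rintegrableD mS iz (ic (rho ^- 2))).
have Iv : \int[@leb3 R]_(x in S) v x <= 8 * pi * h.
  rewrite /v (RintegralZ mS 2 (rintegrableD mS iz (ic (rho ^- 2)))) (RintegralD mS iz (ic (rho ^- 2))).
  have rl : r <= rho by apply: le_trans rrho; rewrite ler_peMl ?(ltW r0)// ler1n.
  have eS : fine (@leb3 R S) = pi * (rho ^+ 2 - r ^+ 2) * h by rewrite (leb3_shell QSO r0 rl h0).
  have ec : \int[@leb3 R]_(x in S) (rho ^- 2) = rho ^- 2 * (pi * (rho ^+ 2 - r ^+ 2) * h).
    by rewrite (Rintegral_cst _ mS); congr (_ * _); exact: eS.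
  rewrite (RintegralZ mS _ i1) ec.
  have -> : \int[@leb3 R]_(x in S) (\1_S2 x : R) = fine (@leb3 R (S2 `&` S)).
    by rewrite /Rintegral integral_indic.
  have -> : S2 `&` S = S2.
    apply/setIidPl => x /(shellP QSO _ _ r2 r0)[/andP[x1 x2] x3]; apply/(shellP QSO _ _ rho0 r0).
    split=> //; rewrite x1 (lt_le_trans x2)// ler_pXn2r ?nnegrE ?(ltW rho0) ?(ltW r2)//.
  have r22 : r <= 2 * r by rewrite ler_peMl ?(ltW r0)// ler1n.
  rewrite (leb3_shell QSO r0 r22 h0).
  rewrite /=.
  have ph : 0 <= pi * h by rewrite mulr_ge0 ?pi_ge0 ?(ltW h0).
  have e1 : r ^- 2 * (pi * ((2 * r) ^+ 2 - r ^+ 2) * h) = 3 * (pi * h) by move: (pi : R) => q; field; rewrite gt_eqF.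
  have e2 : rho ^- 2 * (pi * (rho ^+ 2 - r ^+ 2) * h) <= pi * h.
    have -> : rho ^- 2 * (pi * (rho ^+ 2 - r ^+ 2) * h) = pi * h - rho ^- 2 * r ^+ 2 * (pi * h).
      by move: (pi : R) => q; field; rewrite gt_eqF.
    by rewrite gerBl; apply: mulr_ge0 => //; apply: mulr_ge0 => //; rewrite exprn_ge0// ltW.
  rewrite e1; lra.
pose bd x := 9 * ((a / 2 + 2 / r) * W x + (2 * a)^-1 * v x).
have a2 : 0 <= (2 * a)^-1 by rewrite invr_ge0 mulr_ge0// ltW.
have iz1 := rintegrableZ mS (a / 2 + 2 / r) iW; have iz2 := rintegrableZ mS (2 * a)^-1 iv.
have ibd : rintegrable (@leb3 R) S bd := rintegrableZ mS 9 (rintegrableD mS iz1 iz2).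
apply: (@le_trans _ _ (\int[@leb3 R]_(x in S) bd x)).
  apply: (le_Rintegral mS (rintegrable_shell (integrable_transition QSO r0 rrho L1xi)) ibd).
  move=> x Sx; have [/andP[rP _] _] := (proj1 (shellP QSO _ _ rho0 r0) Sx).
  have ri : 0 < r^-1 by rewrite invr_gt0.
  have rhoi : 0 < rho^-1 by rewrite invr_gt0.
  have rr : rho^-1 <= r^-1 by rewrite lef_pV2 ?posrE//; apply: le_trans rrho; rewrite ler_peMl ?(ltW r0)// ler1n.
  have w0 : 0 <= w x by rewrite /transition_weight rP; case: ifP => _; lra.
  have w2 : w x <= 2 / r by rewrite /transition_weight rP; case: ifP => _; lra.
  have wv : w x ^+ 2 <= v x.
    rewrite /transition_weight rP /v -!exprVn.
    have q := sqr_ge0 (r^-1 - rho^-1); have q2 := sqr_ge0 (rho^-1); have q3 := sqr_ge0 (r^-1).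
    case: ifP => pr.
      have -> : \1_S2 x = 1 :> R.
        rewrite indicE mem_set//; apply/(shellP QSO _ _ r2 r0); split; first by rewrite rP exprMn /=; lra.
        by have [] := (proj1 (shellP QSO _ _ rho0 r0) Sx).
      lra.
    have : 0 <= \1_S2 x :> R by [].
    by move=> /(mulr_ge0 q3); lra.
  have e9 := ler_wpM2r w0 (entry_sum_enorm (xi x)).
  apply: (le_trans e9); rewrite /bd -mulrA ler_pM2l//.
  have W0 := Phi_ge0 p (enorm (xi x)); have n0 := enorm_ge0 (xi x).
  have av : (2 * a)^-1 * w x ^+ 2 <= (2 * a)^-1 * v x by exact: ler_wpM2l.
  have [n1|n1] := leP (enorm (xi x)) 1.
    have We : W x = enorm (xi x) ^+ 2 by rewrite (Phi_small hp) ?n0.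
    have y : enorm (xi x) * w x <= a / 2 * enorm (xi x) ^+ 2 + (2 * a)^-1 * w x ^+ 2.
      rewrite -subr_ge0; have := mulr_ge0 a2 (sqr_ge0 (a * enorm (xi x) - w x)).
      by congr (0 <= _); field; rewrite gt_eqF.
    have : 0 <= 2 / r * W x by rewrite mulr_ge0// mulr_ge0// ltW.
    by rewrite We in W0 *; lra.
  have h1 : enorm (xi x) * w x <= W x * (2 / r) by apply: ler_pM => //; exact: (Phi_large hp (ltW n1)).
  have h2 : 0 <= a / 2 * W x by rewrite mulr_ge0// divr_ge0// ltW.
  have h3 : 0 <= (2 * a)^-1 * w x ^+ 2 by rewrite mulr_ge0 ?sqr_ge0.
  by rewrite mulrDl; lra.
rewrite /bd (RintegralZ mS 9 (rintegrableD mS iz1 iz2)) ler_pM2l// (RintegralD mS iz1 iz2).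
rewrite (RintegralZ mS _ iW) (RintegralZ mS _ iv); apply: lerD.
  by apply: ler_wpM2l => //; rewrite addr_ge0 ?divr_ge0 ?(ltW a0) ?(ltW r0).
apply: le_trans (ler_wpM2l a2 Iv) _; rewrite le_eqVlt; apply/orP; left; apply/eqP.
by move: (pi : R) => q; field; rewrite gt_eqF.
Qed.

End shell_estimate.

(** * The lower bound for a fixed cutoff *)

Section lower_bound.
Variable R : realType.
Local Notation M := 'M[R]_3.
Local Notation V3 := 'cV[R]_3.
Variables (V : M -> R) (p c0 K : R).
Hypothesis hp : 1 < p <= 2.
Hypothesis V_ge0 : forall F, 0 <= V F.
Hypothesis V2 : twice_differentiable_near V 0.
Hypothesis c00 : 0 < c0.
Hypothesis K_gt0 : 0 < K.
Hypothesis low : forall A, c0 * nrm2 (A + A^T) <= quad V A.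
Hypothesis up : forall A, quad V A <= K * nrm2 A.
Variables (om d : R).
Hypothesis om0 : 0 < om.
Hypothesis d0 : 0 < d.
Hypothesis d1 : d <= 1.
Hypothesis taylor_d : forall F, enorm F <= d -> `|V F - 2^-1 * quad V F| <= om * nrm2 F.

(** Small matrices fall under the Taylor expansion and the duality of the form. For
    large ones [V >= 0] suffices: the linear term is at most [K * sc * |A|], and
    |A| is controlled by the energy divided by [d]. *)
Lemma pointwise_bound (X A : M) (ph sc : R) : 0 <= ph <= 1 -> enorm X <= sc ->
  ph * polar V X A - ph * (2^-1 * quad V X) - (om + K * sc / d) * Phi p (enorm A) <= V A.
Proof.
move=> /andP[p0 p1] Xs.
have be_low A' : c0 * nrm2 (A' + A'^T) <= polar V A' A' by rewrite polarE.
have sc0 : 0 <= sc by apply: le_trans Xs; exact: enorm_ge0.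
have qX : 0 <= quad V X by exact: (quad_ge0 c00 low).
have P0 := Phi_ge0 p (enorm A); have n0 := enorm_ge0 A.
have KsP : 0 <= K * sc / d * Phi p (enorm A).
  by apply: mulr_ge0 => //; apply: divr_ge0; [exact: mulr_ge0 (ltW K_gt0) sc0|exact: ltW].
have omP : 0 <= om * Phi p (enorm A) by exact: mulr_ge0 (ltW om0) P0.
have [Ad|Ad] := leP (enorm A) d.
  have PE : Phi p (enorm A) = nrm2 A by rewrite (Phi_small hp) ?n0 ?(le_trans Ad)// sqr_enorm.
  have := taylor_d Ad; rewrite ler_distl -PE => /andP[t1 _].
  have du := quad_duality V2 c00 low X A.
  have h1 : ph * (polar V X A - 2^-1 * quad V X) <= ph * (2^-1 * quad V A) by exact: ler_wpM2l.
  have qA : 0 <= quad V A by exact: (quad_ge0 c00 low).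
  have h2 : ph * (2^-1 * quad V A) <= 2^-1 * quad V A by rewrite ler_piMl// mulr_ge0.
  lra.
have AP := enorm_le_Phi hp d0 d1 Ad.
have pXA : polar V X A <= K * sc * enorm A.
  have sq := be_sqr c00 (polarD V2) (polarZ V2) (polarC V) be_low X A; rewrite !polarE in sq.
  have q1 : quad V X <= K * sc ^+ 2.
    apply: (le_trans (up X)); rewrite ler_pM2l// -sqr_enorm ler_pXn2r ?nnegrE ?enorm_ge0//.
  have q2 : quad V A <= K * enorm A ^+ 2 by rewrite sqr_enorm; exact: up.
  have qA : 0 <= quad V A by exact: (quad_ge0 c00 low).
  have q3 := ler_pM qX qA q1 q2.
  have T0 : 0 <= K * sc * enorm A by rewrite !mulr_ge0// ltW.
  have [|/ltW pn] := leP (polar V X A) 0; first by move=> /le_trans; apply.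
  rewrite -(@ler_pXn2r _ 2) ?nnegrE//; apply: (le_trans sq); apply: (le_trans q3).
  by rewrite le_eqVlt; apply/orP; left; apply/eqP; ring.
have h1 : ph * polar V X A <= K * sc / d * Phi p (enorm A).
  have h3 : K * sc * enorm A <= K * sc / d * Phi p (enorm A).
    rewrite -!mulrA; do 2!(apply: ler_wpM2l; rewrite ?(ltW K_gt0)//).
    by rewrite mulrC in AP *.
  have h4 : ph * polar V X A <= ph * (K * sc / d * Phi p (enorm A)).
    by apply: ler_wpM2l => //; apply: le_trans pXA h3.
  by apply: (le_trans h4); rewrite ler_piMl.
have h2 : 0 <= ph * (2^-1 * quad V X) by rewrite !mulr_ge0.
have := V_ge0 A; lra.
Qed.

Variables (C : R) (Qf : V3 -> M) (b t : V3) (E : R) (G : R -> M) (l : V3) (m n k : R -> V3).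
Hypothesis C0 : 0 <= C.
Local Notation Q := (Qf t).
Hypothesis QSO : SO3 Q.
Hypothesis Qt : Q *m e3 R = t.
Hypothesis t1 : enorm t = 1.
Hypothesis cellE : [/\ psi Qf (hessian V 0) b t <= E, 2 * E = dotv l b & E <= C * enorm b ^+ 2].
Hypothesis cellq : [/\ Cinf (fun th => quad V (G th)), periodic2pi (fun th => quad V (G th)),
          circ (fun th => quad V (G th)) = 2 * E &
          forall th, nrm2 (G th) <= (C * enorm b) ^+ 2].
Hypothesis cellp : forall th A, polar V (G th) A = dotv l (A *m Q *m e_theta th) +
        dotv (m th) (A *m Q *m e_r th) + dotv (n th) (A *m Q *m e3 R).
Hypothesis cellb : forall i, [/\ `|l i 0| <= C * enorm b,
        [/\ Cinf (fun th => m th i 0), periodic2pi (fun th => m th i 0) & forall th, `|m th i 0| <= C * enorm b],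
        [/\ Cinf (fun th => n th i 0), periodic2pi (fun th => n th i 0) & forall th, `|n th i 0| <= C * enorm b] &
        [/\ Cinf (fun th => k th i 0), periodic2pi (fun th => k th i 0),
            forall th : R, is_derive th 1 (fun th => k th i 0) (m th i 0) &
            forall th, 0 <= th <= 2 * pi -> `|k th i 0| <= C * enorm b]].
Variables (r rho h eps : R) (xi : V3 -> M).
Hypothesis r0 : 0 < r.
Hypothesis rrho : 2 * r <= rho.
Hypothesis rhoh : rho <= h.
Hypothesis eps0 : 0 < eps.
Notation T := (mulmx Q @` tube rho h).
Notation S := (mulmx Q @` shell rho r h).
Hypothesis L1xi : L1_fun T xi.
Hypothesis curlxi : curl_eq_hausdorff1 T xi (eps *: otimes b t) (line t `&` T).
Variables (Kphi Ca Cr ka : R) (phi phi' i i' PP D Er e e' : R -> R).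
Hypothesis PhiK : (L1_norm S (fun x => Phi p (enorm (xi x))) <= Kphi%:E)%E.
Hypothesis Ca0 : 0 <= Ca.
Hypothesis Cr0 : 0 <= Cr.
Hypothesis ka0 : 0 < ka.
Hypothesis ka4 : 4 * ka <= 1.
Hypothesis radial : radial_spec Cr r rho phi phi' i i' PP D Er.
Hypothesis axial : axial_spec Ca ka h e e'.
Notation B := (enorm b).
Notation P2 := (rad2 Q).
Notation y := (yc Q).
Notation Xi x := (xi x *m Q).
Notation wt x := (phi (P2 x) * i (P2 x) * e (y 2 x)).
Notation c_ := (e0 Q i).
Notation s_ := (e1 Q i).

(** The pointwise bound integrated over the shell, with the three curl tests for the
    linear term and the rotation average for the quadratic one. *)
Lemma energy_lower_bound : exists2 Mz : R,
  2^-1 * (ln (rho ^+ 2 / 4) - ln (2 * r ^+ 2)) * ((1 - 4 * ka) * h) <= Mz &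
  ((eps ^+ 2 * (2 * E * Mz) - eps * (3 * (5 * Cr + 2 * Ca / ka) * (C * B)) *
      \int[@leb3 R]_(x in T) (entry_sum (xi x) * transition_weight Q r rho x)
    - eps ^+ 2 * (E * h * ln (rho / r)) - (om + K * (eps * r^-1 * (C * B)) / d) * Kphi)%:E <=
   \int[@leb3 R]_(x in S) (V (xi x))%:E)%E.
Proof.
have rho0 : 0 < rho by apply: lt_le_trans rrho; rewrite mulr_gt0.
have h0 : 0 < h by exact: lt_le_trans rho0 rhoh.
have rr : r <= rho by apply: le_trans rrho; rewrite ler_peMl ?(ltW r0)// ler1n.
have mT : measurable (T : set (borel V3)) := measurable_tube QSO h rho0.
have mS : measurable (S : set (borel V3)) := measurable_shell QSO h rho0 r0.
have Bd0 : 0 <= C * B by rewrite mulr_ge0// sqrtr_ge0.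
have [Mz Mlow az] := azimuthal_test QSO r0 rrho rhoh Qt t1 L1xi curlxi ka0 ka4 radial axial.
exists Mz => //.
have [Cq pq cq Gb] := cellq.
have [Hq [HqE mHq _ _]] : exists H : R -> R -> R, [/\ forall th, 0 <= th <= 2 * pi -> H (cos th) (sin th) = quad V (G th),
   measurable_fun setT (fun z : R * R => H z.1 z.2), True & True].
  have [q' _ dq] := CinfP Cq; have [H [H1 H2 _ _]] := periodic_lift Cq dq pq; by exists H.
have /choice[Hm HmP] j : exists H : R -> R -> R, (forall th, 0 <= th <= 2 * pi -> H (cos th) (sin th) = m th j 0) /\
    forall f g : V3 -> R, S3 f -> S3 g -> S3 (fun x => H (f x) (g x)).
  have [_ [Cm pm _] _ _] := cellb j; have [q' _ dq] := CinfP Cm.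
  by have [H [H1 H2 H3 _]] := periodic_lift Cm dq pm; exists H.
have rad j := cellb j.
have radt j : rintegrable (@leb3 R) T (fun x => wt x * Hm j (c_ x) (s_ x) * (Xi x j 0 * c_ x + Xi x j 1 * s_ x)) /\
  `|\int[@leb3 R]_(x in T) (wt x * Hm j (c_ x) (s_ x) * (Xi x j 0 * c_ x + Xi x j 1 * s_ x)) - 0| <=
  \int[@leb3 R]_(x in T) (4 * Cr * (C * B) * (entry_sum (xi x) * transition_weight Q r rho x)).
  have [_ [Cm pm _] _ [Ck pk dk bk]] := cellb j; have [Hm1 Hm2] := HmP j.
  have [Hk [Hk1 _ Hk3 Hk4]] := periodic_lift Ck dk pk.
  exact: (radial_test QSO r0 rrho rhoh Qt L1xi curlxi ka0 radial axial Ck Cm dk bk Bd0 Hk1 Hm1 Hk3 Hm2 Hk4 j).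
have /choice[Hn HnP] j : exists H : R -> R -> R, (forall th, 0 <= th <= 2 * pi -> H (cos th) (sin th) = n th j 0) /\
  (rintegrable (@leb3 R) T (fun x => wt x * H (c_ x) (s_ x) * Xi x j 2) /\
  `|\int[@leb3 R]_(x in T) (wt x * H (c_ x) (s_ x) * Xi x j 2) - 0| <=
  \int[@leb3 R]_(x in T) ((Cr + 2 * Ca / ka) * (C * B) * (entry_sum (xi x) * transition_weight Q r rho x))).
  have [_ _ [Cn pn bn] _] := cellb j; have [q' _ dq] := CinfP Cn.
  have [H [H1 _ H3 H4]] := periodic_lift Cn dq pn; exists H; split=> //.
  exact: (axial_test QSO r0 rrho rhoh Qt L1xi curlxi Ca0 Cr0 ka0 radial axial Cn dq bn H1 H3 H4 j).
pose Aj (j : 'I_3) (x : V3) := l j 0 * (wt x * (Xi x j 1 * c_ x - Xi x j 0 * s_ x)) +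
   wt x * Hm j (c_ x) (s_ x) * (Xi x j 0 * c_ x + Xi x j 1 * s_ x) + wt x * Hn j (c_ x) (s_ x) * Xi x j 2.
set Iw := \int[@leb3 R]_(x in T) (entry_sum (xi x) * transition_weight Q r rho x).
have iw := integrable_transition QSO r0 rrho L1xi.
have iAj j : rintegrable (@leb3 R) T (Aj j).
  have [i1 _] := az j; have [i2 _] := radt j; have [_ [i3 _]] := HnP j.
  by apply: rintegrableD => //; apply: rintegrableD => //; exact: rintegrableZ.
have IAj j : l j 0 * (eps * b j 0 * Mz) - (5 * Cr + 2 * Ca / ka) * (C * B) * Iw <= \int[@leb3 R]_(x in T) Aj j x.
  have [i1 e1] := az j; have [i2 e2] := radt j; have [_ [i3 e3']] := HnP j.
  have i1' := rintegrableZ mT (l j 0) i1.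
  have -> : \int[@leb3 R]_(x in T) Aj j x = l j 0 * (eps * b j 0 * Mz) +
     \int[@leb3 R]_(x in T) (wt x * Hm j (c_ x) (s_ x) * (Xi x j 0 * c_ x + Xi x j 1 * s_ x)) +
     \int[@leb3 R]_(x in T) (wt x * Hn j (c_ x) (s_ x) * Xi x j 2).
    by rewrite (RintegralD mT (rintegrableD mT i1' i2) i3) (RintegralD mT i1' i2) (RintegralZ mT _ i1) e1.
  rewrite subr0 (RintegralZ mT _ iw) -/Iw ler_norml in e2.
  rewrite subr0 (RintegralZ mT _ iw) -/Iw ler_norml in e3'.
  move: e2 e3' => /andP[e2 _] /andP[e3' _].
  have gen (a x1 x2 c1 c2 : R) : - c1 <= x1 -> - c2 <= x2 -> a - (c1 + c2) <= a + x1 + x2 by lra.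
  apply: le_trans (gen _ _ _ _ _ e2 e3'); rewrite le_eqVlt; apply/orP; left; apply/eqP; ring.
pose A x := \sum_j Aj j x.
have iA : rintegrable (@leb3 R) T A by exact: rintegrable_sum.
have IA : eps * (2 * E * Mz) - 3 * (5 * Cr + 2 * Ca / ka) * (C * B) * Iw <= \int[@leb3 R]_(x in T) A x.
  rewrite (Rintegral_sum mT iAj) sum3; have [_ lb _] := cellE; rewrite lb /dotv.
  have := IAj 0; have := IAj 1; have := IAj 2; lra.
have [_ [Ci _ iEE] _ _] := radial; have [[Cphi _ phi01 [phis _] _] _ _ _] := radial.
have [_ _ e01 _ _] := axial.
have A0 x : T x -> ~ S x -> A x = 0.
  move=> /(tubeP QSO _ _ rho0)[x1 x2] nS; have p0 : phi (P2 x) = 0.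
    apply/eqP/negPn/negP => /phis /andP[rP _]; apply: nS; apply/(shellP QSO _ _ rho0 r0).
    by rewrite rP x1.
  by rewrite /A big1// => j _; rewrite /Aj p0 !mul0r mulr0 !addr0.
pose q x := (P2 x)^-1 * Hq (c_ x) (s_ x).
have ave := rotation_average QSO r0 rr h0 Cq pq (fun th => quad_ge0 c00 low (G th)) Ci
  (fun s rs => proj1 (iEE s rs)) HqE mHq.
have [iW WK] := integrable_energy QSO r0 rrho L1xi PhiK.
have angle x : S x -> [/\ r ^+ 2 <= P2 x, 0 < i (P2 x), i (P2 x) ^+ 2 = (P2 x)^-1, i (P2 x) <= r^-1 &
    exists2 th, 0 <= th <= 2 * pi & c_ x = cos th /\ s_ x = sin th].
  move=> /(shellP QSO _ _ rho0 r0)[/andP[rP _] _].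
  have [i0 iP i2P _] := cutoff_invsqrt r0 radial rP.
  have p0 : 0 < P2 x by apply: lt_le_trans rP; rewrite exprn_gt0.
  split=> //; last exact: (frame_angle r0 radial rP).
    by apply: (mulIf (lt0r_neq0 p0)); rewrite i2P mulVf ?gt_eqF.
  rewrite (iEE _ rP).1 lef_pV2 ?posrE ?sqrtr_gt0//.
  by rewrite -(ger0_norm (ltW r0)) -sqrtr_sqr ler_wsqrtr.
have q0 x : S x -> 0 <= q x.
  move=> Sx; have [rP _ _ _ [th th2 [ce se]]] := angle x Sx; rewrite /q ce se HqE//.
  by rewrite mulr_ge0 ?invr_ge0 ?rad2_ge0//; exact: (quad_ge0 c00 low).
have mq : measurable_fun (S : set (borel V3)) (q : borel V3 -> R).
  have mc : measurable_fun setT (c_ : borel V3 -> R).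
    by apply: measurable_S3; apply: S3_mul; [exact: S3_yc|exact: (S3_comp Ci (S3_rad2 Q))].
  have ms : measurable_fun setT (s_ : borel V3 -> R).
    by apply: measurable_S3; apply: S3_mul; [exact: S3_yc|exact: (S3_comp Ci (S3_rad2 Q))].
  apply: measurable_funTS; apply: measurable_funM; first exact: measurable_rad2V.
  exact: (measurableT_comp mHq (measurable_fun_pair mc ms)).
have Eq : (\int[@leb3 R]_(x in S) (q x)%:E <= (2 * E * h * ln (rho / r))%:E)%E by rewrite -cq; exact: ave.
have iq : rintegrable (@leb3 R) S q.
  apply/integrableP; split; first exact/measurable_EFinP.
  apply: le_lt_trans (ltry (2 * E * h * ln (rho / r))); apply: le_trans Eq.
  rewrite le_eqVlt; apply/orP; left; apply/eqP; apply: eq_integral => x /set_mem Sx /=.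
  by rewrite ger0_norm// q0.
have Iq : \int[@leb3 R]_(x in S) q x <= 2 * E * h * ln (rho / r).
  by rewrite -lee_fin /Rintegral fineK//; exact: (integrable_fin_num mS iq).
set om' := om + K * (eps * r^-1 * (C * B)) / d.
have om'0 : 0 <= om'.
  apply: addr_ge0; first exact: ltW.
  by rewrite divr_ge0 ?mulr_ge0 ?invr_ge0 ?(ltW K_gt0) ?(ltW eps0) ?(ltW r0) ?(ltW d0)//; exact: sqrtr_ge0.
have iAS := rintegrable_shell QSO r0 rrho iA.
pose g x := eps * A x + - (eps ^+ 2 / 2 * q x) + - (om' * Phi p (enorm (xi x))).
have i1 := rintegrableZ mS eps iAS; have i2 := rintegrableN (rintegrableZ mS (eps ^+ 2 / 2) iq).
have i3 := rintegrableN (rintegrableZ mS om' iW).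
have ig : rintegrable (@leb3 R) S g := rintegrableD mS (rintegrableD mS i1 i2) i3.
apply: le_trans (integral_ge_Rintegral mS ig (fun x => V_ge0 (xi x)) _); last first.
  move=> x Sx; have [rP i0 i2P ir [th th2 [ce se]]] := angle x Sx.
  have [[t0 t1' t2] [r0' r1 r2]] := frameE th.
  have [z0 z1 z2] := vec3E (0 : R) 0 1.
  pose X := (eps * i (P2 x)) *: G th.
  have ph : 0 <= phi (P2 x) * e (y 2 x) <= 1.
    have /andP[a1 a2] := phi01 (P2 x); have /andP[b1 b2] := e01 (y 2 x).
    by rewrite mulr_ge0//= mulr_ile1.
  have Xs : enorm X <= eps * r^-1 * (C * B).
    rewrite /X enormZr ger0_norm; last by rewrite mulr_ge0 ?(ltW eps0) ?(ltW i0).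
    apply: ler_pM; rewrite ?enorm_ge0 ?mulr_ge0 ?(ltW eps0) ?(ltW i0)//; first by rewrite ler_pM2l.
    by rewrite -(@ler_pXn2r _ 2) ?nnegrE ?enorm_ge0// sqr_enorm.
  have := pointwise_bound (xi x) ph Xs; rewrite -/om'; apply: le_trans.
  have AE : A x = phi (P2 x) * i (P2 x) * e (y 2 x) * polar V (G th) (xi x).
    rewrite cellp /A sum3 /Aj /dotv.
    have [Hm0 _] := HmP 0; have [Hm1 _] := HmP 1; have [Hm2 _] := HmP 2.
    have [Hn0 _] := HnP 0; have [Hn1 _] := HnP 1; have [Hn2 _] := HnP 2.
    have mvE (v : V3) j : (Xi x *m v) j 0 = Xi x j 0 * v 0 0 + Xi x j 1 * v 1 0 + Xi x j 2 * v 2 0.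
      by rewrite mxE sum3.
    rewrite !mvE t0 t1' t2 r0' r1 r2 /e3 z0 z1 z2 ce se Hm0// Hm1// Hm2// Hn0// Hn1// Hn2//.
    by ring.
  have qE : q x = i (P2 x) ^+ 2 * quad V (G th) by rewrite /q ce se HqE// i2P.
  rewrite /g AE qE /X (polarZ V2) (quadZ V2).
  have /andP[ph0 ph1] := ph; have qG : 0 <= quad V (G th) by exact: (quad_ge0 c00 low).
  have h1 : phi (P2 x) * e (y 2 x) * (2^-1 * ((eps * i (P2 x)) ^+ 2 * quad V (G th))) <=
      2^-1 * ((eps * i (P2 x)) ^+ 2 * quad V (G th)).
    rewrite ler_piMl//; apply: mulr_ge0 => //; apply: mulr_ge0 => //; exact: sqr_ge0.
  by rewrite exprMn in h1 *; lra.
rewrite lee_fin (RintegralD mS (rintegrableD mS i1 i2) i3) (RintegralD mS i1 i2).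
have EN1 : \int[@leb3 R]_(x in S) (- (eps ^+ 2 / 2 * q x)) = - (eps ^+ 2 / 2 * \int[@leb3 R]_(x in S) q x).
  rewrite -(RintegralZ mS _ iq) -mulN1r -(RintegralZ mS _ (rintegrableZ mS _ iq)).
  by apply: eq_Rintegral => x _; rewrite mulN1r.
have EN2 : \int[@leb3 R]_(x in S) (- (om' * Phi p (enorm (xi x)))) = - (om' * \int[@leb3 R]_(x in S) Phi p (enorm (xi x))).
  rewrite -(RintegralZ mS _ iW) -mulN1r -(RintegralZ mS _ (rintegrableZ mS _ iW)).
  by apply: eq_Rintegral => x _; rewrite mulN1r.
rewrite EN1 EN2 (RintegralZ mS _ iAS) -(Rintegral_tube_shell QSO r0 rrho A0).
have h1 := ler_wpM2l (ltW eps0) IA.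
have e20 : 0 <= eps ^+ 2 / 2 by rewrite divr_ge0// sqr_ge0.
have h2 := ler_wpM2l e20 Iq.
have h3 := ler_wpM2l om'0 WK.
clearbody Iw om'; move: h1 h2 h3; move: (\int[@leb3 R]_(x in T) A x) (\int[@leb3 R]_(x in S) q x) (\int[@leb3 R]_(x in S) Phi p (enorm (xi x))) => I1 I2 I3 h1 h2 h3.
lra.
Qed.

End lower_bound.

(** * The error function *)

Ltac nonneg := first [ done | exact: ltW | exact: ler0n | exact: sqr_ge0
  | apply: mulr_ge0; nonneg | apply: addr_ge0; nonneg | rewrite invr_ge0; nonneg ].

Section error_function.
Variable R : realType.
Local Notation M := 'M[R]_3.
Variables (p : R) (V : M -> R) (cK l0 : R).

(** The error is a fixed number here, valid for all configurations whose small
    parameter is below [s0]. *)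
Definition line_tension_bound (err s0 : R) : Prop :=
  forall (Q : 'cV[R]_3 -> M), (forall t, enorm t = 1 -> SO3 (Q t) /\ Q t *m e3 R = t) ->
  forall (r rho h eps : R) (b t : 'cV[R]_3) (xi : 'cV[R]_3 -> M),
    0 < 2 * r -> 2 * r <= rho -> rho <= h -> 0 < eps -> enorm t = 1 ->
    L1_fun (mulmx (Q t) @` tube rho h) xi -> l0 <= enorm b ->
    (L1_norm (mulmx (Q t) @` shell rho r h) (fun x => Phi p (enorm (xi x)))
       <= (cK * eps ^+ 2 * h * enorm b ^+ 2 * ln (rho / r))%:E)%E ->
    curl_eq_hausdorff1 (mulmx (Q t) @` tube rho h) xi (eps *: otimes b t)
      (line t `&` (mulmx (Q t) @` tube rho h)) ->
    r / rho + eps * enorm b / r <= s0 ->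
    (((eps ^+ 2 * h * ln (rho / r))^-1)%:E *
       \int[@leb3 R]_(x in mulmx (Q t) @` shell rho r h) (V (xi x))%:E
     >= (psi Q (hessian V 0) b t * (1 - err))%:E)%E.

Hypothesis hp : 1 < p <= 2.
Hypothesis hV : exists W : M -> R,
       (HFinite p W /\ exists Qt : M, SO3 Qt /\
          V = (fun F => W (1%:M + Qt *m F *m Qt^T)))
       \/ (HLin p W /\ V = W).
Hypothesis hcK : 0 < cK.
Hypothesis hl0 : 0 < l0.

(** The parameters are chosen in this order: the axial margin [ka] and the Taylor
    slack [om] are proportional to e; [om] determines the size [d] of the matrices
    that count as small; then s0 makes log (R/r) large and eps |b| / r small
    enough to absorb the remaining errors. *)
Lemma small_error (e : R) : 0 < e -> e <= 1 -> exists2 s0, 0 < s0 & line_tension_bound e s0.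
Proof.
move=> e0 e1.
have V_ge0 := energy_ge0 hV; have V0 := energy_0 hp hV; have V2 := energy_differentiable hV.
have [c0 c00 low] := quad_coercive hp hV.
have [K K0 up] := quad_le V2.
have [C C0 cell] := optimal_cell_field V2 c00 K0 low up.
have [Ca Ca0 axc] := axial_cutoff R.
have [Cr Cr0 rac] := radial_cutoffs R.
have pi0 := pi_gt0 R.
pose c1 := c0 / (6 * pi); have c10 : 0 < c1 by rewrite divr_gt0// mulr_gt0.
pose ka := e / 32; have ka0 : 0 < ka by rewrite divr_gt0.
have ka4 : 4 * ka <= 1 by rewrite /ka; lra.
pose Ct := 3 * (5 * Cr + 2 * Ca / ka).
have Ct0 : 0 <= Ct by rewrite /Ct; nonneg.
pose om := e * c1 / (8 * cK).
have om0 : 0 < om by apply: divr_gt0; apply: mulr_gt0.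
have [d' d'0 tay] := taylor V0 V_ge0 V2 om0.
pose d := Num.min (d' / 2) 1.
have d0 : 0 < d by rewrite lt_min divr_gt0//=.
have d1 : d <= 1 by rewrite ge_min lexx orbT.
have dd : d < d' by rewrite gt_min; apply/orP; left; lra.
pose X1 := Ct * C * (9 / 2 * cK + 36 * pi).
pose X2 := 18 * Ct * C * cK + K * C * cK / d.
have X10 : 0 <= X1 by rewrite /X1; nonneg.
have X20 : 0 <= X2 by rewrite /X2; nonneg.
pose c2 : R := 2^-1 * ln 8.
have c20 : 0 <= c2 by rewrite mulr_ge0// ln_ge0// ler1n.
have ec : 0 < e * c1 by rewrite mulr_gt0.
pose L1 := 8 * c2 / e; pose L2 := (8 * (X1 + 1) / (e * c1)).
have L20 : 0 < L2 by rewrite divr_gt0// mulr_gt0// ltr_wpDl.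
pose Lm := L1 + L2 ^+ 2.
exists (Num.min (e * c1 / (8 * (X2 + 1))) (expR (- Lm))).
  by rewrite lt_min expR_gt0 andbT divr_gt0// mulr_gt0// ltr_wpDl.
move=> Q hQ r rho h eps b t xi r2 rrho rhoh eps0 t1 L1xi lb PhiK curlxi.
set B := enorm b in lb PhiK *; set L := ln (rho / r) in PhiK *.
rewrite le_min => /andP[s1 s2].
have r0 : 0 < r by rewrite -(pmulr_rgt0 _ (ltr0n R 2)).
have rho0 : 0 < rho by exact: lt_le_trans r2 rrho.
have h0 : 0 < h by exact: lt_le_trans rho0 rhoh.
have B0 : 0 < B by exact: lt_le_trans hl0 lb.
have sB0 : 0 <= eps * B / r by nonneg.
have sr0 : 0 < r / rho by rewrite divr_gt0.
have [QSO Qt] := hQ t t1.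
have LLm : Lm <= L.
  have : r / rho <= expR (- Lm) by lra.
  rewrite /L -(invf_div r rho) => h1.
  rewrite -[leLHS]expRK ler_ln ?posrE ?expR_gt0 ?invr_gt0//.
  by rewrite -[Lm]opprK expRN lef_pV2 ?posrE ?expR_gt0.
have L20' : 0 < L2 ^+ 2 by rewrite exprn_gt0.
have L10 : 0 <= L1 by rewrite /L1; nonneg.
have Lp : 0 < L by apply: lt_le_trans LLm; rewrite ltr_wpDl.
pose q := Num.sqrt L.
have q0 : 0 < q by rewrite sqrtr_gt0.
have qq : q ^+ 2 = L by rewrite sqr_sqrtr// ltW.
have qL2 : L2 <= q.
  rewrite -(@ler_pXn2r _ 2) ?nnegrE ?(ltW L20) ?(ltW q0)// qq; apply: le_trans LLm; by rewrite lerDr.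
have [E [G [l [m [n [k [cE cq cp cb]]]]]]] := cell Q b t QSO.
have psil : c1 * B ^+ 2 <= psi Q (hessian V 0) b t.
  by rewrite /B sqr_enorm_dotv; exact: (psi_low V2 c00 low).
have [psiE _ _] := cE.
have [eta [eta' ax]] := axc ka h ka0 ka4 h0.
have [f1 [f2 [f3 [f4 [f5 [f6 [f7 ra]]]]]]] := rac r rho r0 rrho.
have td F : enorm F <= d -> `|V F - 2^-1 * quad V F| <= om * nrm2 F.
  by move=> Fd; apply: tay; exact: le_lt_trans dd.
have [Mz MzL big] := energy_lower_bound hp V_ge0 V2 c00 K0 low up om0 d0 d1 td C0 QSO Qt t1 cE cq cp cb
  r0 rrho rhoh eps0 L1xi curlxi PhiK Ca0 Cr0 ka0 ka4 ra ax.
set Iw := (\int[@leb3 R]_(x in _) (entry_sum _ * _)) in big.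
set N := eps ^+ 2 * h * L.
have N0 : 0 < N by rewrite !mulr_gt0// exprn_gt0.
pose a := (eps * B * q)^-1.
have ebq : 0 < eps * B * q by rewrite !mulr_gt0.
have a0 : 0 < a by rewrite invr_gt0.
have Iwb : Iw <= 9 * ((a / 2 + 2 / r) * (cK * eps ^+ 2 * h * B ^+ 2 * L) + 4 * pi * h / a).
  exact: (transition_integral QSO hp r0 rrho rhoh L1xi PhiK a0).
clearbody Iw.
have B2 : 0 <= B ^+ 2 by rewrite sqr_ge0.
have BN : 0 <= B ^+ 2 * N by rewrite mulr_ge0// ltW.
have err1 : eps * (Ct * (C * B)) * Iw <= B ^+ 2 * N * (X1 / q + 18 * Ct * C * cK * (eps * B / r)).
  have cc : 0 <= eps * (Ct * (C * B)) by nonneg.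
  apply: le_trans (ler_wpM2l cc Iwb) _; rewrite /a invrK /X1 /N -qq.
  rewrite le_eqVlt; apply/orP; left; apply/eqP; clear -q0 B0 eps0 r0.
  by move: (pi : R) (Ct : R) => P T; field; rewrite !gt_eqF.
have err2 : (om + K * (eps * r^-1 * (C * B)) / d) * (cK * eps ^+ 2 * h * B ^+ 2 * L) =
    B ^+ 2 * N * (e * c1 / 8 + K * C * cK / d * (eps * B / r)).
  rewrite /om /N; clear -hcK d0 r0; clearbody c1 d.
  by field; rewrite !gt_eqF.
have X1q : X1 / q <= e * c1 / 8.
  rewrite ler_pdivrMr//; apply: le_trans (ler_wpM2l _ qL2); last by rewrite divr_ge0// ltW.
  have -> : e * c1 / 8 * L2 = X1 + 1 by rewrite /L2; move: (X1 + 1) => z; clear -z e0 c10 hp hV hcK hl0; clearbody c1; field; rewrite !gt_eqF.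
  by rewrite lerDl.
have X2s : X2 * (eps * B / r) <= e * c1 / 8.
  have h1 : eps * B / r <= e * c1 / (8 * (X2 + 1)) by lra.
  have X21 : 0 < X2 + 1 by rewrite ltr_wpDl.
  apply: le_trans (ler_wpM2l X20 h1) _.
  have -> : X2 * (e * c1 / (8 * (X2 + 1))) = e * c1 / 8 * (X2 / (X2 + 1)).
    by clear -X21; clearbody X2; field; rewrite gt_eqF.
  rewrite ler_piMr//; first by rewrite divr_ge0// ltW.
  by rewrite ler_pdivrMr// mul1r lerDl.
have main : N * (E * (1 - e / 2)) <= eps ^+ 2 * (2 * E * Mz) - eps ^+ 2 * (E * h * L).
  have lnE : 2^-1 * (ln (rho ^+ 2 / 4) - ln (2 * r ^+ 2)) = L - c2.
    have r20 : 0 < r ^+ 2 by rewrite exprn_gt0.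
    have rho20 : 0 < rho ^+ 2 by rewrite exprn_gt0.
    rewrite /L /c2 !ln_div ?posrE// lnM ?posrE//.
    have lnsq (x : R) : 0 < x -> ln (x ^+ 2) = 2 * ln x by move=> x0; rewrite lnXn// mulr_natl.
    rewrite !lnsq//.
    have -> : ln 8 = ln 4 + ln 2 :> R by rewrite -lnM ?posrE//; congr ln; lra.
    move: (ln rho) (ln r) (ln 4) (ln 2) => a1 a2 a3 a4; lra.
  rewrite lnE in MzL.
  have E0 : 0 <= E by apply: le_trans psiE; apply: le_trans psil; nonneg.
  have h1 : (L - c2) * ((1 - 4 * ka) * h) * 2 - h * L >= h * (L * (1 - e / 2)).
    have c2L : 2 * c2 <= e / 4 * L.
      have : L1 <= L by apply: le_trans LLm; rewrite lerDl ltW.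
      rewrite /L1 ler_pdivrMr// => h2; lra.
    have -> : (L - c2) * ((1 - 4 * ka) * h) * 2 - h * L = h * (L * (1 - e / 4) - 2 * c2 + c2 * e / 4).
      by rewrite /ka; field.
    rewrite ler_pM2l//; have := mulr_ge0 c20 (ltW e0); lra.
  have h2 : h * (L * (1 - e / 2)) <= 2 * Mz - h * L by lra.
  have eE : 0 <= eps ^+ 2 * E by rewrite mulr_ge0// sqr_ge0.
  have := ler_wpM2l eE h2; rewrite /N; clear -d; lra.
have fin : N * (psi Q (hessian V 0) b t * (1 - e)) <= eps ^+ 2 * (2 * E * Mz) - eps * (Ct * (C * B)) * Iw
    - eps ^+ 2 * (E * h * L) - (om + K * (eps * r^-1 * (C * B)) / d) * (cK * eps ^+ 2 * h * B ^+ 2 * L).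
  rewrite err2.
  have e3 : X1 / q + 18 * Ct * C * cK * (eps * B / r) + (e * c1 / 8 + K * C * cK / d * (eps * B / r)) <= 3 / 8 * (e * c1).
    move: X2s; rewrite /X2 mulrDl; lra.
  have e4 := ler_wpM2l BN e3.
  have e5 : B ^+ 2 * N * (3 / 8 * (e * c1)) <= 3 / 8 * e * (N * psi Q (hessian V 0) b t).
    have -> : B ^+ 2 * N * (3 / 8 * (e * c1)) = 3 / 8 * e * (N * (c1 * B ^+ 2)) by ring.
    by apply: ler_wpM2l; [rewrite mulr_ge0// ltW|apply: ler_wpM2l => //; exact: ltW].
  have e6 : N * (psi Q (hessian V 0) b t * (1 - e / 2)) <= N * (E * (1 - e / 2)).
    apply: ler_wpM2l; first exact: ltW.
    by apply: ler_wpM2r => //; lra.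
  have e7 : 0 <= e * (N * psi Q (hessian V 0) b t).
    apply: mulr_ge0; first exact: ltW.
    by apply: mulr_ge0; [exact: ltW|apply: le_trans psil; nonneg].
  move: e4 e5 e6 e7 main err1; rewrite mulrDr.
  move: (psi _ _ _ _) => ps; clear; lra.
have := le_trans (_ : ((N * (psi Q (hessian V 0) b t * (1 - e)))%:E <= _)%E) big.
rewrite lee_fin => /(_ fin) final.
have NV : (0 <= (N^-1)%:E)%E by rewrite lee_fin invr_ge0 ltW.
have := lee_wpmul2l NV final; rewrite -EFinM mulKf; first exact.
exact: lt0r_neq0.
Qed.

Lemma psi_ge0 (Q : 'cV[R]_3 -> M) b t : SO3 (Q t) -> 0 <= psi Q (hessian V 0) b t.
Proof.
move=> QSO; have V2 := energy_differentiable hV.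
have [c0 c00 low] := quad_coercive hp hV.
apply: le_trans (psi_low V2 c00 low b QSO).
by rewrite mulr_ge0 ?dotv_ge0// divr_ge0 ?mulr_ge0 ?pi_ge0// ltW.
Qed.

(** With error 1 the right side is 0, so positivity of the energy suffices. *)
Lemma unit_error s : line_tension_bound 1 s.
Proof.
move=> Q hQ r rho h eps b t xi r2 rrho rhoh eps0 t1 _ _ _ _ _.
rewrite subrr mulr0; apply: mule_ge0; last first.
  by apply: integral_ge0 => x _; rewrite lee_fin; exact: (energy_ge0 hV).
have r0 : 0 < r by rewrite -(pmulr_rgt0 _ (ltr0n R 2)).
have rho0 : 0 < rho by exact: lt_le_trans r2 rrho.
rewrite lee_fin invr_ge0; apply: mulr_ge0; first by rewrite mulr_ge0 ?sqr_ge0// (le_trans (ltW rho0)).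
by apply: ln_ge0; rewrite ler_pdivlMr// mul1r; lra.
Qed.

Definition error_set (s : R) : set R := [set e | 0 < e /\ line_tension_bound e s].
(** Adding [s] makes the function positive and strictly larger than the infimum,
    so that an admissible error below it exists. *)
Definition error_function (s : R) : R := inf (error_set s) + s.

Lemma error_set_mono s s' : s <= s' -> error_set s' `<=` error_set s.
Proof.
move=> ss e [e0 He]; split=> // Q hQ r rho h eps b t xi a1 a2 a3 a4 a5 a6 a7 a8 a9 a10.
by apply: He => //; exact: le_trans ss.
Qed.

Lemma error_set_inf s : has_inf (error_set s).
Proof.
split; first by exists 1; split; [exact: ltr01|exact: unit_error].
by exists 0 => e [/ltW].
Qed.

Lemma error_inf_ge0 s : 0 <= inf (error_set s).
Proof. by apply: lb_le_inf; [have [] := error_set_inf s|move=> e [/ltW]]. Qed.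

End error_function.

Theorem proposition4p3 (R : realType) (p : R) (hp : 1 < p <= 2)
    (V : 'M[R]_3 -> R)
    (hV : exists W : 'M[R]_3 -> R,
       (HFinite p W /\ exists Qt : 'M[R]_3, SO3 Qt /\
          V = (fun F => W (1%:M + Qt *m F *m Qt^T)))
       \/ (HLin p W /\ V = W))
    (cK l0 : R) (hcK : 0 < cK) (hl0 : 0 < l0) :
  exists sigma : R -> R,
    [/\ forall s, 0 < s -> 0 < sigma s,
        forall s s', 0 < s -> s <= s' -> sigma s <= sigma s'
      & sigma s @[s --> 0^'+] --> (0 : R)] /\
    forall (Q : 'cV[R]_3 -> 'M[R]_3),
    (forall t, enorm t = 1 -> SO3 (Q t) /\ Q t *m e3 R = t) ->
    forall (r rho h eps : R) (b t : 'cV[R]_3) (xi : 'cV[R]_3 -> 'M[R]_3),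
    0 < 2 * r -> 2 * r <= rho -> rho <= h -> 0 < eps -> enorm t = 1 ->
    let QT_full := mulmx (Q t) @` tube rho h in
    let QT_shell := mulmx (Q t) @` shell rho r h in
    L1_fun QT_full xi ->
    l0 <= enorm b ->
    (L1_norm QT_shell (fun x => Phi p (enorm (xi x)))
       <= (cK * eps ^+ 2 * h * enorm b ^+ 2 * ln (rho / r))%:E)%E ->
    curl_eq_hausdorff1 QT_full xi (eps *: otimes b t) (line t `&` QT_full) ->
    (((eps ^+ 2 * h * ln (rho / r))^-1)%:E *
       \int[@leb3 R]_(x in QT_shell) (V (xi x))%:E
     >= (psi Q (hessian V 0) b t * (1 - sigma (r / rho + eps * enorm b / r)))%:E)%E.
Proof.
pose sg := error_function p V cK l0.
have inf0 s : 0 <= inf (error_set p V cK l0 s) by exact: error_inf_ge0.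
have infle e s : 0 < e -> line_tension_bound p V cK l0 e s -> inf (error_set p V cK l0 s) <= e.
  by move=> e0 He; apply: ge_inf; [have [] := error_set_inf cK l0 hV s|split].
exists sg; split; [split|].
- by move=> s s0; rewrite /sg /error_function ltr_wpDl.
- move=> s s' s0 ss; rewrite /sg /error_function lerD//.
  apply: lb_le_inf; first by have [] := error_set_inf cK l0 hV s'.
  by move=> e He; have [e0 He'] := error_set_mono ss He; exact: infle.
- apply/cvgrPdist_le => e e0.
  have m0 : 0 < Num.min (e / 2) 1 by rewrite lt_min divr_gt0//=.
  have m1 : Num.min (e / 2) 1 <= 1 by rewrite ge_min lexx orbT.
  have me : Num.min (e / 2) 1 <= e / 2 by rewrite ge_min lexx.
  have [s0 s00 Hs] := small_error hp hV hcK hl0 m0 m1.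
  have se : 0 < Num.min s0 (e / 2) by rewrite lt_min s00 divr_gt0.
  near=> s.
  have s_gt0 : 0 < s by near: s; exact: nbhs_right_gt.
  have : s < Num.min s0 (e / 2) by near: s; exact: nbhs_right_lt.
  rewrite lt_min => /andP[ss0 ss1].
  have [_ Hs'] := error_set_mono (ltW ss0) (conj m0 Hs : error_set p V cK l0 s0 _).
  have := infle _ _ m0 Hs'; rewrite sub0r normrN ger0_norm.
    by rewrite /sg /error_function; lra.
  by rewrite /sg /error_function addr_ge0// ltW.
move=> Q hQ r rho h eps b t xi r2 rrho rhoh eps0 t1 QT_full QT_shell L1xi lb PhiK curlxi.
set s := r / rho + eps * enorm b / r.
have r0 : 0 < r by rewrite -(pmulr_rgt0 _ (ltr0n R 2)).
have rho0 : 0 < rho by exact: lt_le_trans r2 rrho.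
have s0 : 0 < s.
  by rewrite ltr_pwDl ?divr_gt0// divr_ge0 ?mulr_ge0 ?(ltW eps0) ?(ltW r0)//; exact: sqrtr_ge0.
have [e [e0 He] es] := inf_adherent s0 (error_set_inf cK l0 hV s).
apply: le_trans (He Q hQ r rho h eps b t xi r2 rrho rhoh eps0 t1 L1xi lb PhiK curlxi (lexx s)).
rewrite lee_fin; apply: ler_wpM2l; first by apply: (psi_ge0 hp hV); have [] := hQ t t1.
by rewrite lerD2l lerN2 ltW.
Unshelve. all: by end_near. Qed.
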